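(* Let $\tau\in\mathbb C$ with $\Im\tau>0$, let $C=\mathbb C/(\mathbb Z+\tau\mathbb Z)$, let $b,n,m\ge1$ be integers and $d=bn+m$. Let $V\to S^mC$ be the bundle of Laughlin states on the torus $C$ with $n$ particles and $m$ quasiholes of charge $c=1$ in the completely filled case, equipped with the $L^2$ hermitian metric $\langle\cdot,\cdot\rangle_V$, and let $\Omega$ be the curvature of the Chern connection of $(V,\langle\cdot,\cdot\rangle_V)$. Then in de Rham cohomology of $S^mC$ $$\left[\mathrm{Tr}\, e^{\frac{i}{2\pi}\Omega}\right]=b\,e^{-\frac{1}{b}\theta_m-n\xi_m}.$$
   Context: $S^kC=C^k/\mathfrak S_k$. Theta functions: $\theta\begin{bmatrix}\alpha\\ \beta\end{bmatrix}(z,\tau)=\sum_{k\in\mathbb Z}\exp(\pi i(k+\alpha)^2\tau+2\pi i(k+\alpha)(z+\beta))$ and $\theta_1=\theta\begin{bmatrix}1/2\\1/2\end{bmatrix}$, which has exactly one zero modulo $\mathbb Z+\tau\mathbb Z$, simple, at $z=0$. For $w=w_1+\dots+w_m\in S^mC$, the fibre $V_w$ is the $b$-dimensional space with basis ($0\le l\le b-1$) $$s_{l}(z_1,\dots,z_n|w)=\theta \begin{bmatrix} l/b\\0\end{bmatrix} \Big(b\sum_{\mu=1}^n z_\mu + \sum_{\gamma=1}^m w_\gamma,\;b\tau\Big) \prod_{ 1\le\mu<\nu\le n} \theta_1(z_\mu - z_\nu,\tau)^b \prod_{\mu=1}^n\prod_{\gamma=1}^m\theta_1(z_\mu-w_\gamma,\tau).$$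 In each variable $z_\mu$ these are holomorphic sections of a fixed degree $d$ line bundle $L$ on $C$ (sections of $L$ are entire functions $f$ with $f(z+1)=(-1)^{b(n-1)+m}f(z)$ and $f(z+\tau)=(-1)^{b(n-1)+m}e^{-\pi i d\tau-2\pi i d z}f(z)$). Thus $V_w\subset H^0(C^n,L^{\boxtimes n})$ is the space of holomorphic sections of $L^{\boxtimes n}$, symmetric for $b$ even and antisymmetric for $b$ odd, that are divisible by the local equation of the divisor $b\sum_{\mu<\nu}\{z_\mu=z_\nu\}+\sum_{\mu,\gamma}\{z_\mu=w_\gamma\}$. The spaces $V_w$ form a holomorphic vector bundle $V$ of rank $b$ over $S^mC$, for which the $w\mapsto s_l(\cdot|w)$ are local holomorphic frames. Metric: fix a volume form $d\mathrm{Vol}$ on $C$ coming from a Riemannian metric, and let $d\mathrm{Vol}_n$ be the descent of $\prod_\mu d\mathrm{Vol}(z_\mu)$ to $S^nC$. Then $$\langle s(\cdot|w),s'(\cdot|w)\rangle_V=\int_{S^nC}s(z|w)\,\overline{s'(z|w)}\,e^{-\frac{2\pi}{\Im\tau}(bn+m)\sum_\mu(\Im z_\mu)^2}\,d\mathrm{Vol}_n(z).$$ Classes: $\theta_m\in H^2(S^mC)$ is the pullback of the theta class of $\mathrm{Pic}^m(C)$ (for genus one, the class of a point) under $S^mC\to\mathrm{Pic}^m(C)$; $\xi_m\in H^2(S^mC)$ is the class of the divisor $\{w_1+\dots+w_m: z_0\in\{w_1,\dots,w_m\}\}$ for a fixed $z_0\in C$. *)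

(* Defs.v *)
From HB Require Import structures.
From mathcomp Require Import all_boot all_order all_algebra.
From mathcomp Require Import complex.
From mathcomp Require Import all_classical all_reals all_analysis.

Set Implicit Arguments.
Unset Strict Implicit.
Unset Printing Implicit Defensive.

Import Order.TTheory GRing.Theory Num.Theory.
Import numFieldNormedType.Exports.

Local Open Scope classical_set_scope.
Local Open Scope complex_scope.
Local Open Scope ring_scope.

(* The usual topology of the complex numbers. *)
HB.instance Definition _ (R : realType) := NormedModule.copy R[i] R[i]^o.

(** * Complex-valued differential forms on C^m

    [rcoord m] indexes the real coordinates of C^m: [(j, false)] is x_j and
    [(j, true)] is y_j, where w_j = x_j + i y_j. They are ordered as
    x_0, y_0, x_1, y_1, ..., which is also the complex orientation.
    A form of mixed degree is given by its coefficients: [omega w I] is the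
    coefficient at w of the wedge product, in increasing order, of the dx_j and
    dy_j with index in I. *)

Notation rcoord m := ('I_m * bool)%type.

Definition coord_rank (m : nat) (i : rcoord m) : nat := (i.1.*2 + i.2)%N.

Definition coord_seq (m : nat) : seq (rcoord m) :=
  [seq (j, c) | j <- enum 'I_m, c <- [:: false; true]].

Definition dform (R : realType) (m : nat) : Type :=
  'rV[R[i]]_m -> {set rcoord m} -> R[i].

Definition axis_line (R : realType) (m : nat) (i : rcoord m) (w : 'rV[R[i]]_m)
    (t : R) : 'rV[R[i]]_m :=
  w + (t%:C * (if i.2 then 'i else 1)) *: delta_mx 0 i.1.

Definition partial (R : realType) (m : nat) (i : rcoord m)
    (f : 'rV[R[i]]_m -> R[i]) (w : 'rV[R[i]]_m) : R[i] :=
  derive1 (fun t : R => complex.Re (f (axis_line i w t))) 0 +i*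
  derive1 (fun t : R => complex.Im (f (axis_line i w t))) 0.

Definition has_partial (R : realType) (m : nat) (i : rcoord m)
    (f : 'rV[R[i]]_m -> R[i]) (w : 'rV[R[i]]_m) : Prop :=
  derivable (fun t : R => complex.Re (f (axis_line i w t))) 0 1 /\
  derivable (fun t : R => complex.Im (f (axis_line i w t))) 0 1.

Fixpoint C_class (R : realType) (m : nat) (r : nat)
    (f : 'rV[R[i]]_m -> R[i]) : Prop :=
  continuous f /\
  if r is r'.+1 then
    forall i : rcoord m,
      (forall w, has_partial i f w) /\ C_class r' (partial i f)
  else True.

Definition smooth (R : realType) (m : nat) (f : 'rV[R[i]]_m -> R[i]) : Prop :=
  forall r : nat, C_class r f.

Definition smooth_form (R : realType) (m : nat) (omega : dform R m) : Prop :=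
  forall I : {set rcoord m}, smooth (fun w => omega w I).

Definition homogeneous (R : realType) (m p : nat) (omega : dform R m) : Prop :=
  forall w (I : {set rcoord m}), #|I| <> p -> omega w I = 0.

Definition form0 (R : realType) (m : nat) (f : 'rV[R[i]]_m -> R[i]) :
    dform R m :=
  fun w I => if I == finset.set0 then f w else 0.

(* The sign of dx_I ∧ dx_J = ± dx_(I ∪ J), for disjoint I and J. *)
Definition wedge_sign (R : realType) (m : nat) (I J : {set rcoord m}) : R[i] :=
  (-1) ^+ #|[set p : rcoord m * rcoord m in finset.setX I J
              | (coord_rank p.2 < coord_rank p.1)%N]%SET|.

Definition wedgef (R : realType) (m : nat) (omega eta : dform R m) : dform R m :=
  fun w K => \sum_(I in powerset K)
    wedge_sign R I (K :\: I) * omega w I * eta w (K :\: I).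

Definition extd (R : realType) (m : nat) (omega : dform R m) : dform R m :=
  fun w K => \sum_(i in K)
    wedge_sign R [set i]%SET (K :\ i)%SET
      * partial i (fun v => omega v (K :\ i)%SET) w.

Definition form_exp (R : realType) (m : nat) (omega : dform R m) : dform R m :=
  (* On C^m the powers of a 2-form beyond the m-th vanish. *)
  fun w K => \sum_(r < m.+1)
    (r`!%:R)^-1 * iter r (wedgef omega) (form0 (fun=> 1)) w K.

Definition coord_fun (R : realType) (m : nat) (i : rcoord m)
    (u : 'rV[R[i]]_m) : R[i] :=
  (if i.2 then complex.Im (u 0 i.1) else complex.Re (u 0 i.1))%:C.

Definition pullback (R : realType) (p m : nat)
    (f : 'rV[R[i]]_p -> 'rV[R[i]]_m) (omega : dform R m) : dform R p :=
  fun w K => \sum_(I : {set rcoord m})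
    omega (f w) I *
    (\big[@wedgef R p/form0 (fun=> 1)]_(i <- coord_seq m | i \in I)
       extd (form0 (fun v => coord_fun i (f v)))) w K.

(** * Matrices of forms *)

Definition mform (R : realType) (m b : nat) : Type := 'I_b -> 'I_b -> dform R m.

Definition mwedge (R : realType) (m b : nat) (A B : mform R m b) :
    mform R m b :=
  fun k l w K => \sum_(j < b) wedgef (A k j) (B j l) w K.

Definition mform1 (R : realType) (m b : nat) : mform R m b :=
  fun k l => form0 (fun=> (k == l)%:R).

(* Trace of the exponential of a matrix of 2-forms; see [form_exp] for the
   range of summation. *)
Definition trace_exp (R : realType) (m b : nat) (A : mform R m b) : dform R m :=
  fun w K => \sum_(r < m.+1)
    (r`!%:R)^-1 * \sum_(k < b) iter r (mwedge A) (@mform1 R m b) k k w K.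

(** * Chern connections

    [H k l] = <s_k, s_l> is the Gram matrix of a hermitian metric in a
    holomorphic frame (s_k), and [A] is the matrix of 1-forms of a connection in
    this frame: ∇ s_l = \sum_k A k l s_k. The last two clauses say that A is of
    type (1,0), i.e. that the (0,1)-part of ∇ is the Cauchy-Riemann operator,
    and that d<s_k, s_l> = <∇ s_k, s_l> + <s_k, ∇ s_l>. *)
Definition chern_connection (R : realType) (m b : nat)
    (H : 'I_b -> 'I_b -> 'rV[R[i]]_m -> R[i]) (A : mform R m b) : Prop :=
  [/\ forall k l, smooth_form (A k l),
      forall k l, homogeneous 1 (A k l),
      forall k l w (j : 'I_m),
        A k l w [set (j, true)]%SET = 'i * A k l w [set (j, false)]%SET
    & forall k l w I,
        extd (form0 (H k l)) w I =
        \sum_(j < b) (A j k w I * H j l w + H k j w * (A j l w I)^*)].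

Definition curvature (R : realType) (m b : nat) (A : mform R m b) :
    mform R m b :=
  fun k l w K => extd (A k l) w K + mwedge A A k l w K.

(** * Forms and de Rham classes on S^m C, where C = C/(Z + tau Z)

    The elementary symmetric functions e_1, ..., e_m (component k of [elem_sym] is
    e_(k+1)) identify the symmetric product S^m(C) of the complex plane with
    C^m. Any divisor of degree m on the elliptic curve lifts to a point of
    S^m(C) in which congruent points are equal, and near such a lift the natural
    map S^m(C) -> S^m(C/(Z + tau Z)) is biholomorphic: its local inverses are
    holomorphic charts covering the target. A form on S^m(C/(Z + tau Z)) is thus
    the same as a smooth form in the coordinates e_1, ..., e_m whose pullback to
    the space of (w_1, ..., w_m) is invariant under translation of each w_j by
    Z + tau Z, and the exterior derivative is computed in these coordinates. *)

Definition elem_sym (R : realType) (m : nat) (w : 'rV[R[i]]_m) : 'rV[R[i]]_m :=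
  \row_(k < m) \sum_(I : {set 'I_m} | #|I| == k.+1) \prod_(j in I) w 0 j.

(* A symmetric function of w_1, ..., w_m as a function of e_1, ..., e_m. *)
Definition sym_fun (R : realType) (m : nat) (f : 'rV[R[i]]_m -> R[i]) :
    'rV[R[i]]_m -> R[i] :=
  fun u => f (xget 0 [set w | elem_sym w = u]).

Definition sym_form (R : realType) (tau : R[i]) (m : nat) (omega : dform R m) :
    Prop :=
  smooth_form omega /\
  forall (w : 'rV[R[i]]_m) (j : 'I_m) (p q : int) I,
    pullback (@elem_sym R m) omega (w + (p%:~R + q%:~R * tau) *: delta_mx 0 j) I =
    pullback (@elem_sym R m) omega w I.

Definition closed_form (R : realType) (tau : R[i]) (m : nat)
    (omega : dform R m) : Prop :=
  sym_form tau omega /\ forall w K, extd omega w K = 0.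

Definition same_deRham_class (R : realType) (tau : R[i]) (m : nat)
    (omega omega' : dform R m) : Prop :=
  [/\ closed_form tau omega, closed_form tau omega'
    & exists eta : dform R m, sym_form tau eta /\
        forall w K, omega w K = omega' w K + extd eta w K].

(** * Integration over C^n and over symmetric products *)

Definition int01 (R : realType) (f : R -> R[i]) : R[i] :=
  (\int[lebesgue_measure]_(s in `[0%R, 1%R]) complex.Re (f s)) +i*
  (\int[lebesgue_measure]_(s in `[0%R, 1%R]) complex.Im (f s)).

(* Integral of f(z) dx dy over the parallelogram z = s + t tau, 0 <= s, t <= 1. *)
Definition int_curve (R : realType) (tau : R[i]) (f : R[i] -> R[i]) : R[i] :=
  (complex.Im tau)%:C *
  int01 (fun s => int01 (fun t => f (s%:C + t%:C * tau))).

Fixpoint int_curves (R : realType) (tau : R[i]) (n : nat) :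
    ('rV[R[i]]_n -> R[i]) -> R[i] :=
  if n is n'.+1 return ('rV[R[i]]_n -> R[i]) -> R[i] then
    fun f => int_curve tau (fun z =>
      int_curves tau (fun z' : 'rV[R[i]]_n' => f (row_mx z%:M z')))
  else fun f => f 0.

(* For a symmetric map f from (w_1, ..., w_p) to the coordinates on the m-fold
   symmetric product, the integral of omega along the induced map
   S^p C -> S^m C, computed on C^p. *)
Definition sym_integral (R : realType) (tau : R[i]) (p m : nat)
    (f : 'rV[R[i]]_p -> 'rV[R[i]]_m) (omega : dform R m) : R[i] :=
  (p`!%:R)^-1 * int_curves tau (fun w => pullback f omega w finset.setT).

(** * The classes xi_m and theta_m *)

(* (w_1, ..., w_(m-1)) |-> (z0, w_1, ..., w_(m-1)) *)
Definition add_point (R : realType) (m : nat) (hm : (0 < m)%N) (z0 : R[i])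
    (w : 'rV[R[i]]_m.-1) : 'rV[R[i]]_m :=
  \row_(i < m) (if unlift (Ordinal hm) i is Some i' then w 0 i' else z0).

(* x represents the class of the divisor D of all z0 + w_1 + ... + w_(m-1),
   i.e. the Poincare dual of D, which is the image of S^(m-1) C. *)
Definition xi_class (R : realType) (tau : R[i]) (m : nat) (hm : (0 < m)%N)
    (z0 : R[i]) (x : dform R m) : Prop :=
  [/\ closed_form tau x, homogeneous 2 x
    & forall eta : dform R m, closed_form tau eta ->
        sym_integral tau (@elem_sym R m) (wedgef x eta) =
        sym_integral tau (fun w => elem_sym (add_point hm z0 w)) eta].

(* Pic^m of the curve is identified with the curve by w_1 + ... + w_m, which is
   the coordinate e_1. The class of a point of the curve is the case m = 1 of
   [xi_class]. *)
Definition theta_class (R : realType) (tau : R[i]) (m : nat) (hm : (0 < m)%N)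
    (t : dform R m) : Prop :=
  homogeneous 2 t /\
  exists pt : dform R 1, xi_class tau (ltn0Sn 0) 0 pt /\
    same_deRham_class tau t
      (pullback (fun u => (u 0 (Ordinal hm))%:M) pt).

(** * Laughlin states on the torus *)

Definition cexp (R : realType) (z : R[i]) : R[i] :=
  (expR (complex.Re z))%:C * (cos (complex.Im z) +i* sin (complex.Im z)).

Definition theta (R : realType) (alpha beta z tau : R[i]) : R[i] :=
  limn (fun N : nat => \sum_(k < N.*2.+1)
    let q := k%:R - N%:R + alpha in
    cexp (pi%:C * 'i * q ^+ 2 * tau + 2 * pi%:C * 'i * q * (z + beta))).

Definition theta1 (R : realType) (z tau : R[i]) : R[i] :=
  theta (1 / 2) (1 / 2) z tau.

Definition laughlin_state (R : realType) (tau : R[i]) (b n m : nat) (l : 'I_b)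
    (w : 'rV[R[i]]_m) (z : 'rV[R[i]]_n) : R[i] :=
  theta (l%:R / b%:R) 0 (b%:R * (\sum_(mu < n) z 0 mu) + \sum_(g < m) w 0 g)
    (b%:R * tau)
  * (\prod_(mu < n) \prod_(nu < n | (mu < nu)%N)
       theta1 (z 0 mu - z 0 nu) tau ^+ b)
  * \prod_(mu < n) \prod_(g < m) theta1 (z 0 mu - w 0 g) tau.

(* The volume form of a Riemannian metric on the curve: a positive multiple of
   dx ∧ dy. (In R[i], 0 < a means that a is real and positive.) *)
Definition volume_form (R : realType) (tau : R[i]) (vol : dform R 1) : Prop :=
  [/\ sym_form tau vol, homogeneous 2 vol
    & forall u, 0 < vol u finset.setT].

(* The integral over S^n C is 1/n! times the integral over C^n. *)
Definition l2_product (R : realType) (tau : R[i]) (vol : dform R 1) (d n : nat)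
    (s s' : 'rV[R[i]]_n -> R[i]) : R[i] :=
  (n`!%:R)^-1 * int_curves tau (fun z =>
    s z * (s' z)^*
    * (expR (- (2 * pi / complex.Im tau * d%:R
                * \sum_(mu < n) complex.Im (z 0 mu) ^+ 2)))%:C
    * \prod_(mu < n) vol (z 0 mu)%:M finset.setT).

(* The L^2 metric on V in the frame s_0, ..., s_(b-1), as a function of the
   coordinates e_1, ..., e_m; the frame is symmetric in w_1, ..., w_m, so it is a
   local holomorphic frame of V in the charts of S^m C described above. *)
Definition laughlin_metric (R : realType) (tau : R[i]) (vol : dform R 1)
    (b n m : nat) (k l : 'I_b) : 'rV[R[i]]_m -> R[i] :=
  sym_fun (fun w => l2_product tau vol (b * n + m)
                      (@laughlin_state R tau b n m k w)
                      (@laughlin_state R tau b n m l w)).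

(* Main.v *)
(* In the coordinates u of C^m the Laughlin frame changes by an explicit factor of automorphy when
   one coordinate is translated by a lattice vector, so the trace of the connection form shifts by
   explicit multiples of the dz_j.  Split off the normalized trace: scaling the remaining traceless
   part to 0 yields a Chern-Simons form which descends to S^m C, hence Tr exp is cohomologous to
   b exp(om1), with om1 the normalized trace of the curvature.  A closed symmetric lattice-invariant
   2-form is exact once its pullback to C^m has mean zero over a period cell, by patching local
   primitives.  The shifts of the connection give mean om1 = - (1/b) ptW - n sigma, to be compared
   with mean t = ptW and mean x = sigma. *)

Require Import Defs.
From HB Require Import structures.
From mathcomp Require Import all_boot all_order all_algebra.
From mathcomp Require Import all_fingroup complex.
From mathcomp Require Import all_classical all_reals all_analysis.
From mathcomp Require Import ring lra zify.

Set Implicit Arguments.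
Unset Strict Implicit.
Unset Printing Implicit Defensive.

Import Order.TTheory GRing.Theory Num.Theory.
Import numFieldNormedType.Exports.

Local Open Scope classical_set_scope.
Local Open Scope complex_scope.
Local Open Scope ring_scope.

(** The obstacle is the gap between two coordinate systems: a form on S^m C is smooth in e_1, ...,
    e_m, while periodicity and averages live on the w-space, and [elem_sym] degenerates on the
    diagonals. A periodic primitive in w and a smooth primitive in e are both easy to find; one form
    that is both is the work of [exactness], where local corrections, smooth in e, are glued by bump
    functions. Smoothness in e of symmetric products of theta functions, and of the translations of
    w seen through e, comes from one device: uniform approximation by polynomials, whose symmetric
    expressions in the roots are polynomials in e. The shifts of the connection are read off from
    those of the Gram matrix; this requires its invertibility, hence the linear independence of
    theta functions. The class [x] is given only through Poincare duality. Symmetry confines its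
    mean to the span of [sigma] and [ptW], and the two coefficients follow from test forms made of
    [t] and of the curvature itself: -(1/n)([om1] + [t]/b) is a closed form of mean [sigma]. *)

Local Notation sform := smooth_form.
Local Notation homog := homogeneous.
Local Notation Re := complex.Re.
Local Notation Im := complex.Im.

(** * A real-valued norm on the complex numbers *)

Section ComplexNorm.
Context {R : realType}.
Implicit Types (z u v : R[i]) (a b : R).

(** The sum norm takes values in R, whereas the modulus of R[i] lives in R[i] itself; estimates thus
    stay within real arithmetic. It is submultiplicative and equivalent to the modulus: |z| <=
    [cn z] <= 2 |z|. *)
Definition cn z : R := `|Re z| + `|Im z|.

Lemma cReD z u : Re (z + u) = Re z + Re u.
Proof. by case: z; case: u. Qed.
Lemma cImD z u : Im (z + u) = Im z + Im u.
Proof. by case: z; case: u. Qed.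
Lemma cReN z : Re (- z) = - Re z.
Proof. by case: z. Qed.
Lemma cImN z : Im (- z) = - Im z.
Proof. by case: z. Qed.
Lemma cReB z u : Re (z - u) = Re z - Re u.
Proof. by case: z; case: u. Qed.
Lemma cImB z u : Im (z - u) = Im z - Im u.
Proof. by case: z; case: u. Qed.
Lemma cReM z u : Re (z * u) = Re z * Re u - Im z * Im u.
Proof. by case: z; case: u. Qed.
Lemma cImM z u : Im (z * u) = Re z * Im u + Im z * Re u.
Proof. by case: z => a b; case: u => c d. Qed.
Lemma cReJ z : Re z^* = Re z.
Proof. by case: z. Qed.
Lemma cImJ z : Im z^* = - Im z.
Proof. by case: z. Qed.
Lemma cRe_sum I r (P : pred I) (F : I -> R[i]) :
  Re (\sum_(i <- r | P i) F i) = \sum_(i <- r | P i) Re (F i).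
Proof. exact: (big_morph _ cReD (erefl _)). Qed.
Lemma cIm_sum I r (P : pred I) (F : I -> R[i]) :
  Im (\sum_(i <- r | P i) F i) = \sum_(i <- r | P i) Im (F i).
Proof. exact: (big_morph _ cImD (erefl _)). Qed.
Lemma ceqP z u : Re z = Re u -> Im z = Im u -> z = u.
Proof. by case: z => a b; case: u => c d /= -> ->. Qed.

Lemma cn_ge0 z : 0 <= cn z. Proof. by rewrite addr_ge0. Qed.
Lemma cn0 : cn 0 = 0. Proof. by rewrite /cn normr0 addr0. Qed.
Lemma cn1 : cn 1 = 1. Proof. by rewrite /cn normr0 normr1 addr0. Qed.
Lemma cnD z u : cn (z + u) <= cn z + cn u.
Proof. by rewrite /cn cReD cImD addrACA lerD// ler_normD. Qed.
Lemma cnN z : cn (- z) = cn z.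
Proof. by rewrite /cn cReN cImN !normrN. Qed.
Lemma cnJ z : cn z^* = cn z.
Proof. by rewrite /cn cReJ cImJ normrN. Qed.
Lemma cnB z u : cn (z - u) = cn (u - z).
Proof. by rewrite -cnN opprB. Qed.
Lemma cnM z u : cn (z * u) <= cn z * cn u.
Proof.
rewrite /cn cReM cImM mulrDl !mulrDr -!normrM.
have := ler_normB (Re z * Re u) (Im z * Im u).
have := ler_normD (Re z * Im u) (Im z * Re u).
lra.
Qed.
Lemma cnR a : cn a%:C = `|a|.
Proof. by rewrite /cn normr0 addr0. Qed.
Lemma cnMR a z : cn (a%:C * z) = `|a| * cn z.
Proof. by rewrite /cn cReM cImM !mul0r subr0 addr0 !normrM mulrDr. Qed.
Lemma cn_eq0 z : cn z = 0 -> z = 0.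
Proof.
move=> h; have /andP[/eqP h1 /eqP h2] : (`|Re z| == 0) && (`|Im z| == 0).
  by rewrite -paddr_eq0 //; apply/eqP.
by apply: ceqP; [apply: normr0_eq0|apply: normr0_eq0].
Qed.
Lemma cn_triangle u z v : cn (z - v) <= cn (z - u) + cn (u - v).
Proof. by rewrite (_ : z - v = (z - u) + (u - v)); [exact/cnD | ring]. Qed.
Lemma cn_sum I r (P : pred I) (F : I -> R[i]) :
  cn (\sum_(i <- r | P i) F i) <= \sum_(i <- r | P i) cn (F i).
Proof.
elim/big_rec2 : _ => [|i y x _ h]; first by rewrite cn0.
by apply: (le_trans (cnD _ _)); rewrite lerD2l.
Qed.
Lemma cn_small z : (forall e : R, 0 < e -> cn z <= e) -> z = 0.
Proof.
move=> h; apply: cn_eq0; apply/eqP; rewrite eq_le cn_ge0 andbT.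
by apply/ler_addgt0Pr => e e0; rewrite add0r; exact/h.
Qed.
Lemma Re_le_cn z : `|Re z| <= cn z. Proof. by rewrite lerDl. Qed.
Lemma Im_le_cn z : `|Im z| <= cn z. Proof. by rewrite lerDr. Qed.
Lemma normc_le_cn z : `|z| <= (cn z)%:C.
Proof.
rewrite normc_def lecR -(@ler_pXn2r _ 2) ?nnegrE ?cn_ge0 //.
rewrite sqr_sqrtr ?addr_ge0 ?sqr_ge0 // -[X in X + _]real_normK ?num_real //.
rewrite -[X in _ + X]real_normK ?num_real //.
have : 0 <= `|Re z| * `|Im z| by [].
by rewrite sqrrD; lra.
Qed.
Lemma cn_le_normc z : ((cn z) / 2)%:C <= `|z|.
Proof.
rewrite normc_def lecR.
have h : forall c, c ^+ 2 <= Re z ^+ 2 + Im z ^+ 2 -> `|c| <= Num.sqrt (Re z ^+ 2 + Im z ^+ 2).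
  by move=> c hc; rewrite -sqrtr_sqr ler_sqrt // addr_ge0 ?sqr_ge0.
have := h (Re z); have := h (Im z); rewrite /cn.
rewrite lerDl lerDr !sqr_ge0 => /(_ isT) h1 /(_ isT) h2; lra.
Qed.

Lemma cn_powb z k : cn (z ^+ k) <= cn z ^+ k.
Proof.
elim: k => [|k IH]; first by rewrite cn1.
by rewrite !exprS (le_trans (cnM _ _)) // ler_wpM2l ?cn_ge0.
Qed.

End ComplexNorm.

(** * Derivatives of complex-valued functions of a real variable *)

Section Limits.
Context {R : realType}.

Definition cder (g : R -> R[i]) (t : R) (d : R[i]) : Prop :=
  is_derive t 1 (fun s => Re (g s)) (Re d) /\
  is_derive t 1 (fun s => Im (g s)) (Im d).

Lemma cder_cst c t : cder (fun=> c) t 0.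
Proof. by split ; exact/is_derive_cst. Qed.

Lemma cderD f g t d e : cder f t d -> cder g t e -> cder (fun s => f s + g s) t (d + e).
Proof.
move=> [h1 h2] [h3 h4]; split; rewrite ?cReD ?cImD.
  rewrite (_ : (fun s => _) = (fun s => Re (f s)) \+ (fun s => Re (g s))). exact/is_deriveD.
  by apply/funext => s; rewrite cReD.
rewrite (_ : (fun s => _) = (fun s => Im (f s)) \+ (fun s => Im (g s))). exact/is_deriveD.
by apply/funext => s; rewrite cImD.
Qed.
Lemma is_derive_eq (f : R -> R) (t d e : R) : is_derive t 1 f d -> d = e -> is_derive t 1 f e.
Proof. by move=> h <-. Qed.

Lemma is_deriveMf (f g : R -> R) (t d e : R) : is_derive t 1 f d -> is_derive t 1 g e ->
  is_derive t 1 (fun s => f s * g s) (d * g t + f t * e).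
Proof.
move=> h1 h2; apply: is_derive_eq.
by rewrite /GRing.scale /=; ring.
Qed.
Lemma is_deriveDf (f g : R -> R) (t d e : R) : is_derive t 1 f d -> is_derive t 1 g e ->
  is_derive t 1 (fun s => f s + g s) (d + e).
Proof. exact/is_deriveD. Qed.
Lemma is_deriveNf (f : R -> R) (t d : R) : is_derive t 1 f d ->
  is_derive t 1 (fun s => - f s) (- d).
Proof. exact/is_deriveN. Qed.

Lemma cderM f g t d e : cder f t d -> cder g t e -> cder (fun s => f s * g s) t (d * g t + f t * e).
Proof.
move=> [h1 h2] [h3 h4]; split. rewrite (_ : (fun s => _) = (fun s => Re (f s) * Re (g s) +
     - (Im (f s) * Im (g s)))); last first.
    by apply/funext => s; rewrite cReM.
  apply: (is_derive_eq (is_deriveDf (is_deriveMf h1 h3) (is_deriveNf (is_deriveMf h2 h4)))).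
  by rewrite cReD !cReM; ring.
rewrite (_ : (fun s => _) = (fun s => Re (f s) * Im (g s) + (Im (f s) * Re (g s)))); last first.
  by apply/funext => s; rewrite cImM.
apply: (is_derive_eq (is_deriveDf (is_deriveMf h1 h4) (is_deriveMf h2 h3))).
by rewrite cImD !cImM; ring.
Qed.

Lemma cderJ f t d : cder f t d -> cder (fun s => (f s)^*) t d^*.
Proof.
move=> [h1 h2]; split. by rewrite cReJ; under eq_fun do rewrite cReJ.
by rewrite cImJ; under eq_fun do rewrite cImJ; exact/is_deriveNf.
Qed.

(** The remainder form e |h| involves no quotient and admits h = 0, so derivatives can be
    transported along translations and estimates without punctured neighbourhoods. *)
Lemma is_derive_epsP (f : R -> R) (t d : R) : is_derive t 1 f d <->
  forall e : R, 0 < e -> exists2 r : R, 0 < r & forall h, `|h| < r ->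
    `|f (t + h) - f t - h * d| <= e * `|h|.
Proof.
split. move=> hd e e0. have [hd1 hd2] := hd.
  have /cvgrPdist_le /(_ e e0) : (h^-1 *: (f (h *: 1 + t) - f t) @[h --> 0^'] --> d).
    by rewrite -hd2; exact/hd1.
  rewrite near_withinE => /nbhs_ballP [r /= r0 hr]; exists r => // h hh.
  have [->|h0] := eqVneq h 0; first by rewrite addr0 subrr mul0r subr0 normr0 mulr0.
  have := hr h; rewrite /ball /= sub0r normrN => /(_ hh h0).
  rewrite -(ler_pM2r (x := `|h|)) ?normr_gt0 // -normrM => hle.
  apply: le_trans hle; rewrite -normrN le_eqVlt; apply/orP; left; apply/eqP.
  congr (`| _ |); rewrite /GRing.scale /= mulr1 (addrC h t); field.
  exact/h0.
move=> H.
have hcvg : h^-1 *: (f (h *: 1 + t) - f t) @[h --> 0^'] --> d.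
  apply/cvgrPdist_le => e e0; have [r r0 hr] := H e e0.
  rewrite near_withinE; apply/nbhs_ballP; exists r => //= h.
  rewrite /ball /= sub0r normrN => hh h0.
  rewrite -(ler_pM2r (x := `|h|)) ?normr_gt0 // -normrM.
  apply: le_trans (hr h hh); rewrite -normrN le_eqVlt; apply/orP; left; apply/eqP.
  congr (`| _ |); rewrite /GRing.scale /= mulr1 (addrC h t); field.
  exact/h0.
split; last by apply/cvg_lim.
by apply/cvg_ex; exists d.
Qed.

Lemma cder_epsP f t d : cder f t d <->
  forall e : R, 0 < e -> exists2 r : R, 0 < r & forall h, `|h| < r ->
    cn (f (t + h) - f t - h%:C * d) <= e * `|h|.
Proof.
split. move=> [/is_derive_epsP h1 /is_derive_epsP h2] e e0.
  have e20 : 0 < e / 2 by rewrite divr_gt0.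
  have [r1 r10 H1] := h1 _ e20; have [r2 r20 H2] := h2 _ e20.
  exists (Num.min r1 r2); first by rewrite lt_min r10.
  move=> h; rewrite lt_min => /andP[/H1 + /H2].
  rewrite /cn !cReB !cImB cReM cImM !mul0r subr0 addr0; lra.
split; apply/is_derive_epsP => e e0; have [r r0 hr] := H e e0;
  exists r => // h /hr; rewrite /cn !cReB !cImB cReM cImM !mul0r subr0 addr0;
  apply: le_trans; by rewrite ?lerDl ?lerDr.
Qed.

Lemma cder_lin (z : R[i]) t : cder (fun s => s%:C * z) t z.
Proof.
apply/cder_epsP => e e0; exists 1 => // h _; rewrite [X in cn X](_ : _ = 0); last by rewrite rmorphD /=; ring.
by rewrite cn0 mulr_ge0 // ltW.
Qed.

Lemma cderX f t d n : cder f t d -> cder (fun s => f s ^+ n) t (n%:R * f t ^+ n.-1 * d).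
Proof.
move=> h; elim: n => [|n IH]; first by rewrite !mul0r; exact/cder_cst.
rewrite (_ : (fun s => _) = fun s => f s * f s ^+ n); last by apply/funext => s; rewrite exprS.
rewrite (_ : _ * d = d * f t ^+ n + f t * (n%:R * f t ^+ n.-1 * d)); first exact/cderM.
by case: n {IH} => [|n]; rewrite /= -?[n.+2%:R]natr1 ?exprS; ring.
Qed.

End Limits.

(** * The mean value inequality *)

Section MeanValue.
Context {R : realType}.

Lemma mvt_bound (g dg : R -> R) (c e t : R) :
  (forall x : R, `|x| <= `|t| -> is_derive x 1 g (dg x)) ->
  (forall x, `|x| <= `|t| -> `|dg x - c| <= e) ->
  `|g t - g 0 - t * c| <= e * `|t|.
Proof.
move=> hd hb.
have gc : forall x, `|x| <= `|t| -> {for x, continuous g}.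
  move=> x /hd hx; apply: differentiable_continuous.
  by apply/derivable1_diffP.
case: (leP 0 t) => t0. have [||x hx E] := @MVT_segment R g dg 0 t t0.
  - move=> x; rewrite /= => /andP[x0 xt]; apply: hd. by rewrite !ger0_norm ?(ltW x0) ?(ltW xt).
  - apply: continuous_in_subspaceT => x; rewrite inE => /andP[x0 xt].
    by apply: gc; rewrite !ger0_norm.
  move: hx; rewrite /= => /andP[x0 xt].
  rewrite E subr0 [t * c]mulrC -mulrBl normrM ler_wpM2r // hb //.
  by rewrite !ger0_norm.
have [||x hx E] := @MVT_segment R g dg t 0 (ltW t0).
- move=> x; rewrite /= => /andP[x0 xt]; apply: hd. by rewrite !ltr0_norm ?lerN2 ?ltW.
- apply: continuous_in_subspaceT => x; rewrite inE => /andP[x0 xt].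
  by apply: gc; rewrite !ler0_norm ?lerN2 ?(ltW t0).
move: hx; rewrite /= => /andP[x0 xt].
have -> : g t - g 0 - t * c = (dg x - c) * t. by rewrite -[g t - g 0]opprB E; ring.
by rewrite normrM ler_wpM2r // hb // !ler0_norm ?lerN2 ?(ltW t0).
Qed.

(** The mean value theorem is applied to real and imaginary parts separately, as their intermediate
    points differ; this costs the factor 2. The comparison with a fixed slope c is the shape in
    which first-order remainders are estimated below. *)
Lemma cmvt g dg (c : R[i]) (e t : R) : (forall x : R, `|x| <= `|t| -> cder g x (dg x)) ->
  (forall x, `|x| <= `|t| -> cn (dg x - c) <= e) ->
  cn (g t - g 0 - t%:C * c) <= 2 * e * `|t|.
Proof.
move=> hd hb.
have h1 := @mvt_bound (fun x => Re (g x)) (fun x => Re (dg x)) (Re c) e t (fun x hx => (hd x hx).1).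
have h2 := @mvt_bound (fun x => Im (g x)) (fun x => Im (dg x)) (Im c) e t (fun x hx => (hd x hx).2).
rewrite /cn !cReB !cImB cReM cImM !mul0r subr0 addr0.
have {}h1 : `|Re (g t) - Re (g 0) - t * Re c| <= e * `|t|.
  by apply: h1 => x hx; rewrite -cReB (le_trans (Re_le_cn _)) // hb.
have {}h2 : `|Im (g t) - Im (g 0) - t * Im c| <= e * `|t|.
  by apply: h2 => x hx; rewrite -cImB (le_trans (Im_le_cn _)) // hb.
lra.
Qed.

End MeanValue.

(** * Partial derivatives and total differentiability *)

Section Partials.
Context {R : realType} {m : nat}.
Notation V := 'rV[R[i]]_m.
Implicit Types (w v : V) (i : rcoord m) (f g : V -> R[i]).

Definition cunit i : R[i] := if i.2 then 'i else 1.

Lemma cn_cunit i : cn (cunit i) = 1.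
Proof. by rewrite /cn /cunit; case: i.2 ; rewrite ?normr0 ?normr1 ?addr0 ?add0r. Qed.
Lemma axisE i w t j : axis_line i w t 0 j = w 0 j + t%:C * cunit i * (j == i.1)%:R.
Proof. by rewrite !mxE. Qed.
Lemma axis0 i w : axis_line i w 0 = w.
Proof. by rewrite /axis_line mul0r scale0r addr0. Qed.
Lemma axisD i w s t : axis_line i (axis_line i w s) t = axis_line i w (s + t).
Proof. by rewrite /axis_line -addrA -scalerDl -mulrDl rmorphD. Qed.
Lemma axisC i k w s t : axis_line i (axis_line k w s) t = axis_line k (axis_line i w t) s.
Proof. by rewrite /axis_line addrAC. Qed.

Definition nearv (d : R) w v := forall j, cn (v 0 j - w 0 j) < d.

Lemma nearv_refl d w : 0 < d -> nearv d w w.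
Proof. by move=> d0 j; rewrite subrr cn0. Qed.
Lemma nearv_le d d' w v : d <= d' -> nearv d w v -> nearv d' w v.
Proof. move=> dd h j; exact: lt_le_trans (h j) dd. Qed.

Lemma nearv_trans d d' w v u : nearv d w v -> nearv d' v u -> nearv (d + d') w u.
Proof.
move=> h h' j; apply: le_lt_trans (cn_triangle (v 0 j) _ _) _.
by rewrite addrC ltrD.
Qed.

Lemma nearv_axis d w i t : `|t| < d -> nearv d w (axis_line i w t).
Proof.
move=> td j; rewrite axisE addrAC subrr add0r -mulrA cnMR.
case: eqP => _; rewrite ?mulr1 ?cn_cunit ?mulr1 // mulr0 cn0 mulr0.
by apply: le_lt_trans td.
Qed.

Definition pder i f w d := cder (fun t => f (axis_line i w t)) 0 d.

Lemma pder_partial i f w : has_partial i f w -> pder i f w (partial i f w).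
Proof.
move=> [h1 h2]; split => /=; rewrite derive1E //.
Qed.
Lemma pder_has i f w d : pder i f w d -> has_partial i f w.
Proof. by move=> [[h1 _] [h2 _]]. Qed.

Lemma pderE i f w d : pder i f w d -> partial i f w = d.
Proof.
move=> [[h1 e1] [h2 e2]]; apply: ceqP => /=; rewrite derive1E //.
Qed.

Lemma pder_line i f w s : has_partial i f (axis_line i w s) ->
  cder (fun t => f (axis_line i w t)) s (partial i f (axis_line i w s)).
Proof.
move=> /pder_partial /cder_epsP h; apply/cder_epsP => e /h [r r0 H].
exists r => // t /H; rewrite !axisD addr0 add0r.
by rewrite [s + t]addrC addrC.
Qed.

Lemma pder_ext i f g w d r : 0 < r -> (forall v, nearv r w v -> f v = g v) ->
  pder i f w d -> pder i g w d.
Proof.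
move=> r0 fg /cder_epsP h; apply/cder_epsP => e /h [r' r'0 H].
exists (Num.min r r'); first by rewrite lt_min r0.
move=> t; rewrite lt_min => /andP[tr /H]; rewrite !add0r -!fg //.
  by rewrite axis0; exact/nearv_refl.
exact/nearv_axis.
Qed.

Lemma pder_cst i c w : pder i (fun=> c) w 0. Proof. exact/cder_cst. Qed.
Lemma pderD i f g w d e : pder i f w d -> pder i g w e -> pder i (fun v => f v + g v) w (d + e).
Proof. exact/cderD. Qed.
Lemma pderM i f g w d e : pder i f w d -> pder i g w e ->
  pder i (fun v => f v * g v) w (d * g w + f w * e).
Proof.
move=> h1 h2; have := cderM h1 h2; rewrite axis0 //.
Qed.
Lemma pderJ i f w d : pder i f w d -> pder i (fun v => (f v)^*) w d^*.
Proof. exact/cderJ. Qed.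

Lemma pder_coord i w j : pder i (fun v => v 0 j) w (cunit i * (j == i.1)%:R).
Proof.
apply/cder_epsP => e e0; exists 1 => // h _.
rewrite axis0 axisE [X in cn X](_ : _ = 0); last by ring.
by rewrite cn0 mulr_ge0 // ltW.
Qed.


Definition rcomp (i : rcoord m) w : R := if i.2 then Im (w 0 i.1) else Re (w 0 i.1).

Lemma coord_funE i w : coord_fun i w = (rcomp i w)%:C.
Proof. by []. Qed.
Lemma rcompB i w v : rcomp i (v - w) = rcomp i v - rcomp i w.
Proof. by rewrite /rcomp !mxE; case: i.2; rewrite ?cImB ?cReB. Qed.

(** The point reached from w by moving the real coordinates in s one after the other: the
    telescoping path for [frechet]. *)
Definition shiftv s h w := foldr (fun a v => axis_line a v (h a)) w s.

Lemma shiftvE s h w : shiftv s h w = w + \sum_(a <- s) ((h a)%:C * cunit a) *: delta_mx 0 a.1.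
Proof.
elim: s => [|a s IH] /=; first by rewrite big_nil addr0.
by rewrite IH big_cons /axis_line -addrA [in X in _ + X]addrC.
Qed.

Lemma shiftv_near s h w d : \sum_(a <- s) `|h a| < d -> nearv d w (shiftv s h w).
Proof.
move=> hd j; rewrite shiftvE mxE addrAC subrr add0r summxE.
apply: le_lt_trans (cn_sum _ _ _) _; apply: le_lt_trans hd.
apply: ler_sum => a _; rewrite !mxE -mulrA cnMR -[leRHS]mulr1 ler_wpM2l //.
rewrite (le_trans (cnM _ _)) // cn_cunit.
by case: (_ && _); rewrite ?cn1 ?cn0.
Qed.

Lemma shiftv_full w v : v = shiftv (index_enum (rcoord m)) (fun a => rcomp a (v - w)) w.
Proof.
rewrite shiftvE; apply/rowP => j; rewrite mxE summxE.
rewrite [X in _ = _ + X](_ : _ = v 0 j - w 0 j); first by ring.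
rewrite -(pair_big xpredT xpredT (fun k c =>
  (((rcomp (k, c) (v - w))%:C * cunit (k, c)) *: delta_mx 0 k : 'rV[R[i]]_m) 0 j)).
rewrite (bigD1 j) //= [X in _ + X]big1; last first. move=> k kj; rewrite big1 // => c _.
  by rewrite !mxE eq_sym (negbTE kj) mulr0.
rewrite big_bool !mxE !eqxx /rcomp !mxE.
by apply: ceqP; rewrite /=; ring.
Qed.

(** Along the path that changes one real coordinate at a time, each increment differs from its
    linear part by at most e |h a| ([cmvt] with e / 2), and the errors add up. *)
Lemma frechet f w : (exists2 d : R, 0 < d & forall a v, nearv d w v -> has_partial a f v) ->
  (forall a (e : R), 0 < e -> exists2 d : R, 0 < d &
     forall v, nearv d w v -> cn (partial a f v - partial a f w) < e) ->
  forall e : R, 0 < e -> exists2 d : R, 0 < d & forall v, nearv d w v ->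
    cn (f v - f w - \sum_a (rcomp a (v - w))%:C * partial a f w) <=
    e * \sum_a `|rcomp a (v - w)|.
Proof.
move=> [d0 d00 hp] hc e e0.
have e20 : 0 < e / 2 by rewrite divr_gt0.
have [d1 d10 hd1] : exists2 d : R, 0 < d & forall a v, nearv d w v ->
    cn (partial a f v - partial a f w) < e / 2.
  have H a := hc a _ e20.
  have {}H : forall a, exists d : R, 0 < d /\ forall v, nearv d w v ->
    cn (partial a f v - partial a f w) < e / 2 by move=> a; have [d] := H a; exists d.
  have [D HD] := choice H.
  exists (\big[Num.min/1]_a D a). by elim/big_rec: _ => // a x _ x0; rewrite lt_min x0 (HD a).1.
  move=> a v hv; apply: (HD a).2; apply: nearv_le hv.
  by rewrite (bigD1 a) //= ge_min lexx.
pose d := Num.min d0 d1.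
have key s h : \sum_(a <- s) `|h a| < d ->
   cn (f (shiftv s h w) - f w - \sum_(a <- s) (h a)%:C * partial a f w) <= e * \sum_(a <- s) `|h a|.
  elim: s => [|a s IH]; first by rewrite /= !big_nil !subrr cn0 mulr0.
  rewrite !big_cons /= => hs.
  have hs' : \sum_(a <- s) `|h a| < d by apply: le_lt_trans hs; rewrite lerDr.
  have := IH hs'; set v := shiftv s h w => {}IH.
  have hnear x : `|x| <= `|h a| -> nearv d w (axis_line a v x).
    move=> hx; have : nearv (\sum_(a <- s) `|h a| + (d - \sum_(a <- s) `|h a|)) w (axis_line a v x).
      have {}hx : `|x| < d - \sum_(a <- s) `|h a|. by apply: le_lt_trans hx _; rewrite ltrBrDr.
      have [r /andP[r1 r2]] : exists r, (\sum_(a <- s) `|h a| < r) && (`|x| < d - r).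
        exists ((\sum_(a <- s) `|h a| + (d - `|x|)) / 2).
        by apply/andP; split; lra.
      move=> j; have := nearv_trans (shiftv_near w r1) (@nearv_axis _ v a _ r2) j.
      by rewrite !subrKC.
    by rewrite subrKC.
  have := @cmvt R (fun x => f (axis_line a v x)) (fun x => partial a f (axis_line a v x))
     (partial a f w) (e / 2) (h a).
  rewrite axis0 (_ : 2 * (e / 2) = e); last by field.
  move=> hM; rewrite mulrDr; apply: (@le_trans _ _ (cn (f (axis_line a v (h a)) - f v
    - (h a)%:C * partial a f w) + cn (f v - f w - \sum_(b <- s) (h b)%:C * partial b f w))).
    apply: le_trans (cnD _ _); rewrite le_eqVlt; apply/orP; left; apply/eqP.
    by congr cn; ring.
  apply: lerD IH; apply: hM => x hx. apply: pder_line; apply: hp; apply: nearv_le (hnear _ hx).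
    by rewrite ge_min lexx.
  apply: ltW; apply: hd1; apply: nearv_le (hnear _ hx).
  by rewrite ge_min lexx orbT.
have d_gt0 : 0 < d by rewrite lt_min d00.
(* Without coordinates v = w. Otherwise the radius is divided by their number, which keeps the sum
   of all increments below d. *)
have [N0|N0] := posnP #|{: rcoord m}|.
  have E0 (a : rcoord m) : False by have := card0_eq N0 a; rewrite inE.
  exists 1 => // v _; have -> : v = w.
    by rewrite (shiftv_full w v) shiftvE big1 ?addr0 // => a _; case: (E0 a).
  rewrite subrr [X in _ - X]big1; last by move=> a _; case: (E0 a).
  by rewrite subr0 cn0 mulr_ge0 ?sumr_ge0 // ltW.
exists (d / #|{: rcoord m}|%:R); first by rewrite divr_gt0 // ltr0n.
move=> v hv; rewrite [in f v](shiftv_full w v); apply: key.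
have -> : d = \sum_(a : rcoord m) d / #|{: rcoord m}|%:R.
  by rewrite sumr_const -[RHS]mulr_natr divfK // pnatr_eq0 -lt0n.
have [i0 _] := card_gt0P N0.
apply: ltr_sum => [|a _]; first by apply/hasP; exists i0; rewrite ?mem_index_enum.
rewrite rcompB; apply: le_lt_trans (hv a.1).
rewrite /rcomp /cn; case: a.2; rewrite -?cImB -?cReB ?lerDl ?lerDr //.
Qed.

End Partials.

(** * The chain rule *)

Section Chain.
Context {R : realType} {m p : nat}.

Definition C1at q f (w : 'rV[R[i]]_q) : Prop :=
  (exists2 d : R, 0 < d & forall a v, nearv d w v -> has_partial a f v) /\
  (forall a (e : R), 0 < e -> exists2 d : R, 0 < d &
     forall v, nearv d w v -> cn (partial a f v - partial a f w) < e).

Lemma cn_entry_rcomp q (v w : 'rV[R[i]]_q) j :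
  cn (v 0 j - w 0 j) = `|rcomp (j, false) (v - w)| + `|rcomp (j, true) (v - w)|.
Proof. by rewrite /rcomp !mxE. Qed.

(** f is replaced by its linear part at u w ([frechet]), and the components of u by theirs. K bounds
    the total increment of u per unit of h, M the weight with which the errors of u enter; e is
    split in halves between the two errors. *)
Lemma pder_chain f (u : 'rV[R[i]]_m -> 'rV[R[i]]_p) i w : C1at f (u w) ->
  (forall a, has_partial i (fun v => coord_fun a (u v)) w) ->
  pder i (fun v => f (u v)) w (\sum_a partial i (fun v => coord_fun a (u v)) w * partial a f (u w)).
Proof.
move=> [hf1 hf2] hu; apply/cder_epsP => e e0.
pose c a := partial i (fun v => coord_fun a (u v)) w.
pose K := \sum_a (cn (c a) + 1) + 1.
pose M := \sum_a cn (partial a f (u w)) + 1.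
have K0 : 0 < K by rewrite ltr_wpDl // sumr_ge0 // => a _; rewrite addr_ge0 ?cn_ge0.
have M0 : 0 < M by rewrite ltr_wpDl // sumr_ge0 // => a _; rewrite cn_ge0.
have e10 : 0 < e / (2 * K) by rewrite divr_gt0 // mulr_gt0.
have [d d0 hd] := frechet hf1 hf2 e10.
pose e2 := Num.min 1 (e / (2 * M)).
have e20 : 0 < e2 by rewrite lt_min ltr01 divr_gt0 // mulr_gt0.
have /choice [D HD] : forall a, exists x, 0 < x /\ forall h, `|h| < x ->
     cn ((rcomp a (u (axis_line i w h) - u w))%:C - h%:C * c a) <= e2 * `|h|.
  move=> a.
  have /pder_partial /cder_epsP /(_ _ e20) [r r0 hr] := hu a.
  exists r; split => // h /hr; rewrite !coord_funE add0r axis0 rcompB.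
  by rewrite rmorphB.
pose r0 := \big[Num.min/1]_a D a.
have r00 : 0 < r0. by rewrite /r0; elim/big_rec: _ => // a x _ x0; rewrite lt_min x0 (HD a).1.
exists (Num.min r0 (d / (2 * K))); first by rewrite lt_min r00 divr_gt0 // mulr_gt0.
move=> h; rewrite lt_min => /andP[hr0 hdK]; rewrite add0r axis0.
set v := axis_line i w h.
have Hc a : cn ((rcomp a (u v - u w))%:C - h%:C * c a) <= e2 * `|h|.
  by apply: (HD a).2; apply: lt_le_trans hr0 _; rewrite /r0 (bigD1 a) //= ge_min lexx.
have e2le1 : e2 <= 1 by rewrite ge_min lexx.
have Hr a : `|rcomp a (u v - u w)| <= (cn (c a) + 1) * `|h|.
  rewrite -cnR -[_%:C](subrK (h%:C * c a)) (le_trans (cnD _ _)) //.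
  rewrite mulrDl mul1r [leRHS]addrC lerD //. by rewrite (le_trans (Hc a)) // ler_piMl.
  by rewrite cnMR mulrC.
have Hs : \sum_a `|rcomp a (u v - u w)| <= K * `|h|.
  apply: (@le_trans _ _ (\sum_a (cn (c a) + 1) * `|h|)); first exact/ler_sum.
  by rewrite -mulr_suml ler_wpM2r // lerDl.
have Hnear : nearv d (u w) (u v). move=> j; rewrite cn_entry_rcomp.
  have HK a : `|rcomp a (u v - u w)| < d / 2. apply: (@le_lt_trans _ _ (K * `|h|)).
      apply: le_trans Hs; rewrite (bigD1 a) //= lerDl sumr_ge0 //.
    by rewrite mulrC -ltr_pdivlMr // -mulrA -invfM.
  by rewrite (splitr d) ltrD.
have := hd _ Hnear => {}hd.
have -> : f (u v) - f (u w) - h%:C * (\sum_a c a * partial a f (u w)) =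
  (f (u v) - f (u w) - \sum_a (rcomp a (u v - u w))%:C * partial a f (u w)) +
  \sum_a ((rcomp a (u v - u w))%:C - h%:C * c a) * partial a f (u w).
  have -> : \sum_a ((rcomp a (u v - u w))%:C - h%:C * c a) * partial a f (u w) =
    \sum_a (rcomp a (u v - u w))%:C * partial a f (u w) -
    h%:C * \sum_a c a * partial a f (u w).
    by rewrite mulr_sumr -sumrB; apply: eq_bigr => a _; ring.
  by ring.
apply: le_trans (cnD _ _) _.
have -> : e * `|h| = e / 2 * `|h| + e / 2 * `|h| by rewrite -mulrDl -splitr.
apply: lerD. apply: le_trans hd _; apply: le_trans (ler_wpM2l (ltW e10) Hs) _.
  by rewrite mulrA ler_wpM2r // invfM !mulrA divfK ?gt_eqF.
apply: le_trans (cn_sum _ _ _) _.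
apply: (@le_trans _ _ (\sum_a e2 * `|h| * cn (partial a f (u w)))).
  by apply: ler_sum => a _; rewrite (le_trans (cnM _ _)) // ler_wpM2r ?cn_ge0.
rewrite -mulr_sumr mulrAC ler_wpM2r //.
apply: (@le_trans _ _ (e2 * M)); first by rewrite ler_wpM2l ?lerDl // ltW.
rewrite -ler_pdivlMr //; rewrite ge_min; apply/orP; right.
by rewrite invfM mulrA.
Qed.

End Chain.

(** * Functions of class C^r depending on a real parameter *)

Section Families.
Context {R : realType}.
Section OneDim.
Context {m : nat}.
Notation V := 'rV[R[i]]_m.
Implicit Types (D : V -> R -> Prop) (F G : V -> R -> R[i]).

Definition jcont F w s : Prop := forall e : R, 0 < e -> exists2 d : R, 0 < d &
  forall v s', nearv d w v -> `|s' - s| < d -> cn (F v s' - F w s) < e.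

Definition dopen D : Prop := forall w s, D w s -> exists2 d : R, 0 < d &
  forall v s', nearv d w v -> `|s' - s| < d -> D v s'.

(** Class C^r in w, with all partial derivatives jointly continuous in (w, s); s is never
    differentiated. This is the regularity that survives integrating s out, and families constant in
    s give back [C_class] ([C_classP]). *)
Fixpoint Cf D (r : nat) F : Prop := (forall w s, D w s -> jcont F w s) /\ if r is r'.+1 then
    forall i : rcoord m, (forall w s, D w s -> has_partial i (F^~ s) w) /\
      Cf D r' (fun w s => partial i (F^~ s) w)
  else True.

Lemma jcont_pair F G w s (e : R) : jcont F w s -> jcont G w s -> 0 < e ->
  exists2 d : R, 0 < d & forall v s', nearv d w v -> `|s' - s| < d ->
    cn (F v s' - F w s) < e /\ cn (G v s' - G w s) < e.
Proof.
move=> hF hG e0; have [d1 d10 h1] := hF e e0; have [d2 d20 h2] := hG e e0.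
exists (Num.min d1 d2); first by rewrite lt_min d10.
move=> v s' hv; rewrite lt_min => /andP[hs1 hs2]; split.
  by apply: h1 hs1; apply: nearv_le hv; rewrite ge_min lexx.
by apply: h2 hs2; apply: nearv_le hv; rewrite ge_min lexx orbT.
Qed.
Lemma jcont_cst c w s : jcont (fun _ _ => c) w s.
Proof. by exists 1 => // v s' _ _; rewrite subrr cn0. Qed.

Lemma jcontD F G w s : jcont F w s -> jcont G w s -> jcont (fun v t => F v t + G v t) w s.
Proof.
move=> hF hG e e0; have [|d d0 H] := @jcont_pair F G w s (e / 2) hF hG. by rewrite divr_gt0.
exists d => // v s' hv hs; have [h1 h2] := H v s' hv hs.
have -> : F v s' + G v s' - (F w s + G w s) = (F v s' - F w s) + (G v s' - G w s) by ring.
by apply: le_lt_trans (cnD _ _) _; rewrite (splitr e) ltrD.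
Qed.

Lemma jcontM F G w s : jcont F w s -> jcont G w s -> jcont (fun v t => F v t * G v t) w s.
Proof.
move=> hF hG e e0.
pose K := cn (F w s) + cn (G w s) + 1.
have K0 : 0 < K by rewrite ltr_wpDl // addr_ge0 ?cn_ge0.
pose e1 := Num.min 1 (e / K).
have e10 : 0 < e1 by rewrite lt_min ltr01 divr_gt0.
have [d d0 H] := jcont_pair hF hG e10.
exists d => // v s' hv hs; have [h1 h2] := H v s' hv hs.
have -> : F v s' * G v s' - (F w s * G w s) =
   (F v s' - F w s) * ((G v s' - G w s) + G w s) + F w s * (G v s' - G w s) by ring.
apply: le_lt_trans (cnD _ _) _.
apply: (@le_lt_trans _ _ (cn (F v s' - F w s) * (1 + cn (G w s)) + cn (F w s) * e1)). apply: lerD.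
    apply: le_trans (cnM _ _) _; rewrite ler_wpM2l ?cn_ge0 //.
    apply: le_trans (cnD _ _) _; rewrite lerD2r (le_trans (ltW h2)) //.
    by rewrite ge_min lexx.
  by apply: le_trans (cnM _ _) _; rewrite ler_wpM2l ?cn_ge0 // ltW.
apply: (@lt_le_trans _ _ (e1 * K)); last first. by rewrite -ler_pdivlMr // ge_min lexx orbT.
have : cn (F v s' - F w s) * (1 + cn (G w s)) < e1 * (1 + cn (G w s)).
  by rewrite ltr_pM2r // ltr_pwDl ?cn_ge0.
rewrite /K; lra.
Qed.

Lemma jcontJ F w s : jcont F w s -> jcont (fun v t => (F v t)^*) w s.
Proof.
by move=> hF e e0; have [d d0 H] := hF e e0; exists d => // v s' hv hs;
  rewrite -rmorphB cnJ; exact/H.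
Qed.

Lemma jcont_ext F G w s r : 0 < r ->
  (forall v s', nearv r w v -> `|s' - s| < r -> F v s' = G v s') ->
  jcont F w s -> jcont G w s.
Proof.
move=> r0 FG hF e e0; have [d d0 H] := hF e e0.
exists (Num.min r d); first by rewrite lt_min r0.
move=> v s' hv; rewrite lt_min => /andP[hr hd].
rewrite -FG //; last by apply: nearv_le hv; rewrite ge_min lexx.
rewrite -FG ?subrr ?normr0 //; last exact/nearv_refl.
by apply: H => //; apply: nearv_le hv; rewrite ge_min lexx orbT.
Qed.
Lemma Cf0 D r F w s : Cf D r F -> D w s -> jcont F w s.
Proof. by case: r => [|r] [h _]; exact/h. Qed.
Lemma Cf_partial D r F i : Cf D r.+1 F -> Cf D r (fun w s => partial i (F^~ s) w).
Proof. by case=> _ /(_ i)[]. Qed.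
Lemma Cf_has D r F i w s : Cf D r.+1 F -> D w s -> has_partial i (F^~ s) w.
Proof. by case=> _ /(_ i)[h _]; exact/h. Qed.

Lemma Cf_W D r F : Cf D r.+1 F -> Cf D r F.
Proof.
elim: r F => [|r IH] F; first by case=> h _.
move=> [h1 h2]; split => // i; have [h3 h4] := h2 i; split => //.
exact/IH.
Qed.

Lemma Cf_le D r r' F : (r <= r')%N -> Cf D r' F -> Cf D r F.
Proof.
move=> /subnK <-; elim: (_ - _)%N => //= k IH h; apply: IH.
exact/Cf_W.
Qed.

Lemma Cf_sub D D' r F : (forall w s, D' w s -> D w s) -> Cf D r F -> Cf D' r F.
Proof.
move=> sub; elim: r F => [|r IH] F [h1 h2]; split=> //; try by move=> w s /sub; exact/h1.
move=> i; have [h3 h4] := h2 i; split; first by move=> w s /sub; exact/h3.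
exact/IH.
Qed.

Lemma Cf_loc D r F : (forall w s, D w s -> exists2 D', D' w s & Cf D' r F) -> Cf D r F.
Proof.
elim: r F => [|r IH] F H; split=> //; try by move=> w s /H [D' hD [h _]]; exact/h.
split; first by move=> w s /H [D' hD h]; exact: Cf_has h hD.
by apply: IH => w s /H [D' hD h]; exists D' => //; exact/Cf_partial.
Qed.

Lemma Cf_ext D r F G : dopen D -> (forall w s, D w s -> F w s = G w s) -> Cf D r F -> Cf D r G.
Proof.
move=> oD; elim: r F G => [|r IH] F G FG hF. split => // w s hD; have [d d0 hd] := oD w s hD.
  by apply: (jcont_ext d0) (Cf0 hF hD) => v s' hv hs; exact/FG/hd.
split. move=> w s hD; have [d d0 hd] := oD w s hD.
  by apply: (jcont_ext d0) (Cf0 hF hD) => v s' hv hs; exact/FG/hd.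
move=> i.
have E w s : D w s -> pder i (G^~ s) w (partial i (F^~ s) w).
  move=> hD; have [d d0 hd] := oD w s hD.
  apply: (pder_ext d0) (pder_partial (Cf_has i hF hD)) => v hv; apply: FG.
  by apply: hd => //; rewrite subrr normr0.
split; first by move=> w s /E; exact/pder_has.
apply: IH; last exact: Cf_partial hF.
by move=> w s /E /pderE.
Qed.

Lemma Cf_step D r F dF : dopen D -> (forall w s, D w s -> jcont F w s) ->
  (forall i w s, D w s -> pder i (F^~ s) w (dF i w s)) ->
  (forall i, Cf D r (dF i)) -> Cf D r.+1 F.
Proof.
move=> oD hc hp hd; split => // i; split. move=> w s /(hp i); exact/pder_has.
by apply: Cf_ext (hd i) => // w s /(hp i) /pderE ->.
Qed.
Lemma pder_Cf D r F i w s : Cf D r.+1 F -> D w s -> pder i (F^~ s) w (partial i (F^~ s) w).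
Proof. by move=> hF hD; apply: pder_partial; exact: Cf_has hF hD. Qed.

Lemma Cf_param D r g : dopen D ->
  (forall w s, D w s -> jcont (fun _ => g) w s) -> Cf D r (fun _ s => g s).
Proof.
move=> oD; elim: r g => [|r IH] g hg //.
apply: (@Cf_step _ _ _ (fun _ _ _ => 0)) => //. move=> i w s hD; exact/pder_cst.
by move=> i; apply: IH => w s _; exact/jcont_cst.
Qed.
Lemma Cf_cst D r c : dopen D -> Cf D r (fun _ _ => c).
Proof. by move=> oD; apply: (@Cf_param D r (fun=> c)) => // w s _; exact/jcont_cst. Qed.

Lemma CfD D r F G : dopen D -> Cf D r F -> Cf D r G -> Cf D r (fun w s => F w s + G w s).
Proof.
move=> oD; elim: r F G => [|r IH] F G hF hG.
  by split => // w s hD; apply: jcontD; [exact: Cf0 hF hD|exact: Cf0 hG hD].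
apply: (@Cf_step _ _ _ (fun i w s => partial i (F^~ s) w + partial i (G^~ s) w)) => //.
- by move=> w s hD; apply: jcontD; [exact: Cf0 hF hD|exact: Cf0 hG hD].
- move=> i w s hD; exact: (pderD (pder_Cf i hF hD) (pder_Cf i hG hD)).
- by move=> i; apply: IH; exact/Cf_partial.
Qed.

Lemma CfM D r F G : dopen D -> Cf D r F -> Cf D r G -> Cf D r (fun w s => F w s * G w s).
Proof.
move=> oD; elim: r F G => [|r IH] F G hF hG.
  by split => // w s hD; apply: jcontM; [exact: Cf0 hF hD|exact: Cf0 hG hD].
apply: (@Cf_step _ _ _ (fun i w s => partial i (F^~ s) w * G w s
   + F w s * partial i (G^~ s) w)) => //.
- by move=> w s hD; apply: jcontM; [exact: Cf0 hF hD|exact: Cf0 hG hD].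
- move=> i w s hD; exact: (pderM (pder_Cf i hF hD) (pder_Cf i hG hD)).
- move=> i; apply: CfD => //; apply: IH.
  + exact/Cf_partial.
  + exact/Cf_W.
  + exact/Cf_W.
  + exact/Cf_partial.
Qed.

Lemma CfJ D r F : dopen D -> Cf D r F -> Cf D r (fun w s => (F w s)^*).
Proof.
move=> oD; elim: r F => [|r IH] F hF. by split => // w s hD; apply: jcontJ; exact: Cf0 hF hD.
apply: (@Cf_step _ _ _ (fun i w s => (partial i (F^~ s) w)^*)) => //.
- by move=> w s hD; apply: jcontJ; exact: Cf0 hF hD.
- move=> i w s hD; exact: (pderJ (pder_Cf i hF hD)).
- move=> i; exact/IH/Cf_partial.
Qed.
Lemma CfZ D r c F : dopen D -> Cf D r F -> Cf D r (fun w s => c * F w s).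
Proof. by move=> oD hF; apply: CfM => //; exact/Cf_cst. Qed.

Lemma CfN D r F : dopen D -> Cf D r F -> Cf D r (fun w s => - F w s).
Proof.
move=> oD hF; apply: (Cf_ext oD) (CfZ (-1) oD hF) => w s _; exact/mulN1r.
Qed.
Lemma CfB D r F G : dopen D -> Cf D r F -> Cf D r G -> Cf D r (fun w s => F w s - G w s).
Proof. by move=> oD hF hG; apply: CfD => //; exact/CfN. Qed.

Lemma Cf_sum D r I l (P : pred I) (F : I -> V -> R -> R[i]) :
  dopen D -> (forall k, P k -> Cf D r (F k)) ->
  Cf D r (fun w s => \sum_(k <- l | P k) F k w s).
Proof.
move=> oD hF; elim: l => [|k l IH]. by apply: (Cf_ext oD) (Cf_cst r 0 oD) => w s _; rewrite big_nil.
case Pk: (P k). by apply: (Cf_ext oD) (CfD oD (hF k Pk) IH) => w s _; rewrite big_cons Pk.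
by apply: (Cf_ext oD) IH => w s _; rewrite big_cons Pk.
Qed.

Lemma Cf_prod D r I l (P : pred I) (F : I -> V -> R -> R[i]) :
  dopen D -> (forall k, P k -> Cf D r (F k)) ->
  Cf D r (fun w s => \prod_(k <- l | P k) F k w s).
Proof.
move=> oD hF; elim: l => [|k l IH]. by apply: (Cf_ext oD) (Cf_cst r 1 oD) => w s _; rewrite big_nil.
case Pk: (P k). by apply: (Cf_ext oD) (CfM oD (hF k Pk) IH) => w s _; rewrite big_cons Pk.
by apply: (Cf_ext oD) IH => w s _; rewrite big_cons Pk.
Qed.
Lemma jcont_coord j w s : jcont (fun w _ => w 0 j) w s.
Proof. by move=> e e0; exists e => // v s' hv _. Qed.

Lemma Cf_coord D r j : dopen D -> Cf D r (fun w _ => w 0 j).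
Proof.
move=> oD; case: r => [|r]; first by split => // w s _; exact/jcont_coord.
apply: (@Cf_step _ _ _ (fun i _ _ => cunit i * (j == i.1)%:R)) => //.
- move=> w s _; exact/jcont_coord.
- move=> i w s _; exact/pder_coord.
- move=> i; exact/Cf_cst.
Qed.
Lemma cRe_half (z : R[i]) : (Re z)%:C = (1 / 2)%:C * (z + z^*).
Proof. by case: z => a b; apply: ceqP => /=; field. Qed.
Lemma cIm_half (z : R[i]) : (Im z)%:C = (0 +i* (- (1 / 2))) * (z - z^*).
Proof. by case: z => a b; apply: ceqP => /=; field. Qed.

Lemma CfRe D r F : dopen D -> Cf D r F -> Cf D r (fun w s => (Re (F w s))%:C).
Proof.
move=> oD hF; apply: (Cf_ext oD) (CfZ (1 / 2)%:C oD (CfD oD hF (CfJ oD hF))) => w s _.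
by rewrite cRe_half.
Qed.
Lemma CfIm D r F : dopen D -> Cf D r F -> Cf D r (fun w s => (Im (F w s))%:C).
Proof.
move=> oD hF; apply: (Cf_ext oD) (CfZ (0 +i* (- (1 / 2))) oD (CfB oD hF (CfJ oD hF))) => w s _.
by rewrite cIm_half.
Qed.
Lemma dopenT : dopen (fun _ _ => True).
Proof. by exists 1. Qed.

Lemma C1at_Cf D F w s : dopen D -> Cf D 1 F -> D w s -> C1at (F^~ s) w.
Proof.
move=> oD hF hD; split. have [d d0 hd] := oD _ _ hD; exists d => // a v hv.
  by apply: Cf_has hF _; apply: hd => //; rewrite subrr normr0.
move=> a e e0; have [d d0 hd] := Cf0 (Cf_partial a hF) hD e0.
by exists d => // v hv; apply: hd => //; rewrite subrr normr0.
Qed.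

End OneDim.

Lemma Cf_comps m p D r (u : 'rV[R[i]]_m -> R -> 'rV[R[i]]_p) :
  dopen D -> (forall j, Cf D r (fun w s => u w s 0 j)) ->
  forall a, Cf D r (fun w s => coord_fun a (u w s)).
Proof.
by move=> oD hu [j [|]]; [apply: CfIm|apply: CfRe].
Qed.

Lemma jcont_comp m p (u : 'rV[R[i]]_m -> R -> 'rV[R[i]]_p) f w s :
  (forall j, jcont (fun v t => u v t 0 j) w s) -> jcont f (u w s) s ->
  jcont (fun v t => f (u v t) t) w s.
Proof.
move=> hu hf e e0; have [d d0 hd] := hf e e0.
have /choice [D HD] : forall j, exists x, 0 < x /\ forall v t, nearv x w v ->
    `|t - s| < x -> cn (u v t 0 j - u w s 0 j) < d.
  move=> j.
  by have [x x0 hx] := hu j d d0; exists x.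
exists (Num.min d (\big[Num.min/1]_j D j)).
  by rewrite lt_min d0 /=; elim/big_rec: _ => // a x _ x0; rewrite lt_min (HD a).1.
move=> v t hv; rewrite lt_min => /andP[h1 h2]; apply: hd => // j.
apply: (HD j).2. apply: nearv_le hv; rewrite ge_min; apply/orP; right.
  by rewrite (bigD1 j) //= ge_min lexx.
by apply: lt_le_trans h2 _; rewrite (bigD1 j) //= ge_min lexx.
Qed.

Lemma pder_comp m p D D' (u : 'rV[R[i]]_m -> R -> 'rV[R[i]]_p) f :
  dopen D' -> (forall w s, D w s -> D' (u w s) s) ->
  (forall a, Cf D 1 (fun w s => coord_fun a (u w s))) -> Cf D' 1 f ->
  forall i w s, D w s -> pder i (fun v => f (u v s) s) w
    (\sum_a partial i (fun v => coord_fun a (u v s)) w * partial a (f^~ s) (u w s)).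
Proof.
move=> oD' sub hu hf i w s hD.
apply: (@pder_chain R m p (f^~ s) (u^~ s)); first exact: C1at_Cf oD' hf (sub _ _ hD).
move=> a; exact: Cf_has (hu a) hD.
Qed.

Lemma Cf_comp m p D D' r (u : 'rV[R[i]]_m -> R -> 'rV[R[i]]_p) f :
  dopen D -> dopen D' -> (forall w s, D w s -> D' (u w s) s) ->
  (forall j, Cf D r (fun w s => u w s 0 j)) -> Cf D' r f ->
  Cf D r (fun w s => f (u w s) s).
Proof.
move=> oD oD' sub hu hf.
have hc : forall w s, D w s -> jcont (fun v t => f (u v t) t) w s.
  move=> w s hD; apply: (@jcont_comp m p u f). move=> j; exact: Cf0 (hu j) hD.
  exact: Cf0 hf (sub _ _ hD).
elim: r f hu hf hc => [|r IH] f hu hf hc //.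
have hu' := Cf_comps oD hu.
apply: (@Cf_step _ _ _ _ (fun i w s =>
  \sum_a partial i (fun v => coord_fun a (u v s)) w * partial a (f^~ s) (u w s))) => //.
  apply: (@pder_comp _ _ D D') => // [a|]; first exact: Cf_le (hu' a).
  exact: Cf_le hf.
move=> i; apply: Cf_sum => // a _; apply: CfM => //; first exact: Cf_partial (hu' a).
apply: (IH (fun v s => partial a (f^~ s) v)).
- by move=> j; apply: Cf_W.
- exact/Cf_partial.
- move=> w s hD; apply: (@jcont_comp m p u (fun v t => partial a (f^~ t) v)).
    move=> j; exact: Cf0 (hu j) hD.
  exact: Cf0 (Cf_partial a hf) (sub _ _ hD).
Qed.

End Families.

(** * Smoothness: symmetry of second derivatives, inverses, flat functions *)

Section Smooth.
Context {R : realType}.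

Lemma gt0_complexE (e : R[i]) : 0 < e -> 0 < Re e /\ e = (Re e)%:C.
Proof. by case: e => a b /andP[/eqP -> ?]. Qed.

Lemma continuousP m (f : 'rV[R[i]]_m -> R[i]) (w : 'rV[R[i]]_m) :
  {for w, continuous f} <-> jcont (fun v _ => f v) w 0.
Proof.
split. move=> /cvgrPdist_lt hf e e0. have e2 : 0 < (e / 2)%:C :> R[i] by rewrite ltcR divr_gt0.
  have /nbhs_ballP [d /= /gt0_complexE [d0 dE] hd] := hf _ e2.
  exists (Re d) => // v s' hv _.
  have : ball w d v. split; first by rewrite dE ltcR. move=> i j; rewrite /ball /= ord1 dE.
    apply: le_lt_trans (normc_le_cn _) _; rewrite ltcR cnB.
    exact/hv.
  move=> /hd /= h; have := le_lt_trans (cn_le_normc _) h.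
  rewrite ltcR cnB; lra.
move=> hf; apply/(@cvgrPdist_lt _ _ _ (nbhs w) (nbhs_filter w)) => e /gt0_complexE [e0 eE].
have [d d0 hd] := hf _ e0.
apply/nbhs_ballP; exists (d / 2)%:C; first by rewrite /= ltcR divr_gt0.
move=> v hv; rewrite eE; apply: le_lt_trans (normc_le_cn _) _; rewrite ltcR cnB.
apply: (hd v 0); last by rewrite subrr normr0.
move=> j; have := hv.2 0 j; rewrite /ball /= => h.
have := le_lt_trans (cn_le_normc _) h; rewrite ltcR cnB; lra.
Qed.

Lemma C_classP m r (f : 'rV[R[i]]_m -> R[i]) :
  C_class r f <-> Cf (fun _ _ => True) r (fun w _ => f w).
Proof.
have cP g : continuous g <-> forall w s, True -> jcont (fun v (_ : R) => g v) w s.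
  split => [hg w s _ e e0|hg w]. have [d d0 hd] := (continuousP g w).1 (hg w) e e0.
    by exists d => // v s' hv _; apply: (hd v 0 hv); rewrite subrr normr0.
  by apply/continuousP; exact/hg.
elim: r f => [|r IH] f. by split => -[h _]; split => //; apply/cP.
split => -[h1 h2]; split; try by apply/cP.
  move=> i; have [h3 h4] := h2 i; split; first by move=> w s _.
  exact/IH.
move=> i; have [h3 h4] := h2 i; split; first by move=> w; exact: (h3 w 0).
exact/IH.
Qed.
Lemma smoothP m (f : 'rV[R[i]]_m -> R[i]) :
  smooth f <-> forall r, Cf (fun _ _ => True) r (fun w _ => f w).
Proof. by split => h r; apply/C_classP. Qed.

(** The second difference of f over a square of side t is t^2 times either mixed derivative, up to 4
    e t^2, by two nested applications of [cmvt]; it does not depend on the order of the two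
    directions. *)
Lemma clairaut m (D : 'rV[R[i]]_m -> R -> Prop) F i k w s : dopen D -> Cf D 2 F -> D w s ->
  partial i (partial k (F^~ s)) w = partial k (partial i (F^~ s)) w.
Proof.
move=> oD hF hD; set f := F^~ s.
have [d0 d00 hd0] := oD _ _ hD.
have D1 v : nearv d0 w v -> D v s by move=> hv; apply: hd0 => //; rewrite subrr normr0.
have key a b (e : R) : 0 < e -> exists2 d : R, 0 < d & forall t, `|t| < d ->
   cn (f (axis_line a (axis_line b w t) t) - f (axis_line a w t)
      - f (axis_line b w t) + f w - (t%:C * (t%:C * partial b (partial a f) w)))
   <= 4 * e * `|t| * `|t|.
  move=> e0.
  have h2 : Cf D 1 (fun w s => partial a (F^~ s) w) by exact/Cf_partial.
  have h3 : Cf D 0 (fun w s => partial b (fun v => partial a (F^~ s) v) w). exact/Cf_partial.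
  have [d d1 hd] := Cf0 h3 hD e0.
  exists (Num.min d d0 / 2); first by rewrite divr_gt0 // lt_min d1.
  move=> t; rewrite ltr_pdivlMr // => ht.
  have tt x y : `|x| <= `|t| -> `|y| <= `|t| ->
      nearv (Num.min d d0) w (axis_line a (axis_line b w y) x).
    move=> hx hy; have td : `|t| < Num.min d d0 - `|t| by lra.
    have := nearv_trans (@nearv_axis _ _ (Num.min d d0 - `|t|) w b y (le_lt_trans hy td)).
    have [r /andP[r1 r2]] : exists r, (`|t| < r) && (`|t| < Num.min d d0 - r).
      by exists (Num.min d d0 / 2); apply/andP; split; lra.
    move=> _; have := nearv_trans (@nearv_axis _ _ _ w b y (le_lt_trans hy r2))
      (@nearv_axis _ _ _ (axis_line b w y) a x (le_lt_trans hx r1)).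
    by rewrite subrK.
  have Dt x y : `|x| <= `|t| -> `|y| <= `|t| -> D (axis_line a (axis_line b w y) x) s.
    move=> hx hy; apply: D1; apply: nearv_le (tt x y hx hy); by rewrite ge_min lexx orbT.
  have t0 : `|0 : R| <= `|t| by rewrite normr0.
  have inner x : `|x| <= `|t| ->
     cn (partial a f (axis_line a (axis_line b w t) x) - partial a f (axis_line a w x)
       - t%:C * partial b (partial a f) w) <= 2 * e * `|t|.
    move=> hx.
    have := @cmvt R (fun y => partial a f (axis_line b (axis_line a w x) y))
      (fun y => partial b (partial a f) (axis_line b (axis_line a w x) y))
      (partial b (partial a f) w) e t.
    rewrite axis0 axisC; apply=> y hy. apply: pder_line; rewrite axisC.
      exact/(Cf_has b h2)/Dt.
    apply: ltW; rewrite axisC; apply: hd; last by rewrite subrr normr0.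
    by apply: nearv_le (tt x y hx hy); rewrite ge_min lexx.
  have hder b' x : `|x| <= `|t| -> (b' = t \/ b' = 0) ->
     cder (fun x => f (axis_line a (axis_line b w b') x)) x
       (partial a f (axis_line a (axis_line b w b') x)).
    move=> hx hb; apply/pder_line/(Cf_has a hF).
    by case: hb => ->; apply: Dt.
  have := @cmvt R (fun x => f (axis_line a (axis_line b w t) x) + (- 1) * f (axis_line a w x))
     (fun x => partial a f (axis_line a (axis_line b w t) x)
       + (0 * f (axis_line a w x) + (- 1) * partial a f (axis_line a w x)))
     (t%:C * partial b (partial a f) w) (2 * e * `|t|) t.
  rewrite !axis0 => H; have {}H := H _ _.
  rewrite (_ : 4 * e * `|t| * `|t| = 2 * (2 * e * `|t|) * `|t|); last by ring.
  set X := f (axis_line a (axis_line b w t) t) in H *.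
  rewrite (_ : X - _ - _ + _ - _ = X + -1 * f (axis_line a w t) - (f (axis_line b w t) + -1 * f w) -
    t%:C * (t%:C * partial b (partial a f) w)); last by ring.
  apply: H => x hx. apply: cderD; first by apply: hder => //; left. apply: (cderM (cder_cst _ _)).
    by have := hder 0 x hx (or_intror (erefl _)); rewrite axis0.
  rewrite mul0r add0r mulN1r; exact/inner.
apply/eqP; rewrite -subr_eq0; apply/eqP; apply: cn_small => e e0.
have e8 : 0 < e / 8 by rewrite divr_gt0.
have [d1 d10 H1] := key k i _ e8; have [d2 d20 H2] := key i k _ e8.
pose t := Num.min d1 d2 / 2.
have t0 : 0 < t by rewrite divr_gt0 // lt_min d10.
have tm : t < Num.min d1 d2 by rewrite /t gtr_pMr ?lt_min ?d10 // invf_lt1 // ltr1n.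
have {}H1 := H1 t; have {}H2 := H2 t.
move: tm; rewrite lt_min -{1 2}(gtr0_norm t0) => /andP[/H1 {}H1 /H2 {}H2].
rewrite -(ler_pM2l (x := `|t| * `|t|)) ?mulr_gt0 ?normr_gt0 ?gt_eqF // -mulrA -2!cnMR -/f.
move: H1 H2; rewrite (axisC k i).
set P := partial i (partial k f) w; set Q := partial k (partial i f) w.
move: (f (axis_line i (axis_line k w t) t)) (f (axis_line i w t)) (f (axis_line k w t)) (f w) P Q.
move=> X A B z P Q; rewrite cnB => H1 H2.
have -> : t%:C * (t%:C * (P - Q)) =
  (t%:C * (t%:C * P) - (X - B - A + z)) + (X - A - B + z - t%:C * (t%:C * Q)) by ring.
apply: le_trans (cnD _ _) _.
by apply: le_trans (lerD H1 H2) _; rewrite le_eqVlt; apply/orP; left; apply/eqP; field.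
Qed.

Lemma cnV_le (z : R[i]) : z != 0 -> cn z^-1 <= 2 / cn z.
Proof.
move=> z0; have c0 : 0 < cn z.
  by rewrite lt_neqAle cn_ge0 andbT eq_sym; apply: contra z0 => /eqP /cn_eq0 ->.
case: z z0 c0 => a b z0 c0.
have n0 : 0 < a ^+ 2 + b ^+ 2. rewrite lt_neqAle addr_ge0 ?sqr_ge0 // andbT eq_sym.
  apply: contra z0; rewrite paddr_eq0 ?sqr_ge0 // !sqrf_eq0 => /andP[/eqP -> /eqP ->].
  by [].
rewrite ler_pdivlMr // /cn normrN !normrM
  (ger0_norm (x := (a ^+ 2 + b ^+ 2)^-1)) ?invr_ge0 ?(ltW n0) // -mulrDl mulrAC ler_pdivrMr //.
rewrite -[X in _ <= _ * (X + _)](real_normK (num_real a)).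
rewrite -[X in _ <= _ * (_ + X)](real_normK (num_real b)).
have := sqr_ge0 (`|a| - `|b|); lra.
Qed.

Lemma jcontV m (F : 'rV[R[i]]_m -> R -> R[i]) w s : F w s != 0 -> jcont F w s ->
  jcont (fun v t => (F v t)^-1) w s.
Proof.
move=> F0 hF e e0.
have c0 : 0 < cn (F w s).
  by rewrite lt_neqAle cn_ge0 andbT eq_sym; apply: contra F0 => /eqP /cn_eq0 ->.
pose c := cn (F w s).
pose e1 := Num.min (c / 2) (e * c * c / 8).
have e10 : 0 < e1 by rewrite lt_min ?mulr_gt0.
have [d d0 H] := hF _ e10; exists d => // v s' hv hs.
have := H v s' hv hs; rewrite lt_min => /andP[h1 h2].
have cv : c / 2 < cn (F v s'). have := cnD (F w s - F v s') (F v s'); rewrite subrK -/c cnB; lra.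
have Fv0 : F v s' != 0.
  by apply/eqP => E; move: cv; rewrite E cn0 => h; have := cn_ge0 (F w s); rewrite -/c; lra.
have -> : (F v s')^-1 - (F w s)^-1 = (F v s')^-1 * ((F w s - F v s') * (F w s)^-1).
  by field; rewrite F0.
apply: le_lt_trans (cnM _ _) _.
apply: (@le_lt_trans _ _ (4 / c * (cn (F v s' - F w s) * (2 / c)))).
  apply: ler_pM; rewrite ?cn_ge0 //.
    apply: le_trans (cnV_le Fv0) _; rewrite ler_pdivrMr ?(lt_trans _ cv) ?divr_gt0 //.
    by rewrite mulrAC ler_pdivlMr //; lra.
  apply: le_trans (cnM _ _) _; rewrite cnB ler_wpM2l ?cn_ge0 //; exact/cnV_le.
apply: (@lt_le_trans _ _ (4 / c * (e * c * c / 8 * (2 / c)))).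
  by rewrite ltr_pM2l ?divr_gt0 // ltr_pM2r ?divr_gt0.
by rewrite le_eqVlt; apply/orP; left; apply/eqP; field; rewrite gt_eqF.
Qed.

(** 1 / f is conj f / |f|^2, so that only the inverse of the real function [q] has to be
    differentiated. *)
Lemma pderV m (f : 'rV[R[i]]_m -> R[i]) i w d : f w != 0 -> pder i f w d ->
  pder i (fun v => (f v)^-1) w (- (d * (f w)^-1 * (f w)^-1)).
Proof.
move=> f0 hf.
pose q v := Re (f v) * Re (f v) + Im (f v) * Im (f v).
have q0 : q w != 0.
  apply: contra f0; rewrite paddr_eq0 ?sqr_ge0 // !sqrf_eq0 => /andP[/eqP h1 /eqP h2].
  by apply/eqP; apply: ceqP.
have hq : q w != 0 -> pder i (fun v => (q v)^-1%:C) w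
   (- ((q w)^-1 * (q w)^-1) * (Re d * Re (f w) + Re (f w) * Re d
      + (Im d * Im (f w) + Im (f w) * Im d)))%:C.
  move=> _; case: hf => h1 h2; split ; last exact/is_derive_cst.
  have H := is_deriveDf (is_deriveMf h1 h1) (is_deriveMf h2 h2).
  have := @is_deriveV R (fun t => q (axis_line i w t)) 0 _ 1 _ H.
  rewrite axis0 => /(_ q0) H2; apply: is_derive_eq.
  by rewrite -exprVn.
have := pderM (pderJ hf) (hq q0); rewrite (_ : (fun v => _) = (fun v => (f v)^-1)); last first.
  by apply/funext => v; rewrite /q; case: (f v) => a b; apply: ceqP => /=; ring.
move=> H; have E : forall x y, x = y -> pder i (fun v => (f v)^-1) w x ->
   pder i (fun v => (f v)^-1) w y by move=> x y ->.
apply: E H; move: q0; rewrite /q; case: (f w) => a b q0; case: d {hf hq} => x y.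
by apply: ceqP => /=; field.
Qed.

Lemma CfV m (D : 'rV[R[i]]_m -> R -> Prop) r F : dopen D ->
  (forall w s, D w s -> F w s != 0) -> Cf D r F -> Cf D r (fun w s => (F w s)^-1).
Proof.
move=> oD F0; elim: r => [|r IH] hF.
  by split => // w s hD; apply: jcontV; [exact/F0|exact: Cf0 hF hD].
apply: (@Cf_step _ _ _ _ _ (fun i w s =>
   - (partial i (F^~ s) w * (F w s)^-1 * (F w s)^-1))) => //.
- by move=> w s hD; apply: jcontV; [exact/F0|exact: Cf0 hF hD].
- by move=> i w s hD; apply: pderV; [exact/F0|exact: (pder_Cf i hF hD)].
- move=> i; apply: CfN => //; apply: CfM => //; last exact/IH/Cf_W.
  by apply: CfM => //; [exact: Cf_partial hF|exact/IH/Cf_W].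
Qed.

(** [K] is a whole sequence of functions, each the derivative of the previous one, so that the
    induction on r can pass from [K k] to [K k.+1]. It serves for the constant sequence [expR] and
    for [flat]. *)
Lemma Cf_real_comp m (D : 'rV[R[i]]_m -> R -> Prop) r (K : nat -> R -> R) k F :
  dopen D -> (forall k (x : R), is_derive x 1 (K k) (K k.+1 x)) ->
  (forall w s, D w s -> Im (F w s) = 0) -> Cf D r F ->
  Cf D r (fun w s => (K k (Re (F w s)))%:C).
Proof.
move=> oD hK hR.
have Kc k' w s : D w s -> Cf D 0 F -> jcont (fun v t => (K k' (Re (F v t)))%:C) w s.
  move=> hD hF e e0.
  have : {for Re (F w s), continuous (K k')}.
    by apply: differentiable_continuous; apply/derivable1_diffP; case: (hK k' (Re (F w s))).
  move=> /cvgrPdist_lt /(_ e e0) /nbhs_ballP [d /= d0 hd].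
  have [d1 d10 hd1] := Cf0 hF hD d0; exists d1 => // v s' hv hs.
  rewrite -rmorphB cnR distrC; apply: hd; rewrite /ball /= distrC.
  by apply: le_lt_trans (hd1 v s' hv hs); rewrite -cReB Re_le_cn.
elim: r k => [|r IH] k hF; first by split => // w s hD; exact/Kc.
apply: (@Cf_step _ _ _ _ _ (fun i w s =>
   (K k.+1 (Re (F w s)))%:C * (Re (partial i (F^~ s) w))%:C)) => //.
- by move=> w s hD; apply: Kc => //; exact: Cf_le hF.
- move=> i w s hD; have [h1 h2] := pder_Cf i hF hD; split => /=.
    have := @is_derive1_comp R (K k) _ 0 _ _ _ h1; rewrite axis0 => /(_ _ (hK k _)) H.
    by apply: (is_derive_eq H); rewrite mul0r subr0.
  by rewrite mulr0 mul0r addr0; exact/is_derive_cst.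
- move=> i; apply: CfM => //; first exact/IH/Cf_W. by apply: CfRe => //; exact: Cf_partial hF.
Qed.


(** For x > 0 the k-th derivative of exp(-1/x) is P_k(1/x) exp(-1/x), with P_(k+1) = X^2 (P_k -
    P_k'). *)
Fixpoint flat_poly (k : nat) : {poly R} :=
  if k is k'.+1 then 'X^2 * (flat_poly k' - (flat_poly k')^`()) else 1.

Definition flat k (x : R) : R := if 0 < x then (flat_poly k).[x^-1] * expR (- x^-1) else 0.

(** The polynomial is bounded by C y^n with n its size, and exp y from below by its Taylor term of
    order n + 2. The additional factor y is what differentiability of [flat k] at 0 requires, with y
    = 1/h. *)
Lemma poly_expR_small p (e : R) : 0 < e ->
  exists2 M : R, 0 < M & forall y, M < y -> `|p.[y]| * y <= e * expR y.
Proof.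
move=> e0; pose n := size p; pose C := \sum_(i < n) `|p`_i| + 1.
have C0 : 0 < C by rewrite ltr_wpDl // sumr_ge0.
pose N := (n.+2)`!%:R : R.
have N0 : 0 < N by rewrite ltr0n fact_gt0.
exists (1 + N * C / e); first by rewrite ltr_pwDl // divr_ge0 ?mulr_ge0 // ltW.
move=> y hy.
have y1 : 1 <= y. by apply: ltW; apply: le_lt_trans hy; rewrite lerDl divr_ge0 ?mulr_ge0 // ltW.
have y0 : 0 < y by apply: lt_le_trans y1.
have hp : `|p.[y]| <= C * y ^+ n. rewrite horner_coef; apply: le_trans (ler_norm_sum _ _ _) _.
  apply: (@le_trans _ _ (\sum_(i < n) `|p`_i| * y ^+ n)).
    apply: ler_sum => i _; rewrite normrM ler_wpM2l // normrX gtr0_norm //.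
    by rewrite ler_weXn2l // ltnW.
  by rewrite -mulr_suml ler_wpM2r ?lerDl // exprn_ge0 // ltW.
have h2 : y ^+ n.+2 / N <= expR y. by apply: le_trans (expR_ge1Dxn n.+1 (ltW y0)); rewrite lerDr.
apply: le_trans (ler_wpM2l (ltW e0) h2).
apply: le_trans (ler_wpM2r (ltW y0) hp) _.
have -> : C * y ^+ n * y = C * y ^+ n.+1 by rewrite exprSr mulrA.
have -> : e * (y ^+ n.+2 / N) = (e * y / N) * y ^+ n.+1 by rewrite [y ^+ n.+2]exprS; field; rewrite gt_eqF.
rewrite ler_wpM2r ?exprn_ge0 ?(ltW y0) //.
rewrite ler_pdivlMr // -ler_pdivrMl // mulrC mulrC [C * N]mulrC; lra.
Qed.

Lemma flat_derive k (x : R) : is_derive x 1 (flat k) (flat k.+1 x).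
Proof.
case: (ltrgtP x 0) => hx.
- rewrite /flat [in X in is_derive _ _ _ X]ltNge (ltW hx) /=.
  apply/is_derive_epsP => e e0; exists (- x); first by rewrite oppr_gt0.
  move=> h hh; rewrite ltNge [X in ~~ X](_ : _ = true) /=; last first. by have := ler_norm h; lra.
  by rewrite ltNge (ltW hx) /= mulr0 !subr0 normr0 mulr_ge0 // ltW.
- rewrite /flat hx. have xn0 : x != 0 by rewrite gt_eqF.
  have hv : is_derive x 1 (fun y => y^-1) (- (x^-1 ^+ 2)).
    have := @is_deriveV R id x 1 1 xn0 (is_derive_id x 1) => H.
    by apply: (is_derive_eq H); rewrite /GRing.scale /= mulr1 exprVn.
  have hp : is_derive x 1 (fun y => (flat_poly k).[y^-1])
     (((flat_poly k)^`()).[x^-1] * (- (x^-1 ^+ 2))).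
    have h0 : is_derive (x^-1 : R) 1 (horner (flat_poly k)) (((flat_poly k)^`()).[x^-1]).
      by apply: DeriveDef; [exact/derivable_horner|rewrite -derive1E -derivE].
    exact: (is_derive1_comp h0 hv).
  have he : is_derive x 1 (fun y => expR (- y^-1)) (expR (- x^-1) * (x^-1 ^+ 2)).
    apply: (@is_derive1_comp R expR (fun y => - y^-1)).
    by apply: (is_derive_eq (is_deriveNf hv)); rewrite opprK.
  have /is_derive_epsP H := is_deriveMf hp he.
  apply/is_derive_epsP => e e0; have [r r0 hr] := H e e0.
  exists (Num.min r x); first by rewrite lt_min r0.
  move=> h; rewrite lt_min => /andP[/hr {}hr hh].
  have -> : 0 < x + h by have := ler_norm (- h); rewrite normrN; lra.
  rewrite hx; apply: le_trans hr; rewrite le_eqVlt; apply/orP; left; apply/eqP.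
  have -> : (flat_poly k.+1).[x^-1] = x^-1 ^+ 2 * ((flat_poly k).[x^-1] - (flat_poly k)^`().[x^-1]).
    by rewrite /= hornerM hornerXn hornerD hornerN.
  by congr (`| _ |); ring.
- rewrite hx /flat ltxx /=. apply/is_derive_epsP => e e0.
  have [M M0 hM] := poly_expR_small (flat_poly k) e0.
  exists M^-1; first by rewrite invr_gt0.
  move=> h hh; rewrite add0r mulr0 !subr0 ltxx subr0.
  case: ltP => h0; last by rewrite normr0 mulr_ge0 // ltW.
  have hi : M < h^-1. by rewrite -[M]invrK ltf_pV2 ?posrE ?invr_gt0 //; move: hh; rewrite gtr0_norm.
  rewrite normrM (gtr0_norm (expR_gt0 _)) expRN (gtr0_norm h0) ler_pdivrMr ?expR_gt0 //
    -(ler_pM2r (x := h^-1)) ?invr_gt0 //.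
  apply: le_trans (hM _ hi) _; rewrite le_eqVlt; apply/orP; left; apply/eqP.
  by field; rewrite gt_eqF.
Qed.
Lemma flat_gt0 (x : R) : 0 < x -> 0 < flat 0 x.
Proof. by move=> x0; rewrite /flat x0 hornerE mul1r expR_gt0. Qed.
Lemma flat_le0 (x : R) : x <= 0 -> flat 0 x = 0.
Proof. by move=> x0; rewrite /flat ltNge x0. Qed.
Lemma flat_ge0 x : 0 <= flat 0 x.
Proof. by case: (leP x 0) => [/flat_le0 ->|/flat_gt0 /ltW]. Qed.

End Smooth.

(** * Integration of complex-valued functions over [0, 1] *)

Section Int01.
Context {R : realType}.
Notation mu := (@lebesgue_measure R).
Notation I01 := (`[0%R, 1%R]%classic : set R).

Definition cont01 (g : R -> R[i]) : Prop := forall s : R, 0 <= s <= 1 ->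
  forall e : R, 0 < e -> exists2 d : R, 0 < d & forall s', `|s' - s| < d -> cn (g s' - g s) < e.

Lemma cont01_Re g : cont01 g -> {within I01, continuous (fun s => Re (g s))}.
Proof.
move=> hg; apply: continuous_in_subspaceT => s; rewrite inE => hs.
apply/cvgrPdist_lt => e e0; have [d d0 hd] := hg s hs e e0.
exists d => // s'; rewrite /= => h.
by apply: le_lt_trans (hd s' _); rewrite 1?distrC // -cReB Re_le_cn.
Qed.

Lemma cont01_Im g : cont01 g -> {within I01, continuous (fun s => Im (g s))}.
Proof.
move=> hg; apply: continuous_in_subspaceT => s; rewrite inE => hs.
apply/cvgrPdist_lt => e e0; have [d d0 hd] := hg s hs e e0.
exists d => // s'; rewrite /= => h.
by apply: le_lt_trans (hd s' _); rewrite 1?distrC // -cImB Im_le_cn.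
Qed.
Lemma intble01 (g : R -> R) : {within I01, continuous g} -> mu.-integrable I01 (EFin \o g).
Proof. by apply: continuous_compact_integrable ; exact/segment_compact. Qed.

Lemma meas01 : measurable I01. Proof. exact: measurable_itv. Qed.

Lemma eq_int01 f g : (forall s : R, 0 <= s <= 1 -> f s = g s) -> int01 f = int01 g.
Proof.
move=> fg; congr (_ +i* _); apply: eq_Rintegral => s; by rewrite inE => /fg ->.
Qed.

Lemma lebesgue01 : fine (mu I01) = 1.
Proof.
have /(congr1 fine) := lebesgue_measure_itv (Interval (BLeft (0 : R)) (BRight 1)).
by rewrite lte_fin ltr01 /= oppr0 addr0.
Qed.

Lemma int01_cst c : int01 (fun=> c) = c :> R[i].
Proof.
rewrite /int01 !Rintegral_cst //.
by rewrite lebesgue01 !mulr1; case: c.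
Qed.
Lemma cont01_cst c : cont01 (fun=> c).
Proof. by exists 1 => // s' _; rewrite subrr cn0. Qed.

Lemma jcont_cont01 g :
  (forall s : R, 0 <= s <= 1 -> jcont (fun (_ : 'rV[R[i]]_0) => g) 0 s) <-> cont01 g.
Proof.
split=> hg s hs e e0; have [d d0 hd] := hg s hs e e0; exists d => //.
  by move=> s' h; apply: (hd 0) => // -[].
by move=> v s' _; exact: hd.
Qed.

Lemma cont01D f g : cont01 f -> cont01 g -> cont01 (fun s => f s + g s).
Proof.
move=> /jcont_cont01 hf /jcont_cont01 hg; apply/jcont_cont01 => s hs.
by apply: jcontD; [exact/hf|exact/hg].
Qed.
Lemma cont01M f g : cont01 f -> cont01 g -> cont01 (fun s => f s * g s).
Proof.
move=> /jcont_cont01 hf /jcont_cont01 hg; apply/jcont_cont01 => s hs.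
by apply: jcontM; [exact/hf|exact/hg].
Qed.
Lemma cont01Z c f : cont01 f -> cont01 (fun s => c * f s).
Proof. by apply: cont01M ; exact/cont01_cst. Qed.

Lemma int01D f g : cont01 f -> cont01 g -> int01 (fun s => f s + g s) = int01 f + int01 g.
Proof.
move=> hf hg; apply: ceqP; rewrite /=.
  rewrite -RintegralD //; try exact/intble01/cont01_Re.
  by apply: eq_Rintegral => s _; rewrite cReD.
rewrite -RintegralD //; try exact/intble01/cont01_Im.
by apply: eq_Rintegral => s _; rewrite cImD.
Qed.
Lemma Rint01Z k (g : R -> R) : {within I01, continuous g} ->
  \int[mu]_(s in I01) (k * g s) = k * \int[mu]_(s in I01) g s.
Proof. by move=> hg; apply: RintegralZl; [exact: meas01|exact: intble01]. Qed.

Lemma within01Z k (g : R -> R) : {within I01, continuous g} ->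
  {within I01, continuous (fun s => k * g s)}.
Proof.
move=> hg x; apply: (@continuousM R (subspace I01) (fun=> k) g x); last exact/hg.
exact/cst_continuous.
Qed.

Lemma int01Z c f : cont01 f -> int01 (fun s => c * f s) = c * int01 f.
Proof.
move=> hf.
have h1 := cont01_Re hf; have h2 := cont01_Im hf.
apply: ceqP; rewrite ?cReM ?cImM. rewrite -!Rint01Z // -RintegralB //;
    try exact/intble01/within01Z.
  by apply: eq_Rintegral => s _; rewrite cReM.
rewrite -!Rint01Z // -RintegralD //; try exact/intble01/within01Z.
by apply: eq_Rintegral => s _; rewrite cImM.
Qed.

Lemma int01N f : cont01 f -> int01 (fun s => - f s) = - int01 f.
Proof.
move=> hf; rewrite -mulN1r -int01Z //; apply: eq_int01 => s _; by rewrite mulN1r.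
Qed.

Lemma cont01N f : cont01 f -> cont01 (fun s => - f s).
Proof.
by move=> hf s hs e e0; have [d d0 hd] := hf s hs e e0; exists d => // s' h;
  rewrite -opprD cnN; exact/hd.
Qed.
Lemma int01B f g : cont01 f -> cont01 g -> int01 (fun s => f s - g s) = int01 f - int01 g.
Proof. by move=> hf hg; rewrite int01D ?int01N //; exact/cont01N. Qed.

Lemma cont01_sum I l (P : pred I) F :
  (forall k, P k -> cont01 (F k)) -> cont01 (fun s => \sum_(k <- l | P k) F k s).
Proof.
move=> hF; elim: l => [|k l IH]. by under eq_fun do rewrite big_nil; exact/cont01_cst.
case Pk: (P k); under eq_fun do rewrite big_cons Pk; last exact/IH.
by apply: cont01D => //; exact/hF.
Qed.

Lemma int01_sum I l (P : pred I) F : (forall k, P k -> cont01 (F k)) ->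
  int01 (fun s => \sum_(k <- l | P k) F k s) = \sum_(k <- l | P k) int01 (F k).
Proof.
move=> hF; elim: l => [|k l IH].
  by rewrite big_nil; under eq_fun do rewrite big_nil; exact/int01_cst.
rewrite big_cons; case Pk: (P k); under eq_fun do rewrite big_cons Pk; last exact/IH.
by rewrite int01D ?IH //; [exact/hF|exact/cont01_sum].
Qed.

Lemma int01_le f M : cont01 f ->
  (forall s : R, 0 <= s <= 1 -> cn (f s) <= M) -> cn (int01 f) <= 2 * M.
Proof.
move=> hf hM.
have key (g : R -> R) : {within I01, continuous g} ->
    (forall s : R, 0 <= s <= 1 -> `|g s| <= M) -> `|\int[mu]_(s in I01) g s| <= M.
  move=> cg hg; apply: le_trans (le_normr_Rintegral _ (intble01 cg)) _. exact: meas01.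
  have -> : M = \int[mu]_(s in I01) M. by rewrite Rintegral_cst ?meas01 // lebesgue01 mulr1.
  apply: le_Rintegral; rewrite ?meas01 //.
  - have := intble01 cg => /integrable_abse; apply: eq_integrable => //=.
  - apply: intble01; apply: continuous_subspaceT => x; exact: cst_continuous.
rewrite /cn /=.
have h1 := key _ (cont01_Re hf) (fun s hs => le_trans (Re_le_cn _) (hM s hs)).
have h2 := key _ (cont01_Im hf) (fun s hs => le_trans (Im_le_cn _) (hM s hs)).
by rewrite mulr_natl mulr2n lerD.
Qed.

Lemma int01_FTC F f : cont01 f ->
  (forall s : R, 0 <= s <= 1 -> cder F s (f s)) -> int01 f = F 1 - F 0.
Proof.
move=> hf hF.
have key G g : {within I01, continuous g} -> (forall s : R, 0 <= s <= 1 -> is_derive s 1 G (g s)) ->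
    \int[mu]_(s in I01) g s = G 1 - G 0.
  move=> cg hG.
  have cG : forall s, 0 <= s <= 1 -> {for s, continuous G}.
    move=> s /hG [h _]; apply: differentiable_continuous; exact/derivable1_diffP.
  have := @continuous_FTC2 R g G 0 1 ltr01 cg; rewrite /Rintegral => ->.
  - by [].
  - split.
    + by move=> x; rewrite /= => /andP[x0 x1]; case: (hG x) => //; rewrite !ltW.
    + by apply/cvg_at_right_filter/cG; rewrite lexx ler01.
    + by apply/cvg_at_left_filter/cG; rewrite lexx ler01.
  - move=> x; rewrite /= => /andP[x0 x1]; rewrite derive1E. by case: (hG x); rewrite // !ltW.
apply: ceqP; rewrite ?cReB ?cImB.
  by apply: (key (fun s => Re (F s))); [exact/cont01_Re|move=> s /hF []].
by apply: (key (fun s => Im (F s))); [exact/cont01_Im|move=> s /hF []].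
Qed.

Lemma int01_gt0 f : cont01 f -> (forall s : R, 0 <= s <= 1 -> 0 <= f s) -> int01 f = 0 ->
  forall s : R, 0 <= s <= 1 -> f s = 0.
Proof.
move=> hf f0 i0 s hs; apply/eqP/negP => /negP fs.
have ge s' : 0 <= s' <= 1 -> Im (f s') = 0 /\ 0 <= Re (f s').
  by move=> /f0; rewrite lecE => /andP[/eqP -> ->].
have fs0 : 0 < Re (f s). have [h1 h2] := ge s hs; rewrite lt_neqAle h2 andbT.
  by apply: contra fs => /eqP h; apply/eqP; apply: ceqP.
pose a := Re (f s) / 2.
have a0 : 0 < a by rewrite divr_gt0.
have [d d0 hd] := hf s hs a a0.
(* The interval around s is cut off at 0 and 1 and still has positive length when s is an end
   point. *)
pose c := Num.max 0 (s - d / 2); pose c' := Num.min 1 (s + d / 2).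
have cc' : c < c'. rewrite lt_min !gt_max; apply/and3P; split ; lra.
have sub x : c <= x <= c' -> 0 <= x <= 1 /\ a <= Re (f x).
  rewrite ge_max le_min => /andP[/andP[h1 h2] /andP[h3 h4]].
  have : cn (f x - f s) < a by apply: hd; rewrite ltr_norml; lra.
  move=> /(le_lt_trans (Re_le_cn _)); rewrite ltr_norml /a => /andP[]; lra.
have hint := intble01 (cont01_Re hf).
have : (0 < \int[mu]_(x in I01) (Re (f x))%:E)%E.
  apply: (@lt_le_trans _ _ (\int[mu]_(x in `[c, c']) (Re (f x))%:E)%E); last first.
    apply: ge0_subset_integral => //=.
    - by case/integrableP: hint.
    - by move=> x; rewrite /= => /ge [_].
    - by move=> x; rewrite /= => /sub [].
  apply: (@lt_le_trans _ _ (\int[mu]_(x in `[c, c']) a%:E)%E).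
    by rewrite integral_cst //= lebesgue_measure_itv lte_fin cc' lte_fin mulr_gt0 // subr_gt0.
  apply: ge0_le_integral => //=.
  - by rewrite ltW.
  - apply: measurable_funS (meas01) _ _; last by case/integrableP: hint.
    by move=> x; rewrite /= => /sub [].
  - by move=> x; rewrite /= => /sub [_].
have := congr1 (@complex.Re R) i0; rewrite /= /Rintegral => h.
by rewrite -(fineK (integrable_fin_num _ hint)) //= h ltxx.
Qed.

Lemma int01_ge0 (f : R -> R[i]) : (forall s : R, 0 <= s <= 1 -> 0 <= f s) -> 0 <= int01 f.
Proof.
move=> f0.
have ge s' : 0 <= s' <= 1 -> Im (f s') = 0 /\ 0 <= Re (f s').
  by move=> /f0; rewrite lecE => /andP[/eqP -> ->].
apply/andP; split. rewrite (@eq_Rintegral _ _ _ _ _ (fun=> 0)) ?Rintegral_cst ?mul0r //.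
  by move=> s; rewrite inE => /ge [].
by apply: Rintegral_ge0 => s; rewrite /= => /ge [].
Qed.

End Int01.

Create HintDb sm.
#[local] Hint Resolve cont01_cst cont01D cont01M cont01N cont01_sum : sm.

(** * Differentiation under the integral sign *)

Section ParamIntegral.
Context {R : realType} {m : nat}.
Notation V := 'rV[R[i]]_m.
Implicit Types (D : V -> R -> Prop) (F G : V -> R -> R[i]).

(** Tube lemma by compactness of [0, 1]. The hypothesis asks for all smaller d' at once because the
    radius is treated as a variable tending to 0 from the right. *)
Lemma tube01 P : (forall s : R, 0 <= s <= 1 -> exists2 d : R, 0 < d &
     forall s' d' : R, `|s' - s| < d -> 0 < d' -> d' < d -> P d' s') ->
  exists2 d : R, 0 < d & forall s : R, 0 <= s <= 1 -> P d s.
Proof.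
move=> h.
have := @segment_compact R 0 1 => /compact_near_coveringP /(_ R (at_right 0))
  /(_ (fun d s => P d s)) H.
have : \forall d \near 0^'+, `[0, 1]%classic `<=` P d. apply: H => s; rewrite /= => /h [d d0 hd].
  exists ([set s' | `|s' - s| < d], [set d' | 0 < d' /\ d' < d]). split.
      exists d => // s'; rewrite /= distrC //.
    by near=> d'.
  move=> [s' d'] [h1 [h2 h3]]; exact/hd.
move=> /[dup] h1 _; near (0 : R)^'+ => d.
exists d => //.
have : `[0, 1]%classic `<=` P d by near: d.
Unshelve. all: by end_near.
Qed.

Lemma tube_jcont D F w : dopen D -> (forall s : R, 0 <= s <= 1 -> D w s) ->
  (forall w s, D w s -> jcont F w s) -> forall e : R, 0 < e ->
  exists2 d : R, 0 < d & forall v s, nearv d w v -> 0 <= s <= 1 -> D v s /\ cn (F v s - F w s) < e.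
Proof.
move=> oD hD hF e e0.
have [|d d0 hd] := @tube01 (fun d s => forall v, nearv d w v -> D v s /\ cn (F v s - F w s) < e).
  move=> s /hD hs.
  have e2 : 0 < e / 2 by rewrite divr_gt0.
  have [d1 d10 h1] := hF _ _ hs _ e2; have [d2 d20 h2] := oD _ _ hs.
  exists (Num.min d1 d2); first by rewrite lt_min d10.
  move=> s' d'; rewrite lt_min => /andP[hs1 hs2] d'0; rewrite lt_min => /andP[hd1 hd2] v hv.
  split; first by apply: h2 => //; exact: nearv_le (ltW hd2) hv.
  have := h1 v s' (nearv_le (ltW hd1) hv) hs1.
  have := h1 w s' (nearv_refl _ d10) hs1; rewrite [in X in X -> _]cnB => a b.
  apply: le_lt_trans (cn_triangle (F w s) _ _) _.
  by rewrite (splitr e) ltrD.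
by exists d => // v s hv hs; exact/hd.
Qed.

Lemma jcont_param01 D F w : (forall s : R, 0 <= s <= 1 -> D w s) ->
  (forall w s, D w s -> jcont F w s) -> cont01 (F w).
Proof.
move=> hD hF s hs e e0; have [d d0 hd] := hF w s (hD s hs) e e0.
by exists d => // s' h; apply: hd => //; exact/nearv_refl.
Qed.

Lemma int01_jcont D U F w : dopen D -> (forall w s, U w -> 0 <= s <= 1 -> D w s) ->
  (exists2 d : R, 0 < d & forall v, nearv d w v -> U v) ->
  (forall w s, D w s -> jcont F w s) ->
  forall s, jcont (fun v _ => int01 (F v)) w s.
Proof.
move=> oD hU [d1 d10 hU1] hF s e e0.
have e4 : 0 < e / 4 by rewrite divr_gt0.
have hw : U w by apply: hU1; exact/nearv_refl.
have [d d0 hd] := tube_jcont oD (fun s => hU w s hw) hF e4.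
exists (Num.min d1 d); first by rewrite lt_min d10.
move=> v s' hv _.
have hv1 : U v by apply: hU1; apply: nearv_le hv; rewrite ge_min lexx.
have c1 := jcont_param01 (fun s => hU v s hv1) hF.
have c2 := jcont_param01 (fun s => hU w s hw) hF.
rewrite -int01B //.
apply: le_lt_trans (@int01_le _ _ (e / 4) _ _) _; last by lra. by auto with sm.
move=> x hx; apply: ltW.
by have [] := hd v x _ hx; first by apply: nearv_le hv; rewrite ge_min lexx orbT.
Qed.

(** Compactness makes the partial derivative at nearby points uniformly close to the one at w for
    all s; [cmvt] then bounds the first-order remainder for each s. The two factors 2, from [cmvt]
    and [int01_le], explain e / 4. *)
Lemma pder_int01 D (U : V -> Prop) F i w : dopen D ->
  (forall w s, U w -> 0 <= s <= 1 -> D w s) -> U w ->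
  Cf D 1 F -> 
  pder i (fun v => int01 (F v)) w (int01 (fun s => partial i (F^~ s) w)).
Proof.
move=> oD hU hw hF; apply/cder_epsP => e e0.
have hF0 : forall w s, D w s -> jcont F w s by move=> v s; exact: Cf0 hF.
have hG0 : forall w s, D w s -> jcont (fun w s => partial i (F^~ s) w) w s.
  by move=> v s; exact: Cf0 (Cf_partial i hF).
have e4 : 0 < e / 4 by rewrite divr_gt0.
have [d d0 hd] := tube_jcont oD (fun s => hU w s hw) hG0 e4.
exists d => // h hh; rewrite add0r axis0.
have hn x : `|x| <= `|h| -> nearv d w (axis_line i w x).
  by move=> hx; apply: nearv_axis; exact: le_lt_trans hx hh.
have c1 : cont01 (F (axis_line i w h)).
  by apply: jcont_param01 hF0 => s hs; have [] := hd _ _ (hn h (lexx _)) hs.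
have c2 : cont01 (F w) by apply: jcont_param01 hF0 => s; exact: hU.
have c3 : cont01 (fun s => partial i (F^~ s) w) by apply: (jcont_param01 (fun s => hU w s hw) hG0).
rewrite -int01Z // -!int01B //; last 2 first.
- by apply: cont01D => //; exact: cont01N.
- exact: cont01Z.
have -> : e * `|h| = 2 * (2 * (e / 4) * `|h|) by field.
apply: int01_le.
  by apply: cont01D; [apply: cont01D => //; exact: cont01N|apply: cont01N; exact: cont01Z].
move=> s hs.
have := @cmvt R (fun x => F (axis_line i w x) s) (fun x => partial i (F^~ s) (axis_line i w x))
  (partial i (F^~ s) w) (e / 4) h; rewrite axis0; apply=> x hx.
  apply: (@pder_line _ _ i (F^~ s)); apply: Cf_has hF _.
  by have [] := hd _ _ (hn x hx) hs.
by apply: ltW; have [] := hd _ _ (hn x hx) hs.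
Qed.

Lemma Cf_int01 D U r F : dopen D -> dopen (fun w _ => U w) ->
  (forall w s, U w -> 0 <= s <= 1 -> D w s) -> Cf D r F ->
  Cf (fun w _ => U w) r (fun w _ => int01 (F w)).
Proof.
move=> oD oU hU.
have hU1 w : U w -> exists2 d, 0 < d & forall v, nearv d w v -> U v.
  move=> /(oU w 0) [d d0 hd]; exists d => // v hv.
  by apply: (hd v 0 hv); rewrite subrr normr0.
have hc F' r' : Cf D r' F' -> forall w s, U w -> jcont (fun v _ => int01 (F' v)) w s.
  move=> hF w s hw; apply: (@int01_jcont D U F') => //; first exact/hU1.
  move=> v s'; exact: Cf0 hF.
elim: r F => [|r IH] F hF; first by split => // w s; exact: hc hF w s.
apply: (@Cf_step _ _ _ _ _ (fun i w _ => int01 (fun s => partial i (F^~ s) w))) => //.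
- move=> w s; exact: hc hF w s.
- move=> i w s hw; apply: (@pder_int01 D U F i w oD hU hw). exact: Cf_le hF.
- by move=> i; apply: IH; exact/Cf_partial.
Qed.

End ParamIntegral.

Lemma sum_rcoord (T : nmodType) m (F : rcoord m -> T) :
  \sum_a F a = \sum_j (F (j, false) + F (j, true)).
Proof.
rewrite (eq_bigr (fun a => F (a.1, a.2))); last by case.
rewrite -(pair_big xpredT xpredT (fun j c => F (j, c))).
by apply: eq_bigr => j _; rewrite big_bool addrC.
Qed.

(* Sealed, because unification would otherwise unfold [partial]. *)
Fact pd_key : unit. Proof. exact/tt. Qed.
Definition pd (R : realType) m i f : 'rV[R[i]]_m -> R[i] := locked_with pd_key (partial i f).

Lemma pdE (R : realType) m i (f : 'rV[R[i]]_m -> R[i]) : partial i f = pd i f.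
Proof. by rewrite /pd unlock. Qed.
Lemma pd_eq (R : realType) m i (f : 'rV[R[i]]_m -> R[i]) w d : pder i f w d -> pd i f w = d.
Proof. by rewrite -pdE; exact/pderE. Qed.
Lemma pd_ext (R : realType) m i (f g : 'rV[R[i]]_m -> R[i]) w : f =1 g -> pd i f w = pd i g w.
Proof. by move=> /funext ->. Qed.

(** * Calculus of smooth functions on C^m *)

Section SmoothFunctions.
Context {R : realType}.

Definition smf m (F : 'rV[R[i]]_m -> R -> R[i]) : Prop := forall r, Cf (fun _ _ => True) r F.

Lemma sm_smf m (f : 'rV[R[i]]_m -> R[i]) : smooth f <-> smf (fun w _ => f w).
Proof. exact/smoothP. Qed.

Section Closure.
Context {m : nat}.
Notation V := 'rV[R[i]]_m.
Implicit Types (f g : V -> R[i]) (F G : V -> R -> R[i]).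

Lemma smf_cst c : smf (fun (_ : V) _ => c). Proof. move=> r; exact/Cf_cst/dopenT. Qed.
Lemma smfD F G : smf F -> smf G -> smf (fun w s => F w s + G w s).
Proof. by move=> hF hG r; apply: CfD; [exact/dopenT |  | ]. Qed.
Lemma smfM F G : smf F -> smf G -> smf (fun w s => F w s * G w s).
Proof. by move=> hF hG r; apply: CfM; [exact/dopenT |  | ]. Qed.
Lemma smf_sum I l (P : pred I) (F : I -> V -> R -> R[i]) :
  (forall k, P k -> smf (F k)) -> smf (fun w s => \sum_(k <- l | P k) F k w s).
Proof. by move=> hF r; apply: Cf_sum; [exact/dopenT|move=> k /hF]. Qed.

Lemma smf_param (g : R -> R[i]) : (forall s, forall e : R, 0 < e ->
    exists2 d : R, 0 < d & forall s', `|s' - s| < d -> cn (g s' - g s) < e) ->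
  smf (fun (_ : V) s => g s).
Proof.
move=> hg r; apply: Cf_param; first exact/dopenT.
by move=> w s _ e e0; have [d d0 hd] := hg s e e0; exists d => // v s' _; exact/hd.
Qed.

Lemma smf_id : smf (fun (_ : V) s => s%:C).
Proof.
by apply: smf_param => s e e0; exists e => // s' h; rewrite -rmorphB cnR.
Qed.
Lemma smf_coord j : smf (fun (w : V) _ => w 0 j).
Proof. move=> r; exact/Cf_coord/dopenT. Qed.
Lemma sm_cst c : smooth (fun _ : V => c).
Proof. by apply/sm_smf; exact/smf_cst. Qed.
Lemma smoothD f g : smooth f -> smooth g -> smooth (fun w => f w + g w).
Proof. by move=> /sm_smf hf /sm_smf hg; apply/sm_smf; exact/smfD. Qed.
Lemma smoothM f g : smooth f -> smooth g -> smooth (fun w => f w * g w).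
Proof. by move=> /sm_smf hf /sm_smf hg; apply/sm_smf; exact/smfM. Qed.
Lemma smoothZ c f : smooth f -> smooth (fun w => c * f w).
Proof. by apply: smoothM ; exact/sm_cst. Qed.
Lemma smoothN f : smooth f -> smooth (fun w => - f w).
Proof. by under eq_fun do rewrite -mulN1r; exact/smoothZ. Qed.
Lemma smoothB f g : smooth f -> smooth g -> smooth (fun w => f w - g w).
Proof. by move=> hf hg; apply: smoothD => //; exact/smoothN. Qed.
Lemma smoothJ f : smooth f -> smooth (fun w => (f w)^*).
Proof.
by move=> /sm_smf hf; apply/sm_smf => r; apply: CfJ; [exact/dopenT | ].
Qed.
Lemma sm_sum I l (P : pred I) (F : I -> V -> R[i]) :
  (forall k, P k -> smooth (F k)) -> smooth (fun w => \sum_(k <- l | P k) F k w).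
Proof. by move=> hF; apply/sm_smf; apply: smf_sum => k /hF /sm_smf. Qed.
Lemma sm_prod I l (P : pred I) (F : I -> V -> R[i]) :
  (forall k, P k -> smooth (F k)) -> smooth (fun w => \prod_(k <- l | P k) F k w).
Proof.
move=> hF; apply/sm_smf => r; apply: Cf_prod; first exact/dopenT.
by move=> k /hF /sm_smf.
Qed.
Lemma sm_coord j : smooth (fun w : V => w 0 j).
Proof. by apply/sm_smf; exact/smf_coord. Qed.
Lemma smoothRe f : smooth f -> smooth (fun w => (Re (f w))%:C).
Proof.
by move=> /sm_smf hf; apply/sm_smf => r; apply: CfRe; [exact/dopenT | ].
Qed.
Lemma smoothIm f : smooth f -> smooth (fun w => (Im (f w))%:C).
Proof.
by move=> /sm_smf hf; apply/sm_smf => r; apply: CfIm; [exact/dopenT | ].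
Qed.
Lemma sm_rcomp a : smooth (fun w : V => (rcomp a w)%:C).
Proof.
by rewrite /rcomp; case: a.2; [apply: smoothIm|apply: smoothRe]; exact/sm_coord.
Qed.
Lemma sm_pd i f : smooth f -> smooth (pd i f).
Proof. by move=> hf r; have [_ /(_ i) []] := hf r.+1; rewrite -pdE. Qed.
Lemma sm_has i f w : smooth f -> has_partial i f w.
Proof. by move=> hf; have [_ /(_ i) []] := hf 1%N. Qed.
Lemma pder_pd i f w : smooth f -> pder i f w (pd i f w).
Proof. by move=> hf; rewrite -pdE; exact/pder_partial/sm_has. Qed.
Lemma sm_C1at f w : smooth f -> C1at f w.
Proof.
move=> /sm_smf hf; exact: (@C1at_Cf R m (fun _ _ => True) (fun w _ => f w) w 0
  dopenT (hf 1%N) I).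
Qed.
Lemma sm_jcont f w s : smooth f -> jcont (fun v _ => f v) w s.
Proof. move=> /sm_smf hf; exact: (Cf0 (hf 0%N) I). Qed.

Lemma pd_clairaut f i k w : smooth f -> pd i (pd k f) w = pd k (pd i f) w.
Proof.
move=> /sm_smf hf; rewrite -!pdE; exact: (@clairaut R m (fun _ _ => True) (fun w _ => f w) i k w 0
  dopenT (hf 2%N) I).
Qed.
Lemma pd_cst i c w : pd i (fun _ : V => c) w = 0.
Proof. exact: pd_eq (pder_cst _ _ _). Qed.
Lemma pdD i f g w : smooth f -> smooth g -> pd i (fun v => f v + g v) w = pd i f w + pd i g w.
Proof. by move=> hf hg; apply/pd_eq/pderD; exact/pder_pd. Qed.
Lemma pdM i f g w : smooth f -> smooth g ->
  pd i (fun v => f v * g v) w = pd i f w * g w + f w * pd i g w.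
Proof. by move=> hf hg; apply/pd_eq/pderM; exact/pder_pd. Qed.
Lemma pdZ i c f w : smooth f -> pd i (fun v => c * f v) w = c * pd i f w.
Proof.
by move=> hf; rewrite pdM ?pd_cst ?mul0r ?add0r //; exact/sm_cst.
Qed.
Lemma pdN i f w : smooth f -> pd i (fun v => - f v) w = - pd i f w.
Proof. by move=> hf; under eq_fun do rewrite -mulN1r; rewrite pdZ // mulN1r. Qed.
Lemma pdB i f g w : smooth f -> smooth g -> pd i (fun v => f v - g v) w = pd i f w - pd i g w.
Proof. by move=> hf hg; rewrite pdD ?pdN //; exact/smoothN. Qed.
Lemma pd_sum i I l (P : pred I) (F : I -> V -> R[i]) w : (forall k, P k -> smooth (F k)) ->
  pd i (fun v => \sum_(k <- l | P k) F k v) w = \sum_(k <- l | P k) pd i (F k) w.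
Proof.
move=> hF; elim: l => [|k l IH]. by rewrite big_nil; under eq_fun do rewrite big_nil; exact/pd_cst.
rewrite big_cons; case Pk: (P k); under eq_fun do rewrite big_cons Pk; last exact/IH.
by rewrite pdD ?IH //; [exact/hF|exact/sm_sum].
Qed.
Lemma pd_coord i j w : pd i (fun v : V => v 0 j) w = cunit i * (j == i.1)%:R.
Proof. exact: pd_eq (pder_coord _ _ _). Qed.

Lemma pd_rcomp i a w : pd i (fun v : V => (rcomp a v)%:C) w = (a == i)%:R.
Proof.
apply: pd_eq; have := @pder_coord R m i w a.1; rewrite /pder => h.
have {h}[h1 h2] := h.
have E : (a == i) = (a.1 == i.1) && (a.2 == i.2) by case: a {h1 h2} => ? ?.
rewrite E; split ; rewrite /rcomp; case a2: a.2.
- apply: is_derive_eq; rewrite /cunit; case: (a.1 == i.1); case: i.2 ; rewrite ?mulr1 ?mulr0 //=.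
- apply: is_derive_eq; rewrite /cunit; case: (a.1 == i.1); case: i.2 ; rewrite ?mulr1 ?mulr0 //=.
- by case: (_ && _); exact/is_derive_cst.
- by case: (_ && _); exact/is_derive_cst.
Qed.

Lemma pd_trans i f u w : pd i (fun v => f (v + u)) w = pd i f (w + u).
Proof.
have E t : axis_line i w t + u = axis_line i (w + u) t by rewrite addrAC.
rewrite -!pdE /partial.
have -> : (fun t => Re (f (axis_line i w t + u))) =
  (fun t => Re (f (axis_line i (w + u) t))) by apply/funext => t; rewrite E.
by have -> : (fun t => Im (f (axis_line i w t + u))) =
  (fun t => Im (f (axis_line i (w + u) t))) by apply/funext => t; rewrite E.
Qed.

Definition dirder u f w : R[i] := \sum_a (rcomp a u)%:C * pd a f w.

Lemma sm_dirder u f : smooth f -> smooth (dirder u f).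
Proof.
by move=> hf; apply: sm_sum => a _; exact/smoothZ/sm_pd.
Qed.

Lemma cder_path f (c : R -> V) t (u : V) : smooth f ->
  (forall j, cder (fun t => c t 0 j) t (u 0 j)) ->
  cder (fun t => f (c t)) t (dirder u f (c t)).
Proof.
move=> hf hc.
(* The path becomes a map on C^1 through the real part of the variable, so that the chain rule for
   partial derivatives applies. *)
pose U (z : 'rV[R[i]]_1) : V := c (t + Re (z 0 0)).
have U0 : U 0 = c t by rewrite /U mxE addr0.
have ax s : Re ((axis_line (0 : 'I_1, false) 0 s : 'rV[R[i]]_1) 0 0) = s.
  by rewrite axisE mxE add0r /cunit eqxx !mulr1.
have hU a : pder (0, false) (fun z => coord_fun a (U z)) 0 (rcomp a u)%:C.
  have /cder_epsP h := hc a.1; apply/cder_epsP => e e0.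
  have [r r0 hr] := h e e0; exists r => // x /hr.
  rewrite add0r axis0 !coord_funE /U ax mxE /= addr0 => hx.
  apply: le_trans hx; rewrite -rmorphM -!rmorphB cnR /rcomp.
  by case: a.2; rewrite /cn !cReB !cImB cReM cImM /= !mul0r ?subr0 ?addr0 ?lerDl ?lerDr.
have := @pder_chain R 1 m f U (0, false) 0.
rewrite U0 => /(_ (sm_C1at _ hf)) => H.
have {H} H := H (fun a => pder_has (hU a)).
have -> : dirder u f (c t) = \sum_a partial (0, false)
    (fun v => coord_fun a (U v)) 0 * partial a f (c t).
  by apply: eq_bigr => a _; rewrite !pdE (pd_eq (hU a)).
move/cder_epsP: H => H; apply/cder_epsP => e /H [r r0 hr]; exists r => // x /hr.
by rewrite add0r /U !ax addr0.
Qed.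

Lemma cder_line f (w u : V) s : smooth f ->
  cder (fun s => f (w + s%:C *: u)) s (dirder u f (w + s%:C *: u)).
Proof.
move=> hf; apply: (cder_path (c := fun s => w + s%:C *: u)) => // j.
apply/cder_epsP => e e0; exists 1 => // h _; rewrite !mxE [X in cn X](_ : _ = 0).
  by rewrite cn0 mulr_ge0 // ltW.
by ring.
Qed.

End Closure.

Lemma smf_comp m p (u : 'rV[R[i]]_m -> R -> 'rV[R[i]]_p) f :
  (forall j, smf (fun w s => u w s 0 j)) -> smooth f -> smf (fun w s => f (u w s)).
Proof.
move=> hu /sm_smf hf r.
apply: (@Cf_comp R m p (fun _ _ => True) (fun _ _ => True) r u (fun v _ => f v)) => //.
- exact/dopenT.
- exact/dopenT.
- move=> j; exact/hu.
Qed.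

Lemma sm_comp m p (u : 'rV[R[i]]_m -> 'rV[R[i]]_p) f :
  (forall j, smooth (fun w => u w 0 j)) -> smooth f -> smooth (fun w => f (u w)).
Proof.
move=> hu hf; apply/sm_smf; apply: (smf_comp (u := fun w _ => u w)) => // j.
exact/sm_smf.
Qed.

Lemma sm_coord_fun m p (u : 'rV[R[i]]_m -> 'rV[R[i]]_p) a :
  (forall j, smooth (fun w => u w 0 j)) -> smooth (fun w => coord_fun a (u w)).
Proof.
move=> hu; rewrite /coord_fun.
by case: a.2; [apply: smoothIm|apply: smoothRe].
Qed.

Lemma pd_comp m p (u : 'rV[R[i]]_m -> 'rV[R[i]]_p) f i w :
  (forall j, smooth (fun w => u w 0 j)) -> smooth f ->
  pd i (fun v => f (u v)) w = \sum_a pd i (fun v => (rcomp a (u v))%:C) w * pd a f (u w).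
Proof.
move=> hu hf; under eq_bigr do rewrite -!pdE; apply/pd_eq/pder_chain; first exact/sm_C1at.
move=> a; exact/sm_has/sm_coord_fun.
Qed.

Lemma sm_trans m (f : 'rV[R[i]]_m -> R[i]) u : smooth f -> smooth (fun w => f (w + u)).
Proof.
apply: (sm_comp (u := fun w => w + u)) => j.
under eq_fun do rewrite mxE.
by apply: smoothD; [exact/sm_coord|exact/sm_cst].
Qed.

Lemma sm_int01 m (F : 'rV[R[i]]_m -> R -> R[i]) : smf F -> smooth (fun w => int01 (F w)).
Proof.
move=> hF; apply/sm_smf => r.
apply: (@Cf_int01 R m (fun _ _ => True) (fun _ => True)) => //; exact/dopenT.
Qed.

Lemma pd_int01 m (F : 'rV[R[i]]_m -> R -> R[i]) i w : smf F ->
  pd i (fun v => int01 (F v)) w = int01 (fun s => pd i (F^~ s) w).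
Proof.
move=> hF; apply: pd_eq; under eq_int01 => s _ do rewrite -pdE.
apply: (@pder_int01 R m (fun _ _ => True) (fun _ => True)) => //; exact/dopenT.
Qed.

Lemma smf_cont01 m (F : 'rV[R[i]]_m -> R -> R[i]) w : smf F -> cont01 (F w).
Proof.
move=> hF; apply: (@jcont_param01 R m (fun _ _ => True)) => // v s _.
exact: (Cf0 (hF 0%N) I).
Qed.

End SmoothFunctions.

(** * Averages along segments and their homotopy operator *)

Section Averages.
Context {R : realType} {m : nat}.
Notation V := 'rV[R[i]]_m.
Implicit Types (f g : V -> R[i]) (u v w : V).

Definition wavg (rho : R -> R[i]) v g w : R[i] := int01 (fun s => rho s * g (w + s%:C *: v)).

Definition rho_cont rho : Prop := smf (fun (_ : V) s => rho s).

Lemma smf_wavg rho v g : rho_cont rho -> smooth g -> smf (fun w s => rho s * g (w + s%:C *: v)).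
Proof.
move=> hr hg; apply: smfM => //.
apply: (smf_comp (u := fun w s => w + s%:C *: v)) => // j.
move=> r; apply: (Cf_ext (@dopenT R m)) (smfD (smf_coord j) (smfM smf_id (smf_cst (v 0 j))) r).
by move=> w s _; rewrite !mxE.
Qed.
Lemma sm_wavg rho v g : rho_cont rho -> smooth g -> smooth (wavg rho v g).
Proof. move=> hr hg; exact/sm_int01/smf_wavg. Qed.

Lemma pd_wavg rho v g i w : rho_cont rho -> smooth g ->
  pd i (wavg rho v g) w = wavg rho v (pd i g) w.
Proof.
move=> hr hg; rewrite pd_int01; last exact/smf_wavg.
apply: eq_int01 => s _; rewrite pdZ; last exact/sm_trans.
by rewrite pd_trans.
Qed.
Lemma cont01_wavg rho v g w : rho_cont rho -> smooth g ->
  cont01 (fun s => rho s * g (w + s%:C *: v)).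
Proof. by move=> hr hg; apply: (smf_cont01 w (smf_wavg v hr hg)). Qed.

Lemma wavgD rho v f g w : rho_cont rho -> smooth f -> smooth g ->
  wavg rho v (fun w => f w + g w) w = wavg rho v f w + wavg rho v g w.
Proof.
move=> hr hf hg; rewrite -int01D; try exact/cont01_wavg.
by apply: eq_int01 => s _; rewrite mulrDr.
Qed.

Lemma wavgZ rho v c g w : rho_cont rho -> smooth g ->
  wavg rho v (fun w => c * g w) w = c * wavg rho v g w.
Proof.
move=> hr hg; rewrite -int01Z; last exact/cont01_wavg.
by apply: eq_int01 => s _; rewrite mulrCA.
Qed.

Lemma wavg_sum rho v I l (P : pred I) F w : rho_cont rho -> (forall k, P k -> smooth (F k)) ->
  wavg rho v (fun w => \sum_(k <- l | P k) F k w) w = \sum_(k <- l | P k) wavg rho v (F k) w.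
Proof.
move=> hr hF; rewrite -int01_sum; last by move=> k Pk; apply: cont01_wavg => //; exact/hF.
by apply: eq_int01 => s _; rewrite mulr_sumr.
Qed.

Lemma dirder_wavg rho v u g w : rho_cont rho -> smooth g ->
  dirder u (wavg rho v g) w = wavg rho v (dirder u g) w.
Proof.
move=> hr hg; rewrite wavg_sum //; last first. move=> a _; exact/smoothZ/sm_pd.
apply: eq_bigr => a _; rewrite wavgZ //; last exact/sm_pd.
by rewrite pd_wavg.
Qed.

Definition avg1 v g : V -> R[i] := wavg (fun=> 1) v g.
Definition hom1 v g : V -> R[i] := wavg (fun s => (1 - s)%:C) v g.

Lemma rho1 : rho_cont (fun=> 1). Proof. exact/smf_cst. Qed.
Lemma rho2 : rho_cont (fun s => (1 - s)%:C).
Proof.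
apply: smf_param => s e e0; exists e => // s' h.
by rewrite -rmorphB cnR (_ : 1 - s' - (1 - s) = - (s' - s)) ?normrN //; ring.
Qed.

Lemma avg1_FTC v g w : smooth g -> avg1 v (dirder v g) w = g (w + v) - g w.
Proof.
move=> hg; rewrite /avg1 /wavg.
rewrite (@int01_FTC _ (fun s => g (w + s%:C *: v))) ?scale1r ?scale0r ?addr0 //.
  by apply: cont01_wavg; [exact/rho1|exact/sm_dirder].
by move=> s _; rewrite mul1r; exact/cder_line.
Qed.

(** Integration of the derivative of (1 - s) g(w + s v) over [0, 1]. Up to sign and up to the
    average along v, [hom1 v] inverts the derivative along v; this is the homotopy behind
    [torus_primitive]. *)
Lemma hom1E v g w : smooth g -> dirder v (hom1 v g) w = avg1 v g w - g w.
Proof.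
move=> hg; rewrite dirder_wavg //; last exact/rho2.
pose h s := g (w + s%:C *: v); pose h' s := dirder v g (w + s%:C *: v).
have c1 : cont01 (fun s => 1 * h s) by apply: cont01_wavg => //; exact/rho1.
have c2 : cont01 (fun s => (1 - s)%:C * h' s).
  by apply: cont01_wavg; [exact/rho2|exact/sm_dirder].
have : int01 (fun s => (1 - s)%:C * h' s - 1 * h s) = (1 - 1)%:C * h 1 - (1 - 0)%:C * h 0.
  apply: (@int01_FTC _ (fun s => (1 - s)%:C * h s)). by auto with sm.
  move=> s _; have H1 : cder (fun s => (1 - s)%:C) s (- 1).
    apply/cder_epsP => e e0; exists 1 => // x _; rewrite [X in cn X](_ : _ = 0).
      by rewrite cn0 mulr_ge0 // ltW.
    by ring.
  have H := cderM H1 (cder_line w v s hg).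
  have -> : (1 - s)%:C * h' s - 1 * h s =
    - 1 * g (w + s%:C *: v) + (1 - s)%:C * dirder v g (w + s%:C *: v).
    by rewrite /h /h'; ring.
  exact/H.
rewrite int01B // => E; apply/eqP; rewrite -subr_eq0; apply/eqP.
rewrite (_ : _ - _ = int01 (fun s => (1 - s)%:C * h' s) - int01 (fun s => 1 * h s) + g w).
  by rewrite E subrr subr0 /h scale0r addr0 mul0r mul1r sub0r addNr.
by rewrite opprB [g w - _]addrC addrA.
Qed.

Definition dirper v g : Prop := forall w, g (w + v) = g w.

Lemma wavg_per rho u v g : dirper u g -> dirper u (wavg rho v g).
Proof.
by move=> hg w; apply: eq_int01 => s _; rewrite addrAC hg.
Qed.

(** The derivative of the average along v is g(w + v) - g(w) = 0, hence invariance under all real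
    multiples of v, not only under v. *)
Lemma avg1_invar v g w c : smooth g -> dirper v g -> avg1 v g (w + c%:C *: v) = avg1 v g w.
Proof.
move=> hg hv.
have hM : smooth (avg1 v g) by apply: sm_wavg => //; exact/rho1.
have d0 w' : dirder v (avg1 v g) w' = 0. rewrite dirder_wavg //; last exact/rho1.
  by have := @avg1_FTC v g w' hg; rewrite hv subrr.
have := @cmvt R (fun s => avg1 v g (w + s%:C *: v)) (fun=> 0) 0 0 c.
rewrite !mulr0 mul0r scale0r addr0 !subr0 => H.
apply/eqP; rewrite -subr_eq0; apply/eqP; apply: cn_eq0; apply/eqP.
rewrite eq_le cn_ge0 andbT; apply: H => x _; last by rewrite cn0.
by rewrite -(d0 (w + x%:C *: v)); exact/cder_line.
Qed.
Lemma avg1_cst v c w : avg1 v (fun=> c) w = c.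
Proof. by rewrite /avg1 /wavg int01_cst mul1r. Qed.

Fixpoint avgs (vs : seq V) g : V -> R[i] := if vs is v :: vs' then avg1 v (avgs vs' g) else g.

Lemma sm_avgs vs g : smooth g -> smooth (avgs vs g).
Proof. by move=> hg; elim: vs => //= v vs IH; apply: sm_wavg => //; exact/rho1. Qed.
Lemma avgs_per u vs g : dirper u g -> dirper u (avgs vs g).
Proof. by move=> hg; elim: vs => //= v vs IH; exact/wavg_per. Qed.

Lemma dirder_avgs u vs g w : smooth g -> dirder u (avgs vs g) w = avgs vs (dirder u g) w.
Proof.
move=> hg; elim: vs w => //= v vs IH w.
rewrite dirder_wavg; [|exact/rho1|exact/sm_avgs].
by congr wavg; apply/funext.
Qed.

Lemma pd_avgs i vs g w : smooth g -> pd i (avgs vs g) w = avgs vs (pd i g) w.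
Proof.
move=> hg; elim: vs w => //= v vs IH w.
rewrite pd_wavg; [|exact/rho1|exact/sm_avgs].
by congr wavg; apply/funext.
Qed.

Lemma avgs_invar vs v g w c : smooth g -> (forall u, u \in vs -> dirper u g) ->
  v \in vs -> avgs vs g (w + c%:C *: v) = avgs vs g w.
Proof.
move=> hg; elim: vs w => //= u vs IH w hp; rewrite in_cons => /orP[/eqP ->|hv].
  by apply: avg1_invar; [exact/sm_avgs|apply/avgs_per/hp; rewrite mem_head].
apply: eq_int01 => s _; rewrite addrAC IH // => u' hu'.
by apply: hp; rewrite in_cons hu' orbT.
Qed.

Lemma avgs_dirder vs v g w : smooth g -> dirper v g -> v \in vs -> avgs vs (dirder v g) w = 0.
Proof.
move=> hg hv; elim: vs w => //= u vs IH w; rewrite in_cons => /orP[/eqP <-|hin].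
  rewrite -(_ : dirder v (avgs vs g) = avgs vs (dirder v g)); last first.
    by apply/funext => x; exact/dirder_avgs.
  by rewrite avg1_FTC ?avgs_per ?subrr //; exact/sm_avgs.
have -> : avgs vs (dirder v g) = fun=> 0 by apply/funext => x; exact/IH.
exact/avg1_cst.
Qed.

Lemma avgs_cst vs c w : avgs vs (fun=> c) w = c.
Proof.
elim: vs w => //= v vs IH w; rewrite -[RHS](avg1_cst v c w); congr (avg1 _ _ w).
by apply/funext.
Qed.

Lemma avgsD vs f g w : smooth f -> smooth g ->
  avgs vs (fun w => f w + g w) w = avgs vs f w + avgs vs g w.
Proof.
move=> hf hg; elim: vs w => //= v vs IH w.
rewrite -wavgD; [|exact/rho1|exact/sm_avgs|exact/sm_avgs].
by congr wavg; apply/funext.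
Qed.

Lemma avgsZ vs c g w : smooth g -> avgs vs (fun w => c * g w) w = c * avgs vs g w.
Proof.
move=> hg; elim: vs w => //= v vs IH w.
rewrite -wavgZ; [|exact/rho1|exact/sm_avgs].
by congr wavg; apply/funext.
Qed.

Lemma avgs_sum vs I l (P : pred I) F w : (forall k, P k -> smooth (F k)) ->
  avgs vs (fun w => \sum_(k <- l | P k) F k w) w = \sum_(k <- l | P k) avgs vs (F k) w.
Proof.
move=> hF; elim: l => [|k l IH].
  by rewrite big_nil; under eq_fun do rewrite big_nil; exact/avgs_cst.
rewrite big_cons; case Pk: (P k); under eq_fun do rewrite big_cons Pk; last exact/IH.
by rewrite avgsD ?IH //; [exact/hF|exact/sm_sum].
Qed.

End Averages.

Local Opaque int01.

(** * Lattice-periodic functions and their means over a period cell *)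

Section Lattice.
Context {R : realType} (tau : R[i]).

(** The periods 1 and tau of each coordinate, in the order of the recursion of [int_curves]: the
    iterated integral is (Im tau)^m times the iterated average along them ([int_curvesE]). *)
Fixpoint dirs (m : nat) : seq 'rV[R[i]]_m := if m is m'.+1 return seq 'rV[R[i]]_m then
    (row_mx 1%:M 0 : 'rV[R[i]]_(1 + m')) :: (row_mx tau%:M 0 : 'rV[R[i]]_(1 + m')) ::
      [seq (row_mx 0 v : 'rV[R[i]]_(1 + m')) | v <- dirs m']
  else [::].

Definition lper m (g : 'rV[R[i]]_m -> R[i]) : Prop :=
  forall w j p q, g (w + (p%:~R + q%:~R * tau) *: delta_mx 0 j) = g w.

Lemma row_mx_delta0 m' (c : R[i]) :
  (row_mx c%:M 0 : 'rV[R[i]]_(1 + m')) = c *: (delta_mx 0 ord0 : 'rV[R[i]]_(m'.+1)).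
Proof.
apply/rowP => j; rewrite !mxE; case: splitP => k jk; rewrite ?ord1 !mxE.
  by rewrite (_ : j = ord0) ?mulr1 //; apply: val_inj; rewrite /= jk ord1.
by rewrite (_ : (j == ord0) = false) ?mulr0 //; apply/eqP => /(congr1 val) /=; rewrite jk.
Qed.

Lemma row_mx_delta m' (c : R[i]) (k : 'I_m') : (row_mx 0 (c *: delta_mx 0 k) : 'rV[R[i]]_(1 + m')) =
  c *: (delta_mx 0 (lift ord0 k) : 'rV[R[i]]_(m'.+1)).
Proof.
apply/rowP => j; rewrite !mxE; case: splitP => i ji; rewrite !mxE.
  rewrite (_ : (j == lift ord0 k) = false) ?mulr0 //.
  by apply/eqP => /(congr1 val); rewrite /= ji ord1.
by rewrite -!val_eqE /= ji.
Qed.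

Lemma dirs_delta m (j : 'I_m) : delta_mx 0 j \in dirs m /\ tau *: delta_mx 0 j \in dirs m.
Proof.
elim: m j => [[]//|m IH] j.
have [k ->|->] := unliftP ord0 j.
  have [h1 h2] := IH k; rewrite -[delta_mx 0 (lift _ _)]scale1r scalerA mulr1 -!row_mx_delta scale1r.
  by split; apply/or3P; apply/Or33/map_f.
by split; apply/or3P; [apply: Or31|apply: Or32]; rewrite row_mx_delta0 ?scale1r.
Qed.

Lemma dirs_lattice m v : v \in dirs m -> exists j, v = delta_mx 0 j \/ v = tau *: delta_mx 0 j.
Proof.
elim: m v => // m IH v; rewrite !in_cons => /or3P[/eqP ->|/eqP ->|/mapP [u /IH [k hk] ->]].
- by exists ord0; left; rewrite row_mx_delta0 scale1r.
- by exists ord0; right; rewrite row_mx_delta0.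
- exists (lift ord0 k); case: hk => ->; [left|right]; last exact/row_mx_delta.
  by rewrite -[delta_mx 0 k]scale1r row_mx_delta scale1r.
Qed.

Lemma per_dir m g v : lper g -> v \in dirs m -> dirper v g.
Proof.
move=> hg /dirs_lattice [j [->|->]] w. by rewrite -(hg w j 1 0) mul0r addr0 scale1r.
by rewrite -(hg w j 0 1) mul1r add0r.
Qed.

Lemma dir_per m g : (forall v, v \in dirs m -> dirper v g) -> lper g.
Proof.
move=> hg w j p q.
have key v : dirper v g -> forall w p, g (w + p%:~R *: v) = g w. move=> hv.
  have hn : forall n w, g (w + n%:R *: v) = g w. elim=> [|n IH] w'; first by rewrite scale0r addr0.
    by rewrite -natr1 scalerDl scale1r addrA hv.
  move=> w' [n|n]; first exact/hn.
  by rewrite scaleNr -(hn n.+1) subrK.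
have [/hg h1 /hg h2] := dirs_delta j.
by rewrite scalerDl -scalerA addrA (key _ h2) key.
Qed.

Lemma per_avgs m vs (g : 'rV[R[i]]_m -> R[i]) : lper g -> lper (avgs vs g).
Proof.
by move=> hg w j p q; apply: (@avgs_per R m ((p%:~R + q%:~R * tau) *: delta_mx 0 j)) => v.
Qed.

Lemma per_wavg m rho v (g : 'rV[R[i]]_m -> R[i]) : lper g -> lper (wavg rho v g).
Proof.
by move=> hg w j p q; apply: (@wavg_per R m rho ((p%:~R + q%:~R * tau) *: delta_mx 0 j)) => u.
Qed.

Lemma avgs_row m' ds g z z' :
  avgs [seq (row_mx 0 v : 'rV[R[i]]_(1 + m')) | v <- ds] g (row_mx z z') =
  avgs ds (fun y => g (row_mx z y)) z'.
Proof.
elim: ds z' => //= v ds IH z'; apply: eq_int01 => s _.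
by rewrite scale_row_mx scaler0 add_row_mx addr0 IH.
Qed.

Lemma sm_row m' (g : 'rV[R[i]]_(1 + m') -> R[i]) z : smooth g ->
  smooth (fun y => g (row_mx z y)).
Proof.
apply: (sm_comp (u := fun y => row_mx z y)) => j.
under eq_fun do rewrite mxE.
by case: (fintype.split j) => k; [exact/sm_cst|exact/sm_coord].
Qed.

Lemma int_curvesE m g : smooth g -> int_curves tau g = (Im tau)%:C ^+ m * avgs (dirs m) g 0.
Proof.
elim: m g => [|m IH] g hg; first by rewrite mul1r.
rewrite /= exprS -mulrA; congr (_ * _).
have E s t : int_curves tau (fun z' => g (row_mx (s%:C + t%:C * tau)%:M z')) =
  (Im tau)%:C ^+ m * avgs (map (row_mx (0 : 'rV[R[i]]_1)) (dirs m)) g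
     (0 + s%:C *: row_mx 1%:M 0 + t%:C *: row_mx tau%:M 0 : 'rV[R[i]]_(1 + m)).
  rewrite IH; last exact/sm_row.
  rewrite -avgs_row; congr (_ * avgs _ _ _).
  by rewrite !scale_row_mx !scaler0 add0r add_row_mx addr0 !scale_scalar_mx mulr1 -raddfD.
set G := avgs _ g in E *.
have hG : smooth G by exact/sm_avgs.
transitivity (int01 (fun s => (Im tau)%:C ^+ m *
   (1 * avg1 (row_mx tau%:M 0) G (0 + s%:C *: row_mx 1%:M 0 : 'rV_(1 + m))))).
  apply: eq_int01 => s _.
  transitivity (int01 (fun t => (Im tau)%:C ^+ m *
     (1 * G (0 + s%:C *: row_mx 1%:M 0 + t%:C *: row_mx tau%:M 0 : 'rV_(1 + m))))).
    by apply: eq_int01 => t _; rewrite mul1r.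
  by rewrite int01Z ?mul1r //; apply: cont01_wavg => //; exact/rho1.
rewrite int01Z //; apply: cont01_wavg; first exact/rho1.
by apply: sm_wavg => //; exact/rho1.
Qed.

Hypothesis htau : 0 < Im tau.

(** The averages are invariant under real multiples of both periods in each coordinate, and 1 and
    tau span the complex plane over R. *)
Lemma avgs_dirs_cst m g w : smooth g -> lper g -> avgs (dirs m) g w = avgs (dirs m) g 0.
Proof.
move=> hg hp.
have step v j c : avgs (dirs m) g (v + c *: delta_mx 0 j) = avgs (dirs m) g v.
  have [h1 h2] := dirs_delta j.
  pose b := Im c / Im tau; pose a := Re c - b * Re tau.
  have -> : c = a%:C + b%:C * tau.
    apply: ceqP; rewrite ?cReD ?cImD ?cReM ?cImM ?mul0r ?subr0 ?addr0 ?add0r.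
      by rewrite subrK.
    by rewrite divfK // gt_eqF.
  have hd u : u \in dirs m -> dirper u g by exact/per_dir.
  by rewrite scalerDl -scalerA addrA !avgs_invar.
rewrite (row_sum_delta w) -[X in avgs _ _ X]add0r.
elim: (index_enum _) => [|j l IH]; first by rewrite big_nil addr0.
by rewrite big_cons addrCA addrC step.
Qed.

Definition mean m g : R[i] := avgs (dirs m) g 0.

Lemma mean_cst m c : mean (fun _ : 'rV[R[i]]_m => c) = c.
Proof. exact/avgs_cst. Qed.
Lemma meanD m (f g : 'rV[R[i]]_m -> R[i]) : smooth f -> smooth g ->
  mean (fun w => f w + g w) = mean f + mean g.
Proof. exact/avgsD. Qed.
Lemma meanZ m c (g : 'rV[R[i]]_m -> R[i]) : smooth g -> mean (fun w => c * g w) = c * mean g.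
Proof. exact/avgsZ. Qed.
Lemma mean_sum m I l (P : pred I) (F : I -> 'rV[R[i]]_m -> R[i]) :
  (forall k, P k -> smooth (F k)) ->
  mean (fun w => \sum_(k <- l | P k) F k w) = \sum_(k <- l | P k) mean (F k).
Proof. exact/avgs_sum. Qed.
Lemma mean_dirder m v g : smooth g -> lper g -> v \in dirs m -> mean (dirder v g) = 0.
Proof. by move=> hg hp hv; apply: avgs_dirder => //; exact/per_dir. Qed.

Lemma dirder_delta m j c (g : 'rV[R[i]]_m -> R[i]) w :
  dirder (c *: delta_mx 0 j) g w = (Re c)%:C * pd (j, false) g w + (Im c)%:C * pd (j, true) g w.
Proof.
rewrite /dirder sum_rcoord (bigD1 j) //= big1 ?addr0; last first.
  move=> k kj; move: (pd _ _ _) (pd _ _ _) => X Y.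
  by rewrite /rcomp !mxE (negbTE kj) mulr0 !mul0r addr0.
by rewrite /rcomp !mxE !eqxx mulr1.
Qed.

(** Derivatives along the periods have mean 0; the one along tau is Re tau d/dx + Im tau d/dy, and
    Im tau does not vanish. *)
Lemma mean_pd m i (g : 'rV[R[i]]_m -> R[i]) : smooth g -> lper g -> mean (pd i g) = 0.
Proof.
move=> hg hp; have [h1 h2] := dirs_delta i.1.
have Hx : mean (pd (i.1, false) g) = 0.
  rewrite -(mean_dirder hg hp h1); congr (mean _); apply/funext => w.
  by rewrite -[delta_mx _ _]scale1r dirder_delta mul1r mul0r addr0.
case: i h1 h2 Hx => j [] h1 h2 Hx; last exact/Hx.
have := mean_dirder hg hp h2.
have -> : dirder (tau *: delta_mx 0 j) g = fun w => (Re tau)%:C * pd (j, false) g w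
   + (Im tau)%:C * pd (j, true) g w.
  by apply/funext => w; exact/dirder_delta.
have s1 := sm_pd (j, false) hg; have s2 := sm_pd (j, true) hg.
have E : _ = (Re tau)%:C * mean (pd (j, false) g) + (Im tau)%:C * mean (pd (j, true) g) :=
  etrans (meanD (smoothZ _ s1) (smoothZ _ s2)) (congr2 +%R (meanZ _ s1) (meanZ _ s2)).
have L (x y : R[i]) : x * 0 + y = y by rewrite mulr0 add0r.
move=> E'; have {E'} := etrans (esym (etrans E (etrans (congr1 (fun X => _ * X + _) Hx) (L _ _)))) E'.
move=> /eqP; rewrite mulf_eq0 => /orP[/eqP h|/eqP //].
have h' : Im tau = 0 := congr1 (@complex.Re R) h.
by exfalso; move: htau; rewrite h' ltxx.
Qed.

End Lattice.

#[local] Hint Resolve sm_cst smoothD smoothM smoothN smoothB smoothJ sm_sum sm_prod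
  sm_coord smoothRe smoothIm sm_rcomp sm_pd : sm.

Local Close Scope classical_set_scope.

Import mathcomp.boot.fintype mathcomp.boot.bigop mathcomp.boot.finset.

(** * Signs of the wedge product *)

Section InversionSign.
Context {R : realType} {m : nat}.
Notation I := (rcoord m).
Implicit Types (A B C : {set rcoord m}) (i k : rcoord m).

Lemma crank_inj : injective (@coord_rank m).
Proof.
move=> [j c] [k d]; rewrite /= => h.
have hc : c = d by have := congr1 odd h; rewrite !oddD !odd_double; case: c {h}; case: d.
move: h; rewrite hc => /addIn /double_inj h.
by congr pair; apply: val_inj.
Qed.

Definition ninv A B : nat := \sum_(a in A) \sum_(b in B) (coord_rank b < coord_rank a)%N.

Lemma wedge_signE A B : wedge_sign R A B = (-1) ^+ ninv A B.
Proof.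
rewrite /ninv; congr (_ ^+ _).
rewrite pair_big_dep -sum1_card big_mkcond [RHS]big_mkcond.
apply: eq_bigr => p _; rewrite !inE.
by case: (p.1 \in A); case: (p.2 \in B).
Qed.
Lemma ninvUl A B C : [disjoint A & B] -> ninv (A :|: B) C = (ninv A C + ninv B C)%N.
Proof. by move=> dAB; rewrite -bigU //; apply: eq_bigl => x; rewrite !inE. Qed.

Lemma ninvUr A B C : [disjoint B & C] -> ninv A (B :|: C) = (ninv A B + ninv A C)%N.
Proof.
move=> dBC; rewrite -big_split; apply: eq_bigr => a _.
by rewrite -bigU //; apply: eq_bigl => x; rewrite !inE.
Qed.

(** Every pair with one member in A and one in B is an inversion in exactly one of the two
    orders. *)
Lemma ninv_swap A B : [disjoint A & B] -> (ninv A B + ninv B A = #|A| * #|B|)%N.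
Proof.
move=> dAB; rewrite [X in (_ + X)%N]exchange_big -big_split.
rewrite -sum_nat_const; apply: eq_bigr => a aA.
rewrite -big_split -sum1_card; apply: eq_bigr => b bB.
have : coord_rank a != coord_rank b. apply/eqP => /crank_inj ab; move: bB; rewrite -ab.
  by rewrite (disjointFr dAB aA).
by case: ltngtP.
Qed.

Lemma ninv0l B : ninv set0 B = 0%N. Proof. by rewrite /ninv big_set0. Qed.
Lemma ninv0r A : ninv A set0 = 0%N.
Proof. by rewrite /ninv big1 // => a _; rewrite big_set0. Qed.
Definition sgn A B : R[i] := (-1) ^+ ninv A B.

Lemma sgnUl A B C : [disjoint A & B] -> sgn (A :|: B) C = sgn A C * sgn B C.
Proof. by move=> dAB; rewrite /sgn ninvUl // exprD. Qed.
Lemma sgnUr A B C : [disjoint B & C] -> sgn A (B :|: C) = sgn A B * sgn A C.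
Proof. by move=> dBC; rewrite /sgn ninvUr // exprD. Qed.
Lemma sgn0l B : sgn set0 B = 1. Proof. by rewrite /sgn ninv0l. Qed.
Lemma sgn0r A : sgn A set0 = 1. Proof. by rewrite /sgn ninv0r. Qed.
Lemma sgn_sq A B : sgn A B * sgn A B = 1.
Proof. by rewrite -exprD addnn -mul2n exprM sqrrN !expr1n. Qed.
Lemma sgn_anti i k : i != k -> sgn [set i] [set k] = - sgn [set k] [set i].
Proof.
move=> ik; have h : sgn [set i] [set k] * sgn [set k] [set i] = -1.
  by rewrite -exprD ninv_swap ?cards1 // disjoints1 inE.
by rewrite -[LHS]mulr1 -(sgn_sq [set k] [set i]) mulrA h mulN1r.
Qed.

End InversionSign.

(** * The ring of differential forms *)

Section FormRing.
Context {R : realType} {m : nat}.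
Notation V := 'rV[R[i]]_m.
Notation form := (dform R m).
Implicit Types (om eta : form) (w : V) (I J K L : {set rcoord m}) (i k : rcoord m).

Notation sg := (@sgn R m).

Lemma formP om eta : (forall w I, om w I = eta w I) -> om = eta.
Proof. by move=> h; apply/funext => w; apply/funext => I. Qed.

Definition addf om eta : form := fun w I => om w I + eta w I.
Definition oppf om : form := fun w I => - om w I.
Definition zerof : form := fun w I => 0.

Lemma wedgefE om eta w K :
  wedgef om eta w K = \sum_(I : {set rcoord m} | I \subset K) sg I (K :\: I) * om w I * eta w (K :\: I).
Proof.
by apply: eq_big => [I|I _]; rewrite ?powersetE ?wedge_signE.
Qed.

(** Both sides are sums over chains I within L within K, and the signs agree because the inversion
    count is additive in each argument. *)
Lemma wedgefA om eta zeta : wedgef om (wedgef eta zeta) = wedgef (wedgef om eta) zeta.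
Proof.
apply: formP => w K; rewrite !wedgefE.
transitivity (\sum_(I : {set rcoord m} | I \subset K)
    \sum_(L : {set rcoord m} | (I \subset L) && (L \subset K))
   sg I (K :\: I) * om w I * (sg (L :\: I) (K :\: L) * eta w (L :\: I) * zeta w (K :\: L))).
  apply: eq_bigr => I IK; rewrite wedgefE mulr_sumr.
  rewrite (reindex_onto (fun L => L :\: I) (fun J => I :|: J)); last first.
    move=> J JK; apply/setP => x; rewrite !inE.
    by case xI: (x \in I) => //=; apply/esym/negP => xJ;
      have /subsetP /(_ x xJ) := JK; rewrite !inE xI.
  apply: eq_big => [L|L]. apply/andP/andP => -[h1 h2].
      have IL : I \subset L by rewrite -(eqP h2) subsetUl.
      split => //; rewrite -(eqP h2) subUset IK.
      by apply: subset_trans h1 (subsetDl _ _).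
    split; first exact/setSD.
    by rewrite eqEsubset subUset h1 subsetDl; apply/subsetP => x xL; rewrite !inE xL andbT orbN.
  move=> /andP[h1 /eqP h2]; have -> : (K :\: I) :\: (L :\: I) = K :\: L.
    apply/setP => x; rewrite !inE; case xI: (x \in I) => //=.
    by rewrite -h2 !inE xI.
  by [].
transitivity (\sum_(L : {set rcoord m} | L \subset K) \sum_(I : {set rcoord m} | I \subset L)
   sg L (K :\: L) * (sg I (L :\: I) * om w I * eta w (L :\: I)) * zeta w (K :\: L)); last first.
  by apply: eq_bigr => L LK; rewrite wedgefE mulr_sumr mulr_suml.
rewrite (exchange_big_dep (fun L => L \subset K)); last first. by move=> I L _ /andP[].
apply: eq_bigr => L LK; apply: eq_big => [I|I /andP[_ /andP[IL _]]].
  by rewrite LK; case IL: (I \subset L); rewrite ?andbF ?andbT //; exact: subset_trans LK.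
have E1 : K :\: I = (L :\: I) :|: (K :\: L). apply/setP => x; rewrite !inE; case xL: (x \in L).
    by rewrite (subsetP LK x xL) orbF.
  case xI: (x \in I) => //=; first by have := subsetP IL x xI; rewrite xL.
have E2 : L = I :|: (L :\: I).
  by apply/setP => x; rewrite !inE; case xI: (x \in I) => //=; rewrite (subsetP IL x xI).
have d1 : [disjoint L :\: I & K :\: L].
  by rewrite -setI_eq0; apply/eqP/setP => x; rewrite !inE; case: (x \in L); rewrite ?andbF.
have d2 : [disjoint I & L :\: I].
  by rewrite -setI_eq0; apply/eqP/setP => x; rewrite !inE; case: (x \in I).
have -> : sg L (K :\: L) = sg I (K :\: L) * sg (L :\: I) (K :\: L).
  by rewrite -(sgnUl _ d2); congr sgn.
by rewrite E1 (sgnUr _ d1); ring.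
Qed.

Lemma wedge1f om : wedgef (form0 (fun=> 1)) om = om.
Proof.
apply: formP => w K; rewrite wedgefE (bigD1 set0) ?sub0set //= big1 ?addr0.
  by rewrite /form0 eqxx setD0 sgn0l !mul1r.
by move=> I /andP[_ /negbTE I0]; rewrite /form0 I0 mulr0 mul0r.
Qed.

Lemma wedgef1 om : wedgef om (form0 (fun=> 1)) = om.
Proof.
apply: formP => w K; rewrite wedgefE (bigD1 K) //= big1 ?addr0.
  by rewrite /form0 setDv eqxx sgn0r mul1r mulr1.
move=> I /andP[IK IneK]; rewrite /form0 setD_eq0 (_ : (K \subset I) = false) ?mulr0 //.
by apply/negP => KI; move: IneK; rewrite eqEsubset IK KI.
Qed.

Lemma wedgefDl : left_distributive (@wedgef R m) addf.
Proof.
move=> om eta zeta; apply: formP => w K; rewrite /addf -big_split /=.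
by apply: eq_bigr => I _; ring.
Qed.
Lemma wedgefDr : right_distributive (@wedgef R m) addf.
Proof.
move=> om eta zeta; apply: formP => w K; rewrite /addf -big_split /=.
by apply: eq_bigr => I _; ring.
Qed.

Lemma form1_neq0 : form0 (fun=> 1) <> zerof.
Proof.
move=> /(congr1 (fun om => om 0 set0)); rewrite /form0 eqxx => /eqP.
by rewrite oner_eq0.
Qed.

End FormRing.

(** Forms are made a ring under the wedge product, so that matrices and polynomials over forms, and
    the general lemmas on powers and sums, become available for connections and curvatures. *)
HB.instance Definition _ R m := gen_eqMixin (dform R m).
HB.instance Definition _ R m := gen_choiceMixin (dform R m).

Section FormInstances.
Context (R : realType) (m : nat).

Lemma addfA : associative (@addf R m).
Proof. by move=> a b c; apply: formP => w I; rewrite /addf addrA. Qed.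
Lemma addfC : commutative (@addf R m).
Proof. by move=> a b; apply: formP => w I; rewrite /addf addrC. Qed.
Lemma add0f : left_id (@zerof R m) (@addf R m).
Proof. by move=> a; apply: formP => w I; rewrite /addf add0r. Qed.
Lemma addNf : left_inverse (@zerof R m) (@oppf R m) (@addf R m).
Proof. by move=> a; apply: formP => w I; rewrite /addf addNr. Qed.
HB.instance Definition _ := GRing.isZmodule.Build (dform R m) addfA addfC add0f addNf.

Lemma form1_neq0b : form0 (fun=> 1) != 0 :> dform R m.
Proof. by apply/eqP; exact/form1_neq0. Qed.
HB.instance Definition _ := GRing.Zmodule_isNzRing.Build (dform R m)
  wedgefA wedge1f wedgef1 wedgefDl wedgefDr form1_neq0b.
End FormInstances.

(** * Basis forms, contraction, graded commutativity *)

Section FormAlgebra.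
Context {R : realType} {m : nat}.
Notation V := 'rV[R[i]]_m.
Notation form := (dform R m).
Implicit Types (om eta : form) (w : V) (I J K L : {set rcoord m}) (i k : rcoord m)
  (f g : V -> R[i]).
Notation sg := (@sgn R m).

Lemma addfE om eta w I : (om + eta) w I = om w I + eta w I. Proof. by []. Qed.
Lemma oppfE om w I : (- om) w I = - om w I. Proof. by []. Qed.
Lemma zerofE w I : (0 : form) w I = 0. Proof. by []. Qed.
Lemma subfE om eta w I : (om - eta) w I = om w I - eta w I. Proof. by []. Qed.
Lemma mulfE om eta w K : (om * eta) w K =
  \sum_(I : {set rcoord m} | I \subset K) sg I (K :\: I) * om w I * eta w (K :\: I).
Proof. exact/wedgefE. Qed.
Lemma sumfE T l (P : pred T) (F : T -> form) w I :
  (\sum_(t <- l | P t) F t) w I = \sum_(t <- l | P t) F t w I.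
Proof. by elim/big_rec2: _ => // t a b _ <-. Qed.

Lemma mulf0E om f w K : (form0 f * om) w K = f w * om w K.
Proof.
rewrite mulfE (bigD1 set0) ?sub0set //= big1 ?addr0. by rewrite /form0 eqxx setD0 sgn0l mul1r.
by move=> I /andP[_ /negbTE I0]; rewrite /form0 I0 mulr0 mul0r.
Qed.

Lemma mulf0Er om f w K : (om * form0 f) w K = om w K * f w.
Proof.
rewrite mulfE (bigD1 K) //= big1 ?addr0. by rewrite /form0 setDv eqxx sgn0r mul1r.
move=> I /andP[IK IneK]; rewrite /form0 setD_eq0 (_ : (K \subset I) = false) ?mulr0 //.
by apply/negP => KI; move: IneK; rewrite eqEsubset IK KI.
Qed.
Lemma form0C f om : form0 f * om = om * form0 f.
Proof. by apply: formP => w K; rewrite mulf0E mulf0Er mulrC. Qed.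
Lemma form0M f g : form0 f * form0 g = form0 (fun w => f w * g w) :> form.
Proof. by apply: formP => w K; rewrite mulf0E /form0; case: eqP; rewrite ?mulr0. Qed.
Lemma form0D f g : form0 f + form0 g = form0 (fun w => f w + g w) :> form.
Proof. by apply: formP => w K; rewrite addfE /form0; case: eqP; rewrite ?addr0. Qed.

Definition cf c : form := form0 (fun=> c).
Lemma cfE c om w K : (cf c * om) w K = c * om w K. Proof. exact/mulf0E. Qed.
Lemma cfC c om : cf c * om = om * cf c. Proof. exact/form0C. Qed.
Lemma cfM c d : cf c * cf d = cf (c * d). Proof. exact/form0M. Qed.
Lemma cf_nat n : cf n%:R = n%:R.
Proof.
elim: n => [|n IH]; first by apply: formP => w I; rewrite /cf /form0 if_same.
rewrite -natr1 -natr1 -IH; apply: formP => w K.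
rewrite addfE /cf.
by rewrite /GRing.one /= /form0; case: eqP => //; rewrite addr0.
Qed.
Lemma mulrnfE om n w K : (om *+ n) w K = om w K *+ n.
Proof. by elim: n => // n IH; rewrite !mulrS addfE IH. Qed.
Definition ef i : form := fun w I => (I == [set i])%:R.

Lemma mulefE i om w K : (ef i * om) w K =
  if i \in K then sg [set i] (K :\ i) * om w (K :\ i) else 0.
Proof.
rewrite mulfE; case: ifPn => iK.
  rewrite (bigD1 [set i]) ?sub1set //= big1 ?addr0; first by rewrite /ef eqxx mulr1.
  by move=> I /andP[_ /negbTE h]; rewrite /ef h mulr0 mul0r.
rewrite big1 // => I IK; rewrite /ef; case: eqP => [E|_]; last by rewrite mulr0 mul0r.
by move: IK; rewrite E sub1set (negbTE iK).
Qed.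

(** Contraction with the coordinate vector field of index i, with the sign of moving that index to
    the front; [ctr_ef] is the antiderivation rule. *)
Definition ctr i om : form := fun w K => if i \in K then 0 else sg [set i] K * om w (i |: K).

Lemma sgD1 i k K : k \in K -> sg [set i] K = sg [set i] [set k] * sg [set i] (K :\ k).
Proof.
by move=> kK; rewrite -{1}(setD1K kK) sgnUr // disjoints1 !inE eqxx.
Qed.

Lemma ctr_ef i k om : ctr i (ef k * om) = (i == k)%:R * om - ef k * ctr i om.
Proof.
apply: formP => w K; rewrite subfE mulefE /ctr mulefE.
case: (eqVneq i k) => [<-|ik]. case: ifPn => iK.
    rewrite !inE eqxx setD1K // mulrA sgn_sq !mul1r subrr //.
  by rewrite !inE eqxx subr0 mul1r setU1K // mulrA sgn_sq mul1r.
rewrite mul0r sub0r !inE eq_sym (negbTE ik) /=.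
case: ifPn => iK. by case: ifPn => kK; rewrite ?mulr0 oppr0.
case: ifPn => kK; last by rewrite mulr0 oppr0.
have -> : (i |: K) :\ k = i |: (K :\ k).
  by apply/setP => x; rewrite !inE; case: (eqVneq x k) => // ->; rewrite eq_sym (negbTE ik).
have iKk : [disjoint [set i] & K :\ k] by rewrite disjoints1 !inE (negbTE iK) andbF.
rewrite (sgD1 i kK) (sgnUr _ iKk) (sgn_anti ik).
have := sgn_sq (R := R) [set k] [set i]; set s := sg [set k] [set i] => E.
transitivity (- ((s * s) * (sg [set i] (K :\ k) * (sg [set k] (K :\ k) * om w (i |: K :\ k))))).
  by ring.
by rewrite E; ring.
Qed.

Lemma homog_ctr p i om : homog p.+1 om -> homog p (ctr i om).
Proof.
move=> h w K hK; rewrite /ctr; case: ifPn => // iK; rewrite h ?mulr0 //.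
by rewrite cardsU1 iK => -[].
Qed.

Lemma ef_anti i k : ef i * ef k = - (ef k * ef i).
Proof.
apply: formP => w K; rewrite oppfE !mulefE /ef.
case: (eqVneq i k) => [->|ik]. case: ifPn => kK; last by rewrite oppr0.
  rewrite (_ : (_ == _) = false) ?mulr0 ?oppr0 //.
  by apply/eqP => /setP /(_ k); rewrite !inE eqxx.
have E a b : a != b -> (K :\ a == [set b]) && (a \in K) = (K == [set a; b]).
  move=> ab; apply/andP/eqP => [[/eqP h aK]|->]; first by rewrite -(setD1K aK) h.
  split; last by rewrite !inE eqxx.
  by apply/eqP/setP => x; rewrite !inE; case: (eqVneq x a) => // ->; rewrite (negbTE ab).
have := E i k ik; have := E k i; rewrite eq_sym ik => /(_ isT); rewrite setUC.
case: (eqVneq K [set i; k]) => [->|_].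
  move=> /andP[/eqP -> ->] /andP[/eqP -> ->]; rewrite !eqxx !mulr1.
  exact/sgn_anti.
by case: (k \in K) ; case: (i \in K) ; rewrite ?andbT => h1 h2; rewrite ?h1 ?h2 ?mulr0 ?oppr0.
Qed.

Lemma ef_sq i : ef i * ef i = 0.
Proof.
apply: formP => w K; rewrite mulefE /ef; case: ifPn => // iK.
rewrite (_ : (_ == _) = false) ?mulr0 //.
by apply/eqP => /setP /(_ i); rewrite !inE eqxx.
Qed.

Lemma homogM p q om eta : homog p om -> homog q eta -> homog (p + q) (om * eta).
Proof.
move=> h1 h2 w K hK; rewrite mulfE big1 // => I IK.
case: (eqVneq #|I| p) => [E|/eqP /h1 ->]; last by rewrite mulr0 mul0r.
rewrite (h2 w (K :\: I)) ?mulr0 // cardsD => E2; apply: hK.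
by rewrite -E -E2 (setIidPr IK) subnKC // subset_leq_card.
Qed.
Lemma homogD p om eta : homog p om -> homog p eta -> homog p (om + eta).
Proof. by move=> h1 h2 w K hK; rewrite addfE h1 // h2 // addr0. Qed.
Lemma homogN p om : homog p om -> homog p (- om).
Proof. by move=> h1 w K hK; rewrite oppfE h1 // oppr0. Qed.
Lemma homogB p om eta : homog p om -> homog p eta -> homog p (om - eta).
Proof. by move=> h1 h2; apply: homogD => //; exact/homogN. Qed.
Lemma homog0 p : homog p (0 : form). Proof. by []. Qed.
Lemma homog_form0 f : homog 0 (form0 f : form).
Proof. by move=> w K hK; rewrite /form0; case: eqP hK => // ->; rewrite cards0. Qed.
Lemma homog_ef i : homog 1 (ef i).
Proof. by move=> w K hK; rewrite /ef; case: eqP hK => // ->; rewrite cards1. Qed.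
Lemma homog_sum p T l (P : pred T) (F : T -> form) :
  (forall t, P t -> homog p (F t)) -> homog p (\sum_(t <- l | P t) F t).
Proof. by move=> h; elim/big_rec: _ => [|t x Pt hx]; [exact/homog0|apply: homogD => //; exact/h]. Qed.
Lemma homogX p om n : homog p om -> homog (n * p) (om ^+ n).
Proof.
move=> h; elim: n => [|n IH]; first by rewrite expr0; exact/homog_form0.
by rewrite exprS; exact/homogM.
Qed.
Lemma homogMf0 p f om : homog p om -> homog p (form0 f * om).
Proof. by rewrite -[p]add0n; apply: homogM ; exact/homog_form0. Qed.
(** Passing from I to its complement in K exchanges the two factors, and the signs differ by
    [ninv_swap]. *)
Lemma homog_comm p q om eta : homog p om -> homog q eta ->
  om * eta = (-1) ^+ (p * q) * (eta * om).
Proof.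
move=> h1 h2; apply: formP => w K.
have -> : ((-1) ^+ (p * q) : form) = cf ((-1) ^+ (p * q)). elim: (p * q)%N => [|n IH] //.
  rewrite !exprS IH -cfM; congr (_ * _).
  by apply: formP => v L; rewrite oppfE /cf /GRing.one /= /form0; case: eqP; rewrite ?oppr0.
rewrite cfE !mulfE (reindex_onto (fun I => K :\: I) (fun I => K :\: I)); last first.
  by move=> I IK; rewrite setDDr setDv set0U (setIidPr IK).
rewrite mulr_sumr; apply: eq_big => [I|I].
  rewrite subsetDl; apply/eqP/idP => [<-|IK]; first exact/subsetDl.
  by rewrite setDDr setDv set0U (setIidPr IK).
move=> /andP[_ /eqP E].
rewrite E.
case: (eqVneq #|K :\: I| p) => [Ep|/eqP /h1 ->]; last by rewrite !mulr0 !mul0r.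
case: (eqVneq #|I| q) => [Eq|/eqP /h2 ->]; last by rewrite !(mulr0, mul0r).
have d : [disjoint K :\: I & I].
  by rewrite -setI_eq0; apply/eqP/setP => x; rewrite !inE; case: (x \in I); rewrite ?andbF.
have E2 : sg (K :\: I) I = (-1) ^+ (p * q) * sg I (K :\: I).
  by rewrite -Ep -Eq -(ninv_swap d) exprD -mulrA sgn_sq mulr1.
by rewrite E2; ring.
Qed.

Lemma homog_even_comm p om eta q : homog p om -> homog q eta -> ~~ odd p ->
  om * eta = eta * om.
Proof.
move=> h1 h2 hp; rewrite (homog_comm h1 h2) -signr_odd oddM (negbTE hp) mul1r //.
Qed.

Definition gpart p om : form := fun w I => if #|I| == p then om w I else 0.
Lemma homog_gpart p om : homog p (gpart p om).
Proof. by move=> w I; rewrite /gpart; case: eqP. Qed.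
Lemma gpart_sum om : om = \sum_(p < m.*2.+1) gpart p om.
Proof.
apply: formP => w I; rewrite sumfE.
have hI : (#|I| < m.*2.+1)%N.
  by rewrite ltnS (leq_trans (max_card _)) // card_prod card_ord card_bool muln2.
rewrite (bigD1 (Ordinal hI)) //= /gpart eqxx big1 ?addr0 // => p hp.
by case: eqP => // h; move: hp; rewrite -val_eqE /= h eqxx.
Qed.

(** eta is arbitrary: it is split into its homogeneous parts, each of which commutes with an even
    form. *)
Lemma even_comm p om eta : homog p om -> ~~ odd p -> om * eta = eta * om.
Proof.
move=> h hp; rewrite (gpart_sum eta) mulr_sumr mulr_suml; apply: eq_bigr => q _.
exact: (homog_even_comm h (homog_gpart _) hp).
Qed.

End FormAlgebra.

#[local] Hint Resolve homogD homogN homogB homog0 homog_form0 homog_ef homog_sum homogMf0 homogM homogX : sm.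

(** * Ordered products of anticommuting elements *)

Section CoordSeq.

Lemma cseq_mem m (a : rcoord m) : a \in coord_seq m.
Proof.
case: a => j c; apply/allpairsP; exists (j, c); rewrite mem_enum.
by case: c.
Qed.

Lemma crank_seq m : [seq coord_rank a | a <- coord_seq m] = seq.iota 0 m.*2.
Proof.
have E : [seq coord_rank a | a <- coord_seq m] =
    flatten [seq [:: j.*2; j.*2.+1] | j <- seq.iota 0 m].
  rewrite -val_enum_ord -map_comp map_flatten -map_comp.
  by congr flatten; apply: eq_map => j /=; rewrite /coord_rank addn0 addn1.
have H k : flatten [seq [:: j.*2; j.*2.+1] | j <- seq.iota k m] = seq.iota k.*2 m.*2.
  by elim: m k {E} => [|m IH] k //=; rewrite IH.
by rewrite E.
Qed.
Lemma cseq_uniq m : uniq (coord_seq m).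
Proof. by apply: (@map_uniq _ _ (@coord_rank m)); rewrite crank_seq iota_uniq. Qed.

Lemma cseq_sorted m : pairwise (fun a b => (coord_rank a < coord_rank b)%N) (coord_seq m).
Proof.
rewrite -(pairwise_map (@coord_rank m) ltn) crank_seq.
by rewrite -sorted_pairwise ?iota_ltn_sorted //; exact/ltn_trans.
Qed.

Lemma big_cseq T idx (op : Monoid.com_law idx) m (P : pred (rcoord m)) (F : rcoord m -> T) :
  \big[op/idx]_(a <- coord_seq m | P a) F a = \big[op/idx]_(a | P a) F a.
Proof.
apply/perm_big/uniq_perm; first exact/cseq_uniq. exact/index_enum_uniq.
by move=> a; rewrite cseq_mem mem_index_enum.
Qed.

Section Anticommuting.
Context (A : nzRingType) (m : nat) (th : rcoord m -> A).
Hypothesis anti : forall a b, th a * th b = - (th b * th a).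
Hypothesis sq0 : forall a, th a * th a = 0.
Implicit Types (l : seq (rcoord m)) (I J : {set rcoord m}).

Let P l I : A := \prod_(a <- l | a \in I) th a.

Lemma prod_anti_comm l I a : P l I * th a = (-1) ^+ count (mem I) l * (th a * P l I).
Proof.
rewrite /P; elim: l => [|b l IH]; first by rewrite !big_nil mulr1.
rewrite !big_cons /=; case: (b \in I); last by [].
rewrite -mulrA IH exprS.
have c n x : (-1) ^+ n * x = x * (-1) ^+ n by rewrite commr_sign.
set Q := \prod_(j <- l | _) _; set S := (-1) ^+ _.
have -> : th b * (S * (th a * Q)) = S * (th b * th a * Q). by rewrite mulrA -c -!mulrA.
by rewrite anti [in LHS]mulNr [in LHS]mulrN mulN1r mulNr -mulrA.
Qed.

(** Merging two ordered products of anticommuting square-zero elements sorts them, at the price of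
    the sign that counts inversions. The setting is any ring, so that the differentials of the
    components of a map can be inserted. *)
Lemma prod_anti l I J : pairwise (fun a b => (coord_rank a < coord_rank b)%N) l ->
  P l I * P l J = if has (mem (I :&: J)) l then 0 else
    (-1) ^+ (\sum_(a <- l | a \in I) \sum_(b <- l | b \in J) (coord_rank b < coord_rank a)%N)
     * P l (I :|: J).
Proof.
elim: l => [|a l IH] /=; first by rewrite /P !big_nil.
move=> /andP[/allP ha hl]; have {IH}IH := IH hl.
have PE K : P (a :: l) K = if a \in K then th a * P l K else P l K by rewrite /P big_cons.
rewrite !PE !inE.
have n0 : (\sum_(b <- l | b \in J) (coord_rank b < coord_rank a) = 0)%N.
  by rewrite big_seq_cond big1 // => b /andP[/ha h _]; rewrite ltnNge ltnW.
have n1 c : c \in l -> nat_of_bool (coord_rank a < coord_rank c)%N = 1%N by move=> /ha ->.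
have n2 : (\sum_(c <- l | c \in I) \sum_(b <- a :: l | b \in J) (coord_rank b < coord_rank c) =
  (if a \in J then count (mem I) l else 0) +
  \sum_(c <- l | c \in I) \sum_(b <- l | b \in J) (coord_rank b < coord_rank c))%N.
  under eq_bigr do rewrite big_cons; case: (a \in J) => //.
  rewrite big_split -sum1_count; congr addn.
  by rewrite big_seq_cond [RHS]big_seq_cond; apply: eq_bigr => c /andP[/n1 -> _].
have n3 : (\sum_(b <- a :: l | b \in J) (coord_rank b < coord_rank a) = 0)%N.
  by rewrite big_cons ltnn; case: ifP.
rewrite [X in (-1) ^+ X](_ : _ = (if a \in J then count (mem I) l else 0) +
  \sum_(c <- l | c \in I) \sum_(b <- l | b \in J) (coord_rank b < coord_rank c))%N; last first.
  by rewrite big_cons n3; case: ifP.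
case aI: (a \in I); case aJ: (a \in J).
- by rewrite mulrA -[th a * P l I * th a]mulrA prod_anti_comm -!mulrA
   mulrA commr_sign -mulrA [th a * (th a * _)]mulrA sq0 mul0r mulr0.
- by rewrite -mulrA IH; case: has; rewrite ?mulr0 // mulrA commr_sign -mulrA.
- rewrite mulrA prod_anti_comm -!mulrA IH; case: has; rewrite ?mulr0 // exprD.
  by rewrite -!mulrA; congr (_ * _); rewrite mulrA commr_sign -mulrA.
- by [].
Qed.

Lemma prod_anti_coord I J : P (coord_seq m) I * P (coord_seq m) J =
  if [disjoint I & J] then (-1) ^+ ninv I J * P (coord_seq m) (I :|: J) else 0.
Proof.
rewrite prod_anti ?cseq_sorted //.
have -> : has (mem (I :&: J)) (coord_seq m) = ~~ [disjoint I & J].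
  rewrite -setI_eq0; apply/hasP/set0Pn => [[x _ h]|[x h]]; first by exists x.
  by exists x => //; exact/cseq_mem.
rewrite if_neg; case: ifP => // _; congr (_ ^+ _ * _).
rewrite big_cseq; apply: eq_bigr => a _.
by rewrite big_cseq.
Qed.
End Anticommuting.
End CoordSeq.

(** * Exterior derivative, Cartan's formula, primitives on the torus and on C^m *)

Section ExteriorCalculus.
Context {R : realType} {m : nat}.
Notation V := 'rV[R[i]]_m.
Notation form := (dform R m).
Implicit Types (om eta : form) (w : V) (I J K L : {set rcoord m}) (i k : rcoord m)
  (f g : V -> R[i]).

Definition pdf i om : form := fun w I => pd i (fun v => om v I) w.

Lemma extdE om : extd om = \sum_i ef i * pdf i om.
Proof.
apply: formP => w K; rewrite sumfE /extd big_mkcond; apply: eq_bigr => i _.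
by rewrite mulefE; rewrite wedge_signE pdE.
Qed.
Lemma sformD om eta : sform om -> sform eta -> sform (om + eta).
Proof. move=> h1 h2 I; exact: smoothD (h1 I) (h2 I). Qed.
Lemma sformN om : sform om -> sform (- om).
Proof. move=> h1 I; exact: smoothN (h1 I). Qed.
Lemma sformB om eta : sform om -> sform eta -> sform (om - eta).
Proof. by move=> h1 h2; apply: sformD => //; exact/sformN. Qed.
Lemma sformM om eta : sform om -> sform eta -> sform (om * eta).
Proof.
move=> h1 h2 K.
apply: sm_sum => I _; apply: smoothM; last exact/h2.
by auto with sm.
Qed.
Lemma sform0 : sform (0 : form). Proof. move=> I; exact/sm_cst. Qed.
Lemma sformf f : smooth f -> sform (form0 f : form).
Proof. by move=> hf I; rewrite /form0; case: (I == set0) ; auto with sm. Qed.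
Lemma sform1 : sform (1 : form).
Proof. by apply: (sformf (f := fun=> 1)); auto with sm. Qed.
Lemma sm_cf c : sform (cf c : form).
Proof. by apply: sformf; auto with sm. Qed.
Lemma sm_ef i : sform (ef i : form).
Proof. move=> I; exact/sm_cst. Qed.
Lemma sform_sum T l (P : pred T) (F : T -> form) :
  (forall t, P t -> sform (F t)) -> sform (\sum_(t <- l | P t) F t).
Proof. by move=> h; elim/big_rec: _ => [|t x Pt hx]; [exact/sform0|apply: sformD => //; exact/h]. Qed.
Lemma sform_prod T l (P : pred T) (F : T -> form) :
  (forall t, P t -> sform (F t)) -> sform (\prod_(t <- l | P t) F t).
Proof. by move=> h; elim/big_rec: _ => [|t x Pt hx]; [exact/sform1|apply: sformM => //; exact/h]. Qed.
Lemma sformX om n : sform om -> sform (om ^+ n).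
Proof.
move=> h; elim: n => [|n IH]; first by rewrite expr0; exact/sform1.
by rewrite exprS; exact/sformM.
Qed.
Lemma sm_pdf i om : sform om -> sform (pdf i om).
Proof. by move=> h I; apply: sm_pd. Qed.
Lemma sm_extd om : sform om -> sform (extd om).
Proof.
move=> h; rewrite extdE; apply: sform_sum => i _.
by apply: sformM; [exact/sm_ef|exact/sm_pdf].
Qed.
Lemma sm_ctr i om : sform om -> sform (ctr i om).
Proof.
move=> h K; rewrite /ctr; case: (i \in K); first exact/sm_cst.
exact/smoothZ.
Qed.

#[local] Hint Resolve sformD sformN sformB sformM sform0 sformf
  sform1 sm_cf sm_ef sform_sum sform_prod sformX sm_pdf sm_extd sm_ctr : sm.
Lemma pdfD i om eta : sform om -> sform eta -> pdf i (om + eta) = pdf i om + pdf i eta.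
Proof. by move=> h1 h2; apply: formP => w I; exact: pdD (h1 I) (h2 I). Qed.
Lemma pdfN i om : sform om -> pdf i (- om) = - pdf i om.
Proof. by move=> h1; apply: formP => w I; exact: pdN (h1 I). Qed.
Lemma pdfM i om eta : sform om -> sform eta ->
  pdf i (om * eta) = pdf i om * eta + om * pdf i eta.
Proof.
move=> h1 h2; apply: formP => w K; rewrite addfE !mulfE /pdf.
under pd_ext do rewrite mulfE.
rewrite pd_sum; last first. move=> I _; apply: smoothM; last exact/h2. by auto with sm.
rewrite -big_split; apply: eq_bigr => I _.
rewrite pdM; auto with sm.
by rewrite pdZ.
Qed.
Lemma pdf_form0 i f : pdf i (form0 f) = form0 (pd i f).
Proof.
apply: formP => w I; rewrite /pdf /form0; case: (I == set0) => //.
exact/pd_cst.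
Qed.
Lemma pdf_const i om : (forall w w' I, om w I = om w' I) -> pdf i om = 0.
Proof.
move=> h; apply: formP => w I; transitivity (pd i (fun=> om 0 I) w); last exact/pd_cst.
by apply: pd_ext => v.
Qed.
Lemma pdf_ef i k : pdf i (ef k : form) = 0. Proof. exact/pdf_const. Qed.
Lemma pdf_cf i c : pdf i (cf c : form) = 0. Proof. exact/pdf_const. Qed.
Lemma pdf0 i : pdf i (0 : form) = 0. Proof. exact/pdf_const. Qed.
Lemma homog_pdf p i om : homog p om -> homog p (pdf i om).
Proof.
move=> h w I hI; rewrite -(pd_cst i 0 w); apply: pd_ext => v; exact/h.
Qed.
Lemma pdf_clairaut i k om : sform om -> pdf i (pdf k om) = pdf k (pdf i om).
Proof. by move=> h; apply: formP => w I; exact: pd_clairaut (h I). Qed.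
Lemma pdf_ctr i k om : sform om -> pdf i (ctr k om) = ctr k (pdf i om).
Proof.
move=> h; apply: formP => w K; rewrite /pdf /ctr; case: (k \in K); first exact/pd_cst.
by rewrite pdZ.
Qed.

Lemma homog_extd p om : homog p om -> homog p.+1 (extd om).
Proof.
move=> h; rewrite extdE; apply: homog_sum => i _; rewrite -add1n.
by apply: homogM; [exact/homog_ef|exact/homog_pdf].
Qed.
Lemma extdD om eta : sform om -> sform eta -> extd (om + eta) = extd om + extd eta.
Proof.
move=> h1 h2; rewrite !extdE -big_split; apply: eq_bigr => i _.
by rewrite pdfD // mulrDr.
Qed.
Lemma extdN om : sform om -> extd (- om) = - extd om.
Proof.
move=> h1; rewrite !extdE -sumrN; apply: eq_bigr => i _.
by rewrite pdfN // mulrN.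
Qed.
Lemma extdB om eta : sform om -> sform eta -> extd (om - eta) = extd om - extd eta.
Proof. by move=> h1 h2; rewrite extdD ?extdN; auto with sm. Qed.
Lemma extd0 : extd (0 : form) = 0.
Proof. by rewrite extdE big1 // => i _; rewrite pdf0 mulr0. Qed.
Lemma extd_sum T l (P : pred T) (F : T -> form) : (forall t, P t -> sform (F t)) ->
  extd (\sum_(t <- l | P t) F t) = \sum_(t <- l | P t) extd (F t).
Proof.
move=> h; elim: l => [|t l IH]; first by rewrite !big_nil extd0.
rewrite !big_cons; case Pt: (P t) => //.
by rewrite extdD ?IH; auto with sm.
Qed.
Lemma extdM p om eta : homog p om -> sform om -> sform eta ->
  extd (om * eta) = extd om * eta + (-1) ^+ p * (om * extd eta).
Proof.
move=> hp h1 h2; rewrite !extdE mulr_suml !mulr_sumr -big_split.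
apply: eq_bigr => i _; rewrite pdfM // mulrDr mulrA.
by rewrite mulrA (homog_comm (@homog_ef R m i) hp) mul1n -!mulrA.
Qed.
Lemma extdM_even p om eta : homog p om -> ~~ odd p -> sform om -> sform eta ->
  extd (om * eta) = extd om * eta + om * extd eta.
Proof.
by move=> hp ho h1 h2; rewrite (extdM hp) // -signr_odd (negbTE ho) mul1r.
Qed.
Lemma extdM_odd p om eta : homog p om -> odd p -> sform om -> sform eta ->
  extd (om * eta) = extd om * eta - om * extd eta.
Proof.
by move=> hp ho h1 h2; rewrite (extdM hp) // -signr_odd ho mulN1r.
Qed.
Lemma extd_cfM c om : sform om -> extd (cf c * om) = cf c * extd om.
Proof.
move=> h; rewrite !extdE mulr_sumr; apply: eq_bigr => i _.
rewrite pdfM ?pdf_cf ?mul0r ?add0r; auto with sm.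
by rewrite !mulrA cfC.
Qed.
Lemma extd_const om : (forall w w' I, om w I = om w' I) -> extd om = 0.
Proof. by move=> h; rewrite extdE big1 // => i _; rewrite pdf_const // mulr0. Qed.

Lemma eq_form_oppr0 om : om = - om -> om = 0.
Proof.
move=> h; apply: formP => w I; have := congr1 (fun x => x w I) h.
rewrite oppfE => /eqP; rewrite -addr_eq0 -mulr2n mulrn_eq0 => /eqP ->.
by [].
Qed.

Lemma extd_extd om : sform om -> extd (extd om) = 0.
Proof.
move=> h; rewrite extdE.
have E : \sum_i ef i * pdf i (extd om) = \sum_i \sum_k ef i * ef k * pdf i (pdf k om).
  apply: eq_bigr => i _; rewrite extdE.
  have -> : pdf i (\sum_k ef k * pdf k om) = \sum_k ef k * pdf i (pdf k om).
    elim: (index_enum _) => [|k l IH]; first by rewrite !big_nil pdf0.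
    rewrite !big_cons pdfD ?IH; last 2 first.
    - by auto with sm.
    - apply: sform_sum => k' _. by auto with sm.
    rewrite pdfM ?pdf_ef ?mul0r ?add0r; auto with sm.
  by rewrite mulr_sumr; apply: eq_bigr => k _; rewrite mulrA.
rewrite E; apply: eq_form_oppr0; rewrite {1}exchange_big -sumrN.
apply: eq_bigr => i _; rewrite -sumrN; apply: eq_bigr => k _.
by rewrite ef_anti mulNr pdf_clairaut.
Qed.
Lemma extd_form0E f : extd (form0 f) = \sum_i form0 (pd i f) * ef i :> form.
Proof. by rewrite extdE; apply: eq_bigr => i _; rewrite pdf_form0 form0C. Qed.

Lemma ctrD i om eta : ctr i (om + eta) = ctr i om + ctr i eta.
Proof.
by apply: formP => w K; rewrite addfE /ctr; case: (i \in K); rewrite ?addr0 // mulrDr.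
Qed.
Lemma ctr0 i : ctr i (0 : form) = 0.
Proof. by apply: formP => w K; rewrite /ctr; case: (i \in K); rewrite ?mulr0. Qed.
Lemma ctr_sum i T l (P : pred T) (F : T -> form) :
  ctr i (\sum_(t <- l | P t) F t) = \sum_(t <- l | P t) ctr i (F t).
Proof. exact: (big_morph _ (ctrD i) (ctr0 i)). Qed.

(** The coordinate field is constant, so the Lie derivative in Cartan's formula is the partial
    derivative of the coefficients. *)
Lemma cartan i om : sform om -> ctr i (extd om) + extd (ctr i om) = pdf i om.
Proof.
move=> h; rewrite !extdE ctr_sum -big_split (bigD1 i) //= big1 => [|k ki].
  by rewrite ctr_ef eqxx mul1r pdf_ctr // subrK addr0.
by rewrite ctr_ef eq_sym (negbTE ki) mul0r sub0r pdf_ctr // addNr.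
Qed.

Lemma euler_degree p om : homog p om -> \sum_a ef a * ctr a om = om *+ p.
Proof.
move=> h; apply: formP => w K; rewrite sumfE mulrnfE.
transitivity (\sum_(a in K) om w K).
  rewrite [RHS]big_mkcond; apply: eq_bigr => a _; rewrite mulefE; case: ifP => // aK.
  by rewrite /ctr !inE eqxx mulrA sgn_sq mul1r setD1K.
rewrite sumr_const; case: (eqVneq #|K| p) => [->//|/eqP /h ->].
by rewrite !mul0rn.
Qed.


Definition appf (T : (V -> R[i]) -> V -> R[i]) om : form := fun w I => T (fun v => om v I) w.

Definition slinear (T : (V -> R[i]) -> V -> R[i]) : Prop :=
  (forall f g w, smooth f -> smooth g -> T (fun v => f v + g v) w = T f w + T g w) /\
  forall c f w, smooth f -> T (fun v => c * f v) w = c * T f w.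

(** Operators that commute with all partial derivatives; applied to coefficients they commute with
    [extd]. Averages along vectors are of this kind. *)
Definition translinear T : Prop := [/\ slinear T, forall f, smooth f -> smooth (T f)
    & forall i f w, smooth f -> pd i (T f) w = T (pd i f) w].

Lemma appf_ef T i om : slinear T -> sform om -> appf T (ef i * om) = ef i * appf T om.
Proof.
move=> [_ hZ] h; apply: formP => w K; rewrite mulefE /appf.
have -> : (fun v => (ef i * om) v K) =
   fun v => (if i \in K then sgn (R := R) [set i] (K :\ i) else 0) * om v (K :\ i).
  by apply/funext => v; rewrite mulefE; case: (i \in K); rewrite ?mul0r.
by rewrite hZ; case: (i \in K); rewrite ?mul0r.
Qed.
Lemma appfD T om eta : slinear T -> sform om -> sform eta ->
  appf T (om + eta) = appf T om + appf T eta.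
Proof. by move=> [hD _] h1 h2; apply: formP => w I; exact/hD. Qed.

Lemma appf0 T : slinear T -> appf T 0 = 0.
Proof.
move=> [_ hZ]; apply: formP => w I.
have H := hZ 0 (fun=> 0) w (sm_cst 0).
rewrite zerofE -(mul0r (T (fun=> 0) w)) -H.
by rewrite mulr0.
Qed.

Lemma appf_sum T U l (P : pred U) F : slinear T -> (forall t, P t -> sform (F t)) ->
  appf T (\sum_(t <- l | P t) F t) = \sum_(t <- l | P t) appf T (F t).
Proof.
move=> hT h; elim: l => [|t l IH]; first by rewrite !big_nil appf0.
rewrite !big_cons; case Pt: (P t) => //.
by rewrite appfD ?IH; auto with sm.
Qed.
Lemma sm_appf T om : translinear T -> sform om -> sform (appf T om).
Proof. by move=> [_ hS _] h I; apply: hS. Qed.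

Lemma homog_appf T p om : slinear T -> homog p om -> homog p (appf T om).
Proof.
move=> hT h w I hI; rewrite /appf (_ : (fun v => om v I) = (fun v => (0 : form) v I)).
  by rewrite -/(appf T 0 w I) appf0.
by apply/funext => v; rewrite h.
Qed.

Lemma extd_appf T om : translinear T -> sform om -> extd (appf T om) = appf T (extd om).
Proof.
move=> [hs _ hp] h; rewrite !extdE appf_sum; auto with sm.
apply: eq_bigr => i _; rewrite appf_ef; auto with sm.
congr (_ * _); apply: formP => w I.
by rewrite /pdf hp.
Qed.

Lemma translinear_slinear T : translinear T -> slinear T. Proof. by case. Qed.

Lemma translinear_wavg rho v : rho_cont (m := m) rho -> translinear (wavg rho v).
Proof.
by split=> [|f|i f w] *; [split=> *; [exact/wavgD|exact/wavgZ]|exact/sm_wavg|exact/pd_wavg].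
Qed.

Lemma translinear_avgs vs : translinear (avgs vs).
Proof.
by split=> [|f|i f w] *; [split=> *; [exact/avgsD|exact/avgsZ]|exact/sm_avgs|exact/pd_avgs].
Qed.

Definition ctrv u om : form := \sum_a cf (rcomp a u)%:C * ctr a om.

Lemma sm_ctrv u om : sform om -> sform (ctrv u om).
Proof.
move=> h; apply: sform_sum => a _.
by auto with sm.
Qed.

Lemma homog_ctrv p u om : homog p.+1 om -> homog p (ctrv u om).
Proof.
by move=> h; apply: homog_sum => a _; exact/homogMf0/homog_ctr.
Qed.

Lemma cartanv u om : sform om -> extd om = 0 -> extd (ctrv u om) = appf (dirder u) om.
Proof.
move=> h hc; rewrite extd_sum; last first. by auto with sm.
apply: formP => w I; rewrite sumfE /appf /dirder; apply: eq_bigr => a _.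
rewrite extd_cfM ?cfE; auto with sm.
by have := cartan a h; rewrite hc ctr0 add0r => ->.
Qed.

Definition per_form tau om : Prop := forall I, lper tau (fun w => om w I).

Lemma per_ctrv tau u om : per_form tau om -> per_form tau (ctrv u om).
Proof.
move=> h I w j p q; rewrite /ctrv !sumfE; apply: eq_bigr => a _.
by rewrite !cfE /ctr; rewrite h.
Qed.

Definition meanf tau om : form := fun w I => mean tau (fun v => om v I).

(** Averaging along one period v changes a closed form by an exact one: apply [hom1 v] to the
    contraction with v and use [cartanv] and [hom1E]. Contraction and [hom1] preserve periodicity.
    After all periods the coefficients are constant, by [avgs_dirs_cst]. *)
Lemma torus_primitive (tau : R[i]) p om : 0 < Im tau -> sform om ->
  homog p.+1 om -> extd om = 0 -> per_form tau om ->
  exists be, [/\ sform be, homog p be, per_form tau be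
    & om = meanf tau om + extd be].
Proof.
move=> htau hs hh hc hp.
have key vs : exists be, [/\ sform be, homog p be, per_form tau be
    & appf (avgs vs) om = om + extd be].
  elim: vs => [|v vs [be [h1 h2 h3 h4]]]. exists 0; split => //; auto with sm.
    by rewrite extd0 addr0.
  have tl := translinear_avgs vs; have sl := translinear_slinear tl.
  pose om' := appf (avgs vs) om.
  have s' : sform om' by exact/sm_appf.
  have c' : extd om' = 0 by rewrite extd_appf // hc appf0.
  have th : translinear (hom1 v) by exact: translinear_wavg(rho2).
  have sh := translinear_slinear th.
  exists (be + appf (hom1 v) (ctrv v om')); split.
  - by apply: sformD => //; apply: sm_appf => //; exact/sm_ctrv.
  - by apply: homogD => //; apply: homog_appf => //; exact/homog_ctrv/homog_appf.
  - have pc : per_form tau (ctrv v om'). by apply: per_ctrv => I; apply: per_avgs.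
    move=> I w j a b; rewrite !addfE h3; congr (_ + _).
    exact/per_wavg.
  - rewrite extdD //; last by apply: sm_appf => //; exact/sm_ctrv.
    rewrite addrA -h4 extd_appf //; last exact/sm_ctrv.
    rewrite cartanv //; apply: formP => w I; rewrite addfE.
    rewrite [X in _ + X](_ : _ = dirder v (hom1 v (fun u => om' u I)) w); last first.
      by rewrite dirder_wavg //; exact/rho2.
    by rewrite hom1E // addrC subrK.
have [be [h1 h2 h3 h4]] := key (dirs tau m).
exists (- be); split.
- by auto with sm.
- exact/homogN.
- by move=> I w j a b; rewrite !oppfE h3.
- rewrite extdN // (_ : meanf tau om = om + extd be) ?addrK // -h4.
  by apply: formP => w I; rewrite /appf avgs_dirs_cst.
Qed.

(* The homotopy operator of the Poincare lemma. *)

Definition radial (k : nat) f w : R[i] := int01 (fun s => s%:C ^+ k * f (s%:C *: w)).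

Lemma smf_radial (k : nat) f : smooth f -> smf (fun w s => s%:C ^+ k * f (s%:C *: w)).
Proof.
move=> hf; apply: smfM. elim: k => [|k IH]; first exact/smf_cst.
  by move=> r; apply: (Cf_ext (@dopenT R m)) (smfM (@smf_id R m) IH r) => w s _; rewrite exprS.
apply: (smf_comp (u := fun w s => s%:C *: w)) => // j r.
apply: (Cf_ext (@dopenT R m)) (smfM (@smf_id R m) (smf_coord j) r) => w s _.
by rewrite mxE.
Qed.
Lemma sm_radial (k : nat) f : smooth f -> smooth (radial k f).
Proof. move=> hf; exact/sm_int01/smf_radial. Qed.

Lemma pd_scale i f s w : smooth f -> pd i (fun v => f (s%:C *: v)) w = s%:C * pd i f (s%:C *: w).
Proof.
move=> hf; rewrite (pd_comp (u := fun v => s%:C *: v)) //; last first.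
  move=> j; under eq_fun do rewrite mxE.
  by apply: smoothZ; auto with sm.
have E a : (fun v => (rcomp a (s%:C *: v))%:C) = (fun v => s%:C * (rcomp a v)%:C).
  apply/funext => v; rewrite /rcomp mxE -rmorphM.
  by case: a.2; rewrite ?cImM ?cReM !mul0r ?subr0 ?addr0.
rewrite (bigD1 i) //= big1 => [|a ai].
  by rewrite E pdZ ?pd_rcomp ?eqxx ?mulr1 ?addr0; auto with sm.
by rewrite E pdZ ?pd_rcomp ?(negbTE ai) ?mulr0 ?mul0r; auto with sm.
Qed.

Lemma pd_radial (k : nat) i f w : smooth f -> pd i (radial k f) w = radial k.+1 (pd i f) w.
Proof.
move=> hf; rewrite pd_int01; last exact/smf_radial.
apply: eq_int01 => s _; rewrite pdZ; last first.
  apply: sm_comp => // j; under eq_fun do rewrite mxE.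
  by apply: smoothZ; auto with sm.
by rewrite pd_scale // exprSr mulrA.
Qed.
Lemma cont01_radial (k : nat) f w : smooth f -> cont01 (fun s => s%:C ^+ k * f (s%:C *: w)).
Proof. by move=> hf; apply: (smf_cont01 w (smf_radial k hf)). Qed.

Lemma radialD (k : nat) f g w : smooth f -> smooth g ->
  radial k (fun v => f v + g v) w = radial k f w + radial k g w.
Proof.
move=> hf hg; rewrite -int01D; try exact/cont01_radial.
by apply: eq_int01 => s _; rewrite mulrDr.
Qed.
Lemma radialZ (k : nat) c f w : smooth f -> radial k (fun v => c * f v) w = c * radial k f w.
Proof.
move=> hf; rewrite -int01Z; last exact/cont01_radial.
by apply: eq_int01 => s _; rewrite mulrCA.
Qed.
Lemma slinear_radial (k : nat) : slinear (radial k).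
Proof. by split=> *; [exact/radialD|exact/radialZ]. Qed.

(** The integral over [0, 1] of the derivative of s^(k+1) f(s w). *)
Lemma radial_euler (k : nat) f w : smooth f ->
  k.+1%:R * radial k f w + \sum_a (rcomp a w)%:C * radial k.+1 (pd a f) w = f w.
Proof.
move=> hf.
have hc a : cont01 (fun s => s%:C ^+ k.+1 * pd a f (s%:C *: w)).
  by apply: cont01_radial; auto with sm.
have H : int01 (fun s => k.+1%:R * (s%:C ^+ k * f (s%:C *: w)) +
    \sum_a (rcomp a w)%:C * (s%:C ^+ k.+1 * pd a f (s%:C *: w))) =
  1 ^+ k.+1 * f (1 *: w) - 0 ^+ k.+1 * f (0 *: w).
  apply: (@int01_FTC _ (fun s => s%:C ^+ k.+1 * f (s%:C *: w))).
    apply: cont01D; first exact/cont01Z/cont01_radial.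
    by auto with sm.
  move=> s _.
  have := cderX k.+1 (cder_lin 1 s); under eq_fun do rewrite mulr1; rewrite !mulr1 => H1.
  have H2 : cder (fun s => f (s%:C *: w)) s (dirder w f (s%:C *: w)).
    have := @cder_line R m f 0 w s hf; rewrite add0r.
    by under eq_fun do rewrite add0r.
  have := cderM H1 H2; rewrite /dirder mulr_sumr mulrA.
  by under eq_bigr do rewrite mulrCA.
rewrite expr1n mul1r scale1r exprS !mul0r subr0 in H.
rewrite -H int01D; last 2 first.
- exact/cont01Z/cont01_radial.
- by auto with sm.
rewrite int01Z; last exact/cont01_radial.
rewrite int01_sum => [|a _]; auto with sm.
by congr (_ + _); apply: eq_bigr => a _; rewrite int01Z.
Qed.

(** The primitive is the contraction of om with the Euler field, the coefficients being integrated
    against s^k along the ray to w. The degree k + 1, which enters as a factor through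
    [euler_degree], is just the one in [radial_euler]. *)
Lemma poincare (k : nat) om : sform om -> homog k.+1 om -> extd om = 0 ->
  exists al, [/\ sform al, homog k al & extd al = om].
Proof.
move=> h hh hc.
have sc a : sform (ctr a om) by exact/sm_ctr.
have sr l eta : sform eta -> sform (appf (radial l) eta).
  by move=> he I; apply: sm_radial.
pose x a : V -> R[i] := fun w => (rcomp a w)%:C.
have sx a : smooth (x a) by exact/sm_rcomp.
exists (\sum_a form0 (x a) * appf (radial k) (ctr a om)); split.
- by auto with sm.
- apply: homog_sum => a _; apply/homogMf0/homog_appf; [exact/slinear_radial|exact/homog_ctr].
have E a : extd (form0 (x a) * appf (radial k) (ctr a om)) =
    ef a * appf (radial k) (ctr a om) + form0 (x a) * appf (radial k.+1) (pdf a om).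
  rewrite (extdM_even (@homog_form0 R m (x a))); auto with sm.
  congr (_ * _ + _ * _). rewrite extd_form0E (bigD1 a) //= big1 => [|i ia].
      rewrite addr0; apply: formP => w I.
      by rewrite mulf0E pd_rcomp eqxx mul1r.
    by apply: formP => w I; rewrite mulf0E pd_rcomp eq_sym (negbTE ia) mul0r.
  have <- : extd (ctr a om) = pdf a om by have := cartan a h; rewrite hc ctr0 add0r.
  rewrite !extdE (appf_sum _ (slinear_radial _)); auto with sm.
  apply: eq_bigr => i _; rewrite (appf_ef _ (slinear_radial _)); auto with sm.
  congr (_ * _); apply: formP => w I; rewrite /pdf pd_radial //; exact/sc.
rewrite extd_sum; auto with sm.
rewrite (eq_bigr _ (fun a _ => E a)) big_split /=.
have -> : \sum_a ef a * appf (radial k) (ctr a om) = appf (radial k) om *+ k.+1.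
  under eq_bigr do rewrite -(appf_ef _ (slinear_radial _)) //.
  rewrite -(appf_sum _ (slinear_radial _)) => [|a _]; auto with sm.
  rewrite (euler_degree hh); apply: formP => w I; rewrite mulrnfE /appf.
  rewrite -[RHS]mulr_natl -radialZ //.
  by congr radial; apply/funext => v; rewrite mulrnfE mulr_natl.
apply: formP => w I; rewrite addfE mulrnfE sumfE -mulr_natl.
rewrite -(@radial_euler k (fun v => om v I) w (h I)); congr (_ + _).
by apply: eq_bigr => a _; rewrite mulf0E.
Qed.

End ExteriorCalculus.

#[local] Hint Resolve sformD sformN sformB sformM sform0 sformf
  sform1 sm_cf sm_ef sform_sum sform_prod sformX sm_pdf sm_extd
  sm_ctr homog_pdf homog_extd : sm.

(** * Pullback of forms *)

Section Pullback.
Context {R : realType}.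
Notation V m := 'rV[R[i]]_m.
Notation form m := (dform R m).

Definition smap p m (f : V p -> V m) : Prop := forall j, smooth (fun w => f w 0 j).

Section OneMap.
Context {p m : nat} (f : V p -> V m).
Implicit Types (om eta : form m) (I J K : {set rcoord m}).

Definition pb1 a : form p := extd (form0 (fun v => (rcomp a (f v))%:C)).
Definition pbI I : form p := \prod_(a <- coord_seq m | a \in I) pb1 a.

Lemma pbE om : pullback f om = \sum_I form0 (fun w => om (f w) I) * pbI I.
Proof. by apply: formP => w K; rewrite sumfE; apply: eq_bigr => I _; rewrite mulf0E. Qed.
Lemma homog_pb1 a : homog 1 (pb1 a).
Proof. exact/homog_extd/homog_form0. Qed.
Lemma pb1_anti a b : pb1 a * pb1 b = - (pb1 b * pb1 a).
Proof. by rewrite (homog_comm (homog_pb1 a) (homog_pb1 b)) mulN1r. Qed.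
Lemma pb1_sq a : pb1 a * pb1 a = 0.
Proof. exact/eq_form_oppr0/pb1_anti. Qed.

Lemma pbIM I J : pbI I * pbI J = if [disjoint I & J] then cf (sgn I J) * pbI (I :|: J) else 0.
Proof.
rewrite (prod_anti_coord pb1_anti pb1_sq); case: ifP => // _.
congr (_ * _); rewrite /sgn; elim: (ninv I J) => [|k IH] //.
by rewrite !exprS IH mulN1r; apply: formP => w L; rewrite mulN1r oppfE /cf /form0; case: (L == _); rewrite ?oppr0.
Qed.

Lemma pbD om eta : pullback f (om + eta) = pullback f om + pullback f eta.
Proof.
rewrite !pbE -big_split /=; apply: eq_bigr => I _.
by rewrite -mulrDl form0D.
Qed.
Lemma pb0 : pullback f 0 = 0.
Proof.
rewrite pbE big1 // => I _; apply: formP => w K; rewrite mulf0E.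
by rewrite mul0r.
Qed.
Lemma pb_sum T l (P : pred T) (F : T -> form m) :
  pullback f (\sum_(t <- l | P t) F t) = \sum_(t <- l | P t) pullback f (F t).
Proof. exact: (big_morph _ pbD pb0). Qed.
Lemma pbN om : pullback f (- om) = - pullback f om.
Proof. by apply/eqP; rewrite -subr_eq0 opprK -pbD addNr pb0. Qed.
Lemma pbB om eta : pullback f (om - eta) = pullback f om - pullback f eta.
Proof. by rewrite pbD pbN. Qed.

(** Disjoint pairs (I, J) correspond to a set K with a subset I; pairs that meet contribute nothing
    because repeated differentials vanish ([pbIM]). *)
Lemma pbM om eta : pullback f (om * eta) = pullback f om * pullback f eta.
Proof.
rewrite !pbE mulr_suml.
have HK K I : I \subset K -> I :|: (K :\: I) = K.
  by move=> IK; rewrite -{2}(setID K I) (setIidPr IK).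
pose G I J := form0 (fun w => sgn (R := R) I J * om (f w) I * eta (f w) J) * pbI (I :|: J).
transitivity (\sum_(I : {set rcoord m}) \sum_(J : {set rcoord m} | [disjoint I & J]) G I J); last first.
  apply: eq_bigr => I _; rewrite mulr_sumr big_mkcond; apply: eq_bigr => J _.
  rewrite -mulrA [pbI I * _]mulrA -form0C -[form0 _ * pbI I * _]mulrA pbIM.
  case: ifP => _; last by rewrite !mulr0.
  by apply: formP => w K; rewrite !mulf0E /G mulf0E; ring.
transitivity (\sum_(K : {set rcoord m}) \sum_(I : {set rcoord m} | I \subset K) G I (K :\: I)).
  apply: eq_bigr => K _; apply: formP => w L; rewrite mulf0E sumfE mulfE mulr_suml.
  by apply: eq_bigr => I IK; rewrite /G mulf0E HK.
rewrite (exchange_big_dep predT) //=; apply: eq_bigr => I _.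
rewrite (reindex_onto (fun J => I :|: J) (fun K => K :\: I)); last first. move=> K IK; exact/HK.
have E J : (I \subset I :|: J) && ((I :|: J) :\: I == J) = [disjoint I & J].
  rewrite subsetUl setDUl setDv set0U disjoint_sym.
  by apply/eqP/idP => [/setDidPl //|h]; apply/setDidPl.
rewrite (eq_bigl _ _ E); apply: eq_bigr => J hJ; congr G.
rewrite setDUl setDv set0U; apply/setDidPl; by rewrite disjoint_sym.
Qed.
Lemma pbI0 : pbI set0 = 1.
Proof. by rewrite /pbI big1 // => a; rewrite inE. Qed.
Lemma pbI1 a : pbI [set a] = pb1 a.
Proof.
rewrite /pbI (eq_bigl (pred1 a)) => [|b]; last by rewrite inE.
by rewrite -big_filter filter_pred1_uniq ?cseq_uniq ?cseq_mem // big_seq1.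
Qed.

Lemma pb_form0 g : pullback f (form0 g) = form0 (fun w => g (f w)).
Proof.
rewrite pbE (bigD1 set0) //= big1 => [|I I0].
  by rewrite addr0 pbI0 mulr1; rewrite /form0 eqxx.
by apply: formP => w K; rewrite mulf0E /form0 (negbTE I0) mul0r.
Qed.
Lemma pb_cf c : pullback f (cf c) = cf c. Proof. exact/pb_form0. Qed.
Lemma pullback1 : pullback f 1 = 1. Proof. exact/pb_cf. Qed.
Lemma pb_ef a : pullback f (ef a) = pb1 a.
Proof.
rewrite pbE (bigD1 [set a]) //= big1 => [|I I0]. rewrite addr0 pbI1; rewrite /ef eqxx.
  by rewrite mul1r.
by apply: formP => w K; rewrite mulf0E /ef (negbTE I0) mul0r.
Qed.
Lemma pb_prod T l (P : pred T) (F : T -> form m) :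
  pullback f (\prod_(t <- l | P t) F t) = \prod_(t <- l | P t) pullback f (F t).
Proof. exact: (big_morph _ pbM pullback1). Qed.
Lemma pbI_prod I : pbI I = \prod_(a <- [seq a <- coord_seq m | a \in I]) pb1 a.
Proof. by rewrite /pbI -big_filter. Qed.

Lemma homog_pbI I : homog #|I| (pbI I).
Proof.
have E : #|I| = size [seq a <- coord_seq m | a \in I]. rewrite size_filter -sum1_count -sum1_card.
  by rewrite (@big_cseq nat 0%N addn m (fun a => a \in I) (fun=> 1%N)).
rewrite pbI_prod E; elim: [seq a <- _ | _] => [|a l IH]; first by rewrite big_nil; exact/homog_form0.
by rewrite big_cons -[size _]add1n; apply: homogM => //; exact/homog_pb1.
Qed.

Lemma homog_pb k om : homog k om -> homog k (pullback f om).
Proof.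
move=> h; rewrite pbE; apply: homog_sum => I _.
case: (eqVneq #|I| k) => [<-|/eqP hI]. exact/homogMf0/homog_pbI.
move=> w K _; rewrite mulf0E h ?mul0r //.
Qed.

Hypothesis hf : smap f.

Lemma sm_comp_rcomp a : smooth (fun w => (rcomp a (f w))%:C).
Proof. exact/sm_coord_fun. Qed.
Lemma sm_pb1 a : sform (pb1 a).
Proof. exact/sm_extd/sformf/sm_comp_rcomp. Qed.
Lemma sm_pbI I : sform (pbI I).
Proof. by apply: sform_prod => a _; exact/sm_pb1. Qed.
Lemma extd_pb1 a : extd (pb1 a) = 0.
Proof. exact/extd_extd/sformf/sm_comp_rcomp. Qed.
Lemma extd_pbI I : extd (pbI I) = 0.
Proof.
rewrite pbI_prod; elim: [seq a <- _ | _] => [|a l IH]. by rewrite big_nil; exact/extd_const.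
rewrite big_cons (extdM (homog_pb1 a)) ?extd_pb1 ?IH ?mulr0 ?mul0r ?addr0 //.
- exact/sm_pb1.
- by apply: sform_prod => b _; exact/sm_pb1.
Qed.

Lemma sm_pb om : sform om -> sform (pullback f om).
Proof.
move=> h; rewrite pbE; apply: sform_sum => I _.
apply: sformM; last exact/sm_pbI.
exact/sformf/(sm_comp hf (h I)).
Qed.

Lemma extd_form0_comp g : smooth g ->
  extd (form0 (fun w => g (f w))) = \sum_a form0 (fun w => pd a g (f w)) * pb1 a.
Proof.
rewrite extd_form0E.
transitivity (\sum_i \sum_a form0 (fun w => pd a g (f w)) *
    (form0 (pd i (fun v => (rcomp a (f v))%:C)) * ef i) : form p).
  apply: eq_bigr => i _; apply: formP => w K.
  rewrite mulf0E pd_comp // sumfE mulr_suml; apply: eq_bigr => a _.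
  by rewrite !mulf0E mulrA [pd i _ w * _]mulrC.
rewrite exchange_big; apply: eq_bigr => a _.
by rewrite -mulr_sumr /pb1 extd_form0E.
Qed.

Lemma extd_pb om : sform om -> extd (pullback f om) = pullback f (extd om).
Proof.
move=> h; rewrite pbE extd_sum; last first.
  move=> I _; apply: sformM; last exact/sm_pbI.
  exact/sformf/(sm_comp hf (h I)).
have sI I : sform (form0 (fun w => om (f w) I)). exact/sformf/(sm_comp hf (h I)).
transitivity (\sum_I (\sum_a pb1 a * form0 (fun w => pd a (fun v => om v I) (f w))) * pbI I).
  apply: eq_bigr => I _; rewrite (extdM_even (@homog_form0 R p _)) //; last exact/sm_pbI.
  rewrite extd_pbI mulr0 addr0 (extd_form0_comp (h I)); congr (_ * _).
  by apply: eq_bigr => a _; rewrite form0C.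
rewrite extdE pb_sum.
transitivity (\sum_I \sum_a pb1 a * (form0 (fun w => pd a (fun v => om v I) (f w)) * pbI I)).
  by apply: eq_bigr => I _; rewrite mulr_suml; apply: eq_bigr => a _; rewrite mulrA.
rewrite exchange_big; apply: eq_bigr => a _.
by rewrite pbM pb_ef -mulr_sumr pbE.
Qed.

End OneMap.

Lemma pb_comp p m q (f : V p -> V m) g (om : form q) :
  smap f -> smap g -> pullback f (pullback g om) = pullback (fun w => g (f w)) om.
Proof.
move=> hf hg; rewrite [pullback g om]pbE pb_sum pbE.
apply: eq_bigr => I _; rewrite pbM pb_form0; congr (_ * _).
rewrite pb_prod; apply: eq_bigr => a _.
rewrite -extd_pb ?pb_form0 //.
exact/sformf/sm_comp_rcomp.
Qed.
Lemma smap_comp p m q (f : V p -> V m) (g : V m -> V q) :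
  smap f -> smap g -> smap (fun w => g (f w)).
Proof. move=> hf hg j; exact: (sm_comp hf (hg j)). Qed.

Section Components.
Context {p m : nat} (f : V p -> V m).

Lemma pb1E a w K : pb1 f a w K = \sum_i (pd i (fun v => (rcomp a (f v))%:C) w * (K == [set i])%:R).
Proof. by rewrite /pb1 extd_form0E sumfE; apply: eq_bigr => i _; rewrite mulf0E. Qed.

Lemma pb1_set1 a w i : pb1 f a w [set i] = pd i (fun v => (rcomp a (f v))%:C) w.
Proof.
rewrite pb1E -(@big_pred1_eq _ 0 +%R _ i (fun k => pd k (fun v => (rcomp a (f v))%:C) w)).
rewrite big_mkcond; apply: eq_bigr => k _.
rewrite (inj_eq set1_inj) eq_sym; case: eqP => _; first exact/mulr1.
exact/mulr0.
Qed.

Lemma pb_1form om w i : homog 1 om ->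
  pullback f om w [set i] = \sum_a om (f w) [set a] * pd i (fun v => (rcomp a (f v))%:C) w.
Proof.
move=> h.
have -> : om = \sum_a form0 (fun u => om u [set a]) * ef a. apply: formP => u K; rewrite sumfE.
  have [/cards1P[a ->]|hK] := boolP (#|K| == 1%N).
    rewrite (bigD1 a) //= mulf0E /ef eqxx mulr1 big1 ?addr0 // => b ba.
    by rewrite mulf0E (inj_eq set1_inj) eq_sym (negbTE ba) mulr0.
  rewrite h; last exact/eqP.
  rewrite big1 // => a _; rewrite mulf0E /ef; case: eqP => [E|]; last by rewrite mulr0.
  by move: hK; rewrite E cards1.
rewrite pb_sum sumfE; apply: eq_bigr => a _.
rewrite pbM pb_form0 pb_ef mulf0E pb1_set1 sumfE.
rewrite (bigD1 a) //= mulf0E /ef eqxx mulr1 big1 ?addr0 // => b ba.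
by rewrite mulf0E (inj_eq set1_inj) eq_sym (negbTE ba) mulr0.
Qed.

End Components.

Lemma pb1_id m a : pb1 (fun w : V m => w) a = ef a.
Proof.
apply: formP => w K; rewrite pb1E (bigD1 a) //= pd_rcomp eqxx mul1r.
rewrite big1 ?addr0 // => i ia.
by rewrite pd_rcomp eq_sym (negbTE ia) mul0r.
Qed.

(** Taken in increasing order, the coordinate differentials produce no inversion, so every sign in
    the product is 1. *)
Lemma prod_ef_coord m I w K : pbI (fun w : V m => w) I w K = (K == I)%:R.
Proof.
rewrite pbI_prod.
have : pairwise (fun a b => (coord_rank a < coord_rank b)%N) [seq a <- coord_seq m | a \in I].
  exact/pairwise_filter/cseq_sorted.
have -> : I = [set a in [seq a <- coord_seq m | a \in I]].
  by apply/setP => a; rewrite inE mem_filter cseq_mem andbT.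
have -> : [seq a <- coord_seq m | a \in [set a in [seq a <- coord_seq m | a \in I]]] =
  [seq a <- coord_seq m | a \in I].
  by apply: eq_filter => a; rewrite inE mem_filter cseq_mem andbT.
elim: [seq a <- _ | _] K => [|a l IH] K.
  rewrite big_nil => _; rewrite -[LHS]/(form0 (fun=> 1) w K) /form0.
  by case: eqP.
move=> /andP[/allP ha /IH{}IH]; rewrite big_cons pb1_id mulefE.
have naI : a \notin [set b in l]. by rewrite inE; apply/negP => /ha; rewrite ltnn.
have E : [set b in a :: l] = a |: [set b in l] by apply/setP => b; rewrite !inE.
rewrite E; case: ifPn => aK; last first. rewrite (_ : (K == _) = false) //; apply/negP => /eqP EK.
  by move: aK; rewrite EK !inE eqxx.
rewrite IH.
have -> : (K :\ a == [set b in l]) = (K == a |: [set b in l]).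
  apply/eqP/eqP => [<-|->]; first by rewrite setD1K.
  by rewrite setU1K.
case: eqP => [EK|]; last by rewrite mulr0.
rewrite mulr1 EK setU1K // /sgn.
rewrite /ninv big_set1 big1 // => b.
by rewrite inE => /ha h; rewrite ltnNge ltnW.
Qed.

Lemma pb_id m om : pullback (fun w : V m => w) om = om.
Proof.
apply: formP => w K; rewrite pbE sumfE (bigD1 K) //= mulf0E prod_ef_coord eqxx mulr1.
rewrite big1 ?addr0 // => I IK.
by rewrite mulf0E prod_ef_coord eq_sym (negbTE IK) mulr0.
Qed.

Lemma pb1_shift m (c : V m) a : pb1 (fun w => w + c) a = ef a.
Proof.
apply: formP => w K; rewrite pb1E (bigD1 a) //= big1 => [|i ia].
  rewrite (pd_trans _ (fun v => (rcomp a v)%:C)).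
  by rewrite pd_rcomp eqxx mul1r addr0.
rewrite (pd_trans _ (fun v => (rcomp a v)%:C)).
by rewrite pd_rcomp eq_sym (negbTE ia) mul0r.
Qed.

Lemma pb_shift m (c : V m) om w I : pullback (fun w => w + c) om w I = om (w + c) I.
Proof.
rewrite pbE sumfE (bigD1 I) //=.
have E J : pbI (fun w => w + c) J = pbI (fun w => w) J.
  by apply: eq_bigr => a _; rewrite pb1_shift pb1_id.
rewrite mulf0E E prod_ef_coord eqxx mulr1 big1 ?addr0 // => J JI.
by rewrite mulf0E E prod_ef_coord eq_sym (negbTE JI) mulr0.
Qed.

End Pullback.

#[local] Hint Resolve homog_pb1 sm_pb1 sm_pb homog_pb : sm.

(** * Chern-Weil theory and Chern-Simons forms for matrices of forms *)

Section ChernWeil.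
Context {R : realType} {b' m : nat}.
Notation b := b'.+1.
Notation form := (dform R m).
Notation M := 'M[form]_b.
Notation W := {poly M}.
Implicit Types (A B U : M) (P Q : W).

Definition smM A : Prop := forall k l, sform (A k l).
Definition hmM p A : Prop := forall k l, homog p (A k l).
Definition dM A : M := map_mx (@extd R m) A.

Lemma mulME A B k l : (A * B) k l = \sum_j A k j * B j l.
Proof. by rewrite mxE. Qed.

Lemma smM0 : smM 0. Proof. by move=> k l; rewrite mxE; auto with sm. Qed.
Lemma smM1 : smM 1.
Proof. by move=> k l; rewrite mxE; case: eqP => _; auto with sm. Qed.
Lemma smMD A B : smM A -> smM B -> smM (A + B).
Proof. by move=> h1 h2 k l; rewrite mxE; auto with sm. Qed.
Lemma smMN A : smM A -> smM (- A).
Proof. by move=> h1 k l; rewrite mxE; auto with sm. Qed.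
Lemma smMM A B : smM A -> smM B -> smM (A * B).
Proof. by move=> h1 h2 k l; rewrite mulME; auto with sm. Qed.
Lemma smM_sum T l (p : pred T) G : (forall t, p t -> smM (G t)) -> smM (\sum_(t <- l | p t) G t).
Proof. by move=> h; elim/big_rec: _ => [|t x Pt hx]; [exact/smM0|apply: smMD => //; exact/h]. Qed.
Lemma smM_d A : smM A -> smM (dM A).
Proof. by move=> h k l; rewrite mxE; auto with sm. Qed.
Lemma smM_tr A : smM A -> sform (\tr A).
Proof. by move=> h; apply: sform_sum => k _. Qed.
Lemma smM_cst u : smM (map_mx (@cf R m) u).
Proof. by move=> k l; rewrite mxE; auto with sm. Qed.

Lemma hmM0 p : hmM p 0. Proof. by move=> k l; rewrite mxE. Qed.
Lemma hmM1 : hmM 0 1.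
Proof. by move=> k l; rewrite mxE; case: eqP => _; [exact/homog_form0 | ]. Qed.
Lemma hmMD p A B : hmM p A -> hmM p B -> hmM p (A + B).
Proof. by move=> h1 h2 k l; rewrite mxE; exact/homogD. Qed.
Lemma hmMN p A : hmM p A -> hmM p (- A).
Proof. by move=> h1 k l; rewrite mxE; exact/homogN. Qed.
Lemma hmMM p q A B : hmM p A -> hmM q B -> hmM (p + q) (A * B).
Proof. by move=> h1 h2 k l; rewrite mulME; auto with sm. Qed.
Lemma hmM_sum p T l (c : pred T) G :
  (forall t, c t -> hmM p (G t)) -> hmM p (\sum_(t <- l | c t) G t).
Proof. by move=> h; elim/big_rec: _ => [|t x Pt hx]; [exact/hmM0|apply: hmMD => //; exact/h]. Qed.
Lemma hmM_d p A : hmM p A -> hmM p.+1 (dM A).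
Proof. by move=> h k l; rewrite mxE; auto with sm. Qed.
Lemma hmM_tr p A : hmM p A -> homog p (\tr A).
Proof. by move=> h; apply: homog_sum => k _. Qed.
Lemma hmM_cst u : hmM 0 (map_mx (@cf R m) u).
Proof. by move=> k l; rewrite mxE; exact/homog_form0. Qed.

Lemma dM0 : dM 0 = 0. Proof. by apply/matrixP => k l; rewrite !mxE extd0. Qed.
Lemma dMD A B : smM A -> smM B -> dM (A + B) = dM A + dM B.
Proof. by move=> h1 h2; apply/matrixP => k l; rewrite !mxE extdD. Qed.
Lemma dM_sum T l (c : pred T) G :
  (forall t, c t -> smM (G t)) -> dM (\sum_(t <- l | c t) G t) = \sum_(t <- l | c t) dM (G t).
Proof.
move=> h; elim: l => [|t l IH]; first by rewrite !big_nil dM0.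
rewrite !big_cons; case Pt: (c t) => //.
by rewrite dMD ?IH //; [exact/h|exact/smM_sum].
Qed.
Lemma dMd A : smM A -> dM (dM A) = 0.
Proof. by move=> h; apply/matrixP => k l; rewrite !mxE extd_extd. Qed.
Lemma dM_even p A B : hmM p A -> ~~ odd p -> smM A -> smM B -> dM (A * B) = dM A * B + A * dM B.
Proof.
move=> hp ho h1 h2; apply/matrixP => k l; rewrite mxE [RHS]mxE mulME extd_sum => [|j _]; auto with sm.
rewrite !mulME -big_split; apply: eq_bigr => j _.
by rewrite [dM A k j]mxE [dM B j l]mxE (extdM_even (hp k j)).
Qed.
Lemma dM_odd p A B : hmM p A -> odd p -> smM A -> smM B -> dM (A * B) = dM A * B - A * dM B.
Proof.
move=> hp ho h1 h2; apply/matrixP => k l; rewrite mxE [RHS]mxE mulME extd_sum => [|j _]; auto with sm.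
rewrite [X in _ + X]mxE !mulME -sumrB; apply: eq_bigr => j _.
by rewrite [dM A k j]mxE [dM B j l]mxE (extdM_odd (hp k j)).
Qed.
Lemma dM_cst u : dM (map_mx (@cf R m) u) = 0.
Proof. by apply/matrixP => k l; rewrite !mxE; exact/extd_const. Qed.
Lemma dM1 : dM 1 = 0.
Proof. by apply/matrixP => k l; rewrite !mxE; case: eqP => _; exact/extd_const. Qed.
Lemma dM_tr A : smM A -> extd (\tr A) = \tr (dM A).
Proof.
by move=> h; rewrite extd_sum //; apply: eq_bigr => k _; rewrite mxE.
Qed.

Lemma tr_even p q A B : hmM p A -> hmM q B -> ~~ odd (p * q) -> \tr (A * B) = \tr (B * A).
Proof.
move=> h1 h2 ho; rewrite /mxtrace.
under eq_bigr do rewrite mulME; under [RHS]eq_bigr do rewrite mulME.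
rewrite exchange_big; apply: eq_bigr => k _; apply: eq_bigr => j _.
by rewrite (homog_comm (h1 j k) (h2 k j)) -signr_odd (negbTE ho) mul1r.
Qed.
Lemma tr_odd p q A B : hmM p A -> hmM q B -> odd (p * q) -> \tr (A * B) = - \tr (B * A).
Proof.
move=> h1 h2 ho; rewrite /mxtrace.
under eq_bigr do rewrite mulME; under [in RHS]eq_bigr do rewrite mulME.
rewrite -sumrN exchange_big; apply: eq_bigr => k _; rewrite -sumrN; apply: eq_bigr => j _.
by rewrite (homog_comm (h1 j k) (h2 k j)) -signr_odd ho mulN1r.
Qed.

Definition smW P := forall j, smM P`_j.
Definition hmW p P := forall j, hmM p P`_j.
(** In polynomials over matrices of forms ['X] plays the parameter s of the path of connections d +
    s B, a constant for the exterior derivative. Integration over s becomes a finite sum over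
    coefficients. *)
Definition dW P : W := \poly_(j < size P) dM P`_j.
Definition trW P j : form := \tr P`_j.

Lemma coef_dW P j : (dW P)`_j = dM P`_j.
Proof.
rewrite coef_poly; case: ltnP => // h.
by rewrite nth_default // dM0.
Qed.
Lemma smWD P Q : smW P -> smW Q -> smW (P + Q).
Proof. by move=> h1 h2 j; rewrite coefD; exact/smMD. Qed.
Lemma smWM P Q : smW P -> smW Q -> smW (P * Q).
Proof. by move=> h1 h2 j; rewrite coefM; apply: smM_sum => i _; exact/smMM. Qed.
Lemma smWC A : smM A -> smW A%:P.
Proof. by move=> h j; rewrite coefC; case: eqP => // _; exact/smM0. Qed.
Lemma smW1 : smW 1. Proof. exact: (smWC smM1). Qed.
Lemma smWX P n : smW P -> smW (P ^+ n).
Proof. by move=> h; elim: n => [|n IH]; rewrite ?exprS; [exact/smW1|exact/smWM]. Qed.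
Lemma smWXM P : smW P -> smW ('X * P).
Proof. by move=> h j; rewrite coefXM; case: eqP => // _; exact/smM0. Qed.
Lemma hmWD p P Q : hmW p P -> hmW p Q -> hmW p (P + Q).
Proof. by move=> h1 h2 j; rewrite coefD; exact/hmMD. Qed.
Lemma hmWM p q P Q : hmW p P -> hmW q Q -> hmW (p + q) (P * Q).
Proof. by move=> h1 h2 j; rewrite coefM; apply: hmM_sum => i _; exact/hmMM. Qed.
Lemma hmWC p A : hmM p A -> hmW p A%:P.
Proof. by move=> h j; rewrite coefC; case: eqP => // _; exact/hmM0. Qed.
Lemma hmWX p P n : hmW p P -> hmW (n * p) (P ^+ n).
Proof.
move=> h; elim: n => [|n IH]; rewrite ?exprS; first exact/hmWC/hmM1.
exact/hmWM.
Qed.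
Lemma hmWXM p P : hmW p P -> hmW p ('X * P).
Proof. by move=> h j; rewrite coefXM; case: eqP => // _; exact/hmM0. Qed.
Lemma hmWder p P : hmW p P -> hmW p P^`().
Proof.
move=> h j; rewrite coef_deriv; elim: {2}j.+1 => [|n IH]; first by rewrite mulr0n; exact/hmM0.
by rewrite mulrS; exact/hmMD.
Qed.
Lemma dWD P Q : smW P -> smW Q -> dW (P + Q) = dW P + dW Q.
Proof. by move=> h1 h2; apply/polyP => j; rewrite !(coefD, coef_dW) dMD. Qed.
Lemma dWXM P : dW ('X * P) = 'X * dW P.
Proof. by apply/polyP => j; rewrite !(coefXM, coef_dW); case: eqP => //; rewrite dM0. Qed.
Lemma dWC A : dW A%:P = (dM A)%:P.
Proof. by apply/polyP => j; rewrite !(coefC, coef_dW); case: eqP => //; rewrite dM0. Qed.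
Lemma dW_even p P Q : hmW p P -> ~~ odd p -> smW P -> smW Q -> dW (P * Q) = dW P * Q + P * dW Q.
Proof.
move=> hp ho h1 h2; apply/polyP => j; rewrite coefD coef_dW !coefM dM_sum => [|i _]; last exact/smMM.
by rewrite -big_split; apply: eq_bigr => i _; rewrite !coef_dW (dM_even (hp i)).
Qed.
Lemma dW_odd p P Q : hmW p P -> odd p -> smW P -> smW Q -> dW (P * Q) = dW P * Q - P * dW Q.
Proof.
move=> hp ho h1 h2; apply/polyP => j; rewrite coefB coef_dW !coefM dM_sum => [|i _]; last exact/smMM.
by rewrite -sumrB; apply: eq_bigr => i _; rewrite !coef_dW (dM_odd (hp i)).
Qed.
Lemma trWD P Q j : trW (P + Q) j = trW P j + trW Q j.
Proof. by rewrite /trW coefD mxtraceD. Qed.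
Lemma trWN P j : trW (- P) j = - trW P j.
Proof. by rewrite /trW coefN raddfN. Qed.
Lemma trWB P Q j : trW (P - Q) j = trW P j - trW Q j.
Proof. by rewrite trWD trWN. Qed.
Lemma trW_even p q P Q j : hmW p P -> hmW q Q -> ~~ odd (p * q) -> trW (P * Q) j = trW (Q * P) j.
Proof.
move=> h1 h2 ho; rewrite /trW coefM coefMr !raddf_sum; apply: eq_bigr => i _.
exact: tr_even ho.
Qed.
Lemma trW_odd p q P Q j : hmW p P -> hmW q Q -> odd (p * q) -> trW (P * Q) j = - trW (Q * P) j.
Proof.
move=> h1 h2 ho; apply/eqP; rewrite -addr_eq0 -mxtraceD coefM coefMr -big_split.
rewrite raddf_sum big1 // => i _; rewrite raddfD /=.
by apply/eqP; rewrite addr_eq0 (tr_odd (h1 i) (h2 (j - i)%N) ho).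
Qed.
Lemma trW_XM P j : trW ('X * P) j = if j is j'.+1 then trW P j' else 0.
Proof. by rewrite /trW coefXM; case: j => [|j] //=; exact/mxtrace0. Qed.

Definition curvM B : M := dM B + B * B.
(* The curvature of the connection [d + 'X B]. *)
Definition curvW B : W := 'X * ((dM B)%:P + 'X * (B * B)%:P).

Section OneConnection.
Variable B : M.
Hypotheses (sB : smM B) (hB : hmM 1 B).
Notation F := (curvW B).

Lemma smW_curv : smW F.
Proof.
apply/smWXM/smWD; first exact/smWC/smM_d.
exact/smWXM/smWC/smMM.
Qed.
Lemma hmW_curv : hmW 2 F.
Proof.
apply/hmWXM/hmWD; first exact/hmWC/hmM_d.
exact/hmWXM/hmWC/(hmMM hB hB).
Qed.
Lemma XMl P Q : P * ('X * Q) = 'X * (P * Q).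
Proof. by rewrite !mulrA commr_polyX. Qed.

Lemma bianchi : dW F = 'X * (F * B%:P - B%:P * F).
Proof.
rewrite dWXM dWD; last 2 first.
- exact/smWC/smM_d.
- exact/smWXM/smWC/smMM.
rewrite dWXM !dWC dMd // add0r (dM_odd hB) //; congr (_ * _).
rewrite -!mulrA XMl -mulrBr; congr (_ * _).
by rewrite mulrDl mulrDr -mulrA XMl -!polyCM mulrA opprD addrACA subrr addr0 polyCB.
Qed.

Lemma deriv_curvW : F^`() = (dM B)%:P + 'X * (B * B)%:P *+ 2.
Proof.
by rewrite derivM derivX mul1r derivD derivM derivX mul1r !derivC add0r mulr0 addr0 addrA.
Qed.
Opaque curvW.

Lemma bianchiX k : dW (F ^+ k) = 'X * (F ^+ k * B%:P - B%:P * F ^+ k).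
Proof.
elim: k => [|k IH]. by rewrite mul1r mulr1 subrr mulr0 dWC dM1.
rewrite exprS (dW_even hmW_curv) //; last 2 first.
- exact/smW_curv.
- exact/smWX/smW_curv.
transitivity ('X * ((F * B%:P - B%:P * F) * F ^+ k + F * (F ^+ k * B%:P - B%:P * F ^+ k))).
  by rewrite bianchi IH XMl [RHS]mulrDr !mulrA.
by rewrite mulrBl mulrBr !mulrA addrC addrA subrK.
Qed.

(** F is even, so the trace is cyclic without sign, and each of the k positions of F' in the
    derivative of F^k contributes the same. *)
Lemma tr_derivX k l j : trW ((F ^+ k)^`() * F ^+ l) j = trW (F^`() * F ^+ (k + l).-1) j *+ k.
Proof.
elim: k l => [|k IH] l; first by rewrite derivC mul0r /trW coef0 mxtrace0.
rewrite exprS derivM mulrDl trWD -mulrA -exprD -mulrA.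
rewrite [X in _ + X](trW_even (p := 2) (q := k * 2 + l * 2)); last 3 first.
- exact/hmW_curv.
- by apply: hmWM; [apply: hmWder|]; exact/hmWX/hmW_curv.
- by rewrite oddM.
rewrite -mulrA -exprSr IH addnS mulrS //.
Qed.

(** F' is dB + 2 s B^2. In d tr(B F^k) the Bianchi identity leaves s tr(B (B F^k - F^k B)) beside
    tr(dB F^k), and odd cyclicity makes this 2 s tr(B^2 F^k). *)
Lemma tr_transgression k j : trW (F^`() * F ^+ k) j = extd (trW (B%:P * F ^+ k) j).
Proof.
have sF : smW (F ^+ k) by exact: smWX(smW_curv).
have hF : hmW (k * 2) (F ^+ k) by exact: hmWX(hmW_curv).
have hBW := hmWC hB.
rewrite dM_tr; last by apply: smWM => //; exact/smWC.
rewrite -coef_dW (dW_odd hBW) //; last exact/smWC.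
rewrite dWC bianchiX XMl -!/(trW _ _) trWB trW_XM.
rewrite deriv_curvW mulrDl trWD; congr (_ + _).
have -> : trW ('X * (B * B)%:P *+ 2 * F ^+ k) j = if j is j'.+1 then trW ((B * B)%:P * F ^+ k) j' *+ 2 else 0.
  by rewrite mulrnAl -mulrA trWD trW_XM; case: j => [|j]; rewrite ?addr0.
case: j => [|j]; first by rewrite oppr0.
rewrite mulrBr trWB [in X in _ - X]mulrA (trW_odd _ hBW (hmWM hF hBW)).
  have ho : ~~ odd (k * 2 * (1 + 1)) by rewrite !oddM andbF.
  by rewrite -mulrA -polyCM (trW_even _ hF (hmWC (hmMM hB hB)) ho) opprB opprK.
by rewrite mul1n oddD oddM andbF.
Qed.

(** The Chern-Simons form: k times the integral over s in [0, 1] of tr(B F^(k-1)), the coefficient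
    of s^j being divided by j + 1. The range of j exceeds the degree; it is the one met when F^k is
    expanded in [tr_curv_exact]. *)
Definition cs k : form := \sum_(j < k.*2.+1) cf (k%:R / j.+1%:R) * trW (B%:P * F ^+ k.-1) j.

Lemma sm_trW P j : smW P -> sform (trW P j).
Proof. by move=> h; apply: smM_tr. Qed.

Lemma sm_cs k : sform (cs k).
Proof.
apply: sform_sum => j _; apply: sformM; auto with sm.
by apply/sm_trW/smWM; [exact/smWC|exact/smWX/smW_curv].
Qed.

End OneConnection.

Lemma curvW_E B : curvW B = 'X * ((dM B)%:P + 'X * (B * B)%:P).
Proof. by []. Qed.

Lemma size_curvX B k : (size (curvW B ^+ k) <= k.*2.+1)%N.
Proof.
apply: leq_trans (size_poly_exp_leq _ _) _; rewrite ltnS -muln2 mulnC leq_mul2l.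
apply/orP; right; apply: (@leq_trans (3.-1)) => //; rewrite -!subn1 leq_sub2r //.
by apply/leq_sizeP => -[|[|[|j]]] // _; rewrite coefXM coefD coefC coefXM coefC add0r.
Qed.

Lemma horner_curvX B k : (curvW B ^+ k).[1] = curvM B ^+ k.
Proof.
rewrite horner_exp_comm; last by rewrite /comm_poly mul1r mulr1.
rewrite !(hornerM_comm, hornerD, hornerC, hornerX) ?mul1r //; by rewrite /comm_poly mul1r mulr1.
Qed.

Lemma form_divn (x y : form) j k : x *+ j.+1 = y *+ k.+1 -> x = cf (k.+1%:R / j.+1%:R) * y.
Proof.
move=> E; apply: formP => w K; have := congr1 (fun o => o w K) E.
rewrite !mulrnfE mulf0E; move: (x w K) (y w K) => p q; rewrite -(mulr_natr p) -(mulr_natr q) => E1.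
by rewrite mulrAC [_ * q]mulrC -E1 mulfK.
Qed.

(** F is divisible by s, so tr F^(k+1) vanishes at s = 0 and its value at s = 1 is the integral of
    its derivative, which is exact by [tr_derivX] and [tr_transgression]. *)
Lemma tr_curv_exact B k : smM B -> hmM 1 B -> \tr (curvM B ^+ k.+1) = extd (cs B k.+1).
Proof.
move=> sB hB; have sF := smW_curv sB.
have sP j : sform (trW (B%:P * curvW B ^+ k) j).
  by apply/sm_trW/smWM; [exact/smWC|exact/smWX].
rewrite -horner_curvX (@horner_coef_wide _ (k.+1.*2.+1.+1)); last first.
  by apply: leq_trans (size_curvX _ _) _.
rewrite raddf_sum big_ord_recl mulr1 exprS coef0M coefXM mul0r raddf0 add0r.
rewrite extd_sum => [|j _]; last first. by auto with sm.
apply: eq_bigr => j _; rewrite extd_cfM //= -tr_transgression // expr1n mulr1.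
have := @tr_derivX B hB k.+1 0 j; rewrite mulr1 addn0 /trW coef_deriv.
rewrite -exprS raddfMn => E.
exact: form_divn E.
Qed.

Section Conjugation.
Variables (u u' : 'M[R[i]]_b).
Hypothesis uu' : u' *m u = 1%:M.
Notation U := (map_mx (@cf R m) u : M).
Notation U' := (map_mx (@cf R m) u' : M).

Lemma cfmxM v v' : map_mx (@cf R m) (v *m v') = (map_mx (@cf R m) v : M) * map_mx (@cf R m) v'.
Proof.
apply/matrixP => k l; rewrite mxE mulME mxE; apply: formP => w I.
rewrite sumfE; transitivity (\sum_j (form0 (fun=> v k j * v' j l) : form) w I).
  by rewrite /cf /form0; case: ifP => // _; rewrite big1.
by apply: eq_bigr => j _; rewrite !mxE form0M.
Qed.
Lemma cfmx1 : map_mx (@cf R m) 1%:M = 1 :> M.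
Proof.
apply/matrixP => k l; rewrite !mxE; case: eqP => _ //.
by apply: formP => w I; rewrite /cf /form0 if_same.
Qed.
Lemma conj_id : U' * U = 1. Proof. by rewrite -cfmxM uu' cfmx1. Qed.
Lemma conjM A B : (U * A * U') * (U * B * U') = U * (A * B) * U'.
Proof. by rewrite !mulrA -[U * A * U' * U]mulrA conj_id mulr1. Qed.
Lemma dM_conj A : smM A -> dM (U * A * U') = U * dM A * U'.
Proof.
move=> sA; have sU := @smM_cst u; have sU' := @smM_cst u'.
rewrite -mulrA (dM_even (@hmM_cst u)) //; last exact/smMM.
rewrite dM_cst mul0r add0r -mulrA; congr (_ * _).
apply/matrixP => k l; rewrite mxE !mulME extd_sum => [|j _]; auto with sm.
apply: eq_bigr => j _; rewrite !mxE.
by rewrite -!form0C; apply: extd_cfM.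
Qed.
Lemma curvW_conj A : smM A -> curvW (U * A * U') = U%:P * curvW A * U'%:P.
Proof.
move=> sA; rewrite !curvW_E dM_conj // conjM (XMl U%:P) -['X * _ * _]mulrA; congr (_ * _).
by rewrite [X in _ = X * _]mulrDr (XMl U%:P) mulrDl -['X * _ * _]mulrA -!polyCM.
Qed.
Lemma conjX P k : (U%:P * P * U'%:P) ^+ k.+1 = U%:P * P ^+ k.+1 * U'%:P.
Proof.
have c : U'%:P * U%:P = 1 :> W by rewrite -polyCM conj_id.
elim: k => [|k IH] //.
by rewrite exprS IH !mulrA -[U%:P * P * U'%:P * U%:P]mulrA c mulr1.
Qed.
Lemma trW_conj P j : trW (U%:P * P * U'%:P) j = trW P j.
Proof.
rewrite /trW coefMC coefCM /mxtrace; under eq_bigr => k _.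
  rewrite mulME; under eq_bigr => l _ do rewrite [X in _ * X]mxE -form0C mulME mulr_sumr.
  over.
rewrite exchange_big; apply: eq_bigr => l _.
transitivity (\sum_j0 (\sum_k cf (u' l k) * cf (u k j0)) * P`_j j0 l).
  rewrite exchange_big; apply: eq_bigr => j0 _; rewrite mulr_suml; apply: eq_bigr => k _.
  by rewrite mxE mulrA.
have := conj_id; under eq_bigr => j0 _. have : (U' * U) l j0 = (1 : M) l j0 by rewrite conj_id.
  rewrite mulME; under eq_bigr do rewrite !mxE.
  move=> ->; over.
rewrite (bigD1 l) //= mxE eqxx mul1r big1 ?addr0 // => k kl.
by rewrite mxE eq_sym (negbTE kl) mul0r.
Qed.

(** A constant change of frame has zero differential and so conjugates the whole path of curvatures,
    which the trace does not see. Lattice translations act on the traceless part of the connection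
    in this way. *)
Lemma cs_conj A k : smM A -> cs (U * A * U') k.+1 = cs A k.+1.
Proof.
move=> sA; apply: eq_bigr => j _; congr (_ * _).
rewrite curvW_conj // !polyCM; case: k => [|k] in j *. by rewrite !mulr1 trW_conj.
rewrite conjX.
have c : U'%:P * U%:P = 1 :> W by rewrite -polyCM conj_id.
rewrite !mulrA -[U%:P * A%:P * U'%:P * U%:P]mulrA c mulr1 -[U%:P * A%:P * _]mulrA.
exact/trW_conj.
Qed.
End Conjugation.

Section Splitting.
Variables (A : M) (c : R[i]) (a : form).
Hypotheses (sA : smM A) (hA : hmM 1 A) (sa : sform a) (ha : homog 1 a).
Notation B := (A - a%:M).
Notation om := (cf c * extd a).

(** In the binomial expansion of the trace of (om + c curv B)^k, the term with i + 1 factors curv B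
    is om^(k-i-1) times an exact form; [cw] collects the primitives. *)
Definition cw k : form :=
  \sum_(i < k) (om ^+ (k - i.+1) * (cf (c ^+ i.+1) * cs B i.+1)) *+ 'C(k, i.+1).

Lemma smM_scalar o : sform o -> smM o%:M.
Proof. by move=> h k l; rewrite mxE; case: (k == l) ; auto with sm. Qed.
Lemma hmM_scalar p o : homog p o -> hmM p o%:M.
Proof. by move=> h k l; rewrite mxE; case: (k == l). Qed.
Lemma smM_B : smM B. Proof. by apply: smMD => //; exact/smMN/smM_scalar. Qed.
Lemma hmM_B : hmM 1 B. Proof. by apply: hmMD => //; exact/hmMN/hmM_scalar. Qed.

Lemma cfX n : cf c ^+ n = cf (c ^+ n) :> form.
Proof.
elim: n => [|n IH] //.
by rewrite !exprS IH form0M.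
Qed.

(** The cross terms D a + a D cancel and a a vanishes, the entries being 1-forms; only da
    survives. *)
Lemma curvM_add D : smM D -> hmM 1 D -> curvM (D + a%:M) = curvM D + (extd a)%:M.
Proof.
move=> sD hD; rewrite /curvM dMD //; last exact/smM_scalar.
rewrite mulrDl !mulrDr.
have Z1 : D * a%:M + a%:M * D = 0.
  apply/matrixP => k l; rewrite mxE [RHS]mxE !mulME (bigD1 l) //= big1; last first.
    by move=> j jl; rewrite [X in _ * X]mxE (negbTE jl) mulr0.
  rewrite (bigD1 k) //= big1; last first. by move=> j jl; rewrite mxE eq_sym (negbTE jl) mul0r.
  have aE j : a%:M j j = a by rewrite mxE eqxx.
  by rewrite !aE !addr0 (homog_comm (hD k l) ha) mulN1r addNr.
have Z2 : a%:M * a%:M = 0 :> M. rewrite -mulmxE -scalar_mxM (_ : a * a = 0) ?raddf0 //.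
  by apply: eq_form_oppr0; rewrite {1}(homog_comm ha ha) mulN1r.
rewrite Z2 addr0 -[D * D + _ + _]addrA Z1 addr0 addrAC.
apply/matrixP => k l; rewrite !mxE; case: (k == l) => //.
by rewrite extd0.
Qed.
Lemma curvM_split : curvM A = curvM B + (extd a)%:M.
Proof. by rewrite -curvM_add ?subrK //; [exact/smM_B|exact/hmM_B]. Qed.
Lemma scalar_mxX (o : form) n : o%:M ^+ n = (o ^+ n)%:M :> M.
Proof. by elim: n => [|n IH]; rewrite ?exprS ?IH ?scalar_mxM. Qed.

Lemma scalarM_central (o : form) (D : M) : (forall x, o * x = x * o) -> o%:M * D = D * o%:M.
Proof.
move=> ho; rewrite -!mulmxE mul_scalar_mx; apply/matrixP => k l; rewrite mxE mxE (bigD1 l) //=.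
rewrite big1 => [|j jl]; last by rewrite [X in _ * X]mxE (negbTE jl) mulr0.
by rewrite [X in _ = _ * X + _]mxE eqxx addr0.
Qed.
Lemma homog_om : homog 2 om.
Proof. by apply: homogMf0; auto with sm. Qed.
Lemma sm_om : sform om.
Proof. by auto with sm. Qed.
Lemma closed_om : extd om = 0.
Proof. by rewrite extd_cfM ?extd_extd ?mulr0; auto with sm. Qed.

Lemma closedX (o : form) n : sform o -> homog 2 o -> extd o = 0 -> extd (o ^+ n) = 0.
Proof.
move=> so ho co; elim: n => [|n IH]; first by rewrite expr0; exact/extd_const.
rewrite exprS (extdM_even ho) ?co ?IH ?mul0r ?mulr0 ?addr0 //.
by auto with sm.
Qed.

Lemma tr_curv_split r : \tr (((cf c)%:M * curvM A) ^+ r) =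
  om ^+ r *+ b + \sum_(i < r) (om ^+ (r - i.+1) * (cf (c ^+ i.+1) * \tr (curvM B ^+ i.+1))) *+ 'C(r, i.+1).
Proof.
have -> : (cf c)%:M * curvM A = om%:M + (cf c)%:M * curvM B.
  by rewrite curvM_split mulrDr addrC scalar_mxM mulmxE.
rewrite exprDn_comm; last first. by apply: scalarM_central => x; exact: (even_comm _ homog_om).
have cX n : (cf c)%:M ^+ n = (cf (c ^+ n))%:M :> M by rewrite scalar_mxX cfX.
have T i : \tr (om%:M ^+ (r - i) * ((cf c)%:M * curvM B) ^+ i *+ 'C(r, i)) =
   (om ^+ (r - i) * (cf (c ^+ i) * \tr (curvM B ^+ i))) *+ 'C(r, i).
  rewrite raddfMn /=; congr (_ *+ _).
  have cc : GRing.comm (cf c)%:M (curvM B) by apply: scalarM_central => x; rewrite /cf form0C.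
  by rewrite scalar_mxX (exprMn_comm _ cc) cX -!mulmxE mul_scalar_mx mxtraceZ mul_scalar_mx mxtraceZ.
rewrite raddf_sum big_ord_recl; congr (_ + _); last by apply: eq_bigr => i _; exact/T.
have /= := T 0; rewrite subn0 bin0 !mulr1n => ->.
by rewrite -cfX !expr0 mxtrace1 mul1r mulr_natr.
Qed.

(** om is closed and even, so its powers may be moved inside the exterior derivative in every term
    of [tr_curv_split]. *)
Lemma chern_weil r : \tr (((cf c)%:M * curvM A) ^+ r) = om ^+ r *+ b + extd (cw r).
Proof.
rewrite tr_curv_split; congr (_ + _); rewrite /cw extd_sum; last first.
  move=> i _; rewrite -mulr_natl -cf_nat; apply: sformM; first exact/sm_cf.
  apply: sformM; first exact/sformX/sm_om.
  by apply: sformM; [exact/sm_cf|exact/sm_cs/smM_B].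
apply: eq_bigr => i _; rewrite tr_curv_exact; [|exact/smM_B|exact/hmM_B].
have s1 : sform (cf (c ^+ i.+1) * cs B i.+1).
  by apply: sformM; [exact/sm_cf|exact/sm_cs/smM_B].
have s2 : sform (om ^+ (r - i.+1)) by exact: sformX(sm_om).
rewrite -[in RHS]mulr_natl -cf_nat extd_cfM; last exact/sformM.
rewrite (extdM_even (@homogX _ _ 2 _ _ homog_om)) //; last by rewrite oddM andbF.
rewrite closedX; [|exact/sm_om|exact/homog_om|exact/closed_om].
rewrite mul0r add0r extd_cfM; last exact/sm_cs/smM_B.
by rewrite cf_nat mulr_natl.
Qed.

End Splitting.

Lemma cohom_powers (o o' eta : form) r : sform o -> sform o' -> homog 2 o ->
  homog 2 o' -> extd o = 0 -> extd o' = 0 -> sform eta -> homog 1 eta ->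
  o = o' + extd eta ->
  o ^+ r = o' ^+ r + extd (eta * \sum_(i < r) o ^+ (r.-1 - i) * o' ^+ i).
Proof.
move=> s1 s2 h1 h2 c1 c2 se he E.
have sS i : sform (o ^+ (r.-1 - i) * o' ^+ i). by apply: sformM; exact/sformX.
rewrite (extdM_odd he) //; last by apply: sform_sum => i _; exact/sS.
rewrite [X in _ - eta * X]extd_sum => [|i _]; last exact/sS.
rewrite [X in _ - eta * X]big1 => [|i _]; last first.
  rewrite (extdM_even (@homogX _ _ 2 _ _ h1)) ?oddM ?andbF //; try exact/sformX.
  by rewrite !closedX // mul0r mulr0 addr0.
rewrite mulr0 subr0; have -> : extd eta = o - o' by rewrite E addrAC subrr add0r.
rewrite -subrXX_comm 1?addrC ?subrK //.
exact: (even_comm _ h1).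
Qed.

End ChernWeil.

#[local] Hint Resolve smM0 smM1 smMD smMN smMM smM_sum smM_d smM_tr smM_cst hmM0 hmMD hmMN hmM_sum hmM_d
  hmM_tr hmM_cst : sm.

(** * Characters of the circle, coefficient estimates, Cauchy sequences *)

Section Fourier.
Context {R : realType}.

Definition cis s : R[i] := cos (2 * pi * s) +i* sin (2 * pi * s).

Lemma cisD s t : cis (s + t) = cis s * cis t.
Proof. by apply: ceqP; rewrite /= mulrDr ?cosD ?sinD; ring. Qed.
Lemma cis0 : cis 0 = 1.
Proof. by rewrite /cis mulr0 cos0 sin0. Qed.
Lemma cis1 : cis 1 = 1.
Proof. by rewrite /cis mulr1 mulrC mulr_natr cos2pi sin2pi. Qed.
Lemma cisN s : cis (- s) = (cis s)^*.
Proof. by rewrite /cis mulrN cosN sinN. Qed.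
Lemma cis_nat n : cis n%:R = 1.
Proof. by elim: n => [|n IH]; rewrite ?cis0 // -natr1 cisD cis1 mulr1. Qed.
Lemma cisX s n : cis s ^+ n = cis (n%:R * s).
Proof. by elim: n => [|n IH]; rewrite ?mul0r ?cis0 // exprS IH -cisD -natr1 mulrDl mul1r addrC. Qed.
Lemma cn_cis s : cn (cis s) <= 2.
Proof.
by rewrite lerD // ler_norml ?cos_geN1 ?cos_le1 ?sin_geN1 ?sin_le1.
Qed.

Lemma cder_cis (a s : R) : cder (fun t => cis (a * t)) s ((2 * pi * a)%:C * 'i * cis (a * s)).
Proof.
have h : is_derive s 1 (fun t => 2 * pi * (a * t)) (2 * pi * a).
  apply/is_derive_epsP => e e0; exists 1 => // x _.
  have -> : 2 * pi * (a * (s + x)) - 2 * pi * (a * s) - x * (2 * pi * a) = 0 by ring.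
  by rewrite normr0 mulr_ge0 ?(ltW e0).
split. by apply: (is_derive_eq (is_derive1_comp (is_derive_cos _) h)); rewrite /=; ring.
by apply: (is_derive_eq (is_derive1_comp (is_derive_sin _) h)); rewrite /=; ring.
Qed.

Lemma cder_cont01 f df : (forall s : R, cder f s (df s)) -> cont01 f.
Proof.
move=> h s _ e e0; have /cder_epsP := h s => /(_ 1 ltr01) [r r0 H].
have c0 : 0 < 1 + cn (df s) by rewrite ltr_pwDl ?cn_ge0.
exists (Num.min r (e / (1 + cn (df s)))); first by rewrite lt_min r0 divr_gt0.
move=> s'; rewrite lt_min => /andP[h1 h2]; have := H _ h1; rewrite [s + _]addrC subrK mul1r => h3.
have : cn (f s' - f s) <= `|s' - s| + `|s' - s| * cn (df s).
  rewrite -[f s' - f s](subrK ((s' - s)%:C * df s)); apply: le_trans (cnD _ _) _.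
  by rewrite cnMR lerD.
move=> /le_lt_trans; apply; rewrite -{1}[`|_|]mulr1 -mulrDr.
by rewrite -ltr_pdivlMr.
Qed.
Lemma cont01_cis a : cont01 (fun t => cis (a * t)).
Proof. exact: (cder_cont01 (@cder_cis a)). Qed.

Lemma int01_cis (a : R) : a != 0 -> cis a = 1 -> int01 (fun s => cis (a * s)) = 0.
Proof.
move=> a0 ca; have c0 : (2 * pi * a)%:C * 'i != 0 :> R[i].
  rewrite mulf_neq0 //; first by rewrite eq_complex eqxx andbT !mulf_neq0 // gt_eqF ?pi_gt0.
  by rewrite eq_complex oner_eq0 andbF.
rewrite (_ : (fun s => cis (a * s)) = fun s => ((2 * pi * a)%:C * 'i)^-1 * ((2 * pi * a)%:C * 'i * cis (a * s))); last first.
  by apply/funext => s; rewrite mulKf.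
rewrite int01Z; last exact/cont01Z/cont01_cis.
rewrite (@int01_FTC _ (fun t => cis (a * t))).
- by rewrite mulr1 mulr0 ca cis0 subrr mulr0.
- exact/cont01Z/cont01_cis.
- move=> s _; exact/cder_cis.
Qed.

Lemma int01_cis_orth j k : int01 (fun s => cis s ^+ j * (cis s ^+ k)^*) = (j == k)%:R.
Proof.
rewrite (eq_int01 (g := fun s => cis ((j%:R - k%:R) * s))); last first.
  by move=> s _; rewrite !cisX -cisN -cisD mulrBl.
case: eqVneq => [->|jk].
  rewrite -[RHS]int01_cst; apply: eq_int01 => s _; by rewrite subrr mul0r cis0.
apply: int01_cis; first by rewrite subr_eq0 eqr_nat.
by rewrite cisD cisN !cis_nat mul1r rmorph1.
Qed.

Lemma cont01_cisX j : cont01 (fun s => cis s ^+ j).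
Proof.
rewrite (_ : (fun s => _) = fun s => cis (j%:R * s)); first exact/cont01_cis.
by apply/funext => s; rewrite cisX.
Qed.

Lemma cont01_cisXJ k : cont01 (fun s => (cis s ^+ k)^*).
Proof.
rewrite (_ : (fun s => _) = fun s => cis (- k%:R * s)); first exact/cont01_cis.
by apply/funext => s; rewrite cisX mulNr cisN.
Qed.

(** Cauchy's estimate, from the orthogonality of the characters [cis]. In the norm [cn] the circle
    of radius r is only known to lie within 2 r, and the factor 4 is 2 from [int01_le] times 2 from
    [cn_cis]. *)
Lemma coef_est (p : {poly R[i]}) (r M : R) k : 0 < r ->
  (forall z, cn z <= 2 * r -> cn p.[z] <= M) -> cn p`_k * r ^+ k <= 4 * M.
Proof.
move=> r0 hM.
have hc n a : cont01 (fun s => a * (cis s ^+ n * (cis s ^+ k)^*)).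
  by apply/cont01Z/cont01M; [exact/cont01_cisX|exact/cont01_cisXJ].
have E : int01 (fun s => p.[r%:C * cis s] * (cis s ^+ k)^*) = p`_k * r%:C ^+ k.
  rewrite (eq_int01 (g := fun s => \sum_(j < size p) (p`_j * r%:C ^+ j) * (cis s ^+ j * (cis s ^+ k)^*))).
    rewrite int01_sum //.
    transitivity (\sum_(j < size p) (p`_j * r%:C ^+ j) * ((j : nat) == k)%:R).
      apply: eq_bigr => j _; rewrite int01Z ?int01_cis_orth //.
      by apply: cont01M; [exact/cont01_cisX|exact/cont01_cisXJ].
    have [kp|kp] := ltnP k (size p).
      rewrite (bigD1 (Ordinal kp)) //= eqxx mulr1 big1 ?addr0 // => j jk.
      by rewrite (_ : (_ == k) = false) ?mulr0 //; apply: negbTE.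
    rewrite nth_default // mul0r big1 // => j _.
    by rewrite (_ : (_ == k) = false) ?mulr0 // ltn_eqF // (leq_trans (ltn_ord j)).
  move=> s _; rewrite horner_coef mulr_suml; apply: eq_bigr => j _.
  by rewrite exprMn !mulrA.
have ck : cn (p`_k * r%:C ^+ k) = cn p`_k * r ^+ k.
  by rewrite -rmorphXn mulrC cnMR ger0_norm ?exprn_ge0 ?ltW // mulrC.
rewrite -ck -E; apply: (@le_trans _ _ (2 * (M * 2))); last by rewrite (_ : 2 * (M * 2) = 4 * M) //; ring.
apply: int01_le.
  rewrite (_ : (fun s => _) = fun s => \sum_(j < size p) (p`_j * r%:C ^+ j) * (cis s ^+ j * (cis s ^+ k)^*)).
    by auto with sm.
  apply/funext => s; rewrite horner_coef mulr_suml; apply: eq_bigr => j _.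
  by rewrite exprMn !mulrA.
move=> s _; apply: le_trans (cnM _ _) _.
apply: ler_pM; rewrite ?cn_ge0 //; last by rewrite cnJ cisX cn_cis.
by apply: hM; rewrite cnMR gtr0_norm // mulrC ler_pM2r // cn_cis.
Qed.

Lemma ccauchy (u : nat -> R[i]) :
  (forall e : R, 0 < e -> exists N, forall n k, (N <= n)%N -> (N <= k)%N -> cn (u n - u k) <= e) ->
  exists l, forall e : R, 0 < e -> exists N, forall n, (N <= n)%N -> cn (u n - l) <= e.
Proof.
move=> hu.
have real v : (forall e, 0 < e -> exists N, forall n k, (N <= n)%N -> (N <= k)%N -> `|v n - v k| <= e) ->
   exists l : R, forall e, 0 < e -> exists N, forall n, (N <= n)%N -> `|v n - l| <= e.
  move=> hv.
  have /cauchy_cvgP cv : cauchy (v @ \oo)%classic.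
    apply: cauchy_exP => e e0; have e2 : 0 < e / 2 by rewrite divr_gt0.
    have [N hN] := hv _ e2; exists (v N); exists N => // n /= hn.
    rewrite /ball /= distrC; apply: le_lt_trans (hN _ _ hn (leqnn N)) _.
    by rewrite ltr_pdivrMr // mulr_natr mulr2n ltrDl.
  exists (limn v) => e e0.
  have /cvgrPdist_le /(_ e e0) [N _ H] := cv.
  by exists N => n hn; rewrite distrC; exact/H.
have [l1 h1] : exists l, forall e, 0 < e -> exists N, forall n, (N <= n)%N -> `|Re (u n) - l| <= e.
  apply: real => e /hu [N h]; exists N => n k hn hk; rewrite -cReB.
  exact: le_trans (Re_le_cn _) (h _ _ hn hk).
have [l2 h2] : exists l, forall e, 0 < e -> exists N, forall n, (N <= n)%N -> `|Im (u n) - l| <= e.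
  apply: real => e /hu [N h]; exists N => n k hn hk; rewrite -cImB.
  exact: le_trans (Im_le_cn _) (h _ _ hn hk).
exists (l1 +i* l2) => e e0; have e2 : 0 < e / 2 by rewrite divr_gt0.
have [N1 H1] := h1 _ e2; have [N2 H2] := h2 _ e2; exists (maxn N1 N2) => n.
rewrite geq_max => /andP[n1 n2]; rewrite /cn cReB cImB /= [leRHS](splitr e).
by rewrite lerD ?H1 ?H2.
Qed.

End Fourier.

(** * Holomorphic functions as uniform limits of polynomials *)

Section Holomorphic.
Context {R : realType} {m : nat}.
Notation V := 'rV[R[i]]_m.
Implicit Types (P Q f g : V -> R[i]) (U : V -> Prop) (c v w u : V).

Inductive pfun : (V -> R[i]) -> Prop :=
| pfun_cst a : pfun (fun=> a)
| pfun_coord j : pfun (fun v => v 0 j)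
| pfunD P Q : pfun P -> pfun Q -> pfun (fun v => P v + Q v)
| pfunM P Q : pfun P -> pfun Q -> pfun (fun v => P v * Q v).

Lemma pfunZ a P : pfun P -> pfun (fun v => a * P v).
Proof. by apply: pfunM ; exact/pfun_cst. Qed.
Lemma pfunN P : pfun P -> pfun (fun v => - P v).
Proof.
rewrite (_ : (fun v => _) = fun v => -1 * P v); first exact/pfunZ.
by apply/funext => v; rewrite mulN1r.
Qed.
Lemma pfunB P Q : pfun P -> pfun Q -> pfun (fun v => P v - Q v).
Proof. by move=> h1 h2; apply: pfunD => //; exact/pfunN. Qed.
Lemma pfun_sum I l (p : pred I) F :
  (forall k, p k -> pfun (F k)) -> pfun (fun v => \sum_(k <- l | p k) F k v).
Proof.
move=> h; elim: l => [|k l IH]. by under eq_fun do rewrite big_nil; exact/pfun_cst.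
under eq_fun do rewrite big_cons; case pk: (p k) => //.
by apply: pfunD => //; exact/h.
Qed.
Lemma pfun_prod I l (p : pred I) F :
  (forall k, p k -> pfun (F k)) -> pfun (fun v => \prod_(k <- l | p k) F k v).
Proof.
move=> h; elim: l => [|k l IH]. by under eq_fun do rewrite big_nil; exact/pfun_cst.
under eq_fun do rewrite big_cons; case pk: (p k) => //.
by apply: pfunM => //; exact/h.
Qed.
Lemma pfunX P n : pfun P -> pfun (fun v => P v ^+ n).
Proof.
move=> h; elim: n => [|n IH]; first exact/pfun_cst.
by under eq_fun do rewrite exprS; exact/pfunM.
Qed.
Lemma pfun_poly (p : {poly R[i]}) P : pfun P -> pfun (fun v => p.[P v]).
Proof.
move=> h; under eq_fun do rewrite horner_coef.
by apply: pfun_sum => k _; exact/pfunZ/pfunX.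
Qed.

Lemma pfun_line P u c : pfun P -> exists p : {poly R[i]}, forall z, P (c + z *: u) = p.[z].
Proof.
elim=> [a|j|P1 P2 _ [p1 h1] _ [p2 h2]|P1 P2 _ [p1 h1] _ [p2 h2]].
- by exists a%:P => z; rewrite hornerC.
- by exists ((c 0 j)%:P + (u 0 j) *: 'X) => z; rewrite !mxE !hornerE mulrC.
- by exists (p1 + p2) => z; rewrite h1 h2 hornerD.
- by exists (p1 * p2) => z; rewrite h1 h2 hornerM.
Qed.

(** The last clause reads the derivative off the restriction to a line, as its linear coefficient;
    this is the form to which [coef_est] applies. *)
Lemma pfun_der P j : pfun P -> exists Q, [/\ pfun Q,
  forall b w, pder (j, b) P w (cunit (j, b) * Q w)
  & forall c, exists2 p : {poly R[i]}, forall z, P (c + z *: delta_mx 0 j) = p.[z] & Q c = p`_1].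
Proof.
elim=> [a|k|P1 P2 _ [Q1 [a1 b1 c1]] _ [Q2 [a2 b2 c2]]|P1 P2 h1 [Q1 [a1 b1 c1]] h2 [Q2 [a2 b2 c2]]].
- exists (fun=> 0); split.
  + exact/pfun_cst.
  + by move=> b w; rewrite mulr0; exact/cder_cst.
  + by exists a%:P => [z|]; rewrite ?hornerC ?coefC.
- exists (fun=> (k == j)%:R); split.
  + exact/pfun_cst.
  + move=> b w; exact/pder_coord.
  + move=> c; exists ((c 0 k)%:P + (k == j)%:R *: 'X) => [z|]. by rewrite !mxE !hornerE mulrC.
    by rewrite coefD coefC coefZ coefX add0r mulr1.
- exists (fun v => Q1 v + Q2 v); split.
  + exact/pfunD.
  + by move=> b w; rewrite mulrDr; exact/pderD.
  + move=> c; have [p1 e1 q1] := c1 c; have [p2 e2 q2] := c2 c.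
    by exists (p1 + p2) => [z|]; rewrite ?e1 ?e2 ?hornerD ?coefD ?q1 ?q2.
- exists (fun v => Q1 v * P2 v + P1 v * Q2 v); split.
  + by apply: pfunD; exact/pfunM.
  + move=> b w; rewrite mulrDr mulrA [cunit _ * (P1 w * _)]mulrCA; exact/pderM.
  + move=> c; have [p1 e1 q1] := c1 c; have [p2 e2 q2] := c2 c.
    exists (p1 * p2) => [z|]; first by rewrite e1 e2 hornerM.
    have := e1 0; have := e2 0; rewrite scale0r addr0 !horner_coef0 => -> ->.
    by rewrite coefM !big_ord_recr big_ord0 /= add0r q1 q2 addrC.
Qed.

Lemma pfun_jcont P w s : pfun P -> jcont (fun v _ => P v) w s.
Proof.
elim=> [a|k|P1 P2 _ h1 _ h2|P1 P2 _ h1 _ h2].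
- exact/jcont_cst.
- exact/jcont_coord.
- exact/jcontD.
- exact/jcontM.
Qed.

(** Uniform approximation by polynomials on a polydisc serves as holomorphy. It passes to sums,
    products and derivatives ([papp_der]), and symmetric expressions in roots can be treated at the
    level of the approximating polynomials. *)
Definition papp r c f : Prop :=
  forall e : R, 0 < e -> exists2 P, pfun P & forall v, nearv r c v -> cn (f v - P v) <= e.

Definition hol U f : Prop := forall w, U w -> exists2 r : R, 0 < r & papp r w f.

Lemma nearv_line r c j z : cn z < r -> nearv r c (c + z *: delta_mx 0 j).
Proof.
move=> h k; rewrite !mxE addrAC subrr add0r; case: (k == j); rewrite ?mulr1 //.
by rewrite mulr0 cn0; exact: le_lt_trans (cn_ge0 _) h.
Qed.

Lemma cauchy_der P Q j (r M : R) c v : pfun P -> 0 < r ->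
  (forall c, exists2 p : {poly R[i]}, forall z, P (c + z *: delta_mx 0 j) = p.[z] & Q c = p`_1) ->
  (forall v, nearv r c v -> cn (P v) <= M) -> nearv (r / 2) c v -> cn (Q v) <= 20 * M / r.
Proof.
move=> hP r0 hQ hM hv; have [p e1 e2] := hQ v; rewrite e2.
(* The disc of size 2 r / 5 around v stays in the polydisc of radius r, because r / 2 + 2 r / 5 < r;
   the 20 of the statement is 4 times 5. *)
have r5 : 0 < r / 5 by rewrite divr_gt0.
have := @coef_est _ p (r / 5) M 1 r5; rewrite expr1 ler_pdivlMr // => H.
have : cn p`_1 * (r / 5) <= 4 * M. apply: H => z hz; rewrite -e1; apply: hM.
  apply: (@nearv_le _ _ (r / 2 + r / 2)); first by rewrite -splitr.
  apply: nearv_trans hv _; apply: nearv_line; apply: le_lt_trans hz _.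
  by rewrite mulrCA ltr_pM2l //; lra.
lra.
Qed.

Lemma pderB i f g w d e : pder i f w d -> pder i g w e -> pder i (fun v => f v - g v) w (d - e).
Proof.
move=> h1 h2; have hc : pder i (fun=> -1) w 0 by exact/cder_cst.
have := pderD h1 (pderM hc h2); rewrite mul0r add0r mulN1r.
by under [in X in X -> _]eq_fun do rewrite mulN1r.
Qed.

Lemma nearv_room (r : R) c v : 0 < r -> nearv r c v -> exists2 d : R, 0 < d & nearv (r - d) c v.
Proof.
move=> r0 h; pose M := \big[Num.max/0]_j cn (v 0 j - c 0 j).
have Mr : M < r by apply: bigmax_lt.
exists ((r - M) / 2); first by rewrite divr_gt0 // subr_gt0.
move=> j; apply: (@le_lt_trans _ _ M); first exact/le_bigmax.
by lra.
Qed.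

(** The derivatives of the approximants P_n form a uniform Cauchy sequence on the half polydisc, by
    [cauchy_der], and g is their limit. That g is the derivative of f follows from the mean value
    inequality for P_k - P_N with k arbitrarily large. *)
Lemma papp_der (r : R) c f j : 0 < r -> papp r c f -> exists2 g, papp (r / 2) c g &
  forall b v, nearv (r / 2) c v -> pder (j, b) f v (cunit (j, b) * g v).
Proof.
move=> r0 hf.
have r2 : 0 < r / 2 by rewrite divr_gt0.
have en n : 0 < n.+1%:R^-1 :> R by rewrite invr_gt0.
have /choice [P HP] : forall n, exists P, pfun P /\ forall v, nearv r c v -> cn (f v - P v) <= n.+1%:R^-1.
  by move=> n; have [P h1 h2] := hf _ (en n); exists P.
have /choice [Q HQ] := fun n => @pfun_der (P n) j (HP n).1.
have small (e : R) : 0 < e -> exists N, forall n, (N <= n)%N -> n.+1%:R^-1 <= e.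
  move=> e0; exists (Num.truncn e^-1) => n hn.
  rewrite -[leRHS]invrK lef_pV2 ?posrE ?invr_gt0 //.
  apply: ltW; apply: lt_le_trans (truncnS_gt _) _.
  by rewrite ler_nat.
have dPn n k v e : (forall v, nearv r c v -> cn (f v - P n v) <= e) ->
    (forall v, nearv r c v -> cn (f v - P k v) <= e) ->
    nearv (r / 2) c v -> cn (Q n v - Q k v) <= 40 * e / r.
  move=> h1 h2 hv.
  have [_ _ cn_] := HQ n; have [_ _ ck_] := HQ k.
  have := @cauchy_der (fun v => P n v - P k v) (fun v => Q n v - Q k v) j r (2 * e) c v.
  rewrite (_ : 20 * (2 * e) / r = 40 * e / r); last by ring.
  apply=> //; first by apply: pfunB; [exact: (HP n).1|exact: (HP k).1].
    move=> d; have [p e1 q1] := cn_ d; have [p2 e2 q2] := ck_ d.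
    by exists (p - p2) => [z|]; rewrite ?e1 ?e2 ?hornerD ?hornerN // coefB q1 q2.
  move=> u hu; apply: le_trans (cn_triangle (f u) _ _) _.
  by rewrite mulr2n mulrDl mul1r lerD ?h2 // cnB h1.
have fP n : forall v, nearv r c v -> cn (f v - P n v) <= n.+1%:R^-1 by case: (HP n).
have mono n N v : (N <= n)%N -> nearv r c v -> cn (f v - P n v) <= N.+1%:R^-1.
  by move=> h hv; apply: le_trans (fP n v hv) _; rewrite lef_pV2 ?posrE // ler_nat.
have /choice [g Hg] : forall v, exists l, nearv (r / 2) c v -> forall e : R, 0 < e ->
    exists N, forall n, (N <= n)%N -> cn (Q n v - l) <= e.
  move=> v; have [hv|hv] := pselect (nearv (r / 2) c v); last by exists 0.
  suff [l hl] : exists l, forall e, 0 < e -> exists N, forall n, (N <= n)%N -> cn (Q n v - l) <= e by exists l.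
  apply: ccauchy.
  move=> e e0; have [N HN] := small (e * r / 40) (divr_gt0 (mulr_gt0 e0 r0) (ltr0Sn _ _)).
  exists N => n k hn hk; apply: (@le_trans _ _ (40 * (e * r / 40) / r)); last first.
    by rewrite mulrA [40 * _]mulrC mulfK // mulfK // gt_eqF.
  apply: dPn hv => u hu; apply: le_trans (fP _ _ hu) _; exact/HN.
have gP n v : nearv (r / 2) c v -> cn (g v - Q n v) <= 40 * n.+1%:R^-1 / r.
  move=> hv; apply/ler_addgt0Pr => e e0; have [N HN] := Hg v hv e e0.
  apply: le_trans (cn_triangle (Q (maxn N n) v) _ _) _; rewrite addrC lerD //.
    by apply: dPn hv => u hu; apply: mono => //; exact/leq_maxr.
  by rewrite cnB HN // leq_maxl.
exists g. move=> e e0; have [N HN] := small (e * r / 40) (divr_gt0 (mulr_gt0 e0 r0) (ltr0Sn _ _)).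
  exists (Q N); first by case: (HQ N).
  move=> v hv; apply: le_trans (gP N v hv) _.
  rewrite ler_pdivrMr // mulrC -ler_pdivlMr //; exact/HN.
move=> b v hv; apply/cder_epsP => e e0.
have [d d0 hd] : exists2 d, 0 < d & nearv (r / 2 - d) c v.
  have [d d0 hd] := @nearv_room (r / 2) c v r2 hv.
  by exists d.
pose C n : R := 40 * n.+1%:R^-1 / r.
have [N HN] := small (e / 4 * r / 40) (divr_gt0 (mulr_gt0 (divr_gt0 e0 (ltr0Sn _ _)) r0) (ltr0Sn _ _)).
have CN : C N <= e / 4. by rewrite /C ler_pdivrMr // mulrC -ler_pdivlMr //; exact/HN.
have [_ dP _] := HQ N.
have e4 : 0 < e / 4 by rewrite divr_gt0.
have /cder_epsP /(_ _ e4) [r1 r10 Hr1] := dP b v.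
exists (Num.min r1 d); first by rewrite lt_min r10.
move=> h; rewrite lt_min => /andP[hr1 hd1].
have := Hr1 _ hr1; rewrite !add0r axis0 => H1.
have nr t : `|t| <= `|h| -> nearv (r / 2) c (axis_line (j, b) v t).
  move=> ht; apply: (@nearv_le _ _ (r / 2 - d + d)); first by rewrite subrK.
  by apply: nearv_trans hd _; apply: nearv_axis; exact: le_lt_trans ht hd1.
have toR t : `|t| <= `|h| -> nearv r c (axis_line (j, b) v t).
  by move=> ht; apply: (nearv_le _ (nr _ ht)); rewrite ler_pdivrMr // ler_peMr ?ltW // ltr1n.
(* Here k is taken after t: replacing f by P_k costs at most t, while the derivatives of P_k and P_N
   differ by at most C N for every k >= N. *)
have H2 : cn ((f (axis_line (j, b) v h) - P N (axis_line (j, b) v h)) - (f v - P N v)) <= 2 * C N * `|h|.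
  apply/ler_addgt0Pr => t t0; have t2 : 0 < t / 2 by rewrite divr_gt0.
  have [K HK] := small _ t2; pose k := maxn K N.
  have [_ dk _] := HQ k.
  have := @cmvt R (fun s => P k (axis_line (j, b) v s) - P N (axis_line (j, b) v s))
     (fun s => cunit (j, b) * Q k (axis_line (j, b) v s) - cunit (j, b) * Q N (axis_line (j, b) v s)) 0 (C N) h.
  rewrite mulr0 subr0 axis0 => H.
  have {}H : cn (P k (axis_line (j, b) v h) - P N (axis_line (j, b) v h) - (P k v - P N v)) <= 2 * C N * `|h|.
    apply: H => x hx.
      have pl F G : (forall w, pder (j, b) F w (G w)) -> cder (fun s => F (axis_line (j, b) v s)) x (G (axis_line (j, b) v x)).
        move=> hF; apply/cder_epsP => t' t'0; have /cder_epsP /(_ _ t'0) [q q0 Hq] := hF (axis_line (j, b) v x).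
        exists q => // y hy; have := Hq _ hy.
        by rewrite add0r axis0 axisD.
      apply: (pl (fun w => P k w - P N w) (fun w => cunit (j, b) * Q k w - cunit (j, b) * Q N w)) => w.
      exact/pderB.
    rewrite subr0 -mulrBr; apply: le_trans (cnM _ _) _; rewrite cn_cunit mul1r.
    by apply: dPn (nr _ hx) => u hu; apply: mono => //; exact/leq_maxr.
  have fk s : `|s| <= `|h| -> cn (f (axis_line (j, b) v s) - P k (axis_line (j, b) v s)) <= t / 2.
    move=> hs; apply: le_trans (mono k K _ (leq_maxl _ _) (toR _ hs)) _; exact/HK.
  have f0 := fk 0; rewrite normr0 axis0 normr_ge0 in f0.
  rewrite (_ : _ - _ = (P k (axis_line (j, b) v h) - P N (axis_line (j, b) v h) - (P k v - P N v)) +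
     ((f (axis_line (j, b) v h) - P k (axis_line (j, b) v h)) - (f v - P k v))); last by ring.
  apply: le_trans (cnD _ _) _; rewrite lerD // [leRHS]splitr.
  apply: le_trans (cnD _ _) _; rewrite cnN lerD ?f0 //; exact/fk.
rewrite (_ : _ - _ - _ = ((f (axis_line (j, b) v h) - P N (axis_line (j, b) v h)) - (f v - P N v))
  + (P N (axis_line (j, b) v h) - P N v - h%:C * (cunit (j, b) * Q N v))
  + h%:C * (cunit (j, b) * (Q N v - g v))); last by ring.
apply: (@le_trans _ _ (2 * C N * `|h| + e / 4 * `|h| + `|h| * C N)).
  apply: le_trans (cnD _ _) _; apply: lerD; last first.
    rewrite cnMR ler_wpM2l //; apply: le_trans (cnM _ _) _; rewrite cn_cunit mul1r cnB.
    exact/gP.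
  by apply: le_trans (cnD _ _) _; exact/lerD.
have h0 := normr_ge0 h; nra.
Qed.
Lemma papp_ext r c f g : (forall v, nearv r c v -> f v = g v) -> papp r c f -> papp r c g.
Proof. by move=> fg hf e /hf [P hP H]; exists P => // v hv; rewrite -fg // H. Qed.
Lemma papp_pfun r c P : pfun P -> papp r c P.
Proof. by exists P => // v _; rewrite subrr cn0 ltW. Qed.

Lemma nearv_bound r c v j : nearv r c v -> cn (v 0 j) <= r + cn (c 0 j).
Proof.
move=> /(_ j) h; rewrite -[v 0 j](subrK (c 0 j)); apply: le_trans (cnD _ _) _.
by rewrite lerD2r ltW.
Qed.

Lemma pfun_bound r c P : pfun P -> exists2 M : R, 0 <= M & forall v, nearv r c v -> cn (P v) <= M.
Proof.
elim=> [a|j|P1 P2 _ [M1 p1 h1] _ [M2 p2 h2]|P1 P2 _ [M1 p1 h1] _ [M2 p2 h2]].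
- by exists (cn a) => //; exact/cn_ge0.
- exists (Num.max 0 (r + cn (c 0 j))); first by rewrite le_max lexx.
  by move=> v /nearv_bound h; rewrite le_max h orbT.
- exists (M1 + M2); first exact/addr_ge0.
  by move=> v hv; apply: le_trans (cnD _ _) _; rewrite lerD ?h1 ?h2.
- exists (M1 * M2); first exact/mulr_ge0.
  by move=> v hv; apply: le_trans (cnM _ _) _; apply: ler_pM; rewrite ?cn_ge0 ?h1 ?h2.
Qed.

Lemma papp_bound r c f : papp r c f -> exists2 M : R, 0 <= M & forall v, nearv r c v -> cn (f v) <= M.
Proof.
move=> /(_ 1 ltr01) [P /(@pfun_bound r c) [M M0 hM] H]; exists (1 + M); first by rewrite addr_ge0.
move=> v hv; rewrite -[f v](subrK (P v)); apply: le_trans (cnD _ _) _.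
by rewrite lerD ?H ?hM.
Qed.

Lemma pappD r c f g : papp r c f -> papp r c g -> papp r c (fun v => f v + g v).
Proof.
move=> hf hg e e0; have e2 : 0 < e / 2 by rewrite divr_gt0.
have [P hP HP] := hf _ e2; have [Q hQ HQ] := hg _ e2.
exists (fun v => P v + Q v); first exact/pfunD.
move=> v hv; rewrite opprD addrACA [leRHS]splitr; apply: le_trans (cnD _ _) _.
by rewrite lerD ?HP ?HQ.
Qed.

Lemma pappM r c f g : papp r c f -> papp r c g -> papp r c (fun v => f v * g v).
Proof.
move=> hf hg e e0; have [M M0 hM] := papp_bound hf; have [K K0 hK] := papp_bound hg.
have D0 : 0 < M + K + 1 by rewrite ltr_wpDl // addr_ge0.
pose t := Num.min 1 (e / (M + K + 1)).
have t0 : 0 < t by rewrite lt_min ltr01 divr_gt0.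
have [P hP HP] := hf _ t0; have [Q hQ HQ] := hg _ t0.
exists (fun v => P v * Q v); first exact/pfunM.
move=> v hv; rewrite (_ : _ - _ = f v * (g v - Q v) + (f v - P v) * Q v); last by ring.
apply: le_trans (cnD _ _) _.
have hQv : cn (Q v) <= K + 1.
  rewrite -[Q v](subrK (g v)) addrC; apply: le_trans (cnD _ _) _; rewrite lerD ?hK //.
  by rewrite cnB; apply: le_trans (HQ v hv) _; rewrite ge_min lexx.
apply: (@le_trans _ _ (M * t + t * (K + 1))).
  by apply: lerD; apply: le_trans (cnM _ _) _; apply: ler_pM; rewrite ?cn_ge0 ?hM ?HQ ?HP.
by rewrite mulrC -mulrDr addrA -ler_pdivlMr // ge_min lexx orbT.
Qed.

Lemma papp_jcont (r : R) c f s : 0 < r -> papp r c f -> jcont (fun v _ => f v) c s.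
Proof.
move=> r0 hf e e0; have e4 : 0 < e / 4 by rewrite divr_gt0.
have [P hP HP] := hf _ e4; have [d d0 hd] := @pfun_jcont P c s hP _ e4.
exists (Num.min r d); first by rewrite lt_min r0.
move=> v s' hv hs.
have h1 : nearv r c v by apply: nearv_le hv; rewrite ge_min lexx.
have h2 : cn (P v - P c) < e / 4.
  apply: (hd v s'); first by apply: nearv_le hv; rewrite ge_min lexx orbT.
  by apply: lt_le_trans hs _; rewrite ge_min lexx orbT.
have h3 := HP _ h1; have h4 := HP c (nearv_refl c r0).
have := cn_triangle (P v) (f v) (f c); have := cn_triangle (P c) (P v) (f c).
rewrite [cn (P c - f c)]cnB; lra.
Qed.

Lemma hol_partial U f i : hol U f -> hol U (partial i f) /\ (forall w, U w -> pder i f w (partial i f w)).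
Proof.
case: i => j b hf; have key w : U w -> exists2 r, 0 < r & exists2 g, papp r w g &
    forall v, nearv r w v -> pder (j, b) f v (cunit (j, b) * g v).
  move=> /hf [r r0 hr]; have [g h1 h2] := papp_der j r0 hr.
  exists (r / 2); first by rewrite divr_gt0.
  by exists g => // v; exact/h2.
split=> w /key [r r0 [g h1 h2]].
  exists r => //; apply: (@papp_ext r w (fun v => cunit (j, b) * g v)).
    by move=> v hv; rewrite (pderE (h2 v hv)).
  by apply: pappM => //; exact/papp_pfun/pfun_cst.
have hw := h2 w (nearv_refl w r0).
by rewrite (pderE hw).
Qed.

Lemma hol_Cf U f r : dopen (fun w _ => U w) -> hol U f -> Cf (fun w _ => U w) r (fun w _ => f w).
Proof.
move=> oU; elim: r f => [|r IH] f hf. by split => // w s /hf [d d0 hd]; exact: papp_jcont hd.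
apply: (@Cf_step R m (fun w _ => U w) r (fun w _ => f w) (fun i w _ => partial i f w)).
- exact/oU.
- move=> w s /hf [d d0 hd]; exact: papp_jcont hd.
- by move=> i w s /(hol_partial i hf).2.
- by move=> i; apply: IH; exact: (hol_partial i hf).1.
Qed.

Definition entire f : Prop := forall r : R, 0 < r -> papp r 0 f.

Lemma papp_recenter (r d : R) c w f : nearv d c w -> 0 < r -> papp (d + r) c f -> papp r w f.
Proof.
move=> hd r0 hf e /hf [P hP H]; exists P => // v hv; apply: H; exact: nearv_trans hd hv.
Qed.

Lemma nearv0_ex w : exists2 d : R, 0 < d & nearv d 0 w.
Proof.
exists (1 + \sum_j cn (w 0 j)); first by rewrite ltr_pwDl // sumr_ge0 // => j _; exact/cn_ge0.
move=> j; rewrite mxE subr0 (bigD1 j) //= addrCA -[ltLHS]addr0 ltrD2l ltr_pwDl //.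
by rewrite sumr_ge0 // => k _; exact/cn_ge0.
Qed.

Lemma entire_papp f (r : R) w : entire f -> 0 < r -> papp r w f.
Proof.
move=> hf r0; have [d d0 hd] := nearv0_ex w; apply: (papp_recenter hd r0).
by apply: hf; rewrite addr_gt0.
Qed.

Lemma entire_smooth f : entire f -> smooth f.
Proof.
move=> hf; apply/smoothP => r; apply: (@hol_Cf (fun=> True)); first exact/dopenT.
by exists 1 => //; exact/entire_papp.
Qed.
Lemma entireD f g : entire f -> entire g -> entire (fun v => f v + g v).
Proof. by move=> hf hg r r0; apply: pappD; auto with sm. Qed.
Lemma entireM f g : entire f -> entire g -> entire (fun v => f v * g v).
Proof. by move=> hf hg r r0; apply: pappM; auto with sm. Qed.
Lemma entire_pfun P : pfun P -> entire P.
Proof. move=> hP r _; exact/papp_pfun. Qed.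
Lemma entire_cst a : entire (fun=> a).
Proof. exact/entire_pfun/pfun_cst. Qed.
Lemma entire_sum I l (p : pred I) F :
  (forall k, p k -> entire (F k)) -> entire (fun v => \sum_(k <- l | p k) F k v).
Proof.
move=> h; elim: l => [|k l IH]. by under eq_fun do rewrite big_nil; exact/entire_cst.
under eq_fun do rewrite big_cons; case pk: (p k) => //.
by apply: entireD => //; exact/h.
Qed.
Lemma entire_prod I l (p : pred I) F :
  (forall k, p k -> entire (F k)) -> entire (fun v => \prod_(k <- l | p k) F k v).
Proof.
move=> h; elim: l => [|k l IH]. by under eq_fun do rewrite big_nil; exact/entire_cst.
under eq_fun do rewrite big_cons; case pk: (p k) => //.
by apply: entireM => //; exact/h.
Qed.
Lemma entireX f n : entire f -> entire (fun v => f v ^+ n).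
Proof.
move=> h; elim: n => [|n IH]; first exact/entire_cst.
by under eq_fun do rewrite exprS; exact/entireM.
Qed.

Definition entire1 (h : R[i] -> R[i]) : Prop := forall r e : R, 0 < e ->
  exists p : {poly R[i]}, forall z, cn z <= r -> cn (h z - p.[z]) <= e.

Lemma entire1_pfun h P : entire1 h -> pfun P -> entire (fun v => h (P v)).
Proof.
move=> hh hP r r0 e e0; have [M M0 hM] := pfun_bound r 0 hP.
have [p hp] := hh M e e0; exists (fun v => p.[P v]); first exact/pfun_poly.
by auto with sm.
Qed.

Lemma entire_line f c u : entire f -> entire1 (fun z => f (c + z *: u)).
Proof.
move=> hf r e e0.
pose K : R := 1 + \sum_j (cn (c 0 j) + `|r| * cn (u 0 j)).
have K0 : 0 < K. by rewrite ltr_pwDl // sumr_ge0 // => j _; rewrite addr_ge0 ?mulr_ge0 ?cn_ge0.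
have [P hP H] := hf K K0 e e0.
have [p hp] := pfun_line u c hP; exists p => z hz; rewrite -hp; apply: H => j.
rewrite !mxE subr0; apply: le_lt_trans (cnD _ _) _.
have hzu : cn (z * u 0 j) <= `|r| * cn (u 0 j). apply: le_trans (cnM _ _) _.
  by rewrite ler_wpM2r ?cn_ge0 // (le_trans hz) // ler_norm.
have S0 : 0 <= \sum_(k | k != j) (cn (c 0 k) + `|r| * cn (u 0 k)).
  by rewrite sumr_ge0 // => k _; rewrite addr_ge0 ?mulr_ge0 ?cn_ge0.
rewrite /K (bigD1 j) //=; lra.
Qed.
End Holomorphic.

#[local] Hint Resolve pfun_cst pfun_coord pfunD pfunM pfunN pfunB pfun_sum pfun_prod pfunX entireD entireM
  entire_pfun entire_cst entire_sum entire_prod entireX : sm.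

(** * The identity theorem *)

Section Identity.
Context {R : realType}.

(** The coefficients of an approximating polynomial obey two bounds: at most 4 t / r^k, since h
    vanishes near 0, and at most C / (2 K r)^k. As |z| <= K r, the first N terms are controlled by t
    and the rest by a geometric series; t is chosen after N. *)
Lemma identity0 h (d : R) : entire1 h -> 0 < d ->
  (forall z, cn z < d -> h z = 0) -> forall z, h z = 0.
Proof.
move=> hh d0 hd z; apply: cn_small => e e0.
pose r := d / 4; have r0 : 0 < r by rewrite divr_gt0.
pose K : R := 1 + cn z / r.
have K1 : 1 <= K by rewrite lerDl divr_ge0 ?cn_ge0 ?ltW.
have K0 : 0 < K by apply: lt_le_trans K1.
have zK : cn z <= K * r. by rewrite mulrDl mul1r divfK ?gt_eqF // lerDr ltW.
have [p0 hp0] := hh (4 * K * r) 1 ltr01.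
have [M M0 hM] : exists2 M, 0 < M & forall u, cn u <= 4 * K * r -> cn (h u) <= M.
  exists (1 + \sum_(i < size p0) cn p0`_i * (4 * K * r) ^+ i).
    rewrite ltr_pwDl // sumr_ge0 // => i _; rewrite mulr_ge0 ?cn_ge0 ?exprn_ge0 //.
    by rewrite !mulr_ge0 // ltW.
  move=> u hu; rewrite -[h u](subrK p0.[u]); apply: le_trans (cnD _ _) _.
  rewrite lerD ?hp0 // horner_coef; apply: le_trans (cn_sum _ _ _) _.
  apply: ler_sum => i _; apply: le_trans (cnM _ _) _; rewrite ler_wpM2l ?cn_ge0 //.
  by apply: le_trans (cn_powb _ _) _; rewrite lerXn2r ?nnegrE ?cn_ge0 // (le_trans (cn_ge0 _) hu).
pose C := 4 * (M + 1).
have C0 : 0 < C by rewrite mulr_gt0 // addr_gt0.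
have [N HN] : exists N, C * (2^-1) ^+ N * 2 <= e / 4.
  have /cvgrPdist_le /(_ (e / 4 / (2 * C))) : ((fun n => (2^-1 : R) ^+ n) @ \oo --> 0)%classic.
    by apply: cvg_expr; rewrite gtr0_norm ?invr_gt0 // invf_lt1 // ltr1n.
  have e' : 0 < e / 4 / (2 * C) by apply: divr_gt0; [apply: divr_gt0|apply: mulr_gt0].
  move=> /(_ e') [N _ /(_ N (leqnn N))] /=; rewrite sub0r normrN ger0_norm ?exprn_ge0 ?invr_ge0 //.
  have C2 : 0 < 2 * C by exact/mulr_gt0.
  by rewrite ler_pdivlMr // => hN; exists N; rewrite (_ : _ * 2 = 2^-1 ^+ N * (2 * C)) //; ring.
pose S : R := \sum_(i < N) 4 * K ^+ i.
have S0 : 0 <= S by rewrite sumr_ge0 // => i _; rewrite mulr_ge0 ?exprn_ge0 // ltW.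
pose t := Num.min 1 (Num.min (e / 4) (e / 4 / (S + 1))).
have S1 : 0 < S + 1 by rewrite ltr_wpDl.
have t0 : 0 < t by rewrite !lt_min ltr01 !divr_gt0.
have t1 : t <= 1 by rewrite ge_min lexx.
have t2 : t <= e / 4 by rewrite !ge_min lexx orbT.
have t3 : t <= e / 4 / (S + 1) by rewrite !ge_min lexx !orbT.
have [p hp] := hh (4 * K * r) t t0.
have small k : cn p`_k * r ^+ k <= 4 * t.
  apply: coef_est => // u hu; have ud : cn u < d by apply: le_lt_trans hu _; rewrite /r; lra.
  have := hp u; rewrite hd // sub0r cnN; apply; apply: le_trans hu _.
  have := ler_wpM2r (ltW r0) K1; lra.
have big k : cn p`_k * (2 * K * r) ^+ k <= C.
  apply: coef_est => [|u hu]; first by rewrite !mulr_gt0.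
  have hu' : cn u <= 4 * K * r by apply: le_trans hu _; lra.
  rewrite -[p.[u]](subrK (h u)); apply: le_trans (cnD _ _) _; rewrite addrC lerD ?hM //.
  by rewrite cnB (le_trans (hp u hu')).
have cp i : cn (p`_i * z ^+ i) <= cn p`_i * (K * r) ^+ i.
  apply: le_trans (cnM _ _) _; rewrite ler_wpM2l ?cn_ge0 //.
  by apply: le_trans (cn_powb _ _) _; rewrite lerXn2r ?nnegrE ?cn_ge0 // (le_trans (cn_ge0 _) zK).
have pz : cn p.[z] <= S * t + C * (2^-1) ^+ N * 2.
  rewrite (@horner_coef_wide _ (N + size p)) ?leq_addl // big_split_ord /=.
  apply: le_trans (cnD _ _) _; apply: lerD.
    apply: le_trans (cn_sum _ _ _) _; rewrite /S mulr_suml; apply: ler_sum => i _.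
    apply: le_trans (cp _) _; rewrite exprMn.
    rewrite (_ : cn _ * _ = K ^+ i * (cn p`_i * r ^+ i)); last by ring.
    rewrite (_ : _ * t = K ^+ i * (4 * t)); last by ring.
    by rewrite ler_wpM2l ?exprn_ge0 ?(ltW K0).
  apply: le_trans (cn_sum _ _ _) _.
  apply: (@le_trans _ _ (\sum_(i < size p) C * (2^-1) ^+ N * (2^-1) ^+ i)).
    apply: ler_sum => i _; apply: le_trans (cp _) _.
    have := big (N + i)%N; rewrite -mulrA exprMn mulrCA => hN.
    rewrite -mulrA -exprD exprVn -ler_pdivrMr ?invr_gt0 ?exprn_gt0 // invrK mulrC.
    exact/hN.
  rewrite -mulr_sumr; apply: ler_wpM2l.
    by apply: mulr_ge0; [exact/ltW|rewrite exprn_ge0 // invr_ge0].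
  elim: (size p) => [|n IH]; first by rewrite big_ord0.
  rewrite big_ord_recl expr0; under eq_bigr do rewrite lift0 exprS.
  by rewrite -mulr_sumr; lra.
rewrite -[h z](subrK p.[z]); apply: le_trans (cnD _ _) _.
have zr : cn z <= 4 * K * r. by apply: le_trans zK _; rewrite -mulrA; have := mulr_gt0 K0 r0; lra.
have hz := hp z zr.
have St : S * t <= e / 4.
  rewrite ler_pdivlMr // in t3; apply: le_trans t3; rewrite mulrC ler_wpM2l ?ltW //; lra.
lra.
Qed.

Context {m : nat}.
Notation V := 'rV[R[i]]_m.

(** If f vanished on a polydisc around w, [identity0] on the line from w through v0 would give f v0
    = 0. *)
Lemma entire_dense (f : V -> R[i]) v0 w (d : R) : entire f -> f v0 != 0 -> 0 < d ->
  exists2 v, nearv d w v & f v != 0.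
Proof.
move=> hf f0 d0; apply: contrapT => H.
have Z v : nearv d w v -> f v = 0. by move=> hv; apply: contrapT => /eqP fv; apply: H; exists v.
have hl := entire_line w (v0 - w) hf.
have [k k0 hk] := nearv0_ex (v0 - w).
have := @identity0 _ (d / k) hl (divr_gt0 d0 k0) _ 1; rewrite scale1r [w + _]addrC subrK => E.
move: f0; rewrite E ?eqxx // => z hz; apply: Z => j.
rewrite !mxE addrAC subrr add0r; apply: le_lt_trans (cnM _ _) _.
have := hk j; rewrite !mxE subr0 => hkj.
rewrite ltr_pdivlMr // in hz; apply: le_lt_trans hz.
by rewrite ler_wpM2l ?cn_ge0 // ltW.
Qed.

Lemma entire_neq0_near (f : V -> R[i]) v : entire f -> f v != 0 -> exists2 d : R, 0 < d &
  forall u, nearv d v u -> f u != 0.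
Proof.
move=> hf f0; have c0 : 0 < cn (f v).
  by rewrite lt_neqAle cn_ge0 andbT eq_sym; apply: contra f0 => /eqP /cn_eq0 ->.
have [d d0 hd] := @papp_jcont _ _ 1 v f 0 ltr01 (entire_papp v hf ltr01) _ c0.
exists d => // u hu; have := hd u 0 hu; rewrite subrr normr0 => /(_ d0) h.
by apply: contraTneq h => ->; rewrite sub0r cnN ltxx.
Qed.

Lemma entireM_neq0 (f g : V -> R[i]) v1 v2 : entire f -> entire g -> f v1 != 0 -> g v2 != 0 ->
  exists v, f v * g v != 0.
Proof.
move=> hf hg h1 h2; have [d d0 hd] := entire_neq0_near hf h1.
by have [v hv gv] := entire_dense v1 hg h2 d0; exists v; rewrite mulf_neq0 ?hd.
Qed.

Lemma entire_prod_neq0 I l (p : pred I) (F : I -> V -> R[i]) :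
  (forall k, p k -> entire (F k)) -> (forall k, p k -> exists v, F k v != 0) ->
  exists v, \prod_(k <- l | p k) F k v != 0.
Proof.
move=> h1 h2; elim: l => [|k l [v IH]]; first by exists 0; rewrite big_nil.
case pk: (p k); last by exists v; rewrite big_cons pk.
have [v' h] := h2 k pk.
have [u hu] := entireM_neq0 (h1 k pk) (entire_prod l h1) h IH.
by exists u; rewrite big_cons pk.
Qed.

End Identity.

(** * Elementary symmetric functions and the roots of a polynomial *)

Section ElemSym.
Context {R : realType}.
Notation C := R[i].
Notation V m := 'rV[R[i]]_m.

(** The monic polynomial whose signed coefficients are e; its roots are the coordinates w_j of any
    preimage of e under [elem_sym]. *)
Definition chip m (e : V m) : {poly C} :=
  'X^m + \sum_(k < m) ((-1) ^+ k.+1 * e 0 k) *: 'X^(m - k.+1).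

Lemma chip_esym m (w : V m) : chip (elem_sym w) = \prod_j ('X - (w 0 j)%:P).
Proof.
have -> : \prod_j ('X - (w 0 j)%:P) = \prod_j ((- w 0 j)%:P + 'X).
  by apply: eq_bigr => j _; rewrite addrC polyCN.
rewrite bigA_distr.
have E (J : {set 'I_m}) : \prod_j (if j \in J then (- w 0 j)%:P else 'X) =
   ((-1) ^+ #|J| * \prod_(j in J) w 0 j) *: 'X^(m - #|J|).
  rewrite (bigID (mem J)) /=.
  rewrite (eq_bigr (fun j => (- w 0 j)%:P)) => [|j ->] //.
  rewrite [X in _ * X](eq_bigr (fun=> 'X)) => [|j /negbTE ->] //.
  rewrite -rmorph_prod mul_polyC prodrN; congr (_ *: _).
  rewrite big_const iter_mulr mulr1; congr ('X^_).
  have e : (#|J| + #|[predC J]|)%N = m by rewrite cardC card_ord.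
  apply: (@addnI #|J|); rewrite subnKC; last by rewrite -[X in (_ <= X)%N]e leq_addr.
  by [].
rewrite (eq_bigr _ (fun J _ => E J)).
rewrite (partition_big (fun J : {set 'I_m} => (inord #|J| : 'I_m.+1)) predT) //= big_ord_recl.
congr (_ + _). rewrite (bigD1 set0) ?cards0 //=; last by apply/eqP/val_inj; rewrite /= inordK.
  rewrite big_set0 mulr1 scale1r subn0 big1 ?addr0 // => J /andP[/eqP /(congr1 val)].
  rewrite /= inordK ?ltnS; last by rewrite -[X in (_ <= X)%N]card_ord max_card.
  by move=> /eqP; rewrite cards_eq0 => /eqP -> /eqP.
apply: eq_bigr => k _; rewrite mxE mulr_sumr scaler_suml.
apply: eq_big => [J|J /eqP ->] //=.
apply/eqP/eqP => [h|/(congr1 val)]; first by apply: val_inj; rewrite /= h inordK //= ltnS.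
by rewrite /= inordK // ltnS -[X in (_ <= X)%N]card_ord max_card.
Qed.

Lemma coef_chip m e (k : 'I_m) : (chip e)`_(m - k.+1) = (-1) ^+ k.+1 * e 0 k.
Proof.
rewrite coefD coefXn coef_sum (_ : (_ == _) = false) ?add0r; last first. by have := ltn_ord k; lia.
rewrite (bigD1 k) //= coefZ coefXn eqxx mulr1 big1 ?addr0 // => j jk.
rewrite coefZ coefXn (_ : (_ == _) = false) ?mulr0 //.
by apply/eqP => h; move/eqP: jk; apply; apply: val_inj; have := ltn_ord k; have := ltn_ord j; move: h => /=; lia.
Qed.

Lemma chip_inj m : injective (@chip m).
Proof.
move=> e e' h; apply/rowP => k; have := coef_chip e k; rewrite h coef_chip.
by move=> /mulfI -> //; rewrite signr_eq0.
Qed.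

Lemma chip_size m (e : V m) : size (chip e) = m.+1.
Proof.
rewrite size_polyDl ?size_polyXn //.
apply: (leq_trans (size_sum _ _ _)); apply/bigmax_leqP => k _.
apply: (leq_trans (size_scale_leq _ _)); rewrite size_polyXn.
by have := ltn_ord k; lia.
Qed.

Lemma chip_monic m (e : V m) : chip e \is monic.
Proof.
rewrite monicE lead_coefE chip_size coefD coefXn eqxx coef_sum big1 ?addr0 // => k _.
rewrite coefZ coefXn (_ : (_ == _) = false) ?mulr0 //.
by have := ltn_ord k; lia.
Qed.

Lemma esym_surj m (e : V m) : exists w, elem_sym w = e.
Proof.
have [r hr] := closed_field_poly_normal (chip e).
rewrite (eqP (chip_monic e)) scale1r in hr.
have sr : size r = m. by have := chip_size e; rewrite hr size_prod_XsubC => -[].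
exists (\row_(j < m) r`_j); apply: chip_inj; rewrite chip_esym hr.
rewrite (big_nth 0) big_mkord sr; apply: eq_bigr => j _; by rewrite mxE.
Qed.

(** An arbitrary ordering of the roots, the same one as in [sym_fun], with no continuity in e; only
    symmetric expressions in it are meaningful on the symmetric product. *)
Definition rootv m e : V m := xget 0 [set w | elem_sym w = e]%classic.

Lemma rootvK m (e : V m) : elem_sym (rootv e) = e.
Proof. by have [w hw] := esym_surj e; exact: (@xgetPex _ 0 [set w | elem_sym w = e]%classic (ex_intro _ w hw)). Qed.

Lemma esym_perm m (w : V m) (s : 'S_m) : elem_sym (\row_j w 0 (s j)) = elem_sym w.
Proof.
apply: chip_inj; rewrite !chip_esym [RHS](reindex_inj (@perm_inj _ s)).
by apply: eq_bigr => j _; rewrite mxE.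
Qed.

Lemma esym_fiber m (w w' : V m) : elem_sym w = elem_sym w' ->
  exists s : 'S_m, w = \row_j w' 0 (s j).
Proof.
move=> h; have := chip_esym w; rewrite h chip_esym.
have e v : \prod_j ('X - (v 0 j)%:P) = \prod_(x <- mktuple (fun j => v 0 j)) ('X - x%:P).
  by rewrite big_tuple; apply: eq_bigr => j _; rewrite tnth_mktuple.
rewrite !e => /prod_XsubC_eq; rewrite perm_sym => /tuple_permP [s hs].
exists s; apply/rowP => j; rewrite mxE.
have := congr1 (fun t => nth 0 t j) hs.
rewrite -!tnth_nth !tnth_mktuple //.
Qed.

Lemma rootv_sym m (f : V m -> C) w : (forall (s : 'S_m) (v : V m), f (\row_j v 0 (s j)) = f v) ->
  f (rootv (elem_sym w)) = f w.
Proof.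
move=> hf; have [s ->] := esym_fiber (rootvK (elem_sym w)); exact/hf.
Qed.

Lemma chip_root m (w : V m) j : (chip (elem_sym w)).[w 0 j] = 0.
Proof.
by rewrite chip_esym horner_prod (bigD1 j) //= hornerXsubC subrr mul0r.
Qed.

(** A root of modulus above 1 is bounded by the sum of the moduli of the coefficients; the factor 2
    comes from passing to [cn]. *)
Lemma root_bound m (w : V m) j : cn (w 0 j) <= 2 * (1 + \sum_k cn (elem_sym w 0 k)).
Proof.
have H : `|w 0 j| <= 1 + \sum_k `|elem_sym w 0 k|.
  have [h|h] := real_leP (normr_real (w 0 j)) (real1 _); first by apply: (le_trans h); rewrite lerDl sumr_ge0.
  case: m w j h => [|m] w j h; first by case: (j) => [].  
  have := chip_root w j; rewrite hornerD hornerXn horner_sum => /eqP; rewrite addr_eq0 => /eqP E.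
  have : `|w 0 j| ^+ m.+1 <= (\sum_k `|elem_sym w 0 k|) * `|w 0 j| ^+ m.
    rewrite -normrX E normrN; apply: le_trans (ler_norm_sum _ _ _) _.
    rewrite mulr_suml; apply: ler_sum => k _.
    by rewrite hornerZ hornerXn normrM normrM normrX normrN1 expr1n mul1r normrX ler_wpM2l //
      ler_weXn2l ?(ltW h) // subSS leq_subr.
  rewrite exprS ler_pM2r ?exprn_gt0 ?(lt_trans ltr01 h) // => /le_trans; apply.
  by rewrite lerDr.
have h1 := cn_le_normc (w 0 j).
have : (cn (w 0 j) / 2)%:C <= (1 + \sum_k cn (elem_sym w 0 k))%:C.
  apply: le_trans h1 (le_trans H _); rewrite rmorphD rmorph1 lerD // rmorph_sum.
  by apply: ler_sum => k _; exact/normc_le_cn.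
by rewrite lecR ler_pdivrMr // mulrC.
Qed.

Section SymProd.
Context {q m : nat} (P : V q -> C) (rho : V q -> V m).
Hypotheses (hP : pfun P) (hrho : forall k, pfun (fun v => rho v 0 k)).

Lemma pfun_chip Q : pfun Q -> pfun (fun v => (chip (rho v)).[Q v]).
Proof.
move=> hQ; under eq_fun do rewrite hornerD hornerXn horner_sum.
apply: pfunD; auto with sm.
apply: pfun_sum => k _; under eq_fun do rewrite hornerZ hornerXn.
by auto with sm.
Qed.

(** Splitting p into linear factors turns the product over the w_j into a product, over the roots z
    of p, of values of [chip] at x - z; these are polynomial in x and in e. *)
Lemma prod_comp_roots (p : {poly C}) (x : C) (w : V m) : exists2 r : seq C,
   True & forall x (w : V m), \prod_j p.[x - w 0 j] = lead_coef p ^+ m * \prod_(z <- r) (chip (elem_sym w)).[x - z].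
Proof.
have [r hr] := closed_field_poly_normal p; exists r => // {}x {}w.
have E y : p.[y] = lead_coef p * \prod_(z <- r) ('X - z%:P).[y] by rewrite {1}hr hornerZ horner_prod.
under eq_bigr do rewrite E.
rewrite big_split prodr_const card_ord; congr (_ * _).
rewrite exchange_big; apply: eq_bigr => z _.
rewrite chip_esym horner_prod; apply: eq_bigr => j _.
by rewrite !hornerXsubC addrAC.
Qed.

Lemma pfun_symprod (p : {poly C}) : pfun (fun v => \prod_j p.[P v - rootv (rho v) 0 j]).
Proof.
have [r _ hr] := prod_comp_roots p 0 0.
under eq_fun do rewrite hr rootvK.
apply: pfunZ; apply: pfun_prod => z _; apply: pfun_chip.
by auto with sm.
Qed.

Lemma prod_close I l (a b : I -> C) (K e : R) : 1 <= K -> 0 <= e ->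
  (forall k, cn (a k) <= K) -> (forall k, cn (b k) <= K) -> (forall k, cn (a k - b k) <= e) ->
  cn (\prod_(k <- l) a k - \prod_(k <- l) b k) <= (size l)%:R * K ^+ size l * e.
Proof.
move=> K1 e0 ha hb hab; have K0 : 0 <= K by apply: le_trans K1.
have hp c l' : (forall k, cn (c k) <= K) -> cn (\prod_(k <- l') c k) <= K ^+ size l'.
  move=> hc; elim: l' => [|k l' IH]; first by rewrite big_nil cn1.
  rewrite big_cons exprS; apply: le_trans (cnM _ _) _.
  by apply: ler_pM; rewrite ?cn_ge0.
elim: l => [|k l IH]; first by rewrite !big_nil subrr cn0 mul0r mul0r.
rewrite !big_cons.
rewrite (_ : _ - _ = (a k - b k) * \prod_(j <- l) a j + b k * (\prod_(j <- l) a j - \prod_(j <- l) b j)); last by ring.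
apply: le_trans (cnD _ _) _.
apply: (@le_trans _ _ (e * K ^+ size l + K * ((size l)%:R * K ^+ size l * e))).
  by apply: lerD; apply: le_trans (cnM _ _) _; apply: ler_pM; rewrite ?cn_ge0 ?hp.
have Kl : 0 <= K ^+ size l by rewrite exprn_ge0.
rewrite /= -natr1 exprS; set x := K ^+ size l in Kl *; set n := (size l)%:R.
have : 0 <= (K - 1) * (x * e) by rewrite mulr_ge0 ?subr_ge0 // mulr_ge0.
nra.
Qed.

(** [root_bound] keeps the roots in a bounded set, where h is uniformly close to a polynomial; for
    polynomials the product is a polynomial function by [pfun_symprod]. This is how products of
    theta functions become holomorphic in e. *)
Lemma entire_symprod h : entire1 h -> entire (fun v => \prod_j h (P v - rootv (rho v) 0 j)).
Proof.
move=> hh r r0 e e0.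
have [M M0 hM] := pfun_bound r 0 hP.
have /choice [B hB] : forall k, exists B, 0 <= B /\ forall v, nearv r 0 v -> cn (rho v 0 k) <= B.
  by move=> k; have [B B0 hB] := pfun_bound r 0 (hrho k); exists B.
pose T := M + 2 * (1 + \sum_k B k).
have hT v j : nearv r 0 v -> cn (P v - rootv (rho v) 0 j) <= T.
  move=> hv; apply: le_trans (cnD _ _) _; rewrite cnN lerD ?hM //.
  apply: le_trans (root_bound _ _) _; rewrite rootvK ler_wpM2l // lerD2l.
  by apply: ler_sum => k _; exact: (hB k).2.
have [p0 hp0] := hh T 1 ltr01.
pose K : R := 2 + \sum_(i < size p0) cn p0`_i * `|T| ^+ i.
have S0 : 0 <= \sum_(i < size p0) cn p0`_i * `|T| ^+ i.
  by rewrite sumr_ge0 // => i _; rewrite mulr_ge0 ?cn_ge0 ?exprn_ge0.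
have K1 : 1 <= K by rewrite /K; lra.
have hK u : cn u <= T -> cn (h u) <= K - 1.
  move=> hu; rewrite -[h u](subrK p0.[u]); apply: le_trans (cnD _ _) _.
  rewrite /K (_ : 2 + _ - 1 = 1 + \sum_(i < size p0) cn p0`_i * `|T| ^+ i); last by ring.
  rewrite lerD ?hp0 // horner_coef; apply: le_trans (cn_sum _ _ _) _.
  apply: ler_sum => i _; apply: le_trans (cnM _ _) _; rewrite ler_wpM2l ?cn_ge0 //.
  apply: le_trans (cn_powb _ _) _; rewrite lerXn2r ?nnegrE ?cn_ge0 ?normr_ge0 //.
  exact/(le_trans hu)/ler_norm.
pose D := m%:R * K ^+ m + 1.
have D0 : 0 < D by rewrite ltr_wpDl // mulr_ge0 ?exprn_ge0 //; apply: le_trans K1.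
pose t := Num.min 1 (e / D).
have t0 : 0 < t by rewrite lt_min ltr01 divr_gt0.
have [p hp] := hh T t t0.
exists (fun v => \prod_j p.[P v - rootv (rho v) 0 j]); first exact/pfun_symprod.
move=> v hv; have H := @prod_close _ (index_enum 'I_m) (fun j => h (P v - rootv (rho v) 0 j))
  (fun j => p.[P v - rootv (rho v) 0 j]) K t K1 (ltW t0).
apply: le_trans (H _ _ _) _.
- by move=> j; apply: le_trans (hK _ (hT v j hv)) _; rewrite gerBl.
- move=> j; rewrite -[X in cn X](subrK (h (P v - rootv (rho v) 0 j))); apply: le_trans (cnD _ _) _.
  rewrite -[leRHS](subrK 1) addrC lerD ?hK ?hT // cnB; apply: le_trans (hp _ (hT v j hv)) _.
  by rewrite ge_min lexx.
- move=> j; exact/hp/hT.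
have -> : size (index_enum 'I_m) = m by rewrite -sum1_size sum1_card card_ord.
apply: (@le_trans _ _ (D * t)); first by rewrite ler_wpM2r ?(ltW t0) // lerDl.
by rewrite mulrC -ler_pdivlMr // ge_min lexx orbT.
Qed.
End SymProd.

Lemma pfun_esym m k : pfun (fun w : V m => elem_sym w 0 k).
Proof.
under eq_fun do rewrite mxE; apply: pfun_sum => I _; apply: pfun_prod => j _.
exact/pfun_coord.
Qed.

End ElemSym.

(** * The exponential and theta functions with characteristics *)

Section Theta.
Context {R : realType}.
Notation C := R[i].
Implicit Types (z u tau beta : C) (a : R).

Lemma cexpD z u : cexp (z + u) = cexp z * cexp u.
Proof.
rewrite /cexp cReD cImD expRD cosD sinD.
by apply: ceqP; rewrite /=; ring.
Qed.
Lemma cexp0 : cexp 0 = 1 :> C.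
Proof. by rewrite /cexp expR0 cos0 sin0 mul1r. Qed.
Lemma cexpN_mul z : cexp z * cexp (- z) = 1.
Proof. by rewrite -cexpD subrr cexp0. Qed.
Lemma cexp_neq0 z : cexp z != 0.
Proof. by apply/eqP => h; have := cexpN_mul z; rewrite h mul0r => /eqP; rewrite eq_sym oner_eq0. Qed.
Lemma cn_cexp z : cn (cexp z) <= 2 * expR (Re z).
Proof.
by rewrite cnMR ger0_norm // mulrC ler_wpM2r //
  lerD // ler_norml ?cos_geN1 ?cos_le1 ?sin_geN1 ?sin_le1.
Qed.
Lemma cexp_cis (x : R) : cexp (2 * pi%:C * 'i * x%:C) = cis x.
Proof.
have -> : 2 * pi%:C * 'i * x%:C = 0 +i* (2 * pi * x) :> C. by apply: ceqP; rewrite /=; ring.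
by rewrite /cexp expR0 mul1r.
Qed.
Lemma cder_cexp z s : cder (fun t => cexp (t%:C * z)) s (z * cexp (s%:C * z)).
Proof.
have lin k : is_derive s 1 (fun t => t * k) k. apply/is_derive_epsP => e e0; exists 1 => // x _.
  have -> : (s + x) * k - s * k - x * k = 0 by ring.
  by rewrite normr0 mulr_ge0 ?(ltW e0).
have he : cder (fun t => (expR (Re (t%:C * z)))%:C) s (Re z * expR (Re (s%:C * z)))%:C.
  split => /=; last exact/is_derive_cst.
  rewrite (_ : (fun t => _) = fun t => expR (t * Re z)); last first.
    by apply/funext => t; rewrite cReM mul0r subr0.
  rewrite cReM /= mul0r subr0.
  by apply: is_derive_eq; ring.
have hc : cder (fun t => cos (Im (t%:C * z)) +i* sin (Im (t%:C * z))) s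
   ((Im z)%:C * 'i * (cos (Im (s%:C * z)) +i* sin (Im (s%:C * z)))).
  have E f : (fun t => f (Im (t%:C * z))) = fun t => f (t * Im z).
    by apply/funext => t; rewrite cImM mul0r addr0.
  have E2 : Im (s%:C * z) = s * Im z by rewrite cImM mul0r addr0.
  rewrite E2; split; rewrite /=. rewrite E; apply: is_derive_eq. by ring.
  rewrite E; apply: is_derive_eq.
  by ring.
have := cderM he hc; rewrite (_ : z * _ = (Re z * expR (Re (s%:C * z)))%:C *
     (cos (Im (s%:C * z)) +i* sin (Im (s%:C * z))) +
     (expR (Re (s%:C * z)))%:C * ((Im z)%:C * 'i *
     (cos (Im (s%:C * z)) +i* sin (Im (s%:C * z))))) //.
apply: ceqP; rewrite ?(cReM, cImM) /=; ring.
Qed.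

(** exp(-s z) E_N(s z), with E_N the Taylor polynomial, has derivative -exp(-s z) z (s z)^N / N!,
    which is uniformly small for large N. So its value at s = 1 is close to its value 1 at s = 0. *)
Lemma cexp_entire1 : entire1 (@cexp R).
Proof.
move=> r0 e e0; pose r := Num.max 0 r0.
have r00 : 0 <= r by rewrite le_max lexx.
pose E n z := \sum_(k < n.+1) (k`!%:R)^-1 * z ^+ k.
pose B : R := 8 * expR r * expR r * r + 1.
have B0 : 0 < B by rewrite ltr_wpDl // !mulr_ge0 ?expR_ge0.
have [N hN] : exists N, r ^+ N / N`!%:R <= e / B.
  have /cvg_series_cvg_0 /cvgrPdist_le h := is_cvg_series_exp_coeff r.
  have [N _ /(_ N (leqnn N))] := h (e / B) (divr_gt0 e0 B0).
  rewrite /exp_coeff /= sub0r normrN => H; exists N; apply: le_trans H; exact/ler_norm.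
exists (\sum_(k < N.+1) (k`!%:R)^-1 *: 'X^k) => z hz.
have zr : cn z <= r by rewrite le_max hz orbT.
have -> : (\sum_(k < N.+1) (k`!%:R)^-1 *: 'X^k).[z] = E N z.
  by rewrite horner_sum; apply: eq_bigr => k _; rewrite hornerZ hornerXn.
pose g s := cexp (s%:C * (- z)) * E N (s%:C * z).
pose dg s := - (cexp (s%:C * (- z)) * (z * ((N`!%:R)^-1 * (s%:C * z) ^+ N))).
have dE n s : cder (fun t => E n (t%:C * z)) s (z * (E n (s%:C * z) - (n`!%:R)^-1 * (s%:C * z) ^+ n)).
  elim: n => [|n IH]. rewrite /E; under eq_fun do rewrite big_ord_recr big_ord0 /= expr0 add0r.
    by rewrite big_ord_recr big_ord0 /= add0r expr0 subrr mulr0; exact/cder_cst.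
  have hc : cder (fun=> (n.+1`!%:R)^-1 : C) s 0 by exact/cder_cst.
  have H := cderD IH (cderM hc (cderX n.+1 (cder_lin z s))).
  rewrite (_ : (fun t => _) = fun t => E n (t%:C * z) + (n.+1`!%:R)^-1 * (t%:C * z) ^+ n.+1); last first.
    by apply/funext => t; rewrite /E big_ord_recr.
  suff -> : z * (E n.+1 (s%:C * z) - (n.+1`!%:R)^-1 * (s%:C * z) ^+ n.+1) =
    z * (E n (s%:C * z) - (n`!%:R)^-1 * (s%:C * z) ^+ n) +
    (0 * (s%:C * z) ^+ n.+1 + (n.+1`!%:R)^-1 * (n.+1%:R * (s%:C * z) ^+ n.+1.-1 * z)) by exact/H.
  rewrite /E big_ord_recr /= addrK mul0r add0r factS natrM.
  have n0 : n.+1%:R != 0 :> C by rewrite pnatr_eq0.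
  have f0 : n`!%:R != 0 :> C by rewrite pnatr_eq0 -lt0n fact_gt0.
  move: (n.+1%:R : C) (n`!%:R : C) n0 f0 ((s%:C * z) ^+ n) (\sum_(k < n.+1) _) => p q p0 q0 x y.
  by field; rewrite p0 q0.
have dgP s : cder g s (dg s). have := cderM (cder_cexp (- z) s) (dE N s).
  by rewrite (_ : _ + _ = dg s) //; rewrite /dg; ring.
have hc u : cn u <= r -> cn (cexp u) <= 2 * expR r.
  move=> hu; apply: le_trans (cn_cexp _) _; rewrite ler_wpM2l // ler_expR.
  exact: le_trans (ler_norm _) (le_trans (Re_le_cn _) hu).
have bound x : `|x| <= `|1 : R| -> cn (dg x - 0) <= 2 * expR r * (r * (r ^+ N / N`!%:R)).
  rewrite normr1 subr0 /dg cnN => x1.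
  have xz : cn (x%:C * z) <= r.
    by rewrite cnMR; apply: le_trans zr; rewrite -[leRHS]mul1r ler_wpM2r ?cn_ge0.
  apply: le_trans (cnM _ _) _; apply: ler_pM; rewrite ?cn_ge0 //. by apply: hc; rewrite mulrN cnN.
  apply: le_trans (cnM _ _) _; apply: ler_pM; rewrite ?cn_ge0 //.
  rewrite -[N`!%:R](rmorph_nat (real_complex R)) -fmorphV cnMR mulrC ger0_norm ?invr_ge0 //.
  rewrite ler_wpM2r ?invr_ge0 //; apply: le_trans (cn_powb _ _) _.
  by rewrite lerXn2r ?nnegrE ?cn_ge0.
have := @cmvt R g dg 0 _ 1 (fun x _ => dgP x) bound.
have E0 : E N 0 = 1.
  by rewrite /E big_ord_recl big1 => [|k _]; rewrite ?expr0 ?mulr1 ?invr1 ?addr0 // lift0 expr0n mulr0.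
rewrite mulr0 subr0 normr1 mulr1 /g !mul0r cexp0 E0 !mul1r => H.
have -> : cexp z - E N z = - (cexp z * (cexp (- z) * E N z - 1)).
  by rewrite mulrBr mulrA cexpN_mul mul1r mulr1 opprB.
rewrite cnN; apply: le_trans (cnM _ _) _.
apply: (@le_trans _ _ (2 * expR r * (2 * (2 * expR r * (r * (r ^+ N / N`!%:R)))))).
  by apply: ler_pM; rewrite ?cn_ge0 ?hc.
rewrite (_ : _ * _ = (8 * expR r * expR r * r) * (r ^+ N / N`!%:R)); last by ring.
apply: (@le_trans _ _ (B * (r ^+ N / N`!%:R))).
  by rewrite ler_wpM2r ?mulr_ge0 ?exprn_ge0 ?invr_ge0 // /B lerDl.
by rewrite mulrC -ler_pdivlMr.
Qed.

Lemma limn_cn (v : nat -> C) l : (forall e : R, 0 < e -> exists N, forall n, (N <= n)%N -> cn (v n - l) <= e) ->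
  limn v = l.
Proof.
move=> H; apply/cvg_lim => //; apply/cvgrPdist_le => e e0.
have [e1 e2] := gt0_complexE e0; have [N hN] := H _ e1; exists N => // n hn.
by apply: le_trans (normc_le_cn _) _; rewrite cnB e2 lecR hN.
Qed.

Definition thT tau beta a j z : C :=
  cexp (pi%:C * 'i * (j%:~R + a%:C) ^+ 2 * tau + 2 * pi%:C * 'i * (j%:~R + a%:C) * (z + beta)).
Definition thS tau beta a N z : C := \sum_(k < N.*2.+1) thT tau beta a (k%:Z - N%:Z) z.

Lemma thS_rec tau beta a N z :
  thS tau beta a N.+1 z = thS tau beta a N z + (thT tau beta a (N.+1%:Z) z + thT tau beta a (- N.+1%:Z) z).
Proof.
rewrite /thS big_ord_recl big_ord_recr /= ?sub0r.
rewrite (_ : (bump 0 N.*2.+1)%:Z - N.+1%:Z = N.+1%:Z); last first. by rewrite /bump; lia.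
rewrite [RHS]addrA [LHS]addrC -addrA [_ + thT _ _ _ (- _) z]addrC addrA addrAC; congr (_ + _).
congr (_ + _); apply: eq_bigr => k _.
by rewrite !intS opprD addrACA add0r.
Qed.

(** Completing the square bounds the real part of the exponent by c0 - |s|; the summand 1 in P = 2
    pi M + 1 provides this spare |s|. Then exp(-|s|) <= 4 / (N + 1)^2, and the bound is written as a
    difference so that its sum telescopes. *)
Lemma thT_bound tau beta (M : R) : 0 < Im tau -> exists2 K : R, 0 <= K &
  forall a z N j, 0 <= a <= 1 -> `|Im (z + beta)| <= M -> `|j|%N = N.+1 ->
    cn (thT tau beta a j z) <= K * (N.+1%:R^-1 - N.+2%:R^-1).
Proof.
move=> t0; set t := Im tau in t0.
pose P := 2 * pi * M + 1; pose c0 := P ^+ 2 / (4 * pi * t).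
have pi0 : 0 < pi :> R := pi_gt0 R.
exists (16 * expR c0); first by rewrite mulr_ge0 ?expR_ge0.
move=> a z N j /andP[a0 a1] hM hj.
apply: le_trans (cn_cexp _) _.
set s := (j%:~R + a : R).
have Es : j%:~R + a%:C = s%:C :> C by rewrite /s rmorphD rmorph_int.
have -> : Re (pi%:C * 'i * (j%:~R + a%:C) ^+ 2 * tau + 2 * pi%:C * 'i * (j%:~R + a%:C) * (z + beta)) =
   - (pi * t * s ^+ 2) - 2 * pi * s * Im (z + beta).
  rewrite Es -rmorphXn cReD !(cReM, cImM) /= -/t.
  by move: (Re (z + beta)) (Im (z + beta)) (Re tau) => x y v; ring.
have sM : - (2 * pi * s * Im (z + beta)) <= 2 * pi * M * `|s|.
  have h : - (s * Im (z + beta)) <= M * `|s|.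
    by apply: le_trans (ler_norm _) _; rewrite normrN normrM mulrC ler_wpM2r.
  rewrite (_ : - _ = 2 * pi * - (s * Im (z + beta))); last by ring.
  by rewrite -[2 * pi * M * _]mulrA ler_wpM2l // mulr_ge0 // ltW.
have key : - (pi * t * s ^+ 2) - 2 * pi * s * Im (z + beta) <= c0 - `|s|.
  have pt : 0 < pi * t by rewrite mulr_gt0.
  have sq : s ^+ 2 = `|s| ^+ 2 by rewrite real_normK ?num_real.
  rewrite sq; move: `|s| sM => x sM.
  have : 0 <= (2 * (pi * t) * x - P) ^+ 2 / (4 * (pi * t)) by rewrite divr_ge0 ?sqr_ge0 // mulr_ge0 // ltW.
  have -> : (2 * (pi * t) * x - P) ^+ 2 / (4 * (pi * t)) = pi * t * x ^+ 2 - P * x + c0.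
    have E (w y v : R) : w != 0 -> (2 * w * y - v) ^+ 2 / (4 * w) = w * y ^+ 2 - v * y + v ^+ 2 / (4 * w).
      by move=> w0; field.
    by rewrite E ?gt_eqF // /c0 -[4 * pi * t]mulrA.
  rewrite /P; lra.
have sj : N.+1%:R <= 1 + `|s|. have jn : `|j%:~R : R| = N.+1%:R by rewrite -intr_norm -abszE hj.
  rewrite -jn (_ : j%:~R = s - a); last by rewrite /s addrK.
  apply: le_trans (ler_normB _ _) _; rewrite addrC lerD2r ger0_norm //.
apply: (@le_trans _ _ (2 * (expR c0 * expR (- `|s|)))). by rewrite ler_wpM2l // -expRD ler_expR.
have hs : expR (- `|s|) <= 4 / (N.+1%:R ^+ 2). have h2 : (1 + `|s| / 2) ^+ 2 <= expR `|s|.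
    rewrite {2}(splitr `|s|) expRD -expr2 lerXn2r ?nnegrE ?expR_ge0 ?addr_ge0 ?divr_ge0 //.
    exact: expR_ge1Dx.
  have h3 : N.+1%:R ^+ 2 / 4 <= expR `|s|.
    apply: le_trans h2; rewrite (_ : _ / 4 = (N.+1%:R / 2) ^+ 2); last by field.
    rewrite lerXn2r ?nnegrE ?addr_ge0 ?divr_ge0 //; have := normr_ge0 s; lra.
  by rewrite expRN -[4 / _]invrK lef_pV2 ?posrE ?expR_gt0 ?invr_gt0 ?divr_gt0 ?exprn_gt0 // invf_div.
have hN : 4 / (N.+1%:R ^+ 2) <= 8 * (N.+1%:R^-1 - N.+2%:R^-1) :> R.
  have n1 : 0 < N.+1%:R :> R by [].
  have -> : N.+2%:R = N.+1%:R + 1 :> R by rewrite natr1.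
  have n1' : 1 <= N.+1%:R :> R by rewrite ler1n.
  move: (N.+1%:R : R) n1 n1' => x x0 x1.
  have x20 : 0 < x + 1 by rewrite addr_gt0.
  have -> : 8 * (x^-1 - (x + 1)^-1) = 4 / x ^+ 2 * (2 * x / (x + 1)). by field; rewrite ?gt_eqF.
  rewrite ler_peMr ?divr_ge0 ?exprn_ge0 ?(ltW x0) // ler_pdivlMr //; lra.
rewrite (_ : 16 * _ * _ = 2 * (expR c0 * (8 * (N.+1%:R^-1 - N.+2%:R^-1)))); last by ring.
by rewrite ler_wpM2l // ler_wpM2l ?expR_ge0 // (le_trans hs).
Qed.

Lemma theta_thS tau beta a z : theta a%:C beta z tau = limn (fun N => thS tau beta a N z).
Proof.
congr (limn _); apply/funext => N; apply: eq_bigr => k _.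
by rewrite /thT rmorphB.
Qed.

(** Telescoping of [thT_bound], with a factor 2 for the two new terms of each symmetric partial sum.
    The constant is uniform in the characteristic and on the strip, hence on every disc. *)
Lemma theta_spec tau beta (M : R) : 0 < Im tau -> exists2 K : R, 0 <= K &
  forall a z N, 0 <= a <= 1 -> `|Im (z + beta)| <= M ->
    cn (theta a%:C beta z tau - thS tau beta a N z) <= K / N.+1%:R.
Proof.
move=> t0; have [K K0 hK] := thT_bound beta M t0; exists (2 * K); first by rewrite mulr_ge0.
move=> a z N ha hz.
have step n d : cn (thS tau beta a (n + d) z - thS tau beta a n z) <= 2 * K * (n.+1%:R^-1 - (n + d).+1%:R^-1).
  elim: d => [|d IH]; first by rewrite addn0 !subrr cn0 mulr0.
  rewrite addnS thS_rec addrAC; apply: le_trans (cnD _ _) _.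
  rewrite (_ : 2 * K * _ = 2 * K * (n.+1%:R^-1 - (n + d).+1%:R^-1) +
    (K * ((n + d).+1%:R^-1 - (n + d).+2%:R^-1) + K * ((n + d).+1%:R^-1 - (n + d).+2%:R^-1))); last by ring.
  apply: lerD IH _; apply: le_trans (cnD _ _) _.
  by apply: lerD; apply: hK.
have step' n k : (n <= k)%N -> cn (thS tau beta a k z - thS tau beta a n z) <= 2 * K / n.+1%:R.
  move=> /subnKC <-; apply: le_trans (step _ _) _; rewrite ler_wpM2l ?mulr_ge0 //.
  by rewrite gerBl.
have [l hl] : exists l, forall e, 0 < e -> exists N, forall n, (N <= n)%N -> cn (thS tau beta a n z - l) <= e.
  apply: ccauchy => e e0.
  pose N0 := Num.truncn (4 * K / e).
  have hN0 : 2 * K / N0.+1%:R <= e / 2. have := truncnS_gt (4 * K / e); rewrite -/N0 => h.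
    rewrite ler_pdivrMr // ; rewrite ltr_pdivrMr in h; lra.
  exists N0 => n k hn hk.
  apply: le_trans (cn_triangle (thS tau beta a N0 z) _ _) _; rewrite [leRHS]splitr lerD //.
    by apply: le_trans (step' _ _ hn) _.
  by rewrite cnB; apply: le_trans (step' _ _ hk) _.
rewrite theta_thS (limn_cn hl).
apply/ler_addgt0Pr => e e0; have [N1 hN1] := hl e e0.
apply: le_trans (cn_triangle (thS tau beta a (maxn N1 N) z) _ _) _; rewrite addrC lerD //.
  exact/step'/leq_maxr.
by rewrite cnB hN1 // leq_maxl.
Qed.

Lemma thT_entire1 tau beta a j : entire1 (thT tau beta a j).
Proof.
move=> r e e0; set k := 2 * pi%:C * 'i * (j%:~R + a%:C) : C.
set c := pi%:C * 'i * (j%:~R + a%:C) ^+ 2 * tau + k * beta : C.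
have [p hp] := @cexp_entire1 (cn k * `|r| + cn c) e e0.
exists (p \Po (c%:P + k *: 'X)) => z hz.
rewrite horner_comp hornerD hornerC hornerZ hornerX.
have -> : thT tau beta a j z = cexp (c + k * z).
  by rewrite /thT -/k /c mulrDr [k * z + _]addrC addrA.
apply: hp; apply: le_trans (cnD _ _) _; rewrite addrC lerD2r.
apply: le_trans (cnM _ _) _; rewrite ler_wpM2l ?cn_ge0 //; exact/(le_trans hz)/ler_norm.
Qed.

Lemma entire1D h1 h2 : entire1 h1 -> entire1 h2 -> entire1 (fun z => h1 z + h2 z).
Proof.
move=> H1 H2 r e e0; have e2 : 0 < e / 2 by rewrite divr_gt0.
have [p hp] := H1 r _ e2; have [q hq] := H2 r _ e2; exists (p + q) => z hz.
rewrite hornerD opprD addrACA [leRHS]splitr; apply: le_trans (cnD _ _) _.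
by rewrite lerD ?hp ?hq.
Qed.

Lemma thS_entire1 tau beta a N : entire1 (thS tau beta a N).
Proof.
rewrite /thS; elim: (N.*2.+1) => [|n IH].
  exists 0 => z _; by rewrite big_ord0 horner0 subrr cn0 ltW.
rewrite (_ : (fun z => _) = fun z => \sum_(k < n) thT tau beta a (k%:Z - N%:Z) z + thT tau beta a (n%:Z - N%:Z) z).
  by apply: entire1D => //; exact/thT_entire1.
by apply/funext => z; rewrite big_ord_recr.
Qed.

Lemma archi_small (K e : R) : 0 <= K -> 0 < e -> exists N, K / N.+1%:R <= e.
Proof.
exists (Num.truncn (K / e)); have := truncnS_gt (K / e) => h.
by rewrite ler_pdivrMr // mulrC -ler_pdivrMr // ltW.
Qed.

Lemma theta_entire1 tau beta a : 0 < Im tau -> 0 <= a <= 1 ->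
  entire1 (fun z => theta a%:C beta z tau).
Proof.
move=> t0 ha r e e0; have e2 : 0 < e / 2 by rewrite divr_gt0.
have [K K0 hK] := theta_spec beta (r + cn beta) t0.
have [N hN] := archi_small K0 e2.
have [p hp] := @thS_entire1 tau beta a N r _ e2; exists p => z hz.
apply: le_trans (cn_triangle (thS tau beta a N z) _ _) _; rewrite [leRHS]splitr lerD ?hp //.
apply: le_trans hN; apply: hK => //.
apply: le_trans (Im_le_cn _) _; apply: le_trans (cnD _ _) _; by rewrite lerD2r.
Qed.
Lemma theta_limit tau beta a z l : 0 < Im tau -> 0 <= a <= 1 ->
  (forall e : R, 0 < e -> exists N0, forall N, (N0 <= N)%N -> cn (thS tau beta a N z - l) <= e) ->
  theta a%:C beta z tau = l.
Proof. by move=> t0 ha hl; rewrite theta_thS (limn_cn hl). Qed.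

Lemma theta_approx tau beta a z : 0 < Im tau -> 0 <= a <= 1 ->
  forall e : R, 0 < e -> exists N0, forall N, (N0 <= N)%N -> cn (thS tau beta a N z - theta a%:C beta z tau) <= e.
Proof.
move=> t0 ha e e0; have [K K0 hK] := theta_spec beta `|Im (z + beta)| t0.
have [N0 hN0] := archi_small K0 e0; exists N0 => N hN.
rewrite cnB; apply: le_trans (hK a z N ha (lexx _)) _; apply: le_trans hN0.
by rewrite ler_wpM2l // lef_pV2 ?posrE // ler_nat.
Qed.

Lemma thT_small tau beta a z : 0 < Im tau -> 0 <= a <= 1 ->
  forall e : R, 0 < e -> exists N0, forall N j, (N0 <= N)%N -> `|j|%N = N.+1 -> cn (thT tau beta a j z) <= e.
Proof.
move=> t0 ha e e0; have [K K0 hK] := thT_bound beta `|Im (z + beta)| t0.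
have [N0 hN0] := archi_small K0 e0; exists N0 => N j hN hj.
apply: le_trans (hK a z N j ha (lexx _) hj) _; apply: le_trans hN0; rewrite ler_wpM2l //.
apply: (@le_trans _ _ N.+1%:R^-1); first by rewrite gerBl.
by rewrite lef_pV2 ?posrE // ler_nat.
Qed.

Lemma cexp_int j : cexp (2 * pi%:C * 'i * j%:~R) = 1 :> C.
Proof.
rewrite -(rmorph_int (real_complex R)) cexp_cis.
case: j => n; first by rewrite cis_nat.
by rewrite cisN cis_nat rmorph1.
Qed.

Lemma theta_shift1 tau beta a z : 0 < Im tau -> 0 <= a <= 1 ->
  theta a%:C beta (z + 1) tau = cexp (2 * pi%:C * 'i * a%:C) * theta a%:C beta z tau.
Proof.
move=> t0 ha; apply: theta_limit => // e e0.
have c0 : 0 < 1 + cn (cexp (2 * pi%:C * 'i * a%:C)) by rewrite ltr_pwDl ?cn_ge0.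
have [N0 hN0] := theta_approx beta z t0 ha (divr_gt0 e0 c0); exists N0 => N hN.
have -> : thS tau beta a N (z + 1) = cexp (2 * pi%:C * 'i * a%:C) * thS tau beta a N z.
  rewrite mulr_sumr; apply: eq_bigr => k _.
  rewrite /thT -cexpD; move: (k%:Z - N%:Z) => j.
  by rewrite -[RHS]mulr1 -[X in _ = _ * X](cexp_int j) -[RHS]cexpD; congr cexp; ring.
rewrite -mulrBr; apply: le_trans (cnM _ _) _.
have := hN0 N hN; rewrite ler_pdivlMr // => /(le_trans _); apply.
by rewrite mulrC ler_wpM2l ?cn_ge0 // lerDr.
Qed.

(** Expanding the square in each term moves a shift of z by c tau into the characteristic. As the
    estimates hold for characteristics in [0, 1], a full period is passed in two halves in
    [theta1_ptau]. *)
Lemma theta_shift_tau tau beta a c z : 0 < Im tau -> 0 <= a <= 1 -> 0 <= a + c <= 1 ->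
  theta a%:C beta (z + c%:C * tau) tau =
  cexp (- (pi%:C * 'i * c%:C ^+ 2 * tau + 2 * pi%:C * 'i * c%:C * (z + beta))) * theta (a + c)%:C beta z tau.
Proof.
move=> t0 ha hac; apply: theta_limit => // e e0; set g := cexp _.
have c0 : 0 < 1 + cn g by rewrite ltr_pwDl ?cn_ge0.
have [N0 hN0] := theta_approx beta z t0 hac (divr_gt0 e0 c0); exists N0 => N hN.
have -> : thS tau beta a N (z + c%:C * tau) = g * thS tau beta (a + c) N z.
  rewrite mulr_sumr; apply: eq_bigr => k _.
  rewrite -cexpD; congr cexp.
  by ring.
rewrite -mulrBr; apply: le_trans (cnM _ _) _.
have := hN0 N hN; rewrite ler_pdivlMr // => /(le_trans _); apply.
by rewrite mulrC ler_wpM2l ?cn_ge0 // lerDr.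
Qed.

(** Shifting the summation index by one changes a symmetric partial sum by two boundary terms, which
    tend to 0. *)
Lemma theta_char1 tau beta z : 0 < Im tau -> theta 1 beta z tau = theta 0 beta z tau.
Proof.
move=> t0; have h0 : (fun a => is_true (0 <= a <= 1)) 0 by rewrite lexx ler01.
have h1 : (fun a => is_true (0 <= a <= 1)) 1 by rewrite lexx ler01.
apply: theta_limit => // e e0.
have e3 : 0 < e / 3 by rewrite divr_gt0.
have [N0 hN0] := theta_approx beta z t0 h0 e3.
have [N1 hN1] := thT_small beta z t0 h0 e3.
exists (maxn N0 N1.+1) => -[|N]; rewrite geq_max; first by rewrite andbF.
rewrite ltnS => /andP[hN hN'].
have -> : thS tau beta 1 N.+1 z = thS tau beta 0 N.+1 z + thT tau beta 0 N.+2%:Z z - thT tau beta 0 (- N.+1%:Z) z.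
  have sh (f : nat -> C) n : \sum_(k < n) f k.+1 = \sum_(k < n) f k + f n - f 0%N.
    elim: n => [|n IH]; first by rewrite !big_ord0 add0r subrr.
    by rewrite !big_ord_recr /= IH; ring.
  have := sh (fun k => thT tau beta 0 (k%:Z - N.+1%:Z) z) (N.+1.*2.+1); rewrite sub0r => E.
  rewrite /thS (eq_bigr (fun k : 'I_(N.+1.*2.+1) => thT tau beta 0 (k.+1%:Z - N.+1%:Z) z)); last first.
    move=> k _; have kE : (k.+1%:Z - N.+1%:Z)%:~R = (k%:Z - N.+1%:Z)%:~R + 1 :> C. by ring.
    by rewrite /thT addr0 kE.
  by rewrite E -addnn -addSn PoszD addrK.
rewrite (_ : _ - _ - _ = (thS tau beta 0 N.+1 z - theta 0 beta z tau) + thT tau beta 0 N.+2%:Z z - thT tau beta 0 (- N.+1%:Z) z); last by ring.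
apply: le_trans (cnD _ _) _; apply: (@le_trans _ _ (e / 3 + e / 3 + e / 3)); last by lra.
apply: lerD; last by rewrite cnN; apply: (hN1 N).
apply: le_trans (cnD _ _) _; apply: lerD; auto with sm.
by apply: (hN1 N.+1) => //; exact/leqW.
Qed.

(** On the real points u = b s the function with characteristic l / b has only the frequencies k b +
    l in s. Integration against the frequency j < b keeps the single term k = 0, l = j, whose
    coefficient is an exponential and so not 0. It is carried out on partial sums, with [theta_spec]
    for the error. *)
Lemma theta_indep b tau beta (c : 'I_b -> C) : (0 < b)%N -> 0 < Im tau ->
  (forall u, \sum_(l < b) c l * theta (l%:R / b%:R) beta u tau = 0) -> forall l, c l = 0.
Proof.
move=> b0 t0 H j; have b0' : b%:R != 0 :> R by rewrite pnatr_eq0 -lt0n.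
pose al (l : 'I_b) : R := l%:R / b%:R.
have alE (l : 'I_b) : (l%:R / b%:R : C) = (al l)%:C. by rewrite rmorphM fmorphV !rmorph_nat.
have ha l : 0 <= al l <= 1. by rewrite divr_ge0 // ler_pdivrMr ?ltr0n // mul1r ler_nat ltnW.
pose F N s := \sum_(l < b) c l * thS tau beta (al l) N (b%:R * s)%:C.
pose co j a : C := cexp (pi%:C * 'i * (j%:~R + a%:C) ^+ 2 * tau + 2 * pi%:C * 'i * (j%:~R + a%:C) * beta).
have TE k l s : thT tau beta (al l) k (b%:R * s)%:C = co k (al l) * cis ((k * b%:Z + l%:Z)%:~R * s).
  rewrite -cexp_cis -cexpD; congr cexp.
  have -> : ((k * b%:Z + l%:Z)%:~R * s)%:C = (k%:~R + (al l)%:C) * (b%:R * s)%:C :> C.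
    rewrite -(rmorph_int (real_complex R)) -rmorphD -rmorphM; congr (_%:C).
    by rewrite /al; field.
  by ring.
have cint k l : cont01 (fun s => cis ((k * b%:Z + l%:Z)%:~R * s) * (cis (j%:R * s))^*).
  apply: cont01M; first exact/cont01_cis.
  rewrite (_ : (fun s => _) = fun s => cis (- j%:R * s)); first exact/cont01_cis.
  by apply/funext => s; rewrite mulNr cisN.
have orth k l : int01 (fun s : R => cis ((k * b%:Z + l%:Z)%:~R * s) * (cis (j%:R * s))^*) = (k * b%:Z + l%:Z == j%:Z)%:R.
  rewrite (eq_int01 (g := fun s => cis ((k * b%:Z + l%:Z - j%:Z)%:~R * s))); last first.
    by move=> s _; rewrite -cisN -cisD rmorphB mulrBl.
  case: eqVneq => [->|ne].
    rewrite -[RHS]int01_cst; apply: eq_int01 => s _; by rewrite subrr mul0r cis0.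
  apply: int01_cis; first by rewrite intr_eq0 subr_eq0.
  by rewrite -cexp_cis rmorph_int cexp_int.
have FE N s : F N s * (cis (j%:R * s))^* = \sum_(l < b) \sum_(k < N.*2.+1)
    (c l * co (k%:Z - N%:Z) (al l)) * (cis (((k%:Z - N%:Z) * b%:Z + l%:Z)%:~R * s) * (cis (j%:R * s))^*).
  rewrite mulr_suml; apply: eq_bigr => l _; rewrite mulr_sumr mulr_suml.
  by apply: eq_bigr => k _; rewrite TE !mulrA.
have cF N : cont01 (fun s => F N s * (cis (j%:R * s))^*). under eq_fun do rewrite FE.
  by apply: cont01_sum => l _; auto with sm.
have IF N : int01 (fun s => F N s * (cis (j%:R * s))^*) = c j * co 0 (al j).
  under eq_int01 => s _ do rewrite FE.
  rewrite int01_sum; auto with sm.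
  transitivity (\sum_(l < b) \sum_(k < N.*2.+1) (c l * co (k%:Z - N%:Z) (al l)) * ((k%:Z - N%:Z) * b%:Z + l%:Z == j%:Z)%:R).
    apply: eq_bigr => l _; rewrite int01_sum; auto with sm.
    by apply: eq_bigr => k _; rewrite int01Z ?orth.
  have key k (l : 'I_b) : ((k%:Z - N%:Z) * b%:Z + l%:Z == j%:Z) = (k == N :> nat) && (l == j).
    apply/eqP/andP => [E|[/eqP -> /eqP ->]]; last by rewrite subrr.
    have kN : k%:Z - N%:Z = 0.
      have := congr1 (fun x => divz x b%:Z) E; rewrite divzMDl; last by rewrite -lt0n.
      by rewrite !divz_small ?addr0 // ltz_nat //=.
    split; first by have /eqP := kN; rewrite subr_eq0 => /eqP [->].
    by apply/eqP/val_inj ; move: E; rewrite kN => -[].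
  have NN : (N < N.*2.+1)%N by rewrite -addnn leq_addr.
  rewrite (bigD1 j) //= [X in _ + X]big1 ?addr0 => [|l lj]; last first.
    by rewrite big1 // => k _; rewrite key (negbTE lj) andbF mulr0.
  rewrite (bigD1 (Ordinal NN)) //= [X in _ + X]big1 ?addr0 => [|k kN]; last first.
    rewrite key (_ : (k == N :> nat) = false) ?mulr0 //; apply: contra_neqF kN => /eqP h; exact/val_inj.
  by rewrite subrr eqxx mulr1.
have Z : c j * co 0 (al j) = 0. apply: cn_small => e e0.
  have [K K0 hK] := theta_spec beta (cn beta) t0.
  pose S : R := \sum_(l < b) cn (c l).
  have S0 : 0 <= S by rewrite sumr_ge0 // => l _; exact/cn_ge0.
  have [N hN] := archi_small (mulr_ge0 (mulr_ge0 (ler0n R 4) S0) K0) e0.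
  rewrite -(IF N); apply: le_trans hN.
  rewrite (_ : 4 * S * K / _ = 2 * (S * (K / N.+1%:R) * 2)); last by ring.
  apply: int01_le => // s _; apply: le_trans (cnM _ _) _.
  apply: ler_pM; rewrite ?cn_ge0 //; last by rewrite cnJ cn_cis.
  have -> : F N s = - \sum_(l < b) c l * (theta (al l)%:C beta (b%:R * s)%:C tau - thS tau beta (al l) N (b%:R * s)%:C).
    under [in RHS]eq_bigr do rewrite mulrBr.
    rewrite sumrB opprB (_ : \sum_(l < b) c l * theta _ _ _ _ = 0) ?subr0 //.
    by rewrite -[RHS](H (b%:R * s)%:C); apply: eq_bigr => l _; rewrite alE.
  rewrite cnN; apply: le_trans (cn_sum _ _ _) _; rewrite mulr_suml; apply: ler_sum => l _.
  apply: le_trans (cnM _ _) _; rewrite ler_wpM2l ?cn_ge0 //; apply: hK => //.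
  by rewrite cImD add0r Im_le_cn.
by move/eqP: Z; rewrite mulf_eq0 (negbTE (cexp_neq0 _)) orbF => /eqP.
Qed.

End Theta.

(** * The Laughlin states, their automorphy and their Gram matrix *)

Section Metric.
Context {R : realType} (tau : R[i]) (vol : dform R 1) (b n m : nat).
Hypotheses (htau : 0 < Im tau) (hvol : volume_form tau vol).
Hypotheses (hb : (0 < b)%N) (hn : (0 < n)%N) (hm : (0 < m)%N).
Notation C := R[i].
Notation V k := 'rV[R[i]]_k.
Notation st := (@laughlin_state R tau b n m).

Lemma btau : 0 < Im (b%:R * tau).
Proof.
by rewrite -(rmorph_nat (real_complex R)) cImM mul0r addr0 mulr_gt0 // ltr0n.
Qed.

Lemma half01 : (fun a : R => is_true (0 <= a <= 1)) (1 / 2). Proof. by rewrite /= divr_ge0 //= ler_pdivrMr // mul1r ler1n. Qed.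
Lemma halfC : (1 / 2 : C) = (1 / 2 : R)%:C.
Proof. by rewrite rmorphM fmorphV rmorph_nat. Qed.
Lemma lb01 l : (l <= b)%N -> (fun a : R => is_true (0 <= a <= 1)) (l%:R / b%:R).
Proof. by rewrite /= divr_ge0 //= ler_pdivrMr ?ltr0n // mul1r ler_nat. Qed.
Lemma lbC l : (l%:R / b%:R : C) = (l%:R / b%:R : R)%:C.
Proof. by rewrite rmorphM fmorphV !rmorph_nat. Qed.
Lemma theta1_entire1 : entire1 (fun z => theta1 z tau).
Proof. by rewrite /theta1 halfC; apply: theta_entire1 => //; exact/half01. Qed.

Lemma theta1_neq0 : exists z, theta1 z tau != 0.
Proof.
apply: contrapT => H.
have Z z : theta1 z tau = 0 by apply: contrapT => /eqP h; apply: H; exists z.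
(* [theta1] is the member l = 1 of the family of characteristics l / 2, so independence for b = 2
   prevents it from vanishing identically. *)
have := @theta_indep R 2 tau (1 / 2) (fun l => (l == 1 :> nat)%:R) (ltn0Sn _) htau _ (Ordinal (ltnSn 1)).
rewrite eqxx => h; have /eqP : (1 : C) = 0.
  apply: h => u; rewrite !big_ord_recl big_ord0 /= mul0r add0r addr0 !mul1r.
  by have := Z u; rewrite /theta1 !mul1r.
by rewrite oner_eq0.
Qed.

Lemma theta1_p1 z : theta1 (z + 1) tau = cexp (pi%:C * 'i) * theta1 z tau.
Proof.
rewrite /theta1 halfC (theta_shift1 _ _ htau half01); apply: (congr1 (fun x => cexp x * _)).
by field.
Qed.
Lemma theta1_m1 z : theta1 (z - 1) tau = cexp (- (pi%:C * 'i)) * theta1 z tau.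
Proof. by rewrite -{2}(subrK 1 z) theta1_p1 mulrA [cexp (- _) * _]mulrC cexpN_mul mul1r. Qed.

Lemma theta1_ptau z : theta1 (z + tau) tau = cexp (- (pi%:C * 'i * tau + 2 * pi%:C * 'i * (z + 1 / 2))) * theta1 z tau.
Proof.
have h0 : (fun a : R => is_true (0 <= a <= 1)) 0 by rewrite lexx ler01.
have h1 : (fun a : R => is_true (0 <= a <= 1)) (1 / 2 + 1 / 2) by rewrite -splitr lexx ler01.
have h2 : (fun a : R => is_true (0 <= a <= 1)) (0 + 1 / 2) by rewrite add0r half01.
have -> : z + tau = (z + (1 / 2 : R)%:C * tau) + (1 / 2 : R)%:C * tau by rewrite -halfC; field.
rewrite /theta1 {1}halfC (theta_shift_tau _ _ htau half01 h1) -splitr theta_char1 //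
  (theta_shift_tau _ _ htau h0 h2) add0r -!halfC.
rewrite mulrA -cexpD; congr (cexp _ * _).
by field.
Qed.

Lemma theta1_mtau z : theta1 (z - tau) tau = cexp (2 * pi%:C * 'i * z + pi%:C * 'i * (1 - tau)) * theta1 z tau.
Proof.
rewrite -{3}(subrK tau z) theta1_ptau mulrA -cexpD.
rewrite [X in cexp X](_ : _ = 0) ?cexp0; by field.
Qed.

(* z and the symmetric coordinates of w, as one vector *)
Definition stv (k : 'I_b) (v : V (n + m)) : C := st k (rootv (rsubmx v)) (lsubmx v).

Lemma esym1 (w : V m) : elem_sym w 0 (Ordinal hm) = \sum_j w 0 j.
Proof.
rewrite mxE (partition_big (fun I : {set 'I_m} => odflt (Ordinal hm) [pick j in I]) predT) //=.
apply: eq_bigr => j _; rewrite (bigD1 [set j]%SET) /=; last first.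
  rewrite finset.cards1; case: pickP => [k|/(_ j)]; rewrite finset.inE ?eqxx //.
rewrite finset.big_set1 big1 ?addr0 // => I /andP[/andP[/cards1P[k ->]]].
case: pickP => [k'|/(_ k)]; rewrite finset.inE ?eqxx // => /eqP -> /= /eqP ->.
by rewrite eqxx.
Qed.
Lemma pfun_z k : pfun (fun v : V (n + m) => lsubmx v 0 k).
Proof. by under eq_fun do rewrite mxE; auto with sm. Qed.
Lemma pfun_e k : pfun (fun v : V (n + m) => rsubmx v 0 k).
Proof. by under eq_fun do rewrite mxE; auto with sm. Qed.

(** In w the state involves only the sum of the w_g, which is e_1, and for each z_mu a product over
    all w_g, covered by [entire_symprod]; hence it is holomorphic in z and e together. *)
Lemma entire_stv k : entire (stv k).
Proof.
rewrite /stv /laughlin_state; apply: entireM; [apply: entireM|].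
- rewrite lbC; under eq_fun do rewrite -esym1 rootvK.
  apply: (@entire1_pfun _ _ (fun u => theta (k%:R / b%:R : R)%:C 0 u (b%:R * tau))).
    by apply: theta_entire1; [exact/btau|exact/lb01/ltnW].
  apply: pfunD; last exact/pfun_e.
  by apply: pfunZ; apply: pfun_sum => mu _; exact/pfun_z.
- apply: entire_prod => mu _; apply: entire_prod => nu _; apply: entireX.
  by apply/(entire1_pfun theta1_entire1)/pfunB; exact/pfun_z.
- apply: entire_prod => mu _.
  by apply: (entire_symprod _ _ theta1_entire1); [exact/pfun_z|exact/pfun_e].
Qed.

Lemma entire_st k w : entire (fun z => st k w z).
Proof.
apply: entireM; [apply: entireM|].
- rewrite lbC; apply: (@entire1_pfun _ _ (fun u => theta (k%:R / b%:R : R)%:C 0 u (b%:R * tau))).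
    by apply: theta_entire1; [exact/btau|exact/lb01/ltnW].
  apply: pfunD; last exact/pfun_cst.
  by auto with sm.
- apply: entire_prod => mu _; apply: entire_prod => nu _; apply: entireX.
  by apply: (entire1_pfun theta1_entire1); auto with sm.
- apply: entire_prod => mu _; apply: entire_prod => g _.
  by apply: (entire1_pfun theta1_entire1); auto with sm.
Qed.

Definition wt (z : V n) : C :=
  (expR (- (2 * pi / Im tau * (b * n + m)%:R * \sum_(mu < n) Im (z 0 mu) ^+ 2)))%:C
    * \prod_(mu < n) vol (z 0 mu)%:M finset.setT.

Lemma sm_expR q (f : V q -> C) : smooth f -> (forall v, Im (f v) = 0) ->
  smooth (fun v => (expR (Re (f v)))%:C).
Proof.
move=> hf h; apply/smoothP => r.
have hC : Cf (fun _ _ => True) r (fun v _ => f v) by move/smoothP: hf => hf'.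
apply: (@Cf_real_comp R q (fun _ _ => True) r (fun _ => expR) 0 (fun v _ => f v) (@dopenT R q)) => //.
Qed.

Lemma sm_wt : smooth wt.
Proof.
apply: smoothM.
  have -> : (fun z : V n => (expR (- (2 * pi / Im tau * (b * n + m)%:R * \sum_(mu < n) Im (z 0 mu) ^+ 2)))%:C) =
    fun z => (expR (Re (- (2 * pi / Im tau * (b * n + m)%:R)%:C * \sum_(mu < n) ((Im (z 0 mu))%:C * (Im (z 0 mu))%:C))))%:C.
    apply/funext => z; congr ((expR _)%:C); rewrite mulNr cReN cReM /= mul0r subr0 cRe_sum; congr (- (_ * _)).
    by apply: eq_bigr => mu _; rewrite cReM /= mulr0 subr0 expr2.
  apply: sm_expR.
    apply: smoothZ; apply: sm_sum => mu _; apply: smoothM; apply: smoothIm; exact/sm_coord.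
  move=> v; rewrite mulNr cImN cImM /= mul0r addr0 cIm_sum big1 ?mulr0 ?oppr0 // => mu _.
  by rewrite cImM /= mul0r mulr0 addr0.
apply: sm_prod => mu _; have [[h _] _ _] := hvol.
apply: (sm_comp (u := fun z => (z 0 mu)%:M : V 1) _ (h finset.setT)) => j.
by rewrite [j]ord1; under eq_fun do rewrite mxE eqxx mulr1n; exact/sm_coord.
Qed.

Lemma wt_gt0 z : 0 < wt z.
Proof.
rewrite mulr_gt0 ?ltcR ?expR_gt0 // prodr_gt0 // => mu _.
by have [_ _ ->] := hvol.
Qed.

Notation H := (@laughlin_metric R tau vol b n m).

Lemma l2E s s' : l2_product tau vol (b * n + m) s s' =
  (n`!%:R)^-1 * int_curves tau (fun z => s z * (s' z)^* * wt z).
Proof.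
congr (_ * int_curves _ _).
by apply/funext => z; rewrite !mulrA.
Qed.

Lemma avgs_row0 q ds g z e :
  avgs [seq (row_mx v 0 : V (n + q)) | v <- ds] g (row_mx z e) = avgs ds (fun y => g (row_mx y e)) z.
Proof.
elim: ds z => //= v ds IH z; apply: eq_int01 => s _.
by rewrite scale_row_mx scaler0 add_row_mx addr0 IH.
Qed.

Lemma sm_lsub f : smooth f -> smooth (fun v : V (n + m) => f (lsubmx v)).
Proof.
apply: (sm_comp (u := fun v => lsubmx v)) => j.
by under eq_fun do rewrite mxE; exact/sm_coord.
Qed.

(** The integrand is smooth in (z, e) jointly, and the integral is, up to a constant factor, an
    average along vectors in the z-directions only. *)
Lemma sm_metric k l : smooth (H k l).
Proof.
pose Phi v := stv k v * (stv l v)^* * wt (lsubmx v).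
have sPhi : smooth Phi. apply: smoothM; last exact/sm_lsub/sm_wt.
  by apply: smoothM; [|apply: smoothJ]; exact/entire_smooth/entire_stv.
have rowS e f : smooth f -> smooth (fun z : V n => f (row_mx z e)).
  apply: (sm_comp (u := fun z => row_mx z e)) => j.
  rewrite -(splitK j); case: (fintype.split j) => i.
    by under eq_fun do rewrite row_mxEl; exact/sm_coord.
  by under eq_fun do rewrite row_mxEr; exact/sm_cst.
have E e : H k l e = (n`!%:R)^-1 * ((Im tau)%:C ^+ n *
    avgs [seq row_mx v 0 | v <- dirs tau n] Phi (row_mx 0 e)).
  rewrite /laughlin_metric /sym_fun l2E avgs_row0 -int_curvesE; auto with sm.
  congr (_ * int_curves _ _); apply/funext => z.
  by rewrite /Phi /stv row_mxKl row_mxKr.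
rewrite (_ : H k l = fun e => H k l e) //; under eq_fun do rewrite E.
apply/smoothZ/smoothZ.
apply: (sm_comp (u := fun e => row_mx 0 e)); last exact/sm_avgs.
move=> j; rewrite -(splitK j); case: (fintype.split j) => i.
  by under eq_fun do rewrite row_mxEl; exact/sm_cst.
by under eq_fun do rewrite row_mxEr; exact/sm_coord.
Qed.

Lemma st_perm k (s : 'S_m) (w : V m) z : st k (\row_j w 0 (s j)) z = st k w z.
Proof.
have E1 : \sum_g (\row_j w 0 (s j)) 0 g = \sum_g w 0 g.
  by rewrite [RHS](reindex_inj (@perm_inj _ s)); apply: eq_bigr => g _; rewrite mxE.
have E2 mu : \prod_g theta1 (z 0 mu - (\row_j w 0 (s j)) 0 g) tau = \prod_g theta1 (z 0 mu - w 0 g) tau.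
  by rewrite [RHS](reindex_inj (@perm_inj _ s)); apply: eq_bigr => g _; rewrite mxE.
by rewrite /laughlin_state E1 [X in _ * X](eq_bigr _ (fun mu _ => E2 mu)).
Qed.

Definition Ht k l w : C := H k l (elem_sym w).

Lemma HtE k l w : Ht k l w = l2_product tau vol (b * n + m) (st k w) (st l w).
Proof.
rewrite /Ht /laughlin_metric /sym_fun.
apply: (rootv_sym (f := fun w => l2_product tau vol (b * n + m) (st k w) (st l w))) => s v.
by congr l2_product; apply/funext => z; exact/st_perm.
Qed.

Lemma sm_integrand k l w : smooth (fun z => st k w z * (st l w z)^* * wt z).
Proof.
apply: smoothM; last exact/sm_wt.
by apply: smoothM; [|apply: smoothJ]; exact/entire_smooth/entire_st.
Qed.
Lemma HtI k l w : Ht k l w = (n`!%:R)^-1 * ((Im tau)%:C ^+ n * avgs (dirs tau n) (fun z => st k w z * (st l w z)^* * wt z) 0).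
Proof. by rewrite HtE l2E int_curvesE //; exact/sm_integrand. Qed.

(** The weight does not involve w, so a factor of the states that is constant in z comes out of the
    integral. This makes the shifts of the metric explicit. *)
Lemma Ht_scale k l k' l' w w' c d : (forall z, st k w' z = c * st k' w z) ->
  (forall z, st l w' z = d * st l' w z) -> Ht k l w' = c * d^* * Ht k' l' w.
Proof.
move=> h1 h2; rewrite !HtI (_ : (fun z => _) = fun z => c * d^* * (st k' w z * (st l' w z)^* * wt z)); last first.
  by apply/funext => z; rewrite h1 h2; ring.
rewrite avgsZ; last exact/sm_integrand.
by ring.
Qed.

Lemma sum_shift j (w : V m) (c : C) : \sum_g (w + c *: delta_mx 0 j) 0 g = \sum_g w 0 g + c.
Proof.
under eq_bigr do rewrite !mxE.
rewrite big_split; congr (_ + _); rewrite (bigD1 j) //= !eqxx mulr1 big1 ?addr0 // => g /negbTE ->.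
by rewrite mulr0.
Qed.

Lemma st_shift1 j k (w : V m) z : st k (w + delta_mx 0 j) z =
  cexp (2 * pi%:C * 'i * (k%:R / b%:R)) * cexp (- (pi%:C * 'i)) ^+ n * st k w z.
Proof.
rewrite /laughlin_state -[delta_mx 0 j]scale1r sum_shift addrA lbC theta_shift1; last first.
- exact/lb01/ltnW.
- exact/btau.
have -> : \prod_(mu < n) \prod_(g < m) theta1 (z 0 mu - (w + 1 *: delta_mx 0 j) 0 g) tau =
    cexp (- (pi%:C * 'i)) ^+ n * \prod_(mu < n) \prod_(g < m) theta1 (z 0 mu - w 0 g) tau.
  rewrite -[X in _ ^+ X]card_ord -prodr_const -big_split; apply: eq_bigr => mu _.
  rewrite (bigD1 j) //= [in RHS](bigD1 j) //= mulrA !mxE !eqxx mulr1 opprD addrA theta1_m1.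
  by congr (_ * _); apply: eq_bigr => g gj; rewrite !mxE (negbTE gj) mulr0 addr0.
by ring.
Qed.

Definition next k : 'I_b := ordS k.

Definition Gfac j (w : V m) : C := cexp (- (2 * pi%:C * 'i * ((\sum_g w 0 g) / b%:R + n%:R * w 0 j))
        + (n%:R * (pi%:C * 'i * (1 - tau)) - pi%:C * 'i * tau / b%:R)).

(** A shift by tau is 1 / b of the period b tau of the first theta function and moves the
    characteristic l / b to (l + 1) / b, read cyclically. The factor exp(-2 pi i sum z_mu) it
    produces cancels against the one from the [theta1] factors, so that [Gfac] does not depend on
    z. *)
Lemma st_shift_tau j k (w : V m) z : st k (w + tau *: delta_mx 0 j) z = Gfac j w * st (next k) w z.
Proof.
have bn0 : b%:R != 0 :> C by rewrite pnatr_eq0 -lt0n.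
rewrite /laughlin_state sum_shift addrA.
set u := b%:R * _ + _.
have -> : theta (k%:R / b%:R) 0 (u + tau) (b%:R * tau) =
  cexp (- (pi%:C * 'i * tau / b%:R + 2 * pi%:C * 'i * (u / b%:R))) * theta ((next k)%:R / b%:R) 0 u (b%:R * tau).
  have e1 : tau = (1%:R / b%:R : R)%:C * (b%:R * tau) by rewrite -lbC; field.
  rewrite {1}e1 lbC theta_shift_tau; first last.
  - by rewrite -mulrDl natr1; exact/lb01.
  - exact/lb01/ltnW.
  - exact/btau.
  congr (_ * _); first by congr cexp; field.
  have -> : k%:R / b%:R + 1%:R / b%:R = k.+1%:R / b%:R :> R by rewrite -mulrDl natr1.
  rewrite -!lbC /=; have [h|h] := ltnP k.+1 b; first by rewrite modn_small.
  have -> : k.+1 = b by apply/eqP; rewrite eqn_leq h andbT.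
  by rewrite modnn mul0r divff // theta_char1 //; exact/btau.
have -> : \prod_(mu < n) \prod_(g < m) theta1 (z 0 mu - (w + tau *: delta_mx 0 j) 0 g) tau =
    cexp (2 * pi%:C * 'i * (\sum_(mu < n) z 0 mu - n%:R * w 0 j) + n%:R * (pi%:C * 'i * (1 - tau)))
    * \prod_(mu < n) \prod_(g < m) theta1 (z 0 mu - w 0 g) tau.
  have -> : cexp (2 * pi%:C * 'i * (\sum_(mu < n) z 0 mu - n%:R * w 0 j) + n%:R * (pi%:C * 'i * (1 - tau))) =
     \prod_(mu < n) cexp (2 * pi%:C * 'i * (z 0 mu - w 0 j) + pi%:C * 'i * (1 - tau)).
    have E : forall l, \prod_(mu <- l) cexp (2 * pi%:C * 'i * (z 0 mu - w 0 j) + pi%:C * 'i * (1 - tau)) =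
       cexp (2 * pi%:C * 'i * (\sum_(mu <- l) z 0 mu - (size l)%:R * w 0 j) + (size l)%:R * (pi%:C * 'i * (1 - tau))).
      elim=> [|mu l IH]; first by rewrite !big_nil !mul0r subrr mulr0 addr0 cexp0.
      rewrite !big_cons IH -cexpD /=; congr cexp; ring.
    by rewrite E -sum1_size sum1_card card_ord.
  rewrite -big_split; apply: eq_bigr => mu _.
  rewrite (bigD1 j) //= [in RHS](bigD1 j) //= mulrA !mxE !eqxx mulr1 opprD addrA theta1_mtau.
  by congr (_ * _); apply: eq_bigr => g gj; rewrite !mxE (negbTE gj) mulr0 addr0.
have -> : Gfac j w = cexp (- (pi%:C * 'i * tau / b%:R + 2 * pi%:C * 'i * (u / b%:R))) *
   cexp (2 * pi%:C * 'i * (\sum_(mu < n) z 0 mu - n%:R * w 0 j) + n%:R * (pi%:C * 'i * (1 - tau))).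
  by rewrite -cexpD /u; congr cexp; field.
ring.
Qed.

Lemma avgs_ge0 q vs (g : V q -> C) w : (forall w, 0 <= g w) -> 0 <= avgs vs g w.
Proof.
move=> hg; elim: vs w => //= v vs IH w; apply: int01_ge0 => s _.
by rewrite mul1r.
Qed.

Lemma avg1_eq0 q v (g : V q -> C) w (s : R) : smooth g -> (forall w, 0 <= g w) -> avg1 v g w = 0 ->
  0 <= s <= 1 -> g (w + s%:C *: v) = 0.
Proof.
move=> hg h0 hz hs; have := @int01_gt0 R (fun s => 1 * g (w + s%:C *: v)) _ _ hz s hs.
rewrite mul1r; apply; first exact: (smf_cont01 w (smf_wavg v (@rho1 R q) hg)).
by move=> t _; rewrite mul1r.
Qed.

(** A nonnegative continuous function with zero average along a segment vanishes on it; this is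
    applied in one direction after the other and reaches the points of the closed period cell. *)
Lemma avgs_eq0 q g : smooth g -> (forall w, 0 <= g w) -> avgs (dirs tau q) g 0 = 0 ->
  forall z : V q, (forall j, exists s t : R, [/\ 0 <= s <= 1, 0 <= t <= 1 & z 0 j = s%:C + t%:C * tau]) -> g z = 0.
Proof.
elim: q g => [|q IH] g hg h0. by move=> hz z _; rewrite (_ : z = 0) //; apply/rowP => -[].
move=> hz z hzj; have [s [t [hs ht hst]]] := hzj ord0.
pose ds := [seq (row_mx 0 v : 'rV_(1 + q)) | v <- dirs tau q].
have sG : smooth (avgs ds g) by exact/sm_avgs.
have ge1 w : 0 <= avg1 (row_mx tau%:M 0 : 'rV_(1 + q)) (avgs ds g) w.
  by apply: (@avgs_ge0 _ [:: (row_mx tau%:M 0 : 'rV_(1 + q))]) => w'; exact/avgs_ge0.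
have h1 := avg1_eq0 (sm_wavg (row_mx tau%:M 0) (@rho1 R q.+1) sG) ge1 hz hs.
have h2 := avg1_eq0 sG (fun w => avgs_ge0 _ _ h0) h1 ht.
have zE : z = row_mx (s%:C + t%:C * tau)%:M (\row_j z 0 (lift ord0 j)) :> 'rV_(1 + q).
  apply/rowP => j; rewrite mxE; case: splitP => k jk; rewrite ?ord1 !mxE.
    by rewrite -hst; congr (z 0 _); apply: ord_inj; rewrite jk ord1.
  by congr (z 0 _); apply: ord_inj.
have wE : 0 + s%:C *: (row_mx 1%:M 0 : 'rV_(1 + q)) + t%:C *: (row_mx tau%:M 0 : 'rV_(1 + q)) = row_mx (s%:C + t%:C * tau)%:M 0.
  by rewrite !scale_row_mx !scaler0 add0r add_row_mx addr0 !scale_scalar_mx mulr1 -raddfD.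
rewrite wE avgs_row in h2; rewrite zE.
apply: (IH (fun y => g (row_mx (s%:C + t%:C * tau)%:M y)) _ _ h2).
- exact/sm_row.
- by move=> w.
- by move=> j; rewrite mxE.
Qed.

(** The centre of the period cell is an interior point, so that a function vanishing on the cell
    vanishes on an open set. The radius keeps both real coordinates with respect to 1 and tau within
    1/2 of those of the centre. *)
Lemma box_nbhs : exists2 d, 0 < d & forall u, cn (u - (1 + tau) / 2) < d ->
  exists s t : R, [/\ 0 <= s <= 1, 0 <= t <= 1 & u = s%:C + t%:C * tau].
Proof.
have T0 := htau; set T := Im tau in T0 *; set X := Re tau.
have X0 := normr_ge0 X; have K0 : 0 < T + 1 + `|X| by lra.
pose d := T / (2 * (T + 1 + `|X|)); have dK : d * (2 * (T + 1 + `|X|)) = T by rewrite divfK // gt_eqF // mulr_gt0.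
have d0 : 0 < d by rewrite divr_gt0 // mulr_gt0.
exists d => // u hu; pose p := Im (u - (1 + tau) / 2) / T; pose a := Re (u - (1 + tau) / 2).
have ha : `|a| < d := le_lt_trans (Re_le_cn _) hu.
have hp : `|p| * T < d.
  by rewrite /p normrM normfV (gtr0_norm T0) divfK ?gt_eqF //; exact: le_lt_trans (Im_le_cn _) hu.
have p0 := normr_ge0 p.
have h1 : `|p| <= 1 / 2 by rewrite -(ler_pM2r T0); nra.
have h2 : `|a - p * X| <= 1 / 2.
  apply: le_trans (ler_normB _ _) _; rewrite normrM -(ler_pM2r T0); nra.
exists (1 / 2 + (a - p * X)), (1 / 2 + p); split.
- by move: h2; rewrite ler_norml => /andP[]; lra.
- by move: h1; rewrite ler_norml => /andP[]; lra.
have e2 : (1 + tau) / 2 = (1 / 2 : R)%:C * (1 + tau) by rewrite -halfC; field.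
have hI : Im (u - (1 + tau) / 2) = p * T by rewrite /p divfK // gt_eqF.
have hR : Re (u - (1 + tau) / 2) = a by [].
have : u = (u - (1 + tau) / 2) + (1 / 2 : R)%:C * (1 + tau) by rewrite -e2 subrK.
move: hI hR; move: (u - (1 + tau) / 2) => q hI hR ->.
by apply: ceqP; rewrite !(cReD, cImD, cReM, cImM) ?hI ?hR /= -/T -/X; ring.
Qed.

(** The combination of states is an entire function f, built from theta functions of the sum of the
    z_mu, times a product q that is not identically 0. Entire functions have no zero divisors, and
    [theta_indep] concludes. *)
Lemma st_indep w (c : 'I_b -> C) : (forall z, \sum_k c k * st k w z = 0) -> forall k, c k = 0.
Proof.
move=> h; pose th l u := theta (l%:R / b%:R) 0 u (b%:R * tau).
pose W := \sum_g w 0 g.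
apply: (theta_indep hb btau (beta := 0)) => u; apply: contrapT => /eqP hu.
pose f (z : V n) := \sum_l c l * th l (b%:R * \sum_(mu < n) z 0 mu + W).
pose q (z : V n) := (\prod_(mu < n) \prod_(nu < n | (mu < nu)%N) theta1 (z 0 mu - z 0 nu) tau ^+ b)
  * \prod_(mu < n) \prod_(g < m) theta1 (z 0 mu - w 0 g) tau.
have [x0 hx0] := theta1_neq0.
have bn0 : b%:R != 0 :> C by rewrite pnatr_eq0 -lt0n.
have e1 mu nu : entire (fun z => theta1 (z 0 mu - z 0 nu) tau ^+ b).
  by apply/entireX/(entire1_pfun theta1_entire1); auto with sm.
have e2 mu g : entire (fun z => theta1 (z 0 mu - w 0 g) tau).
  by apply: (entire1_pfun theta1_entire1); auto with sm.
have ef : entire f. apply: entire_sum => l _; apply: entireM; auto with sm.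
  rewrite /th lbC; apply: (@entire1_pfun _ _ (fun u => theta (l%:R / b%:R : R)%:C 0 u (b%:R * tau))).
    by apply: theta_entire1; [exact/btau|exact/lb01/ltnW].
  apply: pfunD; last exact/pfun_cst.
  by auto with sm.
have eq1 : entire q. by apply: entireM; auto with sm.
(* All particles but one are put at 0 and the remaining one at (u - W) / b, so that the theta
   argument becomes u. *)
have nzf : f (\row_mu (if mu == Ordinal hn then (u - W) / b%:R else 0)) != 0.
  rewrite /f (_ : b%:R * _ + W = u) //.
  under eq_bigr do rewrite mxE.
  by rewrite -big_mkcond big_pred1_eq mulrC divfK // subrK.
have [v2 nzq] : exists v, q v != 0.
  have [v1 nz1] : exists v : V n, \prod_(mu < n) \prod_(nu < n | (mu < nu)%N) theta1 (v 0 mu - v 0 nu) tau ^+ b != 0.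
    apply: entire_prod_neq0 => mu _; auto with sm.
    apply: entire_prod_neq0 => nu hmn //.
    exists (\row_k (if k == mu then x0 else 0)); rewrite !mxE eqxx.
    by rewrite (gtn_eqF hmn : (nu == mu) = false) subr0 expf_neq0.
  have [v2 nz2] : exists v : V n, \prod_(mu < n) \prod_(g < m) theta1 (v 0 mu - w 0 g) tau != 0.
    apply: entire_prod_neq0 => mu _; auto with sm.
    apply: entire_prod_neq0 => g _ //.
    by exists (\row_k (x0 + w 0 g)); rewrite mxE addrK.
  apply: entireM_neq0 nz1 nz2; first by auto with sm.
  by auto with sm.
have [v] := entireM_neq0 ef eq1 nzf nzq.
suff -> : f v * q v = \sum_k c k * st k w v by rewrite h eqxx.
rewrite mulr_suml.
by apply: eq_bigr => l _; rewrite !mulrA.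
Qed.

Definition Hmat w : 'M[C]_b := \matrix_(k, l) Ht k l w.

(** A kernel vector would give a combination F of the states with norm 0. Then F vanishes on the
    period cell, hence everywhere by [entire_dense], against [st_indep]. *)
Lemma Hmat_unit w : Hmat w \in unitmx.
Proof.
rewrite unitmxE unitfE; apply/negP => /det0P [c c0 hc].
have Hc : \sum_k \sum_l c 0 k * (c 0 l)^* * Ht k l w = 0. rewrite exchange_big big1 // => l _.
  have := congr1 (fun M : 'rV_b => M 0 l) hc; rewrite !mxE => E.
  transitivity ((c 0 l)^* * \sum_j c 0 j * Hmat w j l); last by rewrite E mulr0.
  rewrite mulr_sumr; apply: eq_bigr => k _; rewrite mxE; ring.
pose F z := \sum_k c 0 k * st k w z.
pose g z := F z * (F z)^* * wt z.
have eF : entire F by apply: entire_sum => k _; apply: entireM; [exact/entire_cst|exact/entire_st].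
have sF : smooth F by exact/entire_smooth.
have sg : smooth g by apply: smoothM; [apply: smoothM => //; exact/smoothJ|exact/sm_wt].
have g0 z : 0 <= g z. by rewrite mulr_ge0 ?(ltW (wt_gt0 z)) // -normCK exprn_ge0.
have gz : avgs (dirs tau n) g 0 = 0.
  have n0 : (n`!%:R)^-1 != 0 :> C by rewrite invr_eq0 pnatr_eq0 -lt0n fact_gt0.
  have t0 : (Im tau)%:C ^+ n != 0 by rewrite expf_neq0 // eq_complex /= eqxx andbT gt_eqF.
  apply/(mulfI t0)/(mulfI n0); rewrite !mulr0 -[RHS]Hc.
  have -> : g = fun z => \sum_k \sum_l c 0 k * (c 0 l)^* * (st k w z * (st l w z)^* * wt z).
    apply/funext => z; rewrite /g /F rmorph_sum !mulr_suml; apply: eq_bigr => k _.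
    rewrite mulr_sumr mulr_suml; apply: eq_bigr => l _; rewrite rmorphM /=; ring.
  have si k l : smooth (fun z => c 0 k * (c 0 l)^* * (st k w z * (st l w z)^* * wt z)).
    exact/smoothZ/sm_integrand.
  rewrite avgs_sum => [|k _]; last by apply: sm_sum => l _; exact/si.
  rewrite !mulr_sumr; apply: eq_bigr => k _.
  rewrite avgs_sum => [|l _]; last exact/si.
  rewrite !mulr_sumr; apply: eq_bigr => l _.
  rewrite avgsZ; last exact/sm_integrand.
  rewrite HtI; ring.
have [d d0 hd] := box_nbhs.
have FZ z : F z = 0. apply: contrapT => /eqP Fz.
  have [v hv] := entire_dense (\row_(j < n) ((1 + tau) / 2)) eF Fz d0.
  have := @avgs_eq0 n g sg g0 gz v; rewrite /g => H Fv.
  have : F v * (F v)^* * wt v = 0. by apply: H => j; apply: hd; have := hv j; rewrite mxE.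
  move=> /eqP; rewrite mulf_eq0 (gt_eqF (wt_gt0 v)) orbF mulf_eq0 conjc_eq0 orbb.
  by rewrite (negbTE Fv).
have c00 := st_indep (c := fun k => c 0 k) FZ.
by move/eqP: c0; apply; apply/rowP => k; rewrite mxE c00.
Qed.

End Metric.

(** * How a Chern connection form follows a factor of automorphy *)

Section Automorphy.
Context {R : realType} {b' m : nat}.
Notation b := b'.+1.
Notation C := R[i].
Notation V := 'rV[R[i]]_m.
Notation MC := 'M[C]_b.

(** Twice the holomorphic derivative in w_j; the factors 2 in the hypotheses below match it. *)
Definition dz j f (w : V) : C := pd (j, false) f w - 'i * pd (j, true) f w.

Lemma dzM j f g w : smooth f -> smooth g -> dz j (fun v => f v * g v) w = dz j f w * g w + f w * dz j g w.
Proof. move=> hf hg; rewrite /dz (pdM _ _ hf hg) (pdM _ _ hf hg).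
by move: (pd (j, false) f w) (pd (j, true) f w) (pd (j, false) g w) (pd (j, true) g w) (f w) (g w) => x y z t u v; ring. Qed.
Lemma dzZ j c f w : smooth f -> dz j (fun v => c * f v) w = c * dz j f w.
Proof. move=> hf; rewrite /dz (pdZ _ _ _ hf) (pdZ _ _ _ hf).
by move: (pd (j, false) f w) (pd (j, true) f w) => x y; ring. Qed.
Lemma dz_sum j I l (P : pred I) F w : (forall k, P k -> smooth (F k)) ->
  dz j (fun v => \sum_(k <- l | P k) F k v) w = \sum_(k <- l | P k) dz j (F k) w.
Proof.
move=> h; rewrite /dz !pd_sum // mulr_sumr -sumrB //.
Qed.
Lemma dz_trans j f u w : dz j (fun v => f (v + u)) w = dz j f (w + u).
Proof. by rewrite /dz !pd_trans. Qed.

Variables (H : V -> MC) (X : 'I_m -> V -> MC).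
Hypotheses (sH : forall k l, smooth (fun w => H w k l)) (uH : forall w, H w \in unitmx).
Hypothesis XH : forall j w k l, dz j (fun w => H w k l) w = 2 * ((X j w)^T *m H w) k l.

(** The relation H(w + la) = g Z H Y is differentiated. Since X^T H is the holomorphic derivative of
    H and H is invertible, X is conjugated by a constant matrix and shifted by ka, the logarithmic
    derivative of g. *)
Lemma automorphy (la : V) g (ka : 'I_m -> C) Z Z' Y Y' :
  Z' *m Z = 1%:M -> Y *m Y' = 1%:M -> smooth g -> (forall w, g w != 0) ->
  (forall j w, dz j g w = 2 * ka j * g w) ->
  (forall w, H (w + la) = g w *: (Z *m H w *m Y)) ->
  forall j w, X j (w + la) = Z'^T *m X j w *m Z^T + (ka j)%:M.
Proof.
move=> ZZ YY sg g0 hg hH j w.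
have ZZ' : Z *m Z' = 1%:M by rewrite mulmx1C.
have E : (X j (w + la))^T *m H (w + la) = g w *: (ka j *: (Z *m H w *m Y) + Z *m (X j w)^T *m H w *m Y).
  apply/matrixP => k l.
  have two : (2 : C) != 0 by [].
  apply: (mulfI two); rewrite -XH -dz_trans.
  rewrite (_ : (fun v => H (v + la) k l) = fun v => g v * (Z *m H v *m Y) k l); last first.
    by apply/funext => v; rewrite hH mxE.
  have SE : (fun v => (Z *m H v *m Y) k l) = fun v => \sum_p \sum_q Z k q * Y p l * H v q p.
    apply/funext => v; rewrite mxE; apply: eq_bigr => p _; rewrite mxE mulr_suml.
    by apply: eq_bigr => q _; ring.
  have sS p q : smooth (fun v => Z k q * Y p l * H v q p) by apply: smoothZ.
  rewrite dzM //; last by rewrite SE; auto with sm.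
  have -> : dz j (fun v => (Z *m H v *m Y) k l) w = 2 * (Z *m (X j w)^T *m H w *m Y) k l.
    rewrite SE dz_sum => [|p _]; auto with sm.
    rewrite -[Z *m _ *m H w]mulmxA [in RHS]mxE mulr_sumr; apply: eq_bigr => p _.
    rewrite dz_sum // [in RHS]mxE mulr_suml mulr_sumr; apply: eq_bigr => q _.
    by rewrite dzZ // XH; ring.
  by rewrite hg [in RHS]mxE [in RHS]mxE [X in _ = _ * (_ * (X + _))]mxE; ring.
have E2 : (X j (w + la))^T *m Z = ka j *: Z + Z *m (X j w)^T. apply: (can_inj (mulmxK (uH w))).
  have Yinj (A B : MC) : A *m Y = B *m Y -> A = B.
    by move=> /(congr1 (mulmx^~ Y')); rewrite -!mulmxA YY !mulmx1.
  apply: Yinj; apply: (scalerI (g0 w)).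
  have := E; rewrite hH -scalemxAr !mulmxA => ->.
  by rewrite !mulmxDl -!scalemxAl.
have : (X j (w + la))^T = ka j *: 1%:M + Z *m (X j w)^T *m Z'.
  by rewrite -[LHS]mulmx1 -ZZ' mulmxA E2 mulmxDl -scalemxAl.
move=> /(congr1 trmx); rewrite trmxK => ->.
by rewrite raddfD /= linearZ /= trmx1 scalemx1 !trmx_mul trmxK addrC mulmxA.
Qed.

End Automorphy.

(** * The connection matrix pulled back to the w-space *)

Section Connection.
Context {R : realType} {b' m : nat}.
Notation b := b'.+1.
Notation C := R[i].
Notation V := 'rV[R[i]]_m.
Notation E := (@elem_sym R m).
Notation MC := 'M[C]_b.
Notation M := 'M[dform R m]_b.

Lemma smap_sym : smap E.
Proof. move=> j; exact/entire_smooth/entire_pfun/pfun_esym. Qed.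
Lemma pd_conj i f (w : V) : smooth f -> pd i (fun v => (f v)^*) w = (pd i f w)^*.
Proof. move=> hf; exact/pd_eq/pderJ/pder_pd. Qed.

Lemma pd_rcomp_real i a w :
  (pd i (fun v => (rcomp a (E v))%:C) w)^* = pd i (fun v => (rcomp a (E v))%:C) w.
Proof.
rewrite -pd_conj; last exact: (sm_comp_rcomp smap_sym).
by apply: pd_ext => v; exact/conjc_real.
Qed.

Lemma pd_pfun (P : V -> C) j w : pfun P -> pd (j, true) P w = 'i * pd (j, false) P w.
Proof.
move=> hP; have [Q [_ hQ _]] := pfun_der j hP.
by rewrite (pd_eq (hQ true w)) (pd_eq (hQ false w)) mul1r.
Qed.

Section OneForm.
Variable (om : dform R m).
Hypotheses (h1 : homog 1 om) (h10 : forall w (j : 'I_m), om w [set (j, true)]%SET = 'i * om w [set (j, false)]%SET).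

(** [elem_sym] is holomorphic, so its Cauchy-Riemann equations carry the type (1,0) over to the
    pullback. *)
Lemma pb_10 w j : pullback E om w [set (j, true)]%SET = 'i * pullback E om w [set (j, false)]%SET.
Proof.
have EE c : pullback E om w [set (j, c)]%SET = \sum_k om (E w) [set (k, false)]%SET * pd (j, c) (fun v => E v 0 k) w.
  rewrite (pb_1form _ _ _ h1) sum_rcoord; apply: eq_bigr => k _.
  rewrite h10 [RHS](_ : _ = om (E w) [set (k, false)]%SET * (pd (j, c) (fun v => (rcomp (k, false) (E v))%:C) w + 'i * pd (j, c) (fun v => (rcomp (k, true) (E v))%:C) w)).
    by ring.
  congr (_ * _); rewrite -pdZ; last exact: (sm_comp_rcomp smap_sym).
  rewrite -pdD; [|exact: (sm_comp_rcomp smap_sym)|exact/smoothZ/(sm_comp_rcomp smap_sym)].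
  apply: pd_ext => v.
  by apply: ceqP; rewrite /=; ring.
rewrite !EE mulr_sumr; apply: eq_bigr => k _.
by rewrite (pd_pfun _ _ (pfun_esym k)); ring.
Qed.
End OneForm.

Variables (H : 'I_b -> 'I_b -> V -> C) (A : mform R m b).
Hypotheses (sH : forall k l, smooth (H k l)) (hA : chern_connection H A).

Definition Am : M := \matrix_(k, l) A k l.
Definition At : M := map_mx (pullback E) Am.
Definition Xc (j : 'I_m) w : MC := \matrix_(k, l) (At k l w [set (j, false)]%SET).
Definition Hc w : MC := \matrix_(k, l) H k l (E w).

Lemma sAm : smM Am. Proof. by move=> k l; rewrite mxE; case: hA. Qed.
Lemma hAm : hmM 1 Am. Proof. by move=> k l; rewrite mxE; case: hA. Qed.
Lemma At_true k l w j : At k l w [set (j, true)]%SET = 'i * At k l w [set (j, false)]%SET.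
Proof. by rewrite !mxE; apply: pb_10; case: hA. Qed.

Lemma pd_Hc i k l w : pd i (fun w => Hc w k l) w =
  \sum_j (At j k w [set i]%SET * Hc w j l + Hc w k j * (At j l w [set i]%SET)^*).
Proof.
case: hA => _ h1 _ h4.
under pd_ext do rewrite mxE.
rewrite (pd_comp _ _ smap_sym (sH k l)).
have pdH a e : pd a (H k l) e = \sum_j (A j k e [set a]%SET * H j l e + H k j e * (A j l e [set a]%SET)^*).
  rewrite -h4 extd_form0E sumfE -[LHS](@big_pred1_eq _ 0 +%R _ a (fun i => pd i (H k l) e)).
  rewrite big_mkcond /=; apply: eq_bigr => c _; rewrite mulf0E /ef (inj_eq set1_inj) eq_sym.
  by case: eqP => _; [rewrite [RHS]mulr1|rewrite [RHS]mulr0].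
under eq_bigr do rewrite pdH mulr_sumr.
rewrite exchange_big /=; apply: eq_bigr => j _.
rewrite !mxE !(pb_1form _ _ _ (h1 _ _)) rmorph_sum mulr_suml mulr_sumr -big_split /=.
by apply: eq_bigr => a _; rewrite rmorphM /= pd_rcomp_real; ring.
Qed.

(** In the metric condition the term with the conjugate of [At] is of type (0,1) and drops out of
    the holomorphic derivative. *)
Lemma Xc_Hc j w k l : dz j (fun w => Hc w k l) w = 2 * ((Xc j w)^T *m Hc w) k l.
Proof.
rewrite /dz !pd_Hc mulr_sumr -sumrB mxE mulr_sumr; apply: eq_bigr => p _.
rewrite !At_true !rmorphM /= [(Xc j w)^T k p]mxE [Xc j w p k]mxE.
have i2 : 'i * 'i = -1 :> C by rewrite -expr2 sqr_i.
have ic : ('i : C)^* = - 'i by apply: ceqP; rewrite /= ?oppr0.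
rewrite ic.
move: (At p k w _) (At p l w _)^* (Hc w p l) (Hc w k p) => x y z t.
rewrite (_ : x * z + t * y - 'i * ('i * x * z + t * (- 'i * y)) = x * z + t * y - ('i * 'i) * (x * z) + ('i * 'i) * (t * y)); last by ring.
by rewrite i2; ring.
Qed.

End Connection.

(** As a ring morphism, pullback extends to matrices and polynomials of forms; this transports
    Chern-Simons forms in [pb_cs]. *)
HB.instance Definition _ (R : realType) p m f :=
  GRing.isZmodMorphism.Build (dform R m) (dform R p) (pullback f) (@pbB R p m f).
HB.instance Definition _ (R : realType) p m f :=
  GRing.isMonoidMorphism.Build (dform R m) (dform R p) (pullback f)
    (conj (@pullback1 R p m f) (@pbM R p m f)).

(** * Pullback of curvatures and Chern-Simons forms *)

Section PullbackCS.
Context {R : realType} {b' p m : nat} (f : 'rV[R[i]]_p -> 'rV[R[i]]_m).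
Notation b := b'.+1.
Hypothesis hf : smap f.
Notation phi := (map_mx (pullback f)).

Lemma pb_dM (B : 'M[dform R m]_b) : smM B -> phi (dM B) = dM (phi B).
Proof. by move=> sB; apply/matrixP => k l; rewrite !mxE extd_pb. Qed.
Lemma smM_pb (B : 'M[dform R m]_b) : smM B -> smM (phi B).
Proof. by move=> sB k l; rewrite mxE; auto with sm. Qed.
Lemma hmM_pb q (B : 'M[dform R m]_b) : hmM q B -> hmM q (phi B).
Proof. by move=> sB k l; rewrite mxE; auto with sm. Qed.

Lemma pb_curvW (B : 'M[dform R m]_b) : smM B -> map_poly phi (curvW B) = curvW (phi B).
Proof.
move=> sB; rewrite !curvW_E rmorphM rmorphD rmorphM /= map_polyX !map_polyC /=.
by rewrite pb_dM // rmorphM.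
Qed.

Lemma pb_cs (B : 'M[dform R m]_b) k : smM B -> pullback f (cs B k) = cs (phi B) k.
Proof.
move=> sB; rewrite rmorph_sum; apply: eq_bigr => j _.
rewrite rmorphM /= pb_cf; rewrite -trace_map_mx.
by rewrite -coef_map rmorphM rmorphXn /= pb_curvW // map_polyC.
Qed.
End PullbackCS.

(** * Lattice shifts of the Laughlin connection *)

Section LaughlinConnection.
Context {R : realType} (tau : R[i]) (vol : dform R 1) (b' n m : nat).
Notation b := b'.+1.
Notation C := R[i].
Notation V := 'rV[R[i]]_m.
Notation E := (@elem_sym R m).
Hypotheses (htau : 0 < Im tau) (hvol : volume_form tau vol).
Hypotheses (hn : (0 < n)%N) (hm : (0 < m)%N).
Notation H := (@laughlin_metric R tau vol b n m).
Variable A : mform R m b.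
Hypothesis hA : chern_connection H A.
Notation M := 'M[dform R m]_b.
Notation At := (At A).
Notation S la := (pullback (fun w : V => w + la)).

Definition dzf j : dform R m := ef (j, false) + cf 'i * ef (j, true).

Lemma shift_smap (la : V) : smap (fun w => w + la).
Proof. by move=> j; under eq_fun do rewrite mxE; apply: smoothD; auto with sm. Qed.

Let sH k l : smooth (H k l). Proof. exact/sm_metric. Qed.
Lemma Hc_unit w : Hc H w \in unitmx.
Proof. exact/Hmat_unit. Qed.
Lemma sHc k l : smooth (fun w => Hc H w k l).
Proof. under eq_fun do rewrite mxE; apply: sm_comp => //; exact/smap_sym. Qed.
Lemma homog_dzf j : homog 1 (dzf j).
Proof. by apply: homogD; [exact/homog_ef|exact/homogMf0/homog_ef]. Qed.
Lemma hAt : hmM 1 At.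
Proof. by apply: hmM_pb; exact: hAm hA. Qed.
Lemma sAt : smM At.
Proof. by apply: smM_pb; [exact/smap_sym|exact: sAm hA]. Qed.

Lemma form1_eq (om eta : dform R m) : homog 1 om -> homog 1 eta ->
  (forall w j c, om w [set (j, c)] = eta w [set (j, c)]) -> om = eta.
Proof.
move=> h1 h2 h; apply: formP => w I; have [/cards1P[[j c] ->]|hI] := boolP (#|I| == 1%N); first exact/h.
by rewrite h1 ?h2; exact/eqP.
Qed.

Lemma dzf_sum ka w j c :
  (\sum_i form0 (ka i) * dzf i) w [set (j, c)] = (if c then 'i else 1) * ka j w.
Proof.
have efE i d : ef (i, d) w [set (j, c)] = ((i == j) && (d == c))%:R.
  by rewrite /ef (inj_eq set1_inj) xpair_eqE [j == i]eq_sym [c == d]eq_sym.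
rewrite sumfE (bigD1 j) //= big1 => [|i ij]. rewrite mulf0E /dzf addfE mulf0E !efE eqxx.
  by clear efE; case: c ; rewrite !(mulr0, mulr1, addr0, add0r, mul1r) // mulrC.
by rewrite mulf0E /dzf addfE mulf0E !efE (negbTE ij) mulr0 addr0 mulr0.
Qed.

Lemma conj_entry U U' (B : M) k l w I :
  (map_mx (@cf R m) U * B * map_mx (@cf R m) U') k l w I = \sum_q \sum_p U k p * B p q w I * U' q l.
Proof.
rewrite mulME sumfE; apply: eq_bigr => q _.
rewrite mulME mxE mulf0Er sumfE mulr_suml; apply: eq_bigr => p _.
by rewrite mxE mulf0E.
Qed.

Lemma At_shift_of la g (ka : 'I_m -> C) Z Z' Y Y' :
  Z' *m Z = 1%:M -> Y *m Y' = 1%:M -> smooth g -> (forall w, g w != 0) ->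
  (forall j w, dz j g w = 2 * ka j * g w) ->
  (forall w, Hc H (w + la) = g w *: (Z *m Hc H w *m Y)) ->
  map_mx (S la) At = map_mx (@cf R m) Z'^T * At * map_mx (@cf R m) Z^T
     + (\sum_i form0 (fun=> ka i) * dzf i)%:M.
Proof.
move=> h1 h2 h3 h4 h5 h6.
have key := automorphy sHc Hc_unit (Xc_Hc sH hA) h1 h2 h3 h4 h5 h6.
have hk : homog 1 (\sum_i form0 (fun=> ka i) * dzf i).
  by apply: homog_sum => i _; exact/homogMf0/homog_dzf.
apply/matrixP => k l; rewrite mxE [RHS]mxE; apply: form1_eq.
- exact/homog_pb/hAt.
- apply: homogD; last by rewrite mxE; case: (k == l).
  by have := hmMM (hmMM (hmM_cst Z'^T) hAt) (hmM_cst Z^T).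
move=> w j c; rewrite pb_shift addfE conj_entry.
have KE : (\sum_i form0 (fun=> ka i) * dzf i)%:M k l w [set (j, c)] = (if c then 'i else 1) * (ka j)%:M k l.
  rewrite [X in X w _]mxE [in RHS]mxE; case: (k == l); last by rewrite mulr0.
  by rewrite !mulr1n dzf_sum.
have XE d v p q : At p q v [set (j, d)] = (if d then 'i else 1) * Xc A j v p q.
  by case: d; rewrite ?(At_true hA) [Xc A j v p q]mxE ?mul1r.
rewrite KE XE key [X in _ * X]mxE mulrDr; congr (_ + _).
transitivity ((if c then 'i else 1) * \sum_q \sum_p Z'^T k p * Xc A j w p q * Z^T q l).
  congr (_ * _); rewrite mxE; apply: eq_bigr => q _.
  by rewrite [X in X * _]mxE mulr_suml.
rewrite mulr_sumr; apply: eq_bigr => q _; rewrite mulr_sumr; apply: eq_bigr => p _; rewrite XE.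
by ring.
Qed.

(** The shift by 1 multiplies each state by a constant, so the frame change is a constant diagonal
    matrix with g = 1, and there is no additive term. *)
Lemma At_shift1 j : exists2 UU, UU.2 *m UU.1 = 1%:M &
  map_mx (S (delta_mx 0 j)) At = map_mx (@cf R m) UU.1 * At * map_mx (@cf R m) UU.2.
Proof.
pose chi k : C := cexp (2 * pi%:C * 'i * (k%:R / b%:R)) * cexp (- (pi%:C * 'i)) ^+ n.
have chi0 k : chi k != 0 by rewrite mulf_neq0 ?expf_neq0 ?cexp_neq0.
pose D f : 'M[C]_b := diag_mx (\row_k f k).
have DD f g : D f *m D g = D (fun k => f k * g k).
  by rewrite mulmx_diag; congr diag_mx; apply/rowP => k; rewrite !mxE.
have D1 f : (forall k, f k = 1) -> D f = 1%:M.
  by move=> h; rewrite -diag_const_mx; congr diag_mx; apply/rowP => k; rewrite !mxE.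
have h1 : D (fun k => (chi k)^-1) *m D chi = 1%:M by rewrite DD D1 // => k; rewrite mulVf.
have h2 : D (fun k => (chi k)^*) *m D (fun k => ((chi k)^*)^-1) = 1%:M.
  by rewrite DD D1 // => k; rewrite mulfV // conjc_eq0.
exists ((D (fun k => (chi k)^-1))^T, (D chi)^T); first by rewrite -trmx_mul h1 trmx1.
have := @At_shift_of (delta_mx 0 j) (fun=> 1) (fun=> 0) _ _ _ _ h1 h2 (sm_cst 1) _ _ _.
rewrite [X in _ + X](_ : _ = 0) ?addr0; last first.
  rewrite big1 ?raddf0 // => i _; apply: formP => w I; by rewrite mulf0E mul0r.
apply.
- by move=> _.
- by move=> i w; rewrite mulr0 mul0r /dz !pd_cst mulr0 subr0.
- move=> w; rewrite scale1r; apply/matrixP => k l. rewrite mul_mx_diag mxE mul_diag_mx !mxE.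
  have e1 q z := @st_shift1 R tau b n m htau (ltn0Sn b') j q w z.
  by rewrite -![H k l (E _)]/(Ht tau vol n k l _)
    (@Ht_scale R tau vol b n m htau hvol (ltn0Sn b') k l k l w _ (chi k) (chi l) (e1 k) (e1 l))
    mulrAC.
Qed.

(** The logarithmic derivative of [Gfac] j in w_i: the part 1 / b comes from the theta function of
    the total sum, the part with n from the n factors [theta1] that contain w_j. *)
Definition kap (j i : 'I_m) : C := - (2 * pi%:C * 'i * (b%:R^-1 + n%:R * (i == j)%:R)).

Lemma pder_Gfac j i w : pder i (Gfac tau b n j) w (cunit i * kap j i.1 * Gfac tau b n j w).
Proof.
pose c := cunit i * kap j i.1.
have E1 t : Gfac tau b n j (axis_line i w t) = cexp (t%:C * c) * Gfac tau b n j w :> C.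
  rewrite -cexpD; congr cexp; rewrite /axis_line -/(cunit i) sum_shift !mxE [j == i.1]eq_sym.
  rewrite /c /kap; have b0 : b%:R != 0 :> C by [].
  move: (b%:R : C) (n%:R : C) b0 => B N b0; field; exact/b0.
have := cderM (cder_cexp c 0) (@cder_cst R (Gfac tau b n j w) 0).
rewrite mul0r cexp0 mulr1 mulr0 addr0.
by rewrite (_ : (fun s => _) = fun t => Gfac tau b n j (axis_line i w t)) //; apply/funext => t.
Qed.

Lemma sm_Gfac j : smooth (@Gfac R tau b n m j).
Proof.
apply/entire_smooth/(entire1_pfun (@cexp_entire1 R)).
apply: pfunD; auto with sm.
apply/pfunN/pfunZ/pfunD; last by apply: pfunZ; auto with sm.
apply: pfunM; last exact/pfun_cst.
by auto with sm.
Qed.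

(** The states are permuted cyclically by P and multiplied by [Gfac], so g is the squared modulus of
    [Gfac]. Its conjugate factor is antiholomorphic and does not contribute to the holomorphic
    derivative, whence the additive term [kap]. *)
Lemma At_shift_tau j : exists2 UU, UU.2 *m UU.1 = 1%:M &
  map_mx (S (tau *: delta_mx 0 j)) At = map_mx (@cf R m) UU.1 * At * map_mx (@cf R m) UU.2
   + (\sum_i form0 (fun=> kap j i) * dzf i)%:M.
Proof.
pose G := @Gfac R tau b n m j.
pose P : 'M[C]_b := \matrix_(k, l) (l == ordS k)%:R.
have PP : P *m P^T = 1%:M.
  apply/matrixP => k l; rewrite !mxE (bigD1 (ordS k)) //= !mxE eqxx mul1r big1 => [|i ik].
    by rewrite addr0 (inj_eq (@ordS_inj b)).
  by rewrite !mxE (negbTE ik) mul0r.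
have PP' : P^T *m P = 1%:M by rewrite mulmx1C.
exists (P, P^T) => //=.
have sG : smooth G by exact/sm_Gfac.
rewrite -{1}[P]trmxK; apply: (@At_shift_of _ (fun w => G w * (G w)^*) _ _ _ _ _ PP' PP').
- by auto with sm.
- by move=> w; rewrite mulf_neq0 // ?conjc_eq0 cexp_neq0.
- move=> i w; rewrite dzM; auto with sm.
  rewrite /dz !pd_conj // !(pd_eq (pder_Gfac j _ w)) /cunit /= -/(G w).
  have cM2 x y : (x * y)^* = x^* * y^* by rewrite rmorphM.
  move: (G w) (kap j i) => g k0; rewrite !cM2.
  have -> : ('i : C)^* = - 'i by apply: ceqP; rewrite /= ?oppr0.
  have i2 : 'i * 'i = -1 :> C by rewrite -expr2 sqr_i.
  move: k0 k0^* g g^* => x y z t.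
  transitivity ((x * z - 'i * 'i * x * z) * t + z * (y * t + ('i * 'i) * y * t)); first by ring.
  by rewrite i2; ring.
- move=> w; apply/matrixP => k l; rewrite mxE.
  rewrite mxE (_ : H k l (E (w + _)) = Ht tau vol n k l (w + tau *: delta_mx 0 j)) //.
  have e1 q z := @st_shift_tau R tau b n m htau (ltn0Sn b') j q w z.
  rewrite (@Ht_scale R tau vol b n m htau hvol (ltn0Sn b') k l (ordS k) (ordS l) w _ (G w) (G w) (e1 k) (e1 l)).
  rewrite mxE (bigD1 (ordS l)) //= [X in _ + X]big1 => [|q ql]; last first.
    by rewrite [P^T _ _]mxE [P _ _]mxE (negbTE ql) mulr0.
  rewrite [P^T _ _]mxE [P _ _]mxE eqxx mulr1 addr0 mxE (bigD1 (ordS k)) //= [X in _ + X]big1 => [|q qk]; last first.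
    by rewrite [P _ _]mxE (negbTE qk) mul0r.
  by rewrite [P _ _]mxE eqxx mul1r addr0 mxE.
Qed.

End LaughlinConnection.

(** * Lattice-invariant forms and constant forms *)

Section SymmetricForms.
Context {R : realType} (tau : R[i]) {m : nat}.
Notation C := R[i].
Notation V := 'rV[R[i]]_m.
Notation form := (dform R m).
Notation E := (@elem_sym R m).
Notation S la := (pullback (fun w : V => w + la)).

Definition lati om : Prop := forall v, v \in dirs tau m -> S v om = om.

Lemma lati_per om : lati om <-> per_form tau om.
Proof.
split=> [h I|h v hv].
  by apply: dir_per => v /h hv w; have := congr1 (fun o => o w I) hv; rewrite pb_shift.
by apply: formP => w I; rewrite pb_shift; exact: (per_dir (h I) hv).
Qed.
Lemma latiD x y : lati x -> lati y -> lati (x + y).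
Proof. by move=> h1 h2 v hv; rewrite rmorphD /= h1 // h2. Qed.
Lemma latiN x : lati x -> lati (- x).
Proof. by move=> h1 v hv; rewrite rmorphN /= h1. Qed.
Lemma latiB x y : lati x -> lati y -> lati (x - y).
Proof. by move=> h1 h2; apply: latiD => //; exact/latiN. Qed.
Lemma latiM x y : lati x -> lati y -> lati (x * y).
Proof. by move=> h1 h2 v hv; rewrite rmorphM /= h1 // h2. Qed.
Lemma latiX x k : lati x -> lati (x ^+ k).
Proof. by move=> h v hv; rewrite rmorphXn /= h. Qed.
Lemma lati_cf c : lati (cf c). Proof. by move=> v hv; rewrite pb_cf. Qed.
Lemma lati_sum T l (P : pred T) F :
  (forall k, P k -> lati (F k)) -> lati (\sum_(k <- l | P k) F k).
Proof. by move=> h v hv; rewrite rmorph_sum; apply: eq_bigr => k /h; exact. Qed.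
Lemma lati_extd x : sform x -> lati x -> lati (extd x).
Proof. by move=> sx h v hv; rewrite -extd_pb ?h //; exact/shift_smap. Qed.

Lemma symfE om : sym_form tau om <-> sform om /\ lati (pullback E om).
Proof.
split=> -[h1 h2]; split=> //; first by apply/lati_per => I w j p q.
by move=> w j p q I; move/lati_per: h2 => h2; exact/h2.
Qed.
Lemma pbE_smooth om : sform om -> sform (pullback E om).
Proof. exact/sm_pb/smap_sym. Qed.
Lemma symfD (x y : form) : sym_form tau x -> sym_form tau y -> sym_form tau (x + y).
Proof. by move=> /symfE[a b] /symfE[c d]; apply/symfE; split; [exact/sformD|rewrite rmorphD; exact/latiD]. Qed.
Lemma symfM (x y : form) : sym_form tau x -> sym_form tau y -> sym_form tau (x * y).
Proof. by move=> /symfE[a b] /symfE[c d]; apply/symfE; split; [exact/sformM|rewrite rmorphM; exact/latiM]. Qed.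
Lemma symf_cf c : sym_form tau (cf c : form).
Proof. by apply/symfE; split; [exact/sm_cf|rewrite pb_cf; exact/lati_cf]. Qed.
Lemma symfX (x : form) k : sym_form tau x -> sym_form tau (x ^+ k).
Proof. by move=> /symfE[a b]; apply/symfE; split; [exact/sformX|rewrite rmorphXn; exact/latiX]. Qed.
Lemma symf_sum T l (P : pred T) (F : T -> form) :
  (forall k, P k -> sym_form tau (F k)) -> sym_form tau (\sum_(k <- l | P k) F k).
Proof.
move=> h; elim/big_rec: _ => [|k x /h hk hx]; last exact/symfD.
by have := symf_cf 0; rewrite (_ : cf 0 = 0 :> form) //; apply: formP => w I; rewrite /cf /form0 if_same.
Qed.
Lemma symf_extd (x : form) : sym_form tau x -> sym_form tau (extd x).
Proof.
move=> /symfE[a b]; apply/symfE; split; auto with sm.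
rewrite -extd_pb //; last exact/smap_sym.
by apply: lati_extd => //; exact/pbE_smooth.
Qed.

#[local] Hint Resolve latiD latiN latiM lati_cf lati_sum lati_extd symfD symfM symf_cf : sm.
Definition iT : C := ((Im tau)%:C)^-1.
Definition Xs : form := \sum_j ef (j, false).
Definition Ys : form := \sum_j ef (j, true).
(** The pullback of dx dy / Im tau, which has integral 1 over the curve, under the map w -> w_1 +
    ... + w_m: the mean of any representative of the theta class ([theta_mean]). *)
Definition ptW : form := cf iT * (Xs * Ys).
(** The sum over all coordinates of the normalized area forms; it turns out to be the mean of every
    representative of the xi class ([mean_x]). *)
Definition sigma : form := cf iT * \sum_j ef (j, false) * ef (j, true).

Lemma Ys_sq : Ys * Ys = 0.
Proof.
apply: eq_form_oppr0; have h : homog 1 Ys by apply: homog_sum => j _; exact/homog_ef.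
by rewrite {1}(homog_comm h h) mulN1r.
Qed.
Lemma XY_anti : Ys * Xs = - (Xs * Ys).
Proof.
have h1 : homog 1 Ys by apply: homog_sum => j _; exact/homog_ef.
have h2 : homog 1 Xs by apply: homog_sum => j _; exact/homog_ef.
by rewrite (homog_comm h1 h2) mulN1r.
Qed.

Definition cstf (om : form) : Prop := forall w w' I, om w I = om w' I.
Lemma cstf_cf c : cstf (cf c). Proof. by []. Qed.
Lemma cstf_ef a : cstf (ef a). Proof. by []. Qed.
Lemma cstfD x y : cstf x -> cstf y -> cstf (x + y).
Proof. by move=> h1 h2 w w' I; rewrite !addfE (h1 w w') (h2 w w'). Qed.
Lemma cstfM x y : cstf x -> cstf y -> cstf (x * y).
Proof. by move=> h1 h2 w w' I; apply: eq_bigr => J _; rewrite (h1 w w') (h2 w w'). Qed.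
Lemma cstf_sum T l (P : pred T) F : (forall k, P k -> cstf (F k)) -> cstf (\sum_(k <- l | P k) F k).
Proof. by move=> h w w' I; rewrite !sumfE; apply: eq_bigr => k /h hk. Qed.
Lemma cstf_ptW : cstf ptW.
Proof. by apply: cstfM; [|apply: cstfM; apply: cstf_sum => j _; exact/cstf_ef]. Qed.
Lemma cstf_sigma : cstf sigma.
Proof. by apply: cstfM; [|apply: cstf_sum => j _; exact/cstfM]. Qed.

Lemma meanf_cst om : cstf om -> meanf tau om = om.
Proof.
move=> h; apply: formP => w I; rewrite /meanf (_ : (fun v => om v I) = fun=> om w I) ?mean_cst //.
by apply/funext => v.
Qed.
Lemma meanfD (x y : form) : sform x -> sform y -> meanf tau (x + y) = meanf tau x + meanf tau y.
Proof. by move=> hx hy; apply: formP => w I; exact/meanD. Qed.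
Lemma meanf_cfM c (x : form) : sform x -> meanf tau (cf c * x) = cf c * meanf tau x.
Proof.
move=> hx; apply: formP => w I; rewrite cfE -meanZ //.
by congr mean; apply/funext => v; rewrite cfE.
Qed.
Hypothesis htau : 0 < Im tau.
Lemma meanf_extd x : sform x -> lati x -> meanf tau (extd x) = 0.
Proof.
move=> hx /lati_per px; rewrite extdE; apply: formP => w I; rewrite /meanf.
rewrite (_ : (fun v => _) = fun v => \sum_i (ef i * pdf i x) v I); last by apply/funext => v; rewrite sumfE.
have sp i J : smooth (fun v => pdf i x v J) by exact/sm_pdf.
rewrite mean_sum => [|i _]; last by apply: sformM; auto with sm.
rewrite big1 // => i _; pose c := if i \in I then sgn (R := R) [set i] (I :\ i) else 0.
rewrite (_ : (fun v => _) = fun v => c * pdf i x v (I :\ i)); last first.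
  by apply/funext => v; rewrite mulefE /c; case: (i \in I); rewrite ?mul0r.
by rewrite meanZ // mean_pd ?mulr0.
Qed.

End SymmetricForms.

#[local] Hint Resolve latiD latiN latiB latiM latiX lati_cf lati_sum lati_extd symfD
  symfM symf_cf symfX symf_sum symf_extd cstf_cf cstf_ef cstfD cstfM cstf_sum cstf_ptW
  cstf_sigma : sm.

(** * The normalized trace of the curvature and the invariance of the transgression forms *)

Section LaughlinCurvature.
Context {R : realType} (tau : R[i]) (vol : dform R 1) (b' n m : nat).
Notation b := b'.+1.
Notation C := R[i].
Notation V := 'rV[R[i]]_m.
Notation E := (@elem_sym R m).
Notation form := (dform R m).
Hypotheses (htau : 0 < Im tau) (hvol : volume_form tau vol).
Hypotheses (hn : (0 < n)%N) (hm : (0 < m)%N).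
Notation H := (@laughlin_metric R tau vol b n m).
Variable A : mform R m b.
Hypothesis hA : chern_connection H A.
Notation M := 'M[dform R m]_b.
Notation At := (At A).
Notation Am := (Am A).
Notation S la := (pullback (fun w : V => w + la)).
Notation dzf := (@dzf R m).

Definition imf i (w : V) : C := (Im (w 0 i))%:C.
(** Real linear in w, with value 0 on the period 1 and value [kap] j i on the period tau of
    coordinate j. The 1-form [Qf] built from it thus has the same shifts as the normalized trace of
    the connection, and their difference [Pf] is invariant. *)
Definition qf i w : C :=
  - (2 * pi%:C * 'i * iT tau) * (b%:R^-1 * (\sum_g imf g w) + n%:R * imf i w).

Lemma imfD i u v : imf i (u + v) = imf i u + imf i v.
Proof. by rewrite /imf mxE cImD rmorphD. Qed.
Lemma qfD i u v : qf i (u + v) = qf i u + qf i v.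
Proof.
rewrite /qf (eq_bigr (fun g => imf g u + imf g v)) => [|g _]; last exact/imfD.
rewrite big_split imfD /=; ring.
Qed.

Definition Kf v : form := \sum_i form0 (fun=> qf i v) * dzf i.
Definition Qf : form := \sum_i form0 (qf i) * dzf i.

Lemma At_shift v : v \in dirs tau m -> exists2 UU, UU.2 *m UU.1 = 1%:M &
  map_mx (S v) At = map_mx (@cf R m) UU.1 * At * map_mx (@cf R m) UU.2 + (Kf v)%:M.
Proof.
have T0 : (Im tau)%:C != 0 :> C by rewrite eq_complex gt_eqF.
move=> /dirs_lattice [j [->|->]].
  have [UU h1 h2] := At_shift1 htau hvol hn hm hA j; exists UU => //; rewrite (_ : Kf _ = 0) ?raddf0 ?addr0 //.
  rewrite /Kf big1 // => i _; apply: formP => w I; rewrite mulf0E /qf.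
  have z g : imf g (delta_mx 0 j) = 0. by rewrite /imf mxE; case: (g == j).
  by rewrite big1 // z !mulr0 addr0 mulr0 mul0r.
have [UU h1 h2] := At_shift_tau htau hvol hn hm hA j; exists UU => //; rewrite h2; congr (_ + _%:M).
apply: eq_bigr => i _; congr (form0 _ * _); apply/funext => _.
have z g : imf g (tau *: delta_mx 0 j) = (Im tau)%:C * (g == j)%:R.
  rewrite /imf !mxE; case: (g == j); rewrite ?mulr1 ?mulr0 //.
rewrite /qf (bigD1 j) //= big1 => [|g gj]; last by rewrite z (negbTE gj) mulr0.
rewrite !z eqxx /kap /iT mulr1.
have b0 : b%:R != 0 :> C by [].
move: T0 b0; move: (b%:R : C) (n%:R : C) (Im tau)%:C ((i == j)%:R : C) => B N T D T0 B0.
by field; rewrite B0.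
Qed.

Definition a1 : form := cf b%:R^-1 * \tr Am.
Definition ta : form := pullback E a1.

Lemma taE : ta = cf b%:R^-1 * \tr At.
Proof. by rewrite /ta rmorphM /= pb_cf; rewrite trace_map_mx. Qed.
Lemma sm_a1 : sform a1.
Proof. by apply: sformM; [exact/sm_cf|apply: smM_tr; exact: sAm hA]. Qed.
Lemma homog_a1 : homog 1 a1.
Proof. by apply/homogMf0/hmM_tr; exact: hAm hA. Qed.
Lemma sm_ta : sform ta.
Proof. exact/pbE_smooth/sm_a1. Qed.

Lemma S_ta v : v \in dirs tau m -> S v ta = ta + Kf v.
Proof.
move=> /At_shift [[u u'] h1 h2].
rewrite taE rmorphM /= pb_cf -trace_map_mx h2 raddfD /= mulrDr; congr (_ * _ + _).
  rewrite -mulrA (@tr_even _ _ _ 0 1 _ _ (hmM_cst u)) //. by rewrite -mulrA (conj_id h1) mulr1.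
  have := hmMM (hAt hA) (hmM_cst u'); exact.
apply: formP => w I; transitivity (b%:R^-1 * (b%:R * Kf v w I) : C).
  by rewrite mxtrace_scalar cfE mulrnfE mulr_natl.
by rewrite mulrA mulVf ?mul1r.
Qed.

Definition Pf : form := ta - Qf.

Lemma sm_imf i : smooth (imf i).
Proof. by have := @sm_rcomp R m (i, true). Qed.
Lemma sm_qf i : smooth (qf i).
Proof.
apply: smoothZ; apply: smoothD; apply: smoothZ; last exact/sm_imf.
by apply: sm_sum => g _; exact/sm_imf.
Qed.
Lemma sm_dzf i : sform (dzf i).
Proof.
by apply: sformD; auto with sm.
Qed.
Lemma sm_Qf : sform Qf.
Proof. by apply: sform_sum => i _; apply: sformM; [exact/sformf/sm_qf|exact/sm_dzf]. Qed.
Lemma sm_Pf : sform Pf.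
Proof. by apply: sformB; [exact/sm_ta|exact/sm_Qf]. Qed.
Lemma pb_shift_ef (v : V) a : S v (ef a) = ef a.
Proof. by rewrite pb_ef pb1_shift. Qed.
Lemma S_dzf (v : V) i : S v (dzf i) = dzf i.
Proof. by rewrite rmorphD rmorphM /= pb_cf !pb_shift_ef. Qed.

Lemma lati_Pf : lati tau Pf.
Proof.
move=> v hv; rewrite rmorphB /= S_ta // rmorph_sum.
rewrite (eq_bigr (fun i => form0 (qf i) * dzf i + form0 (fun=> qf i v) * dzf i)) => [|i _]; last first.
  rewrite rmorphM /= S_dzf pb_form0 -mulrDl form0D; congr (form0 _ * _).
  by apply/funext => w; exact/qfD.
by rewrite big_split opprD addrACA subrr addr0.
Qed.

(** The differentials of the [qf i] contain only dy_j. Against dw = dx + i dy the part i dy drops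
    out, by antisymmetry or by [ef_sq], and dy dx = - dx dy. *)
Lemma extd_Qf : extd Qf = cf (2 * pi%:C * 'i) * (cf b%:R^-1 * ptW tau + cf n%:R * sigma tau).
Proof.
pose ka : C := 2 * pi%:C * 'i * iT tau.
have dq i : extd (form0 (qf i) : form) = - cf ka * (cf b%:R^-1 * @Ys R m + cf n%:R * ef (i, true)).
  rewrite extd_form0E.
  have pi0 g a w : pd a (imf g) w = (a == (g, true))%:R.
    by have := @pd_rcomp R m a (g, true) w; rewrite eq_sym.
  have pq a w : pd a (qf i) w = - ka * (b%:R^-1 * (a.2)%:R + n%:R * (a == (i, true))%:R).
    rewrite pdZ; last first. apply: smoothD; apply: smoothZ; last exact/sm_imf.
      by apply: sm_sum => g _; exact/sm_imf.
    rewrite pdD; [|by apply: smoothZ; apply: sm_sum => g _; exact/sm_imf|exact/smoothZ/sm_imf].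
    have sS : smooth (fun v => \sum_g imf g v) by apply: sm_sum => g _; exact/sm_imf.
    rewrite (pdZ _ _ _ sS) (pdZ _ _ _ (sm_imf i)).
    rewrite pi0 pd_sum => [|g _]; last exact/sm_imf.
    congr (_ * (_ * _ + _)); case: a => g [] /=.
      rewrite (bigD1 g) //= pi0 eqxx big1 ?addr0 // => k kg.
      by rewrite pi0 xpair_eqE eq_sym (negbTE kg).
    by rewrite big1 // => k _; rewrite pi0 xpair_eqE andbF.
  apply: formP => w I; rewrite sumfE mulNr oppfE cfE addfE !cfE /Ys sumfE.
  rewrite sum_rcoord big_split /= big1 => [|j _]; last by rewrite mulf0E pq xpair_eqE andbF !mulr0 addr0 mulr0 mul0r.
  rewrite add0r (eq_bigr (fun j => - ka * (b%:R^-1 * ef (j, true) w I) + - ka * (n%:R * ((j == i)%:R * ef (j, true) w I)))) => [|j _].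
    have e : \sum_j (j == i)%:R * ef (j, true) w I = ef (i, true) w I :> C.
      by rewrite (bigD1 i) //= eqxx mul1r big1 ?addr0 // => j ji; rewrite (negbTE ji) mul0r.
    by rewrite big_split /= -!mulr_sumr e -mulrDr mulNr.
  by rewrite mulf0E pq /= xpair_eqE andbT; ring.
rewrite extd_sum => [|i _]; last by apply: sformM; [exact/sformf/sm_qf|exact/sm_dzf].
have d0 i : extd (dzf i) = 0 by apply: extd_const.
have E1 i : extd (form0 (qf i) * dzf i) = - cf ka * (cf b%:R^-1 * @Ys R m * dzf i + cf n%:R * (ef (i, true) * dzf i)).
  rewrite (extdM_even (@homog_form0 R m (qf i))) //; [|exact/sformf/sm_qf|exact/sm_dzf].
  by rewrite d0 mulr0 addr0 dq -[LHS]mulrA; rewrite mulrDl; rewrite mulrA.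
rewrite (eq_bigr _ (fun i _ => E1 i)) -mulr_sumr big_split /= -!mulr_sumr.
have -> : \sum_i dzf i = @Xs R m + cf 'i * @Ys R m by rewrite big_split -mulr_sumr.
have YE : @Ys R m * (@Xs R m + cf 'i * @Ys R m) = - (@Xs R m * @Ys R m).
  by rewrite mulrDr XY_anti [cf 'i * _]cfC mulrA Ys_sq mul0r addr0.
rewrite -[_ * @Ys R m * _]mulrA YE.
have e2 i : ef (i, true) * dzf i = - (ef (i, false) * ef (i, true)) :> form.
  by rewrite mulrDr ef_anti [cf 'i * _]cfC mulrA ef_sq mul0r addr0.
rewrite (eq_bigr _ (fun i _ => e2 i)) sumrN /ptW /sigma.
apply: formP => w I; rewrite mulNr !(cfE, addfE, oppfE) /ka.
by ring.
Qed.

Definition cpi : C := 'i / (2 * pi%:C).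
(** The wedge square of a matrix of 1-forms has trace 0, so the trace of the curvature is the
    differential of tr A alone; [a1] is tr A / b. *)
Definition om1 : form := cf cpi * extd a1.

Lemma pi_neq0 : 2 * pi%:C != 0 :> C.
Proof. by rewrite mulf_neq0 // eq_complex gt_eqF // pi_gt0. Qed.

Lemma pb_om1 : pullback E om1 = cf cpi * (extd Qf + extd Pf).
Proof.
rewrite rmorphM /= pb_cf -extd_pb; [|exact/smap_sym|exact/sm_a1].
rewrite -extdD; [|exact/sm_Qf|exact/sm_Pf].
by rewrite addrC subrK.
Qed.

Lemma lati_ef a : lati tau (ef a : form). Proof. move=> v _; exact/pb_shift_ef. Qed.
Lemma lati_ptW : lati tau (@ptW R tau m).
Proof. by apply: latiM; [exact/lati_cf|apply: latiM; apply: lati_sum => j _; exact/lati_ef]. Qed.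
Lemma lati_sigma : lati tau (@sigma R tau m).
Proof. by apply: latiM; [exact/lati_cf|apply: lati_sum => j _; apply: latiM; exact/lati_ef]. Qed.

Lemma sym_om1 : sym_form tau om1.
Proof.
apply/symfE; split; first exact: (sm_om cpi sm_a1).
rewrite pb_om1; apply: latiM; first exact/lati_cf; apply: latiD.
  rewrite extd_Qf; apply: latiM; auto with sm.
  apply: latiD; (apply: latiM; first exact/lati_cf); [exact/lati_ptW|exact/lati_sigma].
by apply: lati_extd; [exact/sm_Pf|exact/lati_Pf].
Qed.

Lemma mean_om1 : meanf tau (pullback E om1) = - (cf b%:R^-1 * ptW tau + cf n%:R * sigma tau).
Proof.
rewrite pb_om1 meanf_cfM; last by apply: sformD; apply: sm_extd; [exact/sm_Qf|exact/sm_Pf].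
rewrite meanfD; [|exact/sm_extd/sm_Qf|exact/sm_extd/sm_Pf].
rewrite (meanf_extd htau sm_Pf lati_Pf) addr0 meanf_cst; last first.
  rewrite extd_Qf; apply: cstfM; first exact/cstf_cf.
  by auto with sm.
rewrite extd_Qf; apply: formP => w I; rewrite !cfE mulrA (_ : cpi * _ = -1) ?mulN1r //.
rewrite /cpi; have := pi_neq0; move: (2 * pi%:C : C) => x x0.
rewrite -mulrA [x^-1 * _]mulrA mulVf // mul1r -expr2 sqr_i //.
Qed.

Notation Bt := (At - ta%:M).

Lemma cst_scalarC u (o : form) : map_mx (@cf R m) u * o%:M = o%:M * map_mx (@cf R m) u :> M.
Proof.
apply/matrixP => k l; rewrite !mulME (bigD1 l) //= big1 => [|j jl]; last by rewrite [X in _ * X]mxE (negbTE jl) mulr0.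
rewrite (bigD1 k) //= [X in _ = _ + X]big1 => [|j jk]; last by rewrite mxE eq_sym (negbTE jk) mul0r.
have e1 j : o%:M j j = o by rewrite mxE eqxx.
by rewrite !e1 !mxE cfC.
Qed.
Lemma map_subscal (f : {rmorphism form -> form}) (X : M) o :
  map_mx f (X - o%:M) = map_mx f X - (f o)%:M.
Proof. by rewrite map_mxB map_scalar_mx. Qed.
Lemma sBt : smM Bt.
Proof. by apply: smM_B; [exact: (sAt hA)|exact/sm_ta]. Qed.

(** Under a lattice shift the scalar increment of [At] and that of its normalized trace cancel, and
    the difference is only conjugated by a constant matrix; [cs_conj] applies. *)
Lemma sym_cs k : sym_form tau (cs (Am - a1%:M) k.+1).
Proof.
have sB : smM (Am - a1%:M) by apply: smM_B; [exact: (sAm hA)|exact/sm_a1].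
apply/symfE; split; first exact/sm_cs.
have EB : map_mx (pullback E) (Am - a1%:M) = Bt. exact/map_subscal.
rewrite pb_cs //; last exact/smap_sym.
rewrite EB => v hv; rewrite pb_cs; [|exact/shift_smap|exact/sBt].
have [[u u'] h1 h2] := At_shift hv.
rewrite (_ : map_mx _ Bt = map_mx (@cf R m) u * Bt * map_mx (@cf R m) u'); first by apply: cs_conj => //; exact/sBt.
have u1 : u *m u' = 1%:M by rewrite mulmx1C.
rewrite mulrBr mulrBl cst_scalarC -[ta%:M * _ * _]mulrA (conj_id u1) mulr1.
have -> : map_mx (S v) Bt = map_mx (S v) At - (S v ta)%:M. exact/map_subscal.
by rewrite h2 S_ta // raddfD opprD addrACA subrr addr0.
Qed.

Lemma sym_cw r : sym_form tau (cw Am cpi a1 r).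
Proof.
apply: symf_sum => i _; rewrite -mulr_natl -cf_nat; apply: symfM; auto with sm.
apply: symfM; first exact/symfX/sym_om1.
by apply: symfM; [exact/symf_cf|exact/sym_cs].
Qed.

End LaughlinCurvature.

(** * Continuity of roots, bump functions, translations in symmetric coordinates *)

Section Roots.
Context {R : realType}.
Notation C := R[i].
Notation V m := 'rV[R[i]]_m.

Lemma fin_min (T : finType) (P : T -> R -> Prop) :
  (forall i, exists2 d : R, 0 < d & P i d) -> (forall i d d', d' <= d -> P i d -> P i d') ->
  exists2 d : R, 0 < d & forall i, P i d.
Proof.
move=> h1 h2; have [f hf] := choice (fun i => let: ex_intro2 d a b := h1 i in ex_intro _ d (conj a b)).
exists (\big[Num.min/1]_i f i); first by apply: lt_bigmin => [|i _]; [|case: (hf i)].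
by move=> i; apply: h2 (hf i).2; exact/bigmin_le.
Qed.

Lemma pfun_lip m r (c : V m) P : pfun P -> exists2 K : R, 0 <= K & forall u v h,
  nearv r c u -> nearv r c v -> (forall j, cn (u 0 j - v 0 j) <= h) -> 0 <= h -> cn (P u - P v) <= K * h.
Proof.
elim=> [a|j|P1 P2 h1 [K1 p1 H1] h2 [K2 p2 H2]|P1 P2 h1 [K1 p1 H1] h2 [K2 p2 H2]].
- by exists 0 => // u v h _ _ _ h0; rewrite subrr cn0 mul0r.
- by exists 1 => // u v h _ _ hj _; rewrite mul1r.
- exists (K1 + K2); first exact/addr_ge0. move=> u v h hu hv hj h0; rewrite opprD addrACA mulrDl.
  by apply: le_trans (cnD _ _) _; rewrite lerD ?H1 ?H2.
- have [M1 q1 B1] := pfun_bound r c h1; have [M2 q2 B2] := pfun_bound r c h2.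
  exists (K1 * M2 + M1 * K2); first by rewrite addr_ge0 ?mulr_ge0.
  move=> u v h hu hv hj h0.
  rewrite (_ : _ - _ = (P1 u - P1 v) * P2 u + P1 v * (P2 u - P2 v)); last by ring.
  apply: le_trans (cnD _ _) _; rewrite [leRHS]mulrDl lerD //; apply: le_trans (cnM _ _) _.
    by rewrite mulrAC ler_pM ?cn_ge0 ?H1 ?B2.
  by rewrite -mulrA ler_pM ?cn_ge0 ?H2 ?B1.
Qed.

(** The coefficients of a polynomial of degree below N are fixed linear combinations of its values
    at 0, ..., N - 1, by the inverse of the Vandermonde matrix. *)
Lemma pfun_coef q (F : V q -> {poly C}) N : (forall v, (size (F v) <= N)%N) ->
  (forall x, pfun (fun v => (F v).[x])) -> forall i, (i < N)%N -> pfun (fun v => (F v)`_i).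
Proof.
move=> hs hx i hi; pose a : 'rV[C]_N := \row_j j%:R.
have U : Vandermonde N a \in unitmx.
  rewrite unitmxE det_Vandermonde unitfE; apply/prodf_neq0 => k _; apply/prodf_neq0 => l kl.
  by rewrite !mxE subr_eq0 eqr_nat neq_ltn kl orbT.
have E v : \row_(k < N) (F v)`_k = (\row_j (F v).[j%:R]) *m invmx (Vandermonde N a).
  rewrite -[LHS](mulmxK U); congr (_ *m _); apply/rowP => j; rewrite [RHS]mxE mxE.
  by rewrite (horner_coef_wide _ (hs v)); apply: eq_bigr => k _; rewrite !mxE.
have -> : (fun v => (F v)`_i) = fun v => \sum_j invmx (Vandermonde N a) j (Ordinal hi) * (F v).[j%:R].
  apply/funext => v; have := congr1 (fun M : 'rV_N => M 0 (Ordinal hi)) (E v); rewrite !mxE => ->.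
  by apply: eq_bigr => j _; rewrite mxE mulrC.
by apply: pfun_sum => j _; exact/pfunZ.
Qed.

Definition mapv m (q : {poly C}) (w : V m) : V m := \row_j q.[w 0 j].

(** The polynomial with roots q(w_j) takes at x the value prod_j (x - q(w_j)), a polynomial function
    of e by [pfun_symprod]; [pfun_coef] passes from values to coefficients. *)
Lemma pfun_mapv m q k : pfun (fun e : V m => elem_sym (mapv q (rootv e)) 0 k).
Proof.
have E e : elem_sym (mapv q (rootv e)) 0 k = (-1) ^+ k.+1 * (chip (elem_sym (mapv q (rootv e))))`_(m - k.+1).
  by rewrite coef_chip mulrA -exprMn mulN1r opprK expr1n mul1r.
rewrite (_ : (fun e => _) = fun e => (-1) ^+ k.+1 * (chip (elem_sym (mapv q (rootv e))))`_(m - k.+1)); last exact/funext.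
apply: pfunZ; apply: (@pfun_coef _ _ m.+1) => [v|x|]; first by rewrite chip_size.
  (* [pfun_symprod] is used at the point 0, so its polynomial is evaluated at - w_j; this explains
     the argument - 'X of q. *)
  have := @pfun_symprod R m m (fun=> 0) (fun e => e) (pfun_cst 0) (fun j => pfun_coord j) (x%:P - (q \Po (- 'X))).
  rewrite (_ : (fun v => _) = fun e => (chip (elem_sym (mapv q (rootv e)))).[x]) //.
  apply/funext => e; rewrite chip_esym horner_prod; apply: eq_bigr => j _.
  by rewrite sub0r hornerXsubC hornerD hornerC hornerN horner_comp hornerN hornerX opprK mxE.
by rewrite ltnS leq_subr.
Qed.

Lemma mapv_perm m q (w : V m) (s : 'S_m) : elem_sym (mapv q (\row_j w 0 (s j))) = elem_sym (mapv q w).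
Proof.
rewrite -(esym_perm (mapv q w) s); congr elem_sym; by apply/rowP => j; rewrite !mxE.
Qed.
Lemma mapv_rootv m q (w : V m) : elem_sym (mapv q (rootv (elem_sym w))) = elem_sym (mapv q w).
Proof. by have := @rootv_sym R m (fun v => elem_sym (mapv q v) 0 _) w; move=> h; apply/rowP => k; apply: h => s v; rewrite mapv_perm. Qed.

Lemma cn_prod_ge I l (F : I -> C) (h : R) : 0 <= h -> (forall k, h <= cn (F k)) ->
  (h / 2) ^+ size l <= cn (\prod_(k <- l) F k).
Proof.
move=> h0 hF; suff H : ((h / 2) ^+ size l)%:C <= `|\prod_(k <- l) F k|.
  by have := le_trans H (normc_le_cn _); rewrite lecR.
rewrite normr_prod rmorphXn; elim: l => [|k l IH]; first by rewrite big_nil.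
have h2 : 0 <= (h / 2)%:C by rewrite lecR divr_ge0.
have hk : (h / 2)%:C <= `|F k|. by apply: (le_trans _ (cn_le_normc (F k))); rewrite lecR ler_pM2r.
by rewrite big_cons exprS; apply: ler_pM => //; exact/exprn_ge0.
Qed.

Lemma esym_cont m (w0 : V m) (e : R) : 0 < e -> exists2 d : R, 0 < d & forall w, nearv d w0 w -> nearv e (elem_sym w0) (elem_sym w).
Proof.
move=> e0.
have [d d0 hd] : exists2 d, 0 < d & forall k w, nearv d w0 w -> cn (elem_sym w 0 k - elem_sym w0 0 k) < e.
  apply: (@fin_min _ (fun k d => forall w, nearv d w0 w -> cn (elem_sym w 0 k - elem_sym w0 0 k) < e)).
    move=> k; have [d d0 hd] := @pfun_jcont R m _ w0 0 (pfun_esym k) _ e0.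
    by exists d => // w hw; apply: (hd w 0) => //; rewrite subrr normr0.
  by move=> k d d' dd h w hw; apply: h; exact: nearv_le hw.
by exists d => // w hw k; exact/hd.
Qed.

(** Every root of a nearby polynomial is close to some root of w0, which defines a map p of the
    indices, not known to be bijective. The vector of the w0_(p j) has elementary symmetric
    functions close to those of w0; as there are finitely many p, close means equal ([he1]), and
    this vector is a permutation of w0. *)
Lemma root_continuity m w0 (d : R) : 0 < d -> exists2 e : R, 0 < e &
  forall w, nearv e (elem_sym w0) (elem_sym w) -> exists s : 'S_m, nearv d w0 (\row_j w 0 (s j)).
Proof.
move=> d0; set e0 := elem_sym w0.
pose wp (p : {ffun 'I_m -> 'I_m}) : V m := \row_j w0 0 (p j).
have [e1 e10 he1] : exists2 e, 0 < e & forall p, nearv e e0 (elem_sym (wp p)) -> elem_sym (wp p) = e0.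
  apply: (@fin_min _ (fun p e => nearv e e0 (elem_sym (wp p)) -> elem_sym (wp p) = e0)); last first.
    by move=> p e e' ee h h'; apply: h; exact: nearv_le h'.
  move=> p; have [->|ne] := pselect (elem_sym (wp p) = e0); first by exists 1.
  have [k hk] : exists k, elem_sym (wp p) 0 k != e0 0 k.
    apply: contrapT => H; apply: ne; apply/rowP => k; apply/eqP; apply: contrapT => /negP hk; apply: H; by exists k.
  exists (cn (elem_sym (wp p) 0 k - e0 0 k)); last by move=> /(_ k); rewrite ltxx.
  rewrite lt_neqAle cn_ge0 andbT eq_sym; apply: contra hk => /eqP /cn_eq0 /eqP; by rewrite subr_eq0.
pose B : R := 2 * (1 + \sum_k (1 + cn (e0 0 k))) + 1 + \sum_j cn (w0 0 j).
have S0 : 0 <= \sum_k (1 + cn (e0 0 k)) by rewrite sumr_ge0 // => k _; rewrite addr_ge0 // cn_ge0.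
have S1 : 0 <= \sum_j cn (w0 0 j) by rewrite sumr_ge0 // => k _; rewrite cn_ge0.
have B1 : 1 <= B by rewrite /B; lra.
have B0 : 0 < B by exact: lt_le_trans B1.
have [K K0 hK] : exists2 K, 0 < K & forall (k : 'I_m) u v h, nearv B 0 u -> nearv B 0 v ->
    (forall j, cn (u 0 j - v 0 j) <= h) -> 0 <= h -> cn (elem_sym u 0 k - elem_sym v 0 k) <= K * h.
  have [d2 d20 h2] : exists2 e, 0 < e & forall (k : 'I_m), 0 < e -> forall u v h, nearv B 0 u -> nearv B 0 v ->
    (forall j, cn (u 0 j - v 0 j) <= h) -> 0 <= h -> cn (elem_sym u 0 k - elem_sym v 0 k) <= e^-1 * h.
    apply: (@fin_min _ (fun k e => 0 < e -> forall u v h, nearv B 0 u -> nearv B 0 v ->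
    (forall j, cn (u 0 j - v 0 j) <= h) -> 0 <= h -> cn (elem_sym u 0 k - elem_sym v 0 k) <= e^-1 * h)) => [k|k e e' ee h e'0 u v h' a1 a2 a3 a4]; last first.
      have ep := lt_le_trans e'0 ee; apply: le_trans (h ep u v h' a1 a2 a3 a4) _.
      by rewrite ler_wpM2r // lef_pV2.
    have [K K0 hK] := pfun_lip B 0 (pfun_esym k); exists (K + 1)^-1; first by rewrite invr_gt0 ltr_wpDl.
    move=> _ u v h a1 a2 a3 a4; rewrite invrK; apply: le_trans (hK u v h a1 a2 a3 a4) _.
    by rewrite ler_wpM2r // lerDl.
  by exists d2^-1 => [|k]; [rewrite invr_gt0|exact/h2].
pose h : R := Num.min d (e1 / (2 * K)) / 2.
have h0 : 0 < h by rewrite divr_gt0 // lt_min d0 divr_gt0 // mulr_gt0.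
have hd : h < d by rewrite /h; apply: lt_le_trans (_ : Num.min d (e1 / (2 * K)) <= _); rewrite ?ge_min ?lexx // ltr_pdivrMr // ltr_pMr ?ltr1n // lt_min d0 divr_gt0 // mulr_gt0.
have hKh : K * h <= e1 / 2.
  have : h <= e1 / (2 * K) by rewrite /h ler_pdivrMr //; apply: le_trans (_ : _ <= e1 / (2 * K)) _; rewrite ?ge_min ?lexx ?orbT // ler_peMr ?ler1n // ltW // divr_gt0 // mulr_gt0.
  move=> /(ler_wpM2l (ltW K0)); rewrite (_ : K * (e1 / (2 * K)) = e1 / 2) //; field; exact/lt0r_neq0.
(* If every root of w0 were at distance at least h from w_j, the product of the differences would be
   at least (h / 2)^m; but it is the difference of the two polynomials at w_j, at most m e B^m. *)
pose e : R := Num.min (Num.min 1 (e1 / 2)) ((h / 2) ^+ m / ((m%:R + 1) * B ^+ m)).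
have eb0 : 0 < (h / 2) ^+ m / ((m%:R + 1) * B ^+ m) 
  by apply: divr_gt0; [exact/exprn_gt0/divr_gt0|apply: mulr_gt0; [exact/ltr_wpDl|exact/exprn_gt0]].
have e_0 : 0 < e by rewrite !lt_min ltr01 divr_gt0.
exists e => // w hw.
have ele1 : e <= 1 by rewrite !ge_min lexx.
have ele2 : e <= e1 / 2 by rewrite !ge_min lexx orbT.
have ele3 : e <= (h / 2) ^+ m / ((m%:R + 1) * B ^+ m) by rewrite ge_min lexx orbT.
have wB j : cn (w 0 j) < B.
  apply: le_lt_trans (root_bound w j) _; rewrite /B -addrA ltr_pwDr //; first by rewrite ltr_pwDl.
  rewrite ler_pM2l // lerD2l; apply: ler_sum => k _.
  rewrite -[elem_sym w 0 k](subrK (e0 0 k)); apply: le_trans (cnD _ _) _; rewrite lerD2r.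
  exact: le_trans (ltW (hw k)) ele1.
have close j : exists i, cn (w 0 j - w0 0 i) < h. apply: contrapT => H.
  have Hi i : h <= cn (w 0 j - w0 0 i) by rewrite leNgt; apply/negP => H'; apply: H; exists i.
  have := @cn_prod_ge _ (index_enum 'I_m) (fun i => w 0 j - w0 0 i) h (ltW h0) Hi.
  rewrite (_ : size _ = m); last by rewrite [index_enum _]unlock -enumT size_enum_ord.
  have -> : \prod_i (w 0 j - w0 0 i) = (chip e0).[w 0 j] - (chip (elem_sym w)).[w 0 j].
    rewrite chip_root subr0 /e0 chip_esym horner_prod; apply: eq_bigr => i _.
    by rewrite hornerXsubC.
  rewrite /chip !hornerD opprD addrACA subrr add0r !horner_sum -sumrB => H2.
  have H3 : (h / 2) ^+ m <= m%:R * e * B ^+ m.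
    apply: le_trans H2 _; apply: le_trans (cn_sum _ _ _) _.
    rewrite -mulrA -[m in m%:R]card_ord mulr_natl -sumr_const; apply: ler_sum => k _.
    rewrite !hornerZ !hornerXn -mulrBl -mulrBr; apply: le_trans (cnM _ _) _.
    apply: ler_pM; rewrite ?cn_ge0 //.
      apply: le_trans (cnM _ _) _; rewrite -signr_odd; case: (odd _); rewrite ?expr1 ?expr0 ?cnN cn1 mul1r cnB; exact: ltW (hw k).
    apply: le_trans (cn_powb _ _) _; apply: le_trans (_ : _ <= B ^+ (m - k.+1)) _.
      by rewrite lerXn2r ?nnegrE ?cn_ge0 ?(ltW B0) // ltW.
    by rewrite ler_weXn2l // leq_subr.
  have mb : 0 < (m%:R + 1) * B ^+ m by rewrite mulr_gt0 ?exprn_gt0 // ltr_wpDl.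
  have : m%:R * e * B ^+ m < (h / 2) ^+ m.
    apply: lt_le_trans (_ : _ < e * ((m%:R + 1) * B ^+ m)) _; last by rewrite -ler_pdivlMr.
    by rewrite mulrA ltr_pM2r ?exprn_gt0 // mulrC ltr_pM2l // ltrDl.
  by move/lt_le_trans => /(_ _ H3); rewrite ltxx.
have [p hp] := choice close; pose pf := [ffun j => p j].
have wpB : nearv B 0 (wp pf).
  move=> j; rewrite !mxE subr0 /B ltr_pwDl //; first by rewrite ltr_wpDl // mulr_ge0 // addr_ge0.
  by rewrite (bigD1 (pf j)) //= lerDl sumr_ge0 // => k _; exact/cn_ge0.
have cl j : cn (w 0 j - wp pf 0 j) <= h by rewrite mxE ffunE ltW.
have nE : elem_sym (wp pf) = e0.
  apply: he1 => k; apply: le_lt_trans (cn_triangle (elem_sym w 0 k) _ _) _.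
  rewrite [ltRHS]splitr ler_ltD //; last exact: lt_le_trans (hw k) ele2.
  rewrite cnB; apply: le_trans (hK k w (wp pf) h _ wpB cl (ltW h0)) _ => //.
  by move=> j; rewrite mxE subr0.
have [s hs] := esym_fiber nE.
exists (s^-1)%g => j; rewrite mxE.
have -> : w0 0 j = wp pf 0 ((s^-1)%g j) by rewrite hs mxE permKV.
by apply: le_lt_trans (cl _) hd.
Qed.

Definition nn z : R := Re z ^+ 2 + Im z ^+ 2.
Lemma nn_ge0 z : 0 <= nn z. Proof. by rewrite addr_ge0 // sqr_ge0. Qed.
Lemma nnE z : z * z^* = (nn z)%:C.
Proof. by case: z => x y; apply: ceqP; rewrite /nn /=; ring. Qed.
Lemma nn_le_cn z : nn z <= cn z ^+ 2.
Proof.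
rewrite /nn /cn -[Re z ^+ 2]real_normK ?num_real // -[Im z ^+ 2]real_normK ?num_real //.
by have := normr_ge0 (Re z); have := normr_ge0 (Im z); nra.
Qed.
Lemma cn_le_nn z : cn z ^+ 2 <= 2 * nn z.
Proof.
rewrite /nn /cn -[Re z ^+ 2]real_normK ?num_real // -[Im z ^+ 2]real_normK ?num_real //.
move: `|_| `|_| => x y; have := sqr_ge0 (x - y); nra.
Qed.

Section Bump.
Context {m : nat}.
Definition dist2 (c v : V m) : R := \sum_j nn (v 0 j - c 0 j).

Lemma dist2E c v : (dist2 c v)%:C = \sum_j (v 0 j - c 0 j) * (v 0 j - c 0 j)^*.
Proof. by rewrite rmorph_sum; apply: eq_bigr => j _; rewrite nnE. Qed.
Lemma sm_dist2 c : smooth (fun v => (dist2 c v)%:C).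
Proof.
rewrite (_ : (fun v => _) = fun v : V m => \sum_j (v 0 j - c 0 j) * (v 0 j - c 0 j)^*); last first.
  by apply/funext => v; exact/dist2E.
have h j : smooth (fun v => v 0 j - c 0 j) by apply: smoothB; auto with sm.
by auto with sm.
Qed.
Lemma dist2_near c v (s : R) j : 0 < s -> 2 * dist2 c v < s ^+ 2 -> cn (v 0 j - c 0 j) < s.
Proof.
move=> s0 h; rewrite -(ltr_pXn2r (n := 2)) ?nnegrE ?cn_ge0 ?ltW //.
apply: le_lt_trans (cn_le_nn _) (le_lt_trans _ h); rewrite ler_pM2l // /dist2 (bigD1 j) //= lerDl.
by apply: sumr_ge0 => k _; exact/nn_ge0.
Qed.
Lemma near_dist2 c v s : nearv s c v -> dist2 c v <= m%:R * s ^+ 2.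
Proof.
move=> h; rewrite -[m in m%:R]card_ord mulr_natl -sumr_const; apply: ler_sum => j _.
by apply: le_trans (nn_le_cn _) _; rewrite lerXn2r ?nnegrE ?cn_ge0 ?(le_trans (cn_ge0 _) (ltW (h j))) // ltW.
Qed.

Lemma sm_flat (x : V m -> R) : smooth (fun v => (x v)%:C) -> smooth (fun v => (flat 0 (x v))%:C).
Proof.
move=> /smoothP hx; apply/smoothP => r.
by have := @Cf_real_comp R m (fun _ _ => True) r (@flat R) 0 (fun v _ => (x v)%:C) (@dopenT R m) (@flat_derive R) (fun _ _ _ => erefl) (hx r).
Qed.

Lemma smoothV (f : V m -> C) : (forall v, f v != 0) -> smooth f -> smooth (fun v => (f v)^-1).
Proof.
move=> f0 /smoothP hf; apply/smoothP => r.
by apply: (CfV (F := fun v _ => f v)) => //; exact/dopenT.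
Qed.

Definition step x : R := flat 0 x / (flat 0 x + flat 0 (1 - x)).
Lemma step_den (x : R) : 0 < flat 0 x + flat 0 (1 - x).
Proof.
have [x0|x0] := ltP 0 x; first by rewrite ltr_pwDl ?flat_gt0 ?flat_ge0.
by rewrite ltr_wpDl ?flat_ge0 // flat_gt0; lra.
Qed.
Lemma step_ge0 x : 0 <= step x.
Proof. by rewrite divr_ge0 ?flat_ge0 // ltW // step_den. Qed.
Lemma step_le1 x : step x <= 1.
Proof. by rewrite ler_pdivrMr ?step_den // mul1r lerDl flat_ge0. Qed.
Lemma step1 x : 1 <= x -> step x = 1.
Proof.
move=> x1; rewrite /step (flat_le0 (x := 1 - x)) ?subr_le0 // addr0 divff // gt_eqF // flat_gt0 //.
exact: lt_le_trans x1.
Qed.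
Lemma step0 (x : R) : x <= 0 -> step x = 0.
Proof. by move=> x0; rewrite /step flat_le0 // mul0r. Qed.

Lemma sm_step (x : V m -> R) : smooth (fun v => (x v)%:C) -> smooth (fun v => (step (x v))%:C).
Proof.
move=> hx; have hx1 : smooth (fun v => (1 - x v)%:C). under eq_fun do rewrite rmorphB.
  by apply: smoothB ; auto with sm.
rewrite (_ : (fun v => _) = fun v => (flat 0 (x v))%:C * ((flat 0 (x v))%:C + (flat 0 (1 - x v))%:C)^-1); last first.
  by apply/funext => v; rewrite rmorphM fmorphV rmorphD.
apply: smoothM; first exact/sm_flat.
apply: smoothV; last by apply: smoothD; exact/sm_flat.
move=> v; rewrite eq_complex gt_eqF //; exact/step_den.
Qed.

(** [smooth] and [poincare] concern the whole of C^m; composition with this map extends data given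
    on a polydisc without changing them near its centre. *)
Lemma sm_retract c (d : R) : 0 < d -> exists u : V m -> V m, [/\ smap u, forall v, nearv d c (u v)
  & exists2 d' : R, 0 < d' & forall v, nearv d' c v -> u v = v].
Proof.
(* x >= 1 where 4 [dist2] <= d^2, and there the map is the identity; x > 0 forces 2 [dist2] < d^2,
   which by [dist2_near] keeps the image within d. *)
move=> d0; pose x v := 2 - 4 / d ^+ 2 * dist2 c v.
have hx : smooth (fun v => (x v)%:C). under eq_fun do rewrite rmorphB rmorphM.
  by apply: smoothB; [exact/sm_cst|exact/smoothZ/sm_dist2].
have d2 : 0 < d ^+ 2 by rewrite exprn_gt0.
exists (fun v => c + (step (x v))%:C *: (v - c)); split.
- move=> j; under eq_fun do rewrite !mxE. apply: smoothD; first exact/sm_cst.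
  apply: smoothM; first exact/sm_step.
  by apply: smoothB; [exact/sm_coord|exact/sm_cst].
- move=> v j; rewrite !mxE addrAC subrr add0r cnMR ger0_norm ?step_ge0 //.
  have [x0|x0] := leP (x v) 0; first by rewrite step0 // mul0r.
  apply: le_lt_trans (_ : _ <= cn (v 0 j - c 0 j)) _; first by rewrite ler_piMl ?cn_ge0 ?step_le1.
  apply: dist2_near => //; move: x0; rewrite /x subr_gt0 mulrAC ltr_pdivrMr //.
  by move: (dist2 c v) (d ^+ 2) => a b; lra.
- have m1 : 0 < m%:R + 1 :> R by rewrite ltr_wpDl.
  exists (d / (2 * (m%:R + 1))); first by rewrite divr_gt0 // mulr_gt0.
  move=> v /near_dist2 h; rewrite step1 ?scale1r; first by rewrite addrC subrK.
  rewrite /x lerBrDr -lerBrDl (_ : 2 - 1 = 1); last by ring.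
  rewrite mulrAC ler_pdivrMr // mul1r; apply: le_trans (ler_wpM2l _ h) _ => //.
  rewrite (_ : 4 * _ = d ^+ 2 * (m%:R / (m%:R + 1) ^+ 2)); last first.
    by move: m1 => /lt0r_neq0; move: (m%:R : R) => M hM; field.
  rewrite ler_piMr ?(ltW d2) // ler_pdivrMr ?exprn_gt0 // mul1r.
  by have := ler0n R m; move: (m%:R : R) => M hM; nra.
Qed.
End Bump.

Section Reduction.
Context {m : nat} (w0 la : V m).
Hypothesis compat : forall i j, w0 0 i = w0 0 j -> la 0 i = la 0 j.

Let ell (i : 'I_m) : {poly C} := \prod_(j | w0 0 j != w0 0 i) ((w0 0 i - w0 0 j)^-1 *: ('X - (w0 0 j)%:P)).
Lemma ellE i j : (ell i).[w0 0 j] = (w0 0 j == w0 0 i)%:R.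
Proof.
rewrite horner_prod; case: eqVneq => [e|ne].
  rewrite big1 // => k hk; rewrite hornerZ hornerXsubC e mulVf // subr_eq0 eq_sym //.
by rewrite (bigD1 j) //= hornerZ hornerXsubC subrr mulr0 mul0r.
Qed.
(** The map 3 t^2 - 2 t^3 fixes 0 and 1 with derivative 0 there. Its iterates turn the interpolation
    polynomials [ell] into polynomials that converge, near the distinct values of w0, to locally
    constant functions with the same values 0 and 1. *)
Let phi (p : {poly C}) : {poly C} := 3 *: p ^+ 2 - 2 *: p ^+ 3.
Let el N i := iter N phi (ell i).

Lemma phi_contr (z : C) : cn z <= 1 / 16 -> cn (3 * z ^+ 2 - 2 * z ^+ 3) <= cn z / 2.
Proof.
move=> h; have h0 := cn_ge0 z.
rewrite (_ : _ - _ = (3 * z - 2 * (z * z)) * z); last by ring.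
apply: le_trans (cnM _ _) _; rewrite mulrC ler_wpM2l //.
apply: le_trans (cnD _ _) _; rewrite cnN.
have e3 : cn (3 : C) = 3 by rewrite -(rmorph_nat (real_complex R)) cnR normr_nat.
have e2 : cn (2 : C) = 2 by rewrite -(rmorph_nat (real_complex R)) cnR normr_nat.
have := cnM 3 z; have := cnM 2 (z * z); have := cnM z z.
by nra.
Qed.

Lemma el_close N i j x : cn ((ell i).[x] - (w0 0 j == w0 0 i)%:R) <= 1 / 16 ->
  cn ((el N i).[x] - (w0 0 j == w0 0 i)%:R) <= (1 / 2) ^+ N / 16.
Proof.
move=> h; elim: N => [|N IH]; first by rewrite expr0.
have p1 : (1 / 2 : R) ^+ N <= 1 by rewrite exprn_ile1 //; lra.
have e : cn ((el N i).[x] - (w0 0 j == w0 0 i)%:R) <= 1 / 16 by apply: le_trans IH _; rewrite ler_pM2r ?invr_gt0.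
rewrite (_ : el N.+1 i = phi (el N i)) // /phi !(hornerD, hornerN, hornerZ, horner_exp).
move: e IH; case: eqP => _; last first.
  rewrite mulr0n !subr0 => e IH; apply: le_trans (phi_contr e) _; rewrite exprS.
  by move: IH; lra.
rewrite mulr1n -[cn ((el N i).[x] - 1)]cnN => e IH; pose z := - ((el N i).[x] - 1).
rewrite (_ : _ - 1 = - (3 * z ^+ 2 - 2 * z ^+ 3)); last by rewrite /z; ring.
rewrite cnN; apply: le_trans (phi_contr e) _; rewrite exprS.
by move: IH; lra.
Qed.

(** Indices with the same value of w0 carry the same polynomial [ell], so the sum over i counts each
    value with its multiplicity; [mu] corrects this. *)
Let mu (i : 'I_m) : C := #|[set j | w0 0 j == w0 0 i]|%:R^-1.
Let q N : {poly C} := 'X - \sum_i (la 0 i * mu i) *: el N i.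

Lemma q_close : exists2 d : R, 0 < d & exists2 K, 0 <= K & forall N w, nearv d w0 w ->
  forall j, cn (mapv (q N) w 0 j - (w - la) 0 j) <= K * (1 / 2) ^+ N.
Proof.
have [d d0 hd] : exists2 d, 0 < d & forall ij, forall w, nearv d w0 w ->
    cn ((ell ij.1).[w 0 ij.2] - (w0 0 ij.2 == w0 0 ij.1)%:R) <= 1 / 16.
  apply: (@fin_min _ (fun ij d => forall w, nearv d w0 w ->
    cn ((ell ij.1).[w 0 ij.2] - (w0 0 ij.2 == w0 0 ij.1)%:R) <= 1 / 16)) => [[i j]|ij d d' dd h w hw]; last first.
    by apply: h; exact: nearv_le hw.
  have e16 : 0 < 1 / 16 :> R by lra.
  have [d d0 hd] := @pfun_jcont R m _ w0 0 (pfun_poly (ell i) (pfun_coord j)) _ e16.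
  by exists d => // w hw; rewrite -ellE; apply/ltW/(hd w 0) => //; rewrite subrr normr0.
exists d => //; exists (\sum_i cn (la 0 i * mu i)); first by apply: sumr_ge0 => i _; exact/cn_ge0.
move=> N w hw j; have E : la 0 j = \sum_i la 0 i * mu i * (w0 0 j == w0 0 i)%:R.
  rewrite (eq_bigr (fun i => if w0 0 i == w0 0 j then la 0 j * mu j else 0)) => [|i _]; last first.
    case: (eqVneq (w0 0 i) (w0 0 j)) => [e|ne]; last by rewrite mulr0.
    by rewrite mulr1 (compat e) /mu e.
  rewrite -big_mkcond sumr_const -mulr_natr -mulrA (_ : #|_| = #|[set k | w0 0 k == w0 0 j]|); last first.
    by apply: eq_card => k; rewrite inE.
  rewrite mulVf ?mulr1 // pnatr_eq0 -lt0n; apply/card_gt0P; exists j; by rewrite inE.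
rewrite !mxE hornerD hornerX hornerN horner_sum opprB addrC addrA subrK {1}E.
rewrite [X in _ - X](eq_bigr (fun i => (la 0 i * mu i) * (el N i).[w 0 j])) => [|i _]; last by rewrite hornerZ.
rewrite -sumrB mulr_suml; apply: le_trans (cn_sum _ _ _) _; apply: ler_sum => i _.
rewrite -mulrBr; apply: le_trans (cnM _ _) _; rewrite ler_wpM2l ?cn_ge0 // cnB.
apply: le_trans (el_close N (hd (i, j) w hw)) _.
by rewrite ler_piMr //; lra.
Qed.

Lemma half_small (K e : R) : 0 <= K -> 0 < e -> exists N, K * (1 / 2) ^+ N <= e.
Proof.
move=> K0 e0; have [N hN] := archi_small K0 e0; exists N; apply: le_trans hN; rewrite ler_wpM2l //.
rewrite div1r exprVn lef_pV2 ?posrE // -natrX ler_nat; exact/ltn_expl.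
Qed.

(** The translation by - la, constant near each value of w0 thanks to [compat], is a uniform limit
    of polynomials [q N] applied to every coordinate. In the coordinates e these are polynomial maps
    ([pfun_mapv]), so the limit is holomorphic: a change of charts on S^m C. *)
Lemma reduction : exists2 d : R, 0 < d & exists2 rt, smap rt &
  forall w, nearv d w0 w -> elem_sym (w - la) = rt (elem_sym w).
Proof.
have [d1 d10 [K K0 hK]] := q_close.
have [e1 e10 he1] := root_continuity w0 d10.
(* Some ordering of the roots close to w0; it exists for e near elem_sym w0 by [root_continuity]. By
   [key] the value of f is a limit that does not depend on the choice. *)
pose wn e : V m := xget 0 [set w | nearv d1 w0 w /\ elem_sym w = e]%classic.
have wnP w : nearv d1 w0 w -> nearv d1 w0 (wn (elem_sym w)) /\ elem_sym (wn (elem_sym w)) = elem_sym w.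
  move=> hw; exact: (@xgetPex _ 0 [set v | nearv d1 w0 v /\ elem_sym v = elem_sym w]%classic (ex_intro _ w (conj hw erefl))).
pose f e := elem_sym (wn e - la).
have key k : exists2 Kk : R, 0 <= Kk & forall N w, nearv d1 w0 w ->
    cn (elem_sym (w - la) 0 k - elem_sym (mapv (q N) (rootv (elem_sym w))) 0 k) <= Kk * (1 / 2) ^+ N.
  pose B := d1 + 1 + \sum_j cn (w0 0 j) + \sum_j cn (la 0 j) + K.
  have [Kk Kk0 hk] := pfun_lip B 0 (pfun_esym k); exists (Kk * K); first exact/mulr_ge0.
  move=> N w hw; rewrite mapv_rootv -mulrA.
  have p0 : 0 <= K * (1 / 2) ^+ N by rewrite mulr_ge0 ?exprn_ge0 //; lra.
  have p1 : K * (1 / 2) ^+ N <= K by rewrite ler_piMr ?exprn_ile1 //; lra.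
  have w0j j : cn (w0 0 j) <= \sum_j cn (w0 0 j) by rewrite (bigD1 j) //= lerDl sumr_ge0 // => i _; exact/cn_ge0.
  have laj j : cn (la 0 j) <= \sum_j cn (la 0 j) by rewrite (bigD1 j) //= lerDl sumr_ge0 // => i _; exact/cn_ge0.
  have b1 j : cn ((w - la) 0 j) < d1 + 1 + \sum_j cn (w0 0 j) + \sum_j cn (la 0 j).
    rewrite !mxE; apply: le_lt_trans (cnD _ _) _; rewrite cnN.
    have := cnD (w 0 j - w0 0 j) (w0 0 j); rewrite subrK; have := hw j; have := w0j j; have := laj j; lra.
  apply: hk => //.
  - by move=> j; rewrite [X in _ - X]mxE subr0 /B; have := b1 j; lra.
  - move=> j; rewrite [X in _ - X]mxE subr0 -[mapv _ _ _ _](subrK ((w - la) 0 j)); apply: le_lt_trans (cnD _ _) _.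
    by have := hK N w hw j; have := b1 j; rewrite /B; lra.
  - by move=> j; rewrite cnB; exact/hK.
have ap k : papp e1 (elem_sym w0) (fun e => f e 0 k).
  move=> h h0; have [Kk Kk0 hk] := key k; have [N hN] := half_small Kk0 h0.
  exists (fun e => elem_sym (mapv (q N) (rootv e)) 0 k); first exact/pfun_mapv.
  move=> e he; have [s hs] : exists s : 'S_m, nearv d1 w0 (\row_j rootv e 0 (s j)).
    by apply: he1; rewrite rootvK.
  have eE : elem_sym (\row_j rootv e 0 (s j)) = e by rewrite esym_perm rootvK.
  have [a1 a2] := wnP _ hs; rewrite eE in a1 a2.
  apply: le_trans hN; have := hk N _ a1; by rewrite a2.
have oU : dopen (fun e _ => nearv e1 (elem_sym w0) e).
  move=> e s0 he; have [d d0 hd] := nearv_room e10 he; exists d => // v s1 hv _.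
  by have := nearv_trans hd hv; rewrite subrK.
have hC k r : Cf (fun e _ => nearv e1 (elem_sym w0) e) r (fun e _ => f e 0 k).
  apply: hol_Cf => // e he; have [d d0 hd] := nearv_room e10 he; exists d => //.
  apply: (papp_recenter hd) => //; rewrite subrK; exact/ap.
have [u [su nu [d' d'0 hu]]] := sm_retract (elem_sym w0) e10.
have [d2 d20 hd2] := esym_cont w0 d'0.
have [d3 d30 hd3] := esym_cont w0 e10.
exists (Num.min d1 (Num.min d2 d3)); first by rewrite !lt_min d10 d20.
exists (fun e => f (u e)). move=> k; apply/smoothP => r.
  apply: (@Cf_comp R m m (fun _ _ => True) (fun e _ => nearv e1 (elem_sym w0) e) r (fun e _ => u e) (fun e _ => f e 0 k)) => //.
    exact/dopenT.
  by move=> j; have := (smoothP _).1 (su j) r.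
move=> w hw.
have hw1 : nearv d1 w0 w by apply: nearv_le hw; rewrite ge_min lexx.
have hw2 : nearv d' (elem_sym w0) (elem_sym w) by apply/hd2/(nearv_le _ hw); rewrite !ge_min lexx orbT.
rewrite hu //; apply/rowP => k; apply/eqP; rewrite -subr_eq0; apply/eqP; apply: cn_small => h h0.
have [Kk Kk0 hk] := key k; have [N hN] := half_small Kk0 (divr_gt0 h0 (ltr0n R 2)).
have [a1 a2] := wnP _ hw1.
apply: le_trans (cn_triangle (elem_sym (mapv (q N) (rootv (elem_sym w))) 0 k) _ _) _.
rewrite [leRHS]splitr lerD //; apply: le_trans hN; first exact/hk.
by rewrite cnB /f; have := hk N _ a1; rewrite a2.
Qed.

End Reduction.

End Roots.

(** * Forms in symmetric coordinates and local primitives *)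

Section LocalForms.
Context {R : realType}.
Notation C := R[i].
Notation V m := 'rV[R[i]]_m.
Notation form m := (dform R m).

Lemma pd_near m i (f g : V m -> C) w (d : R) : 0 < d -> smooth f ->
  (forall v, nearv d w v -> f v = g v) -> pd i f w = pd i g w.
Proof. by move=> d0 hf h; rewrite (pd_eq (pder_ext d0 h (pder_pd i w hf))). Qed.

Lemma pd_Re m i (f : V m -> C) w : smooth f -> pd i (fun v => (Re (f v))%:C) w = (Re (pd i f w))%:C.
Proof.
move=> hf; rewrite (pd_ext _ _ (fun v => cRe_half (f v))) pdZ; auto with sm.
by rewrite pdD ?pd_conj ?cRe_half //; exact/smoothJ.
Qed.
Lemma pd_Im m i (f : V m -> C) w : smooth f -> pd i (fun v => (Im (f v))%:C) w = (Im (pd i f w))%:C.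
Proof.
move=> hf; rewrite (pd_ext _ _ (fun v => cIm_half (f v))) pdZ; auto with sm.
by rewrite pdB ?pd_conj ?cIm_half //; exact/smoothJ.
Qed.

Lemma prod_pt p q T l (F : T -> form p) (G : T -> form p) w w' :
  (forall a K, F a w K = G a w' K) -> forall K, (\prod_(a <- l) F a) w K = (\prod_(a <- l) G a) w' K :> (id (fun _ : nat => C) q).
Proof.
move=> h; elim: l => [|a l IH] K; first by rewrite !big_nil.
by rewrite !big_cons; apply: eq_bigr => I _; rewrite h IH.
Qed.

Lemma pb_pt p m (f g : V p -> V m) om w w' K :
  (forall a K, pb1 f a w K = pb1 g a w' K) -> f w = g w' -> pullback f om w K = pullback g om w' K.
Proof.
move=> h e; rewrite !pbE !sumfE; apply: eq_bigr => I _; rewrite !mulf0E e; congr (_ * _).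
by rewrite !pbI_prod; exact: (@prod_pt p 0).
Qed.

Lemma pb_local p m (f g : V p -> V m) om w K (d : R) : 0 < d -> smap f ->
  (forall v, nearv d w v -> f v = g v) -> pullback f om w K = pullback g om w K.
Proof.
move=> d0 sf h; apply: pb_pt; last exact/h/nearv_refl.
move=> a L; rewrite !pb1E; apply: eq_bigr => i _; congr (_ * _); apply: (pd_near _ d0).
  exact/sm_comp_rcomp.
by move=> v /h ->.
Qed.
Lemma pb_val p m (f : V p -> V m) (om om' : form m) w K :
  (forall I, om (f w) I = om' (f w) I) -> pullback f om w K = pullback f om' w K.
Proof. by move=> h; apply: eq_bigr => I _; rewrite h. Qed.

Lemma extd_form0_set1 m (g : V m -> C) v i : extd (form0 g) v [set i] = pd i g v.
Proof.
rewrite extd_form0E sumfE -(@big_pred1_eq _ 0 +%R _ i (fun k => pd k g v)).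
rewrite big_mkcond; apply: eq_bigr => k _; rewrite mulf0E /ef.
rewrite (inj_eq set1_inj) eq_sym; case: eqP => _; first exact/mulr1.
exact/mulr0.
Qed.

Lemma const_near m (k : V m -> C) w0 d : smooth k ->
  (forall v i, nearv d w0 v -> pd i k v = 0) -> forall v, nearv d w0 v -> k v = k w0.
Proof.
move=> sk h v hv; apply/eqP; rewrite -subr_eq0.
have := @int01_FTC R (fun s => k (w0 + s%:C *: (v - w0))) (fun=> 0) (cont01_cst 0).
rewrite int01_cst scale1r scale0r addr0 [w0 + _]addrC subrK => <- // s /andP[s0 s1].
have := cder_line w0 (v - w0) s sk; rewrite /dirder big1 // => i _; rewrite h ?mulr0 // => j.
rewrite !mxE addrAC subrr add0r cnMR ger0_norm //; apply: le_lt_trans (hv j).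
by rewrite ler_piMl ?cn_ge0.
Qed.

Section Jacobian.
Context {m : nat}.
Notation E := (@elem_sym R m).
Variable w : V m.
Hypothesis winj : injective (fun j => w 0 j).

Definition Jac : 'M[C]_m := \matrix_(j, k) pd (j, false) (fun v => E v 0 k) w.

Let sE k : smooth (fun v => E v 0 k). Proof. exact/smap_sym. Qed.

(** For x = w_l the function prod_j (x - u_j) is affine in the e_k, so a kernel vector v annihilates
    its differential. At u = w only its l-th derivative is not 0, the w_j being distinct, and v_l =
    0. *)
Lemma Jac_unit : Jac \in unitmx.
Proof.
rewrite unitmxE unitfE; apply/negP => /det0P [v v0 hv]; move/eqP: v0; apply; apply/rowP => l; rewrite mxE.
pose x := w 0 l; pose f (u : V m) := \prod_j (x - u 0 j).
have sx i : smooth (fun u : V m => x - u 0 i) by apply: smoothB; [exact/sm_cst|exact/sm_coord].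
have e1 : \sum_j v 0 j * pd (j, false) f w = 0.
  have fE : f = fun u => x ^+ m + \sum_(k < m) ((-1) ^+ k.+1 * x ^+ (m - k.+1)) * E u 0 k.
    apply/funext => u; rewrite /f; transitivity (chip (E u)).[x].
      by rewrite chip_esym horner_prod; apply: eq_bigr => j _; rewrite hornerXsubC.
    rewrite /chip hornerD hornerXn horner_sum; congr (_ + _); apply: eq_bigr => k _.
    by rewrite hornerZ hornerXn; ring.
  have pE j : pd (j, false) f w = \sum_(k < m) ((-1) ^+ k.+1 * x ^+ (m - k.+1)) * Jac j k.
    rewrite fE pdD; [|exact/sm_cst|by apply: sm_sum => k _; exact/smoothZ].
    rewrite pd_cst add0r pd_sum => [|k _]; last exact/smoothZ.
    by apply: eq_bigr => k _; rewrite pdZ // mxE.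
  under eq_bigr do rewrite pE mulr_sumr.
  rewrite exchange_big big1 // => k _.
  have := congr1 (fun M : 'rV_m => M 0 k) hv; rewrite !mxE => hk.
  transitivity (((-1) ^+ k.+1 * x ^+ (m - k.+1)) * \sum_j v 0 j * Jac j k); last by rewrite hk mulr0.
  by rewrite mulr_sumr; apply: eq_bigr => j _; rewrite mulrCA.
have pf j : pd (j, false) f w = - \prod_(i | i != j) (x - w 0 i).
  have sp : smooth (fun u => \prod_(i | i != j) (x - u 0 i)) by apply: sm_prod => i _.
  rewrite (pd_ext _ _ (fun u => bigD1 (op := *%R) j isT)) /= (pdM _ _ (sx j) sp).
  rewrite pdB; [|exact/sm_cst|exact/sm_coord].
  rewrite pd_cst pd_coord eqxx /cunit /= mul1r sub0r mulN1r.
  rewrite (_ : pd (j, false) _ w = 0) ?mulr0 ?addr0 //; apply: pd_eq; rewrite /pder.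
  rewrite (_ : (fun t => _) = fun=> \prod_(i | i != j) (x - w 0 i)); first exact/cder_cst.
  apply/funext => t; apply: eq_bigr => i ij; rewrite axisE /=; congr (x - _).
  by rewrite (negbTE ij) mulr0 addr0.
move: e1; rewrite (bigD1 l) //= [X in _ + X]big1 => [|j jl]; last first.
  by rewrite pf (bigD1 l) 1?eq_sym //= subrr mul0r oppr0 mulr0.
rewrite pf addr0 mulrN => /eqP; rewrite oppr_eq0 mulf_eq0 => /orP[/eqP //|/eqP].
move=> /eqP; rewrite prodf_seq_eq0 => /hasP [i _ /andP[il]].
by rewrite subr_eq0 => /eqP /winj hil; rewrite hil eqxx in il.
Qed.

(** A pullback at a point depends on the map only to first order ([pb_pt]). So an affine map psi,
    with the inverse Jacobian as its derivative, takes the place of a local inverse of [elem_sym] at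
    E w. *)
Lemma pbE_inj om : (forall K, pullback E om w K = 0) -> forall I, om (E w) I = 0.
Proof.
move=> h I; pose N := invmx Jac; pose psi (e : V m) : V m := w + (e - E w) *m N.
have spsi : smap psi. move=> j; under eq_fun do rewrite !mxE. apply: smoothD; auto with sm.
  apply: sm_sum => k _; under eq_fun do rewrite !mxE mulrC.
  by apply: smoothZ; auto with sm.
have psiE : psi (E w) = w by rewrite /psi subrr mul0mx addr0.
have dpsi i j : pd i (fun v => psi v 0 j) (E w) = cunit i * N i.1 j.
  have e v : psi v 0 j = w 0 j + \sum_k N k j * (v 0 k - E w 0 k).
    by rewrite !mxE; congr (_ + _); apply: eq_bigr => k _; rewrite !mxE mulrC.
  have s1 k : smooth (fun v => v 0 k - E w 0 k) by apply: smoothB; auto with sm.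
  rewrite (pd_ext _ _ e) pdD; auto with sm.
  rewrite pd_cst add0r pd_sum => [|k _]; auto with sm.
  rewrite (bigD1 i.1) //= big1 => [|k ki]. rewrite pdZ // pdB; auto with sm.
    by rewrite pd_cst pd_coord eqxx mulr1 subr0 addr0 mulrC.
  rewrite pdZ // pdB; auto with sm.
  by rewrite pd_cst pd_coord (negbTE ki) mulr0 subr0 mulr0.
have dEpsi i k : pd i (fun v => E (psi v) 0 k) (E w) = cunit i * (k == i.1)%:R.
  rewrite (@pd_comp _ _ _ psi (fun v => E v 0 k)) // sum_rcoord psiE.
  transitivity (\sum_j cunit i * (N i.1 j * Jac j k)).
    apply: eq_bigr => j _; rewrite (pd_pfun _ _ (pfun_esym k)) /rcomp /= pd_Re // pd_Im // dpsi [Jac j k]mxE.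
    rewrite [RHS]mulrA; move: (cunit i * N i.1 j) (pd (j, false) _ w) => [a c] [p q].
    by apply: ceqP; rewrite /=; ring.
  rewrite -mulr_sumr; congr (_ * _).
  have := congr1 (fun M : 'M[C]_m => M i.1 k) (mulVmx Jac_unit); rewrite !mxE eq_sym => ->.
  by [].
have := pb_comp om spsi smap_sym => /(congr1 (fun o => o (E w) I)).
rewrite (@pb_val _ _ psi _ 0) ?pb0 => [|K]; last by rewrite psiE.
rewrite (@pb_pt _ _ (fun v => E (psi v)) (fun v => v) om (E w) (E w) I) ?pb_id //; last by rewrite psiE.
move=> a K; rewrite !pb1E; apply: eq_bigr => i _.
have sEp k : smooth (fun v => E (psi v) 0 k) by exact/smap_comp.
case: a => k c; case: c. by rewrite (pd_Im _ _ (sEp k)) (pd_Im i _ (sm_coord k)) dEpsi pd_coord.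
by rewrite (pd_Re _ _ (sEp k)) (pd_Re i _ (sm_coord k)) dEpsi pd_coord.
Qed.
End Jacobian.

Section Near.
Context {m : nat}.
Notation E := (@elem_sym R m).

Lemma distinct_dense (w : V m) (d : R) : 0 < d -> exists2 v, nearv d w v & injective (fun j => v 0 j).
Proof.
move=> d0; pose f (v : V m) := \prod_(ij : 'I_m * 'I_m | (ij.1 != ij.2)) (v 0 ij.1 - v 0 ij.2).
have ef : entire f. by apply: entire_prod => ij _; auto with sm.
have f0 : f (\row_j j%:R) != 0. apply/prodf_neq0 => -[i j] ij; rewrite !mxE subr_eq0 eqr_nat.
  by auto with sm.
have [v hv fv] := entire_dense w ef f0 d0; exists v => // i j hij; apply/eqP; apply: contraT => ij.
by move: fv; rewrite /f (bigD1 (i, j)) //= hij subrr mul0r eqxx.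
Qed.

(** On the diagonals the Jacobian is not invertible; there the coefficients vanish by continuity,
    vectors with distinct coordinates being dense. *)
Lemma pbE_inj_near om w0 (d : R) : 0 < d -> sform om ->
  (forall w K, nearv d w0 w -> pullback E om w K = 0) ->
  exists2 d' : R, 0 < d' & forall e I, nearv d' (E w0) e -> om e I = 0.
Proof.
move=> d0 so h; have d2 : 0 < d / 2 by rewrite divr_gt0.
have [d' d'0 hd'] := root_continuity w0 d2; exists d' => // e I he.
have [s hs] : exists s : 'S_m, nearv (d / 2) w0 (\row_j rootv e 0 (s j)) by apply: hd'; rewrite rootvK.
set w := \row_j _ in hs; have wE : E w = e by rewrite esym_perm rootvK.
apply: cn_small => h1 h10.
have so' : smooth (fun v => om (E v) I) by exact: (sm_comp smap_sym (so I)).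
have [d1 d10 hd1] := sm_jcont w 0 so' h10.
have [v hv vi] : exists2 v, nearv (Num.min d1 (d / 2)) w v & injective (fun j => v 0 j).
  by apply: distinct_dense; rewrite lt_min d10.
have z : om (E v) I = 0.
  apply: pbE_inj => // K; apply: h; rewrite [d]splitr; apply: nearv_trans hs _.
  by apply: nearv_le hv; rewrite ge_min lexx orbT.
have := hd1 v 0; rewrite subrr normr0 z sub0r cnN wE => H; apply/ltW/H => //.
by apply: nearv_le hv; rewrite ge_min lexx.
Qed.

Variable tau : C.
Definition lattice (la : V m) : Prop := forall j, exists p q, la 0 j = p%:~R + q%:~R * tau.

Lemma lper_lattice g la w : lper tau g -> lattice la -> g (w + la) = g w.
Proof.
move=> hg hla; rewrite [la]row_sum_delta; elim: (index_enum _) w => [|j l IH] w; first by rewrite big_nil addr0.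
by rewrite big_cons addrA IH; have [p [q ->]] := hla j.
Qed.

Section LocalPrimitive.
Variables (f : V m -> C) (al be y : form m) (w0 la : V m).
Hypotheses (sf : smooth f) (sal : sform al) (hal : homog 1 al) (yE : y = extd al).
Hypotheses (pbe : per_form tau be) (py : per_form tau (pullback E y)).
Hypothesis dfE : extd (form0 f) = be - pullback E al.
Hypotheses (hla : lattice la) (compat : forall i j, w0 0 i = w0 0 j -> la 0 i = la 0 j).

Lemma lattice_sub : lattice (- la).
Proof. by move=> j; have [p [q e]] := hla j; exists (- p), (- q); rewrite mxE e !rmorphN mulNr opprD. Qed.

(** The differential of f(w) - f(w - la) is the pullback by E of the form ga, the pullback of al
    under rt minus al, with rt from [reduction]. Since y is invariant, ga is closed near E w0 and
    has a primitive smooth in e there; what remains is locally constant. *)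
Lemma local_primitive : exists2 d : R, 0 < d & exists2 ka, smooth ka &
  forall w, nearv d w0 w -> f w - f (w - la) = ka (E w).
Proof.
have [d d0 [rt srt hrt]] := reduction compat.
have sE := @smap_sym R m.
have sy : sform y by rewrite yE; auto with sm.
have red o w K : nearv d w0 w ->
    pullback E (pullback rt o - o) w K = pullback E o (w - la) K - pullback E o w K.
  move=> hw; have [d1 d10 hd1] := nearv_room d0 hw.
  rewrite pbB (pb_comp _ sE srt); congr (_ - _).
  rewrite -pb_shift (pb_comp _ (shift_smap _) sE).
  apply: (pb_local _ _ d10) => [|v hv]; first exact/smap_comp.
  by rewrite hrt; have := nearv_trans hd1 hv; rewrite subrK.
pose ga := pullback rt al - al.
have sga : sform ga by apply: sformB ; auto with sm.
have hga : homog 1 ga by apply: homogB ; auto with sm.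
have [d1 d10 hd1] : exists2 d' : R, 0 < d' & forall e I, nearv d' (E w0) e -> extd ga e I = 0.
  apply: (pbE_inj_near d0); auto with sm.
  move=> w K hw; rewrite extdB; auto with sm.
  by rewrite extd_pb // -yE red // (lper_lattice _ (py K) lattice_sub) subrr.
(* [ga] is closed only near E w0; its pullback by the retraction is closed everywhere, so that
   [poincare] applies. *)
have [u [su nu [d2 d20 hu]]] := sm_retract (E w0) d10.
have [ka [ska hka dka]] : exists ka, [/\ sform ka, homog 0 ka & extd ka = pullback u ga].
  apply: poincare; auto with sm.
  rewrite extd_pb //; apply: formP => e I; rewrite (@pb_val _ _ u _ 0) ?pb0 // => J.
  exact/hd1.
pose k0 e := ka e set0.
have kaE : ka = form0 k0.
  by apply: formP => e I; rewrite /form0; case: eqP => [->//|/eqP hI]; rewrite hka //; apply/eqP; rewrite cards_eq0.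
have [d3 d30 hd3] := esym_cont w0 d20.
pose k w := f w - f (w - la) - k0 (E w).
have sk0 : smooth k0 by exact/ska.
have sfl : smooth (fun w => f (w - la)) by exact/sm_trans.
have sk0E : smooth (fun w => k0 (E w)) by exact/sm_comp.
have sk : smooth k by apply: smoothB => //; exact/smoothB.
exists (Num.min d d3); first by rewrite lt_min d0.
exists (fun e => k0 e + k w0); auto with sm.
move=> w hw; suff zk v i : nearv (Num.min d d3) w0 v -> pd i k v = 0.
  by rewrite -(const_near sk zk hw) [RHS]addrC subrK.
move=> hv.
have hv1 : nearv d w0 v by apply: nearv_le hv; rewrite ge_min lexx.
have hv3 : nearv d3 w0 v by apply: nearv_le hv; rewrite ge_min lexx orbT.
rewrite pdB; auto with sm.
rewrite pdB // pd_trans -!extd_form0_set1.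
have -> : extd (form0 (fun w1 => k0 (E w1))) = pullback E (pullback u ga).
  by rewrite -dka -extd_pb // kaE pb_form0.
have -> : pullback E (pullback u ga) v [set i] = pullback E ga v [set i].
  rewrite (pb_comp _ sE su).
  have [d4 d40 hd4] := nearv_room d30 hv3.
  apply: (pb_local _ _ d40) => [|v' hv']; first exact/smap_comp.
  by apply/hu/hd3; have := nearv_trans hd4 hv'; rewrite subrK.
rewrite red // dfE !subfE (lper_lattice _ (pbe [set i]) lattice_sub).
by ring.
Qed.
End LocalPrimitive.
End Near.
End LocalForms.

(** * Local corrections of a symmetric function on charts of S^m C *)

Section Patches.
Context {R : realType} (tau : R[i]) {m : nat}.
Notation C := R[i].
Notation V := 'rV[R[i]]_m.
Notation E := (@elem_sym R m).
Notation lattice := (lattice tau).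
Hypothesis htau : 0 < Im tau.

Definition lat1 (z : C) : Prop := exists p q, z = p%:~R + q%:~R * tau.
Lemma lat1D z u : lat1 z -> lat1 u -> lat1 (z + u).
Proof. by move=> [p [q ->]] [p' [q' ->]]; exists (p + p'), (q + q'); ring. Qed.
Lemma lat1N z : lat1 z -> lat1 (- z).
Proof. by move=> [p [q ->]]; exists (- p), (- q); ring. Qed.
Lemma lat1B z u : lat1 z -> lat1 u -> lat1 (z - u).
Proof. by move=> h1 h2; apply: lat1D => //; exact/lat1N. Qed.
Lemma lat10 : lat1 0. Proof. by exists 0, 0; rewrite mul0r addr0. Qed.

Definition latmin : R := Num.min 1 (Im tau).
Lemma latmin_gt0 : 0 < latmin. Proof. by rewrite lt_min ltr01. Qed.
Lemma lat1_small z : lat1 z -> cn z < latmin -> z = 0.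
Proof.
move=> [p [q ->]] h; have intR r : (r%:~R : C) = (r%:~R)%:C by rewrite rmorph_int.
have hI := le_lt_trans (Im_le_cn _) h; have hR := le_lt_trans (Re_le_cn _) h.
move: hI hR; rewrite !intR cImD cReD cImM cReM !mul0r subr0 addr0 add0r => hI hR.
have q0 : q = 0. apply/eqP; rewrite -[_ == _]negbK; apply/negP => hq.
  have : Im tau <= `|q%:~R * Im tau|.
    by rewrite normrM (gtr0_norm htau) ler_peMl ?(ltW htau) // -intr_norm ler1z -gtz0_ge1 normr_gt0.
  move=> /le_lt_trans /(_ hI); rewrite lt_min ltxx andbF //.
move: hR; rewrite q0 mul0r addr0 => hR.
have -> : p = 0; last by rewrite mul0r addr0.
apply/eqP; rewrite -[_ == _]negbK; apply/negP => hp.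
have : (1 : R) <= `|p%:~R| by rewrite -intr_norm ler1z -gtz0_ge1 normr_gt0.
by move=> /le_lt_trans /(_ hR); rewrite lt_min ltxx.
Qed.

Lemma lat1_isolated z : exists2 d, 0 < d & forall l, lat1 l -> cn (z - l) < d -> z = l.
Proof.
have m2 : 0 < latmin / 2 by rewrite divr_gt0 // latmin_gt0.
have [[l [hl ll]]|H] := pselect (exists l, lat1 l /\ cn (z - l) < latmin / 2); last first.
  by exists (latmin / 2) => // l hl hz; exfalso; apply: H; exists l.
have key l' : lat1 l' -> cn (z - l') < latmin / 2 -> l = l'.
  move=> hl' h; apply/eqP; rewrite -subr_eq0; apply/eqP; apply: lat1_small; first exact/lat1B.
  by apply: le_lt_trans (cn_triangle z _ _) _; rewrite [latmin]splitr ltrD // cnB.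
have [zl|zl] := eqVneq z l. by exists (latmin / 2) => // l' hl' h; rewrite zl; exact/key.
have c0 : 0 < cn (z - l).
  by rewrite lt_neqAle cn_ge0 andbT eq_sym; apply: contra zl => /eqP /cn_eq0 /eqP; rewrite subr_eq0.
exists (Num.min (cn (z - l)) (latmin / 2)); first by rewrite lt_min c0.
move=> l' hl' h; have e := key l' hl' (lt_le_trans h _); rewrite -e in h; last by rewrite ge_min lexx orbT.
by move: h; rewrite lt_min ltxx.
Qed.
Lemma latticeD (a c : V) : lattice a -> lattice c -> lattice (a + c).
Proof. by move=> h1 h2 j; rewrite mxE; apply: lat1D. Qed.

Variable f : V -> C.
Hypothesis sf : smooth f.
Hypothesis fsym : forall (s : 'S_m) (w : V), f (\row_j w 0 (s j)) = f w.
Hypothesis fprim : forall w0 la : V, lattice la -> (forall i j, w0 0 i = w0 0 j -> la 0 i = la 0 j) ->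
  exists2 d : R, 0 < d & exists2 ka : V -> C, smooth ka & forall w, nearv d w0 w -> f w - f (w - la) = ka (E w).

(** Every e' near e has a root vector close to that of e ([root_continuity]), so smoothness in e can
    be tested near points of the w-space. *)
Lemma sm_loc g : (forall w0, exists2 d : R, 0 < d & exists2 g', smooth g' &
  forall w, nearv d w0 w -> g (E w) = g' (E w)) -> smooth g.
Proof.
move=> h; apply/smoothP => r; apply: Cf_loc => e s _.
have [d d0 [g' sg' hg']] := h (rootv e); have [d' d'0 hd'] := root_continuity (rootv e) d0.
exists (fun e' _ => nearv d' e e'); first exact/nearv_refl.
have oD : dopen (fun e' _ => nearv d' e e').
  move=> e1 s1 he; have [d1 d10 hd1] := nearv_room d'0 he; exists d1 => // v s2 hv _.
  by have := nearv_trans hd1 hv; rewrite subrK.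
apply: Cf_ext (Cf_sub _ ((smoothP _).1 sg' r)) => // e' s' he'.
have [t ht] : exists t : 'S_m, nearv d (rootv e) (\row_j rootv e' 0 (t j)) by apply: hd'; rewrite !rootvK.
by have := hg' _ ht; rewrite esym_perm rootvK.
Qed.

Section Patch.
Variable a : V.
Hypothesis hred : forall i j, lat1 (a 0 i - a 0 j) -> a 0 i = a 0 j.

Lemma separated : exists2 d : R, 0 < d & forall i j l, lat1 l -> cn (a 0 i - a 0 j - l) < d -> l = 0.
Proof.
have [d d0 hd] : exists2 d, 0 < d & forall ij, forall l, lat1 l ->
    cn (a 0 ij.1 - a 0 ij.2 - l) < d -> l = 0; last by exists d => // i j; exact: (hd (i, j)).
apply: (@fin_min _ _ (fun ij d => forall l, lat1 l -> cn (a 0 ij.1 - a 0 ij.2 - l) < d -> l = 0)); last first.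
  by move=> ij d d' dd h l hl hc; apply: h => //; exact: lt_le_trans hc dd.
move=> [i j]; have [d d0 hd] := lat1_isolated (a 0 i - a 0 j); exists d => // l hl /(hd _ hl) e.
by rewrite -e (hred (i := i) (j := j)) ?subrr // e.
Qed.

(** For a vector a whose congruent coordinates are equal, the translate w - la close to a, up to
    order, is unique. X is a bump function of that translate and G = X (f(w) - f(w - la)), so that X
    f - G = X f(w - la) is periodic; by [fprim] G is smooth in e. *)
Lemma chart_patch : exists X G, [/\ smooth X /\ smooth G, forall e, 0 <= X e,
   lper tau (fun w => X (E w)), lper tau (fun w => X (E w) * f w - G (E w))
   & exists2 d : R, 0 < d & forall w la, lattice la -> nearv d a (w - la) -> 0 < X (E w)].
Proof.
(* h is d / 6, so that two translates of one number lying within 3 h of coordinates of a must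
   coincide. *)
have [d d0 hd] := separated; pose h : R := d / 6.
have h0 : 0 < h by rewrite divr_gt0.
have uniq_la x l l' i j : lat1 l -> lat1 l' -> cn (x - l - a 0 i) < 3 * h -> cn (x - l' - a 0 j) < 3 * h -> l = l'.
  move=> hl hl' h1 h2; apply/eqP; rewrite -subr_eq0; apply/eqP.
  apply: (hd j i); first exact/lat1B.
  rewrite (_ : _ - _ = (x - l - a 0 i) - (x - l' - a 0 j)); last by ring.
  by apply: le_lt_trans (cnD _ _) _; rewrite cnN; move: h1 h2; rewrite /h; lra.
have [e e0 he] := root_continuity a h0.
pose dd v : R := e ^+ 2 - 2 * dist2 (E a) (E v).
pose valid w la := lattice la /\ 0 < dd (w - la).
have validP w la : valid w la -> exists s : 'S_m, forall j, cn (w 0 j - la 0 j - a 0 (s j)) < h.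
  move=> [_ hv]; have [s hs] : exists s : 'S_m, nearv h a (\row_j (w - la) 0 (s j)).
    by apply: he => j; apply: dist2_near => //; rewrite -subr_gt0.
  by exists (s^-1)%g => j; have := hs ((s^-1)%g j); rewrite !mxE permKV.
have near3 x : x < h -> x < 3 * h by move: h0; lra.
have valid_uniq w la la' : valid w la -> valid w la' -> la = la'.
  move=> h1 h2; have [s hs] := validP _ _ h1; have [s' hs'] := validP _ _ h2.
  apply/rowP => j; apply: (uniq_la (w 0 j) _ _ (s j) (s' j)); [exact/h1.1|exact/h2.1|exact/near3|exact/near3].
(* Where no translate is valid, [xget] returns 0, which is itself a lattice vector: if [dd] were
   positive there, 0 would be valid. Hence X vanishes at such points (K2). *)
pose la_ w : V := xget 0 [set la | valid w la]%classic.
pose ra u : V := rootv u - la_ (rootv u).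
have K1 w la : valid w la -> E (ra (E w)) = E (w - la) /\ f (ra (E w)) = f (w - la).
  move=> hv; have [s hs] := esym_fiber (rootvK (E w)).
  have hsub : \row_j w 0 (s j) - \row_j la 0 (s j) = \row_j (w - la) 0 (s j) by apply/rowP => j; rewrite !mxE.
  have hv' : valid (rootv (E w)) (\row_j la 0 (s j)).
    split; first by move=> j; rewrite mxE; exact/hv.1.
    by rewrite /dd hs hsub esym_perm; exact/hv.2.
  have -> : ra (E w) = \row_j (w - la) 0 (s j).
    rewrite /ra -hsub -hs; congr (_ - _); apply: (valid_uniq _ _ _ _ hv').
    exact: (@xgetPex _ 0 [set la | valid (rootv (E w)) la]%classic (ex_intro _ _ hv')).
  by rewrite esym_perm fsym.
pose X u : C := (flat 0 (dd (ra u)))%:C.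
have K2 w : ~ (exists la, valid w la) -> X (E w) = 0.
  move=> H; rewrite /X flat_le0 // leNgt; apply/negP => hpos.
  have [s hs] := esym_fiber (rootvK (E w)).
  have hex : valid (rootv (E w)) (la_ (rootv (E w))).
    have [hx|hno] := pselect (exists la, valid (rootv (E w)) la).
      exact: (@xgetPex _ 0 [set la | valid (rootv (E w)) la]%classic hx).
    have l0 : la_ (rootv (E w)) = 0 by apply: xgetPN => la hla; apply: hno; exists la.
    by split; [move=> j; rewrite l0 mxE; exact/lat10|exact/hpos].
  apply: H; exists (\row_j la_ (rootv (E w)) 0 ((s^-1)%g j)); split; first by move=> j; rewrite mxE; exact/hex.1.
  move: hex.2; rewrite /dd -(esym_perm (w - _) s) (_ : rootv (E w) - _ = \row_j (w - \row_j0 la_ (rootv (E w)) 0 ((s^-1)%g j0)) 0 (s j)) //.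
  by apply/rowP => j; rewrite [in RHS]mxE [in RHS]mxE [in RHS]mxE [in RHS]mxE permK mxE {1}hs !mxE.
have XE w la : valid w la -> X (E w) = (flat 0 (dd (w - la)))%:C.
  by move=> hv; rewrite /X /dd (K1 _ _ hv).1.
pose G u : C := X u * (f (rootv u) - f (ra u)).
have froot w : f (rootv (E w)) = f w by apply: rootv_sym => s v; exact/fsym.
have GE u : G u = X u * (f (rootv u) - f (ra u)) by [].
have Xge u : 0 <= X u by rewrite lecR; exact/flat_ge0.
clearbody G X ra la_.
have key w : X (E w) * f w - G (E w) = X (E w) * f (ra (E w)). by rewrite GE froot; ring.
(* The threshold 2 h for w0 leaves a margin h for w on both sides: if no translate of w0 is within 2
   h, none of w is within h, and X vanishes; if one is, it stays within 3 h for w near w0 and is the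
   only candidate. *)
have local w0 : exists2 d1, 0 < d1 & exists2 gg, smooth gg.1 /\ smooth gg.2 &
    forall w, nearv d1 w0 w -> X (E w) = gg.1 (E w) /\ G (E w) = gg.2 (E w).
  have [[la [hla [s hs]]]|H] := pselect (exists la, lattice la /\ exists s : 'S_m, forall j, cn (w0 0 j - la 0 j - a 0 (s j)) < 2 * h); last first.
    exists h => //; exists (fun=> 0, fun=> 0); first by split; exact/sm_cst.
    move=> w hw /=; have X0 : X (E w) = 0.
      apply: K2 => -[la hv]; apply: H; exists la; split; first exact/hv.1.
      have [s hs] := validP _ _ hv; exists s => j.
      rewrite (_ : _ - _ = (w 0 j - la 0 j - a 0 (s j)) - (w 0 j - w0 0 j)); last by ring.
      by apply: le_lt_trans (cnD _ _) _; rewrite cnN; have := hs j; have := hw j; lra.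
    by rewrite GE X0 mul0r.
  have h23 x : x < 2 * h -> x < 3 * h by move: h0; lra.
  have compat i j : w0 0 i = w0 0 j -> la 0 i = la 0 j.
    move=> wij; apply: (uniq_la (w0 0 i) _ _ (s i) (s j)); [exact/hla|exact/hla|exact/h23|].
    by rewrite wij; exact/h23.
  have [d1 d10 [rt srt hrt]] := reduction compat.
  have [d2 d20 [ka ska hka]] := fprim hla compat.
  pose g1 u : C := (flat 0 (e ^+ 2 - 2 * dist2 (E a) (rt u)))%:C.
  have sg1 : smooth g1. have sq : smooth (fun u => 2 * (dist2 (E a) (rt u))%:C : C).
      by apply: smoothZ; exact: (sm_comp srt (sm_dist2 (E a))).
    apply: sm_flat; rewrite (_ : (fun u => _) = fun u => (e ^+ 2)%:C - 2 * (dist2 (E a) (rt u))%:C).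
      by apply: smoothB => //; exact/sm_cst.
    by apply/funext => u; rewrite rmorphB; congr (_ - _); rewrite rmorphM rmorph_nat.
  exists (Num.min h (Num.min d1 d2)); first by rewrite !lt_min h0 d10.
  exists (g1, fun u => g1 u * ka u); first by split => //; exact/smoothM.
  move=> w hw /=.
  have hw1 : nearv d1 w0 w by apply: nearv_le hw; rewrite !ge_min lexx orbT.
  have hw2 : nearv d2 w0 w by apply: nearv_le hw; rewrite !ge_min lexx !orbT.
  have hwh : nearv h w0 w by apply: nearv_le hw; rewrite ge_min lexx.
  have g1E : g1 (E w) = (flat 0 (dd (w - la)))%:C by rewrite /g1 /dd hrt.
  have [hv|hv] := pselect (valid w la).
    have XX := XE _ _ hv; rewrite GE XX froot (K1 _ _ hv).2 hka // g1E; split => //.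
  have hX : X (E w) = 0. apply: K2 => -[la' hv']; apply: hv; have [s' hs'] := validP _ _ hv'.
    rewrite (_ : la = la') //; apply/rowP => j.
    apply: (uniq_la (w 0 j) _ _ (s j) (s' j)); [exact/hla|exact/hv'.1| |exact/near3].
    rewrite (_ : _ - _ = (w0 0 j - la 0 j - a 0 (s j)) + (w 0 j - w0 0 j)); last by ring.
    by apply: le_lt_trans (cnD _ _) _; have := hs j; have := hwh j; lra.
  have hg : g1 (E w) = 0. by rewrite g1E flat_le0 // leNgt; apply/negP => hp; apply: hv; split.
  by rewrite GE hX hg !mul0r.
have shift_valid w la j p q : valid w la <-> valid (w + (p%:~R + q%:~R * tau) *: delta_mx 0 j) (la + (p%:~R + q%:~R * tau) *: delta_mx 0 j).
  have hl : lattice ((p%:~R + q%:~R * tau) *: delta_mx 0 j).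
    by move=> k; rewrite !mxE; case: (_ && _); rewrite ?mulr0 ?mulr1; [exists p, q|exact/lat10].
  have hs : w + (p%:~R + q%:~R * tau) *: delta_mx 0 j - (la + (p%:~R + q%:~R * tau) *: delta_mx 0 j) = w - la.
    by rewrite opprD addrACA subrr addr0.
  split=> -[h1 h2]; split; rewrite ?hs //; first exact/latticeD.
    have := latticeD h1 (@lattice_sub _ _ _ _ hl); by rewrite addrK.
  by rewrite -hs.
have shift_cases w j p q : let w' := w + (p%:~R + q%:~R * tau) *: delta_mx 0 j in
    X (E w') = X (E w) /\ X (E w') * f (ra (E w')) = X (E w) * f (ra (E w)).
  move=> w'; have [[la hv]|H] := pselect (exists la, valid w la).
    have hv' := (shift_valid w la j p q).1 hv.
    have hs : w' - (la + (p%:~R + q%:~R * tau) *: delta_mx 0 j) = w - la.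
      by rewrite /w' opprD addrACA subrr addr0.
    by rewrite (XE _ _ hv) (XE _ _ hv') (K1 _ _ hv).2 (K1 _ _ hv').2 hs.
  rewrite (K2 w H) (K2 w') ?mul0r // => -[la hv]; apply: H.
  exists (la - (p%:~R + q%:~R * tau) *: delta_mx 0 j); apply/(shift_valid _ _ j p q); by rewrite subrK.
exists X, G; split.
- split; apply: sm_loc => w0; have [d1 d10 [gg [s1 s2] hg]] := local w0; exists d1 => //.
    by exists gg.1 => // w /hg[].
  by exists gg.2 => // w /hg[].
- exact/Xge.
- by move=> w j p q; have [] := shift_cases w j p q.
- by move=> w j p q; rewrite !key; have [] := shift_cases w j p q.
have e20 : 0 < e / (2 * (m%:R + 1)) by rewrite divr_gt0 // mulr_gt0 // ltr_wpDl.
have [d1 d10 hd1] := esym_cont a e20.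
exists d1 => // w la hla hw; have hv : valid w la.
  split => //; rewrite /dd subr_gt0; apply: le_lt_trans (ler_wpM2l _ (near_dist2 (hd1 _ hw))) _ => //.
  have M0 := ler0n R m; have e2 : 0 < e ^+ 2 by rewrite exprn_gt0.
  rewrite (_ : 2 * _ = e ^+ 2 * (m%:R / (2 * (m%:R + 1) ^+ 2))); last first.
    have : m%:R + 1 != 0 :> R by rewrite gt_eqF // ltr_wpDl.
    by move: (m%:R : R) => M hM; field.
  rewrite gtr_pMr // ltr_pdivrMr ?mulr_gt0 ?exprn_gt0 ?ltr_wpDl //.
  by move: (m%:R : R) M0 => M M0; nra.
by rewrite (XE _ _ hv) ltcR flat_gt0 //; exact/hv.2.
Qed.
End Patch.
End Patches.

(** * Gluing, and the exactness of closed invariant 2-forms of mean zero *)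

Section Exactness.
Context {R : realType} (tau : R[i]) {m : nat}.
Notation C := R[i].
Notation V := 'rV[R[i]]_m.
Notation form := (dform R m).
Notation E := (@elem_sym R m).
Notation lattice := (@lattice R m tau).
Notation lat1 := (@lat1 R tau).
Hypothesis htau : 0 < Im tau.

(** Each coordinate is replaced by that of one chosen index in its class modulo the lattice;
    congruent indices have the same class and so the same chosen index. *)
Lemma reduced_center w : exists2 la, lattice la &
  forall i j, lat1 ((w - la) 0 i - (w - la) 0 j) -> (w - la) 0 i = (w - la) 0 j.
Proof.
pose P i : pred 'I_m := fun j => `[< lat1 (w 0 i - w 0 j) >].
pose c i := odflt i [pick j | P i j].
have cP i : lat1 (w 0 i - w 0 (c i)). rewrite /c; case: pickP => [j /asboolP //|/(_ i)].
  by move=> /asboolP H; exfalso; apply: H; rewrite subrr; exact/lat10.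
exists (\row_i (w 0 i - w 0 (c i))); first by move=> j; rewrite mxE; exact/cP.
have wc i : (w - \row_i (w 0 i - w 0 (c i))) 0 i = w 0 (c i). by rewrite !mxE opprB addrC subrK.
move=> i j; rewrite !wc => hij.
have wij : lat1 (w 0 i - w 0 j).
  rewrite (_ : _ - _ = (w 0 i - w 0 (c i)) + (w 0 (c i) - w 0 (c j)) - (w 0 j - w 0 (c j))); last by ring.
  by apply: lat1B => //; apply: lat1D.
have Pij : P i =1 P j. move=> k; apply/asboolP/asboolP => h.
    rewrite (_ : _ - _ = (w 0 i - w 0 k) - (w 0 i - w 0 j)); [exact/lat1B|ring].
  rewrite (_ : _ - _ = (w 0 i - w 0 j) + (w 0 j - w 0 k)); [exact/lat1D|ring].
rewrite /c (eq_pick Pij); case: pickP => [k //|/(_ j)].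
by move=> /asboolP H; exfalso; apply: H; rewrite subrr; exact/lat10.
Qed.

Definition wx (x : 'rV[R]_(m + m)) : V := \row_j ((x 0 (lshift m j))%:C + (x 0 (rshift m j))%:C * tau).

Lemma box1 (z : C) : exists s t : R, [/\ 0 <= s <= 1, 0 <= t <= 1 & lat1 (z - (s%:C + t%:C * tau))].
Proof.
pose t0 := Im z / Im tau; pose s0 := Re z - t0 * Re tau.
have zE : z = s0%:C + t0%:C * tau.
  apply: ceqP; rewrite ?(cReD, cImD, cReM, cImM) ?mul0r ?subr0 ?addr0 ?add0r ?subrK //.
  by rewrite divfK // gt_eqF.
have fl (x : R) : 0 <= x - (Num.floor x)%:~R <= 1.
  by have /andP[h1 h2] := mem_rg1_floor x; rewrite subr_ge0 h1 lerBlDl ltW.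
exists (s0 - (Num.floor s0)%:~R), (t0 - (Num.floor t0)%:~R); split => //.
exists (Num.floor s0), (Num.floor t0); rewrite {1}zE; ring.
Qed.

Lemma box (w : V) : exists x : 'rV[R]_(m + m), (forall i, 0 <= x 0 i <= 1) /\ lattice (w - wx x).
Proof.
have [s hs] := choice (fun j => box1 (w 0 j)); have [t ht] := choice hs.
exists (row_mx (\row_j s j) (\row_j t j)); split.
  by move=> i; rewrite mxE; case: fintype.splitP => j _; rewrite mxE; have [] := ht j.
move=> j; rewrite mxE [X in _ + X]mxE [wx _ _ _]mxE row_mxEl row_mxEr !mxE.
by have [_ _] := ht j.
Qed.

Section Globalize.
Variable f : V -> C.
Hypothesis sf : smooth f.
Hypothesis fsym : forall (s : 'S_m) (w : V), f (\row_j w 0 (s j)) = f w.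
Hypothesis fprim : forall w0 la : V, lattice la -> (forall i j, w0 0 i = w0 0 j -> la 0 i = la 0 j) ->
  exists2 d : R, 0 < d & exists2 ka : V -> C, smooth ka & forall w, nearv d w0 w -> f w - f (w - la) = ka (E w).

Definition good_patch p : Prop := [/\ smooth p.1, smooth p.2, forall e, 0 <= p.1 e,
  lper tau (fun w => p.1 (E w)) & lper tau (fun w => p.1 (E w) * f w - p.2 (E w))].

Notation T := {p : (V -> C) * (V -> C) | good_patch p}.
(** Finite lists of patches ordered by inclusion. The covering form of compactness along this filter
    gives a single finite list that serves the whole period cell. *)
Definition incl_filter : set_system (seq T) := fun S => exists l0, forall l, (forall p, List.In p l0 -> List.In p l) -> S l.

Lemma incl_filterP : Filter incl_filter.
Proof.
split; first by exists [::].
- move=> A B [l0 hA] [l1 hB]; exists (l0 ++ l1) => l hl; split.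
    by apply: hA => p hp; apply/hl/List.in_or_app; left.
  by apply: hB => p hp; apply/hl/List.in_or_app; right.
- by move=> A B AB [l0 hA]; exists l0 => l hl; auto with sm.
Qed.

Lemma patch_near (x0 : 'rV[R]_(m + m)) : exists p : T, exists2 d : R, 0 < d & forall x : 'rV[R]_(m + m),
  (forall i, `|x 0 i - x0 0 i| < d) -> 0 < (sval p).1 (E (wx x)).
Proof.
have [la hla hred] := reduced_center (wx x0).
have [X [G [[sX sG] X0 pX pG [d d0 hd]]]] := chart_patch htau fsym fprim hred.
exists (exist _ (X, G) (And5 sX sG X0 pX pG)).
have t0 : 0 < 1 + cn tau by rewrite ltr_pwDl ?cn_ge0.
exists (d / (1 + cn tau)); first by rewrite divr_gt0.
move=> x hx; apply: hd => // j; rewrite !mxE.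
rewrite (_ : _ - _ = (x 0 (lshift m j) - x0 0 (lshift m j))%:C + (x 0 (rshift m j) - x0 0 (rshift m j))%:C * tau); last first.
  by ring.
apply: le_lt_trans (cnD _ _) _; rewrite cnR cnMR.
rewrite (_ : d = d / (1 + cn tau) + d / (1 + cn tau) * cn tau); last by field; rewrite gt_eqF.
by rewrite ltr_leD // ler_wpM2r ?cn_ge0 // ltW.
Qed.

Lemma finite_patches : exists l : seq T, forall w, exists2 p, List.In p l & 0 < (sval p).1 (E w).
Proof.
have K : compact [set v : 'rV[R]_(m + m) | forall i, [set` `[0, 1]%R]%classic (v ord0 i)]%classic.
  by apply: (@rV_compact R (m + m) (fun=> [set` `[0, 1]%R]%classic)) => i; exact/segment_compact.
move/compact_near_coveringP: K => /(_ (seq T) incl_filter (fun l x => exists2 p, List.In p l & 0 < (sval p).1 (E (wx x))) incl_filterP).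
case. move=> x _; have [p [d d0 hd]] := patch_near x.
  exists ([set x' : 'rV[R]_(m + m) | forall i, `|x' 0 i - x 0 i| < d]%classic, [set l | List.In p l]%classic).
    split => /=; last by exists [:: p] => l; apply; left.
    apply/nbhs_ballP; exists d => // x' hx' i.
    by have := hx'.2 0 i; rewrite /ball /= distrC.
  by move=> [x' l] /= [h1 h2]; exists p => //; exact/hd.
move=> l hl; exists l => w; have [x [hx hwx]] := box w.
have hxK : [set v : 'rV[R]_(m + m) | forall i, [set` `[0, 1]%R]%classic (v ord0 i)]%classic x.
  by move=> i; rewrite /= in_itv /=; exact/hx.
have [p hp h0] := hl l (fun _ h => h) x hxK.
exists p => //; have [_ _ _ hper _] := svalP p.
by have := lper_lattice (wx x) hper hwx; rewrite addrC subrK => ->.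
Qed.

(** h is the quotient of the sum of the G by the sum of the X. Then f - h(E w) is the sum of the
    periodic functions X f - G divided by a periodic function without zeros. *)
Lemma globalize : exists2 h, smooth h & lper tau (fun w => f w - h (E w)).
Proof.
have [l hl] := finite_patches.
pose SX e := \sum_(p <- l) (sval p).1 e; pose SG e := \sum_(p <- l) (sval p).2 e.
have S0 e : SX e != 0. have [w <-] := esym_surj e; have [p hp h0] := hl w.
  rewrite gt_eqF // /SX; elim: l hp {hl SX SG} => [//|q l IH] /= [->|hp]; rewrite big_cons.
    by rewrite ltr_pwDl // sumr_ge0 // => r _; have [] := svalP r.
  by rewrite ltr_wpDl ?IH //; have [] := svalP q.
have sSX : smooth SX by apply: sm_sum => p _; have [] := svalP p.
have sSG : smooth SG by apply: sm_sum => p _; have [] := svalP p.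
exists (fun e => SG e * (SX e)^-1); first by apply: smoothM => //; exact/smoothV.
have E1 w : f w - SG (E w) * (SX (E w))^-1 = (\sum_(p <- l) ((sval p).1 (E w) * f w - (sval p).2 (E w))) * (SX (E w))^-1.
  by rewrite big_split /= sumrN -mulr_suml -/(SX (E w)) -/(SG (E w)) mulrBl mulrAC divff ?mul1r.
move=> w j p q; rewrite !E1; congr (_ * _^-1); apply: eq_bigr => r _; have [_ _ _ h1 h2] := svalP r.
  exact/h2.
exact/h1.
Qed.
End Globalize.

Definition permv (s : 'S_m) (w : V) : V := \row_j w 0 (s j).
Lemma smap_permv s : smap (permv s).
Proof. by move=> j; under eq_fun do rewrite mxE; exact/sm_coord. Qed.
Lemma permvD s u v : permv s (u + v) = permv s u + permv s v.
Proof. by apply/rowP => j; rewrite !mxE. Qed.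

Lemma lattice_dirs v : v \in dirs tau m -> lattice v.
Proof.
move=> /dirs_lattice [j [->|->]] k; rewrite !mxE.
  by exists (k == j)%:R, 0; rewrite mul0r addr0; case: (k == j).
by exists 0, (k == j)%:R; rewrite add0r; case: (k == j); rewrite ?mulr1 ?mulr0 ?mul1r ?mul0r.
Qed.

Lemma lati_permv s o : lati tau o -> lati tau (pullback (permv s) o).
Proof.
move=> /lati_per ho v hv; rewrite (pb_comp _ (shift_smap v) (smap_permv s)).
rewrite (_ : (fun w => _) = fun w => permv s w + permv s v); last by apply/funext => w; exact/permvD.
rewrite -(pb_comp _ (smap_permv s) (shift_smap (permv s v))); congr (pullback _ _).
apply: formP => w I; rewrite pb_shift; apply: (lper_lattice _ (ho I)).
by move=> j; rewrite mxE; exact/lattice_dirs.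
Qed.

Lemma lati_form0 g : lper tau g -> lati tau (form0 g : form).
Proof.
by move=> hg v hv; rewrite pb_form0; congr form0; apply/funext => w; exact/per_dir.
Qed.

Lemma pbE_permv s o : pullback (permv s) (pullback E o) = pullback E o.
Proof.
rewrite (pb_comp _ (smap_permv s) smap_sym); congr (pullback _ o).
by apply/funext => w; exact/esym_perm.
Qed.

(** y has a primitive al in e by [poincare], and its pullback has a periodic primitive in w by
    [torus_primitive], the mean being 0. After symmetrization they differ by df for a symmetric
    function f. By [globalize], f minus a function h of e is periodic, and al + dh is smooth in e
    and invariant at once. *)
Theorem exactness (y : form) : sym_form tau y -> homog 2 y -> extd y = 0 ->
  meanf tau (pullback E y) = 0 -> exists eta : form, [/\ sym_form tau eta, homog 1 eta & y = extd eta].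
Proof.
move=> /symfE [sy iy] hy cy my; have sE := @smap_sym R m.
have [al [sal hal dal]] := poincare sy hy cy.
have [be0 [sbe hbe pbe0 dbe]] : exists be, [/\ sform be, homog 1 be, per_form tau be
    & pullback E y = meanf tau (pullback E y) + extd be].
  apply: torus_primitive ; auto with sm. by rewrite extd_pb // cy pb0.
  exact/lati_per.
rewrite my add0r in dbe.
have [ph [sph hph dph]] : exists ph, [/\ sform ph, homog 0 ph & extd ph = be0 - pullback E al].
  apply: poincare.
  - by auto with sm.
  - by auto with sm.
  - by rewrite extdB //; [rewrite extd_pb // dal dbe subrr|exact/pbE_smooth].
pose f0 w := ph w set0; have sf0 : smooth f0 by exact/sph.
have phE : ph = form0 f0.
  by apply: formP => e I; rewrite /form0; case: eqP => [->//|/eqP hI]; rewrite hph //; apply/eqP; rewrite cards_eq0.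
pose N : C := #|{: 'S_m}|%:R; have N0 : N != 0.
  by rewrite pnatr_eq0 -lt0n; apply/card_gt0P; exists 1%g.
(* f0 is symmetrized by averaging over the permutations; this replaces be0 by its average, while the
   pullback of al is already invariant. *)
pose f w := N^-1 * \sum_s f0 (permv s w).
have sfs s : smooth (fun w => f0 (permv s w)) by exact: (sm_comp (smap_permv s) sf0).
have sf : smooth f by apply: smoothZ; auto with sm.
have fsym (t : 'S_m) (w : V) : f (\row_j w 0 (t j)) = f w.
  congr (_ * _); rewrite [RHS](reindex_inj (mulIg t)); apply: eq_bigr => s _.
  by congr f0; apply/rowP => j; rewrite !mxE permM.
pose be := cf N^-1 * \sum_s pullback (permv s) be0.
have ibe : lati tau be.
  by apply: latiM; [exact/lati_cf|apply: lati_sum => s _; apply: lati_permv; exact/lati_per].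
have dfE : extd (form0 f) = be - pullback E al.
  have -> : form0 f = cf N^-1 * \sum_s pullback (permv s) ph.
    apply: formP => w I; rewrite cfE sumfE phE.
    under eq_bigr do rewrite pb_form0.
    by rewrite /form0; case: eqP => // _; rewrite big1 ?mulr0.
  rewrite extd_cfM; last by apply: sform_sum => s _; apply: sm_pb => //; exact/smap_permv.
  rewrite extd_sum => [|s _]; last by apply: sm_pb => //; exact/smap_permv.
  rewrite (eq_bigr (fun s => pullback (permv s) be0 - pullback E al)) => [|s _]; last first.
    rewrite extd_pb //; last exact/smap_permv.
    by rewrite dph pbB pbE_permv.
  rewrite big_split sumr_const mulrDr; congr (_ + _).
  apply: formP => w I; rewrite cfE mulrnfE; transitivity (N^-1 * (N * - pullback E al w I)); last by rewrite mulrA mulVf ?mul1r.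
  by rewrite mulr_natl.
have [h sh ph'] : exists2 h, smooth h & lper tau (fun w => f w - h (E w)).
  apply: globalize => // w0 la hla hc.
  by apply: (@local_primitive R m tau f al be y w0 la) => //; exact/lati_per.
exists (al + extd (form0 h)).
have sfh : sform (form0 h : form) by exact/sformf.
have shE : smooth (fun w => h (E w)) by exact/sm_comp.
split.
- apply/symfE; split; auto with sm.
  have -> : pullback E (al + extd (form0 h)) = be - extd (form0 (fun w => f w - h (E w))).
    have -> : form0 (fun w => f w - h (E w)) = form0 f - form0 (fun w => h (E w)) :> form.
      by apply: formP => w I; rewrite subfE /form0; case: eqP => // _; rewrite subrr.
    rewrite extdB; auto with sm.
    rewrite dfE rmorphD /= -extd_pb // pb_form0 !opprD !opprK !addrA subrr add0r //.
  apply: latiB => //; apply: lati_extd; last exact/lati_form0.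
  by auto with sm.
- by auto with sm.
- by rewrite extdD ?extd_extd ?addr0; auto with sm.
Qed.

End Exactness.

(** * Powers of sums of central square-zero elements *)

Section SquareZero.
Context {A : nzRingType}.

Lemma sq0_addX (u S : A) k : u * u = 0 -> (forall x, u * x = x * u) ->
  (u + S) ^+ k.+1 = S ^+ k.+1 + (u * S ^+ k) *+ k.+1.
Proof.
move=> u2 uc; elim: k => [|k IH]; first by rewrite mulr1 addrC.
by rewrite exprS IH mulrDl !mulrDr !mulrnAr mulrA u2 mul0r mul0rn addr0 [S * (u * _)]mulrA -uc -mulrA -!exprS
  addrCA.
Qed.

(** Products with a repeated factor vanish, and the remaining ones agree up to the order of their
    factors, which commute. *)
Lemma sq0_sum T l (u : T -> A) : (forall a, u a * u a = 0) -> (forall a x, u a * x = x * u a) ->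
  (\sum_(a <- l) u a) ^+ size l = (\prod_(a <- l) u a) *+ (size l)`! /\
  (forall k, (size l < k)%N -> (\sum_(a <- l) u a) ^+ k = 0).
Proof.
move=> u2 uc; elim: l => [|a l [IH1 IH2]].
  by rewrite !big_nil; split => // -[|k] // _; rewrite expr0n.
rewrite !big_cons; split. rewrite sq0_addX // IH2 // add0r IH1 mulrnAr -mulrnA mulnC //.
case=> // k hk; rewrite sq0_addX //.
by rewrite !IH2 ?mulr0 ?mul0rn ?addr0 // ltnW.
Qed.
End SquareZero.

(** * Means of products, and constant 2-forms invariant under permutations *)

Section ConstantForms.
Context {R : realType} (tau : R[i]).
Hypothesis htau : 0 < Im tau.
Notation C := R[i].
Notation V m := 'rV[R[i]]_m.
Notation form m := (dform R m).
Notation iT := (@iT R tau).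

Lemma lati_pb p q f (o : form q) : smap f ->
  (forall v, v \in dirs tau p -> exists2 u, lattice tau u & forall w, f (w + v) = f w + u) ->
  lati tau o -> lati tau (pullback f o).
Proof.
move=> sf hf /lati_per ho v hv; have [u hu fu] := hf v hv.
rewrite (pb_comp _ (shift_smap v) sf).
rewrite (_ : (fun w => _) = fun w => f w + u); last exact/funext.
rewrite -(pb_comp _ sf (shift_smap u)); congr (pullback _ _).
by apply: formP => w I; rewrite pb_shift; exact: (lper_lattice _ (ho I)).
Qed.

Lemma cstf_meanf m (o : form m) : cstf (meanf tau o). Proof. by []. Qed.

Lemma cstf_prod p T l (F : T -> form p) : (forall a, cstf (F a)) -> cstf (\prod_(a <- l) F a).
Proof.
move=> h; elim: l => [|a l IH]; first by rewrite big_nil.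
by rewrite big_cons; exact/cstfM.
Qed.

Lemma cstf_pb p q (f : V p -> V q) o : (forall a, cstf (pb1 f a)) -> cstf o -> cstf (pullback f o).
Proof.
move=> h ho; rewrite pbE; apply: cstf_sum => I _; rewrite pbI_prod.
have hp : cstf (\prod_(a <- [seq a <- coord_seq q | a \in I]) pb1 f a) by exact/cstf_prod.
move=> w w' K; rewrite !mulf0E (hp w w') (ho (f w) (f w')) //.
Qed.
Lemma sm_cstf m (o : form m) : cstf o -> sform o.
Proof. by move=> h I; rewrite (_ : (fun w => o w I) = fun=> o 0 I); [exact/sm_cst|apply/funext => w; exact/h]. Qed.

Lemma meanf_cstM m (o eta : form m) : cstf o -> sform eta -> meanf tau (o * eta) = o * meanf tau eta.
Proof.
move=> ho se; apply: formP => w K; rewrite /meanf mulfE.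
rewrite (_ : (fun v => _) = fun v => \sum_(I : {set rcoord m} | I \subset K) sgn I (K :\: I) * o w I * eta v (K :\: I)).
  by rewrite mean_sum => [|I _]; [apply: eq_bigr => I _; rewrite meanZ //; exact/se|exact/smoothZ].
by apply/funext => v; rewrite mulfE; apply: eq_bigr => I _; rewrite (ho v w).
Qed.

(** x is its mean plus d be with be periodic. As y is closed, (d be) y = d (be y) has mean 0, and
    the constant form comes out of the mean of its product with y. *)
Lemma meanf_mul m (x y : form m) : sform x -> homog 2 x -> extd x = 0 -> lati tau x ->
  sform y -> extd y = 0 -> lati tau y -> meanf tau (x * y) = meanf tau x * meanf tau y.
Proof.
move=> sx hx cx px sy cy py.
have [be [sbe hbe pbe xE]] := torus_primitive htau sx hx cx ((lati_per _ _).1 px).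
have E : x * y = meanf tau x * y + extd (be * y).
  by rewrite (extdM_odd hbe) // cy mulr0 subr0 {1}xE mulrDl.
have sbey : sform (be * y) by exact/sformM.
rewrite E meanfD; [|apply: sformM => //; exact/sm_cstf|exact/sm_extd].
rewrite meanf_cstM // meanf_extd ?addr0 //.
by apply: latiM => //; apply/lati_per.
Qed.
Lemma meanf1 m : meanf tau (1 : form m) = 1.
Proof. exact/meanf_cst. Qed.

Lemma meanf_pb p q f (x : form q) : smap f -> (forall a, cstf (pb1 f a)) ->
  (forall v, v \in dirs tau p -> exists2 u, lattice tau u & forall w, f (w + v) = f w + u) ->
  sform x -> homog 2 x -> extd x = 0 -> lati tau x ->
  meanf tau (pullback f x) = pullback f (meanf tau x).
Proof.
move=> sf cf1 hf sx hx cx px.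
have [be [sbe hbe pbe xE]] := torus_primitive htau sx hx cx ((lati_per _ _).1 px).
rewrite {1}xE pbD -extd_pb // meanfD; last 2 first.
- exact/sm_cstf/cstf_pb.
- by auto with sm.
rewrite meanf_cst; last exact/cstf_pb.
rewrite meanf_extd ?addr0; auto with sm.
by apply: lati_pb => //; apply/lati_per.
Qed.

Lemma homog_meanf m p (x : form m) : homog p x -> homog p (meanf tau x).
Proof.
move=> h w I hI; rewrite /meanf (_ : (fun v => _) = fun=> 0) ?mean_cst //.
by apply/funext => v; exact/h.
Qed.

Section OneDim.
Context {m : nat}.
Notation X := (@Xs R m).
Notation Y := (@Ys R m).
Notation sig := (@sigma R tau m).
Notation ptw := (@ptW R tau m).
Notation u := (fun j : 'I_m => ef (j, false) * ef (j, true) : form m).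
Notation S := (\sum_j u j).
Notation top o := ((o : form m) 0 setT).

Lemma u_sq j : u j * u j = 0.
Proof. by rewrite mulrA -[ef _ * ef _ * ef _]mulrA [ef (j, true) * _]ef_anti mulrN mulrA ef_sq mul0r oppr0 mul0r. Qed.
Lemma u_central j x : u j * x = x * u j.
Proof. by apply: (@even_comm _ _ 2) => //; exact: (homogM (homog_ef _) (homog_ef _)). Qed.
Lemma prod_coord T (F : T * bool -> form m) s :
  \prod_(a <- [seq (j, c) | j <- s, c <- [:: false; true]]) F a = \prod_(j <- s) (F (j, false) * F (j, true)).
Proof.
elim: s => [|j s IH]; first by rewrite !big_nil.
by rewrite big_cat IH /= !big_cons big_nil mulr1.
Qed.

Lemma top_prod : top (\prod_(j <- enum 'I_m) u j) = 1.
Proof.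
have := prod_ef_coord setT (0 : V m) setT; rewrite eqxx mulr1n pbI_prod => <-.
rewrite (_ : [seq a <- coord_seq m | a \in setT] = coord_seq m); last by apply/all_filterP/allP => a _.
by rewrite prod_coord; congr (_ 0 setT); apply: eq_bigr => j _; rewrite !pb1_id.
Qed.
Lemma SE : S = \sum_(j <- enum 'I_m) u j.
Proof. by rewrite big_enum. Qed.

Lemma top_sigmaX : top (sig ^+ m) = iT ^+ m * m`!%:R.
Proof.
have sE : sig = cf iT * S by [].
have cc : GRing.comm (cf iT) S by rewrite /GRing.comm cfC.
rewrite (exprMn_comm _ cc) cfX cfE SE.
have [h _] := @sq0_sum _ _ (enum 'I_m) u u_sq u_central.
by rewrite size_enum_ord in h; rewrite h mulrnfE top_prod.
Qed.

(** The form dx_j dy_k annihilates u_j and u_k, so only m - 2 square-zero summands of S remain, too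
    few for the power m - 1. *)
Lemma offdiag j k : j != k -> ef (j, false) * ef (k, true) * S ^+ m.-1 = 0.
Proof.
move=> jk; set d := ef _ * ef _.
pose l := rem k (rem j (enum 'I_m)); pose S' := \sum_(i <- l) u i.
have kl : k \in rem j (enum 'I_m) by rewrite (mem_rem_uniq _ (enum_uniq _)) inE eq_sym jk mem_enum.
have Sd : S = u j + (u k + S'). by rewrite SE (big_rem j) ?mem_enum //= (big_rem k).
have sl : (size l < m.-1)%N.
  rewrite (size_rem kl) (size_rem (mem_enum _ _ : j \in _)) size_enum_ord.
  have := ltn_ord j; have := ltn_ord k; move: jk; rewrite -val_eqE /=; move: (j : nat) (k : nat) => a b.
  by case: m => [|[|n]] //; case: a b => [|a] [|b].
have du1 : d * u j = 0.
  by rewrite -u_central /d !mulrA -[ef _ * ef (j, true) * ef (j, false)]mulrA [ef (j, true) * _]ef_anti mulrN mulrA ef_sq mul0r oppr0 mul0r.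
have du2 : d * u k = 0.
  by rewrite /d -mulrA [ef (k, true) * _]mulrA [ef (k, true) * ef (k, false)]ef_anti mulNr -[_ * ef (k, true) * ef (k, true)]mulrA ef_sq mulr0 oppr0 mulr0.
have S'c x : S' * x = x * S' by rewrite mulr_suml mulr_sumr; apply: eq_bigr => i _; exact/u_central.
have dS : d * S = d * S' by rewrite Sd !mulrDr du1 du2 !add0r.
have dX p : d * S ^+ p = d * S' ^+ p. elim: p => [|p IH]; first by rewrite !expr0.
  by rewrite !exprS mulrA dS -mulrA S'c mulrA IH -mulrA -exprSr exprS.
have [_ h] := @sq0_sum _ _ l u u_sq u_central.
by rewrite dX h ?mulr0.
Qed.

(** Of the product Xs Ys only the diagonal terms dx_j dy_j survive multiplication by sigma^(m-1), by
    [offdiag]. *)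
Lemma ptW_sigmaX : (0 < m)%N -> ptw * sig ^+ m.-1 = sig ^+ m.
Proof.
move=> m0; have -> : sig ^+ m = sig * sig ^+ m.-1 by rewrite -exprS; rewrite prednK.
have sE : sig = cf iT * S by [].
have cc : GRing.comm (cf iT) S by rewrite /GRing.comm cfC.
rewrite (exprMn_comm _ cc) cfX -!mulrA; congr (_ * _).
rewrite [S * _]mulrA [X * _]mulrA [X * Y * _]mulrA -![_ * cf _]cfC -!mulrA; congr (_ * _).
rewrite mulrA [X * Y]mulr_suml mulr_suml mulr_suml; apply: eq_bigr => j _.
rewrite [ef _ * Y]mulr_sumr; rewrite mulr_suml (bigD1 j) //= [X in _ + X]big1 ?addr0 // => k kj.
by apply: offdiag; rewrite eq_sym.
Qed.

Lemma Xs_sq : X * X = 0.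
Proof.
apply: eq_form_oppr0; have h : homog 1 X by apply: homog_sum => j _; exact/homog_ef.
by rewrite {1}(homog_comm h h) mulN1r.
Qed.

Lemma ptW_sq : ptw * ptw = 0.
Proof.
by rewrite -mulrA [X * Y * _]mulrA -[X * Y * cf _]cfC -!mulrA (_ : X * (Y * (X * Y)) = 0) ?mulr0 //
  [Y * _]mulrA XY_anti mulNr -mulrA Ys_sq mulr0 oppr0 mulr0.
Qed.

Definition Zc c : form m := \sum_j ef (j, c).
Definition spanned (z : form m) : Prop := exists a b, z = cf a * sig + cf b * ptw.

Lemma cfD a b : cf (a + b) = cf a + cf b :> form m.
Proof. by rewrite form0D. Qed.
Lemma cfN a : cf (- a) = - cf a :> form m.
Proof. by apply: formP => w I; rewrite oppfE /cf /form0; case: (I == _); rewrite ?oppr0. Qed.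
Lemma spannedD x y : spanned x -> spanned y -> spanned (x + y).
Proof. by move=> [a [b ->]] [c [d ->]]; exists (a + c), (b + d); rewrite !cfD !mulrDl addrACA. Qed.
Lemma spannedZ k x : spanned x -> spanned (cf k * x).
Proof. by move=> [a [b ->]]; exists (k * a), (k * b); rewrite mulrDr !mulrA !cfM. Qed.
Lemma spannedN x : spanned x -> spanned (- x).
Proof. by move=> [a [b ->]]; exists (- a), (- b); rewrite !cfN !mulNr opprD. Qed.
Lemma spanned0 : spanned 0.
Proof. by exists 0, 0; rewrite (_ : cf 0 = 0 :> form m) ?mul0r ?addr0 //; apply: formP => w I; rewrite /cf /form0 if_same. Qed.
Lemma spanned_sum T l (F : T -> form m) : (forall a, spanned (F a)) -> spanned (\sum_(a <- l) F a).
Proof. by move=> h; elim/big_rec: _ => [|a x _ hx]; [exact/spanned0|exact/spannedD]. Qed.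
Lemma spanned_natl k x : spanned (x *+ k.+1) -> spanned x.
Proof.
move=> h; rewrite (_ : x = cf (k.+1%:R^-1) * (x *+ k.+1)); first exact/spannedZ.
apply: formP => w I; rewrite cfE mulrnfE; transitivity (k.+1%:R^-1 * (k.+1%:R * x w I)); last by rewrite mulr_natl.
by rewrite mulrA mulVf ?mul1r.
Qed.
Lemma spanned_nat k x : spanned x -> spanned (x *+ k).
Proof. by rewrite -mulr_natl -cf_nat; exact/spannedZ. Qed.

Lemma iTK x : x = cf (Im tau)%:C * (cf iT * x) :> form m.
Proof.
rewrite mulrA cfM divff; last by rewrite eq_complex gt_eqF.
by rewrite ?mul1r.
Qed.

Lemma spanned_diag c c' : spanned (\sum_j ef (j, c) * ef (j, c')).
Proof.
have d0 : spanned (\sum_j ef (j, false) * ef (j, true)).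
  rewrite [X in spanned X]iTK; apply: spannedZ; exists 1, 0.
  rewrite (_ : cf 0 = 0 :> form m) ?mul0r ?addr0; last by apply: formP => w I; rewrite /cf /form0 if_same.
  by rewrite ?mul1r.
case: c c' => [] [] //; try by rewrite big1 => [|j _]; [exact/spanned0|exact/ef_sq].
rewrite (eq_bigr (fun j => - (ef (j, false) * ef (j, true)))) => [|j _]; last exact/ef_anti.
by rewrite sumrN; exact/spannedN.
Qed.

Lemma spanned_Z c c' : spanned (Zc c * Zc c').
Proof.
have d0 : spanned (X * Y). rewrite [X in spanned X]iTK; apply: spannedZ; exists 0, 1.
  rewrite (_ : cf 0 = 0 :> form m) ?mul0r ?add0r; last by apply: formP => w I; rewrite /cf /form0 if_same.
  by rewrite ?mul1r.
case: c c' => [] [] //; [rewrite Ys_sq; exact/spanned0|rewrite XY_anti; exact/spannedN|rewrite Xs_sq; exact/spanned0].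
Qed.

Definition Mjk c c' j k : form m := \sum_(s : 'S_m) ef (s j, c) * ef (s k, c').

Lemma Mjk_inv c c' (p : 'S_m) j k : Mjk c c' (p j) (p k) = Mjk c c' j k.
Proof.
rewrite [RHS](reindex_inj (mulgI p)); apply: eq_bigr => s _.
by rewrite !permM.
Qed.

Lemma spanned_diagM c c' j : spanned (Mjk c c' j j).
Proof.
have [k mE] : exists k, m = k.+1 by case: m j => [[]|k _] //; exists k.
apply: (@spanned_natl k); rewrite -mE -[m in _ *+ m]card_ord -sumr_const.
rewrite (eq_bigr (fun l => Mjk c c' l l)) => [|l _]; last by rewrite -[RHS](Mjk_inv c c' (tperm j l)) tpermR.
rewrite exchange_big; apply: spanned_sum => s.
rewrite (_ : \sum_l _ = \sum_l ef (l, c) * ef (l, c')); first exact/spanned_diag.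
by rewrite [RHS](reindex_inj (@perm_inj _ s)).
Qed.

(** The sum of a row over l is, up to a rational factor, the product of two total sums [Zc]. All
    off-diagonal entries of a row agree, by a transposition, and their sum is the row sum minus the
    diagonal entry. *)
Lemma spanned_M c c' j k : spanned (Mjk c c' j k).
Proof.
have [->|jk] := eqVneq j k; first exact/spanned_diagM.
have rowE : \sum_l Mjk c c' j l = \sum_(s : 'S_m) ef (s j, c) * Zc c'.
  rewrite exchange_big; apply: eq_bigr => s _; rewrite -mulr_sumr; congr (_ * _).
  by rewrite [RHS](reindex_inj (@perm_inj _ s)).
have N_inv l : \sum_(s : 'S_m) ef (s l, c) = \sum_(s : 'S_m) ef (s j, c) :> form m.
  by rewrite [RHS](reindex_inj (mulgI (tperm j l))); apply: eq_bigr => s _; rewrite permM tpermL.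
have [p mE] : exists p, m = p.+1 by case: m j {jk rowE N_inv} => [[]|p _] //; exists p.
have hrow : spanned (\sum_l Mjk c c' j l).
  rewrite rowE -mulr_suml; apply: (@spanned_natl p); rewrite -mE -mulrnAl -[m in _ *+ m]card_ord -sumr_const.
  rewrite (eq_bigr (fun l => \sum_(s : 'S_m) ef (s l, c))) => [|l _] //.
  rewrite exchange_big (eq_bigr (fun=> Zc c)) => [|s _]; last by rewrite [RHS](reindex_inj (@perm_inj _ s)).
  by rewrite sumr_const mulrnAl; exact/spanned_nat/spanned_Z.
have offE l : l != j -> Mjk c c' j l = Mjk c c' j k.
  by move=> lj; rewrite -[RHS](Mjk_inv c c' (tperm k l)) tpermL tpermD // eq_sym.
have hk : spanned (\sum_(l | l != j) Mjk c c' j l).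
  rewrite (_ : \sum_(l | l != j) _ = \sum_l Mjk c c' j l - Mjk c c' j j); last by rewrite [X in _ = X - _](bigD1 j) //= [RHS]addrC addKr.
  by apply: spannedD => //; exact/spannedN/spanned_diagM.
rewrite (eq_bigr (fun=> Mjk c c' j k)) in hk; auto with sm.
rewrite sumr_const in hk.
have : (0 < #|[pred l | l != j]|)%N by apply/card_gt0P; exists k; rewrite inE eq_sym.
move: hk.
by case: #|_| => // q hq _; exact: spanned_natl hq.
Qed.

Lemma cst_1form (o : form m) : cstf o -> homog 1 o -> o = \sum_a cf (o 0 [set a]) * ef a.
Proof.
move=> ho h; apply: formP => w K; rewrite (ho w 0) sumfE.
have [/cards1P[a ->]|hK] := boolP (#|K| == 1%N).
  rewrite -(@big_pred1_eq _ 0 +%R _ a (fun k => o 0 [set k])) big_mkcond; apply: eq_bigr => k _.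
  by rewrite cfE /ef (inj_eq set1_inj) [a == k]eq_sym; case: eqP => _; rewrite ?mulr1 ?mulr0.
rewrite h; last exact/eqP.
rewrite big1 // => a _; rewrite cfE /ef; case: eqP => [E|]; last by rewrite mulr0.
by move: hK; rewrite E cards1.
Qed.
Lemma pb1_permv s a : pb1 (permv s) a = ef (s a.1, a.2) :> form m.
Proof. by rewrite -pb1_id; congr (extd (form0 _)); apply/funext => v; rewrite /rcomp mxE. Qed.

(** An invariant form equals its average over the permutations, and averaging the monomials of o
    yields the [Mjk]. The factor 2 comes from recovering o from its contractions
    ([euler_degree]). *)
Lemma inv_spanned o : cstf o -> homog 2 o -> (forall s, pullback (permv s) o = o) -> spanned o.
Proof.
move=> ho h inv.
have hc a : cstf (ctr a o) by move=> w w' K; rewrite /ctr; rewrite (ho w w').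
have E : o *+ 2 = \sum_a \sum_b cf (ctr a o 0 [set b]) * (ef a * ef b).
  rewrite -(euler_degree h); apply: eq_bigr => a _; rewrite {1}(cst_1form (hc a) (homog_ctr a h)) mulr_sumr.
  by apply: eq_bigr => b _; rewrite !mulrA cfC.
have F0 : (0 < #|{: 'S_m}|)%N by apply/card_gt0P; exists 1%g.
have Av : (o *+ 2) *+ #|{: 'S_m}| = \sum_a \sum_b cf (ctr a o 0 [set b]) * Mjk a.2 b.2 a.1 b.1.
  rewrite -sumr_const (eq_bigr (fun s => pullback (permv s) (o *+ 2))) => [|s _]; last by rewrite raddfMn /= inv.
  under eq_bigr do rewrite E rmorph_sum.
  rewrite exchange_big; apply: eq_bigr => a _.
  under eq_bigr do rewrite rmorph_sum.
  rewrite exchange_big; apply: eq_bigr => b _; rewrite mulr_sumr; apply: eq_bigr => s _.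
  by rewrite !rmorphM /= pb_cf !pb_ef !pb1_permv.
apply: (@spanned_natl 1); move: Av F0; case: #|_| => // q Av _; apply: (@spanned_natl q); rewrite Av.
by apply: spanned_sum => a; apply: spanned_sum => b; exact/spannedZ/spanned_M.
Qed.

End OneDim.
End ConstantForms.

(** * Means of the xi and theta classes *)

Section ClassMeans.
Context {R : realType} (tau : R[i]).
Hypothesis htau : 0 < Im tau.
Notation C := R[i].
Notation V m := 'rV[R[i]]_m.
Notation form m := (dform R m).
Notation T := ((Im tau)%:C : C).
Notation iT := (@iT R tau).
Notation E m := (@elem_sym R m).
Notation top o := (o 0 setT).

Lemma T0 : T != 0.
Proof. by rewrite eq_complex gt_eqF. Qed.

Lemma sym_integralE p q (f : V p -> V q) o : smap f -> sform o ->
  sym_integral tau f o = (p`!%:R)^-1 * (T ^+ p * top (meanf tau (pullback f o))).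
Proof.
move=> sf so; rewrite /sym_integral int_curvesE //; exact/sm_pb.
Qed.

Lemma meanf_perm m o : sform o -> homog 2 o -> extd o = 0 -> sym_form tau o ->
  forall s, pullback (permv s) (meanf tau (pullback (E m) o)) = meanf tau (pullback (E m) o).
Proof.
move=> so ho co /symfE [_ io] s.
rewrite -(meanf_pb htau (smap_permv s)) ?pbE_permv //.
- by move=> a; rewrite pb1_permv.
- move=> v hv; exists (permv s v) => [j|w]; first by rewrite mxE; exact/lattice_dirs. exact/permvD.
- exact/pbE_smooth.
- by auto with sm.
- by rewrite extd_pb ?co ?pb0 //; exact/smap_sym.
Qed.

Lemma closedE m (o : form m) : closed_form tau o <-> sym_form tau o /\ extd o = 0.
Proof.
split=> -[h1 h2]; split=> //; first by apply: formP => w K.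
by rewrite h2.
Qed.

Lemma closed_meanfM m x y : closed_form tau x -> homog 2 x -> closed_form tau y ->
  meanf tau (pullback (E m) (x * y)) = meanf tau (pullback (E m) x) * meanf tau (pullback (E m) y).
Proof.
move=> /closedE [/symfE [sx ix] cx] hx /closedE [/symfE [sy iy] cy].
have sE := @smap_sym R m.
rewrite rmorphM /= meanf_mul; auto with sm. by rewrite extd_pb // cx pb0.
by rewrite extd_pb // cy pb0.
Qed.

Lemma closedM m (x y : form m) : closed_form tau x -> homog 2 x -> closed_form tau y -> closed_form tau (x * y).
Proof.
move=> /closedE [ix cx] hx /closedE [iy cy]; split; auto with sm.
by rewrite (extdM_even hx) //; [rewrite cx cy mul0r mulr0 addr0|case: ix|case: iy].
Qed.
Lemma closed1 m : closed_form tau (1 : form m).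
Proof. by apply/closedE; split; [exact: (@symf_cf R tau m 1)|exact/extd_const]. Qed.

Lemma closed_formX m (x : form m) k : closed_form tau x -> homog 2 x -> closed_form tau (x ^+ k).
Proof.
move=> hx h2; elim: k => [|k IH]; first by rewrite expr0; exact/closed1.
by rewrite exprS; exact/closedM.
Qed.

Lemma closed_meanfX m x k : closed_form tau x -> homog 2 x ->
  meanf tau (pullback (E m) (x ^+ k)) = meanf tau (pullback (E m) x) ^+ k.
Proof.
move=> hx h2; elim: k => [|k IH]; first by rewrite rmorph1 meanf1.
by rewrite !exprS closed_meanfM ?IH //; exact/closed_formX.
Qed.

Section AddPoint.
Variables (k : nat) (hm : (0 < k.+1)%N) (z0 : C).
Notation m := k.+1.
Notation ap := (@add_point R m hm z0 : V k -> V m).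

Let hm0 : Ordinal hm = ord0. Proof. exact/val_inj. Qed.
Lemma add_point0 w : ap w 0 ord0 = z0.
Proof. by rewrite mxE hm0 unlift_none. Qed.
Lemma add_pointS w j : ap w 0 (lift ord0 j) = w 0 j.
Proof. by rewrite mxE liftK. Qed.

Lemma smap_ap : smap ap.
Proof.
move=> j; case: (unliftP ord0 j) => [i|] ->.
  by under eq_fun do rewrite add_pointS; exact/sm_coord.
by under eq_fun do rewrite add_point0; exact/sm_cst.
Qed.

Lemma pb1_ap0 c : pb1 ap (ord0, c) = 0.
Proof.
rewrite /pb1 (_ : form0 _ = cf ((rcomp (ord0, c) (\row_(j < m) z0))%:C)); first exact/extd_const.
by congr form0; apply/funext => v; rewrite /rcomp add_point0 mxE.
Qed.
Lemma pb1_apS j c : pb1 ap (lift ord0 j, c) = ef (j, c).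
Proof. by rewrite -pb1_id; congr (extd (form0 _)); apply/funext => v; rewrite /rcomp add_pointS. Qed.

Lemma cstf_ap a : cstf (pb1 ap a).
Proof.
case: a => j c; case: (unliftP ord0 j) => [i|] ->; first by rewrite pb1_apS.
by rewrite pb1_ap0.
Qed.

Lemma ap_sigma : pullback ap (sigma tau) = sigma tau.
Proof.
rewrite rmorphM /= pb_cf rmorph_sum big_ord_recl rmorphM /= !pb_ef pb1_ap0 mul0r add0r.
by congr (_ * _); apply: eq_bigr => j _; rewrite rmorphM /= !pb_ef !pb1_apS.
Qed.
Lemma ap_ptW : pullback ap (ptW tau) = ptW tau.
Proof.
rewrite !rmorphM /= pb_cf !rmorph_sum !big_ord_recl /= !pb_ef !pb1_ap0 !add0r.
by congr (_ * (_ * _)); apply: eq_bigr => j _; rewrite pb_ef pb1_apS.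
Qed.

Lemma ap_lattice v : v \in dirs tau k -> exists2 u, lattice tau u & forall w, ap (w + v) = ap w + u.
Proof.
move=> hv; exists (\row_j (if unlift ord0 j is Some i then v 0 i else 0)).
  move=> j; rewrite mxE; case: unliftP => [i _|_]; first exact: (lattice_dirs hv).
  exact/lat10.
move=> w; apply/rowP => j; rewrite [RHS]mxE [X in _ = _ + X]mxE.
case: (unliftP ord0 j) => [i|] e; rewrite e; last by rewrite !add_point0 addr0.
by rewrite !add_pointS mxE.
Qed.

Lemma ap_meanf x : closed_form tau x -> homog 2 x ->
  meanf tau (pullback ap (pullback (E m) x)) = pullback ap (meanf tau (pullback (E m) x)).
Proof.
move=> /closedE [/symfE [sx ix] cx] hx; have sE := @smap_sym R m.
apply: (meanf_pb htau smap_ap cstf_ap ap_lattice) => //; first by auto with sm.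
  by auto with sm.
by rewrite extd_pb // cx pb0.
Qed.

Lemma ap_meanfM x y : closed_form tau x -> homog 2 x -> closed_form tau y ->
  meanf tau (pullback ap (pullback (E m) (x * y))) =
  pullback ap (meanf tau (pullback (E m) x)) * meanf tau (pullback ap (pullback (E m) y)).
Proof.
move=> hx h2 hy; rewrite -ap_meanf //; move: hx hy.
move=> /closedE [/symfE [sx ix] cx] /closedE [/symfE [sy iy] cy].
have sE := @smap_sym R m; have sa := smap_ap.
rewrite !rmorphM meanf_mul //.
- by apply: sm_pb => //; exact/pbE_smooth.
- by do 2 apply: homog_pb.
- by rewrite ?extd_pb ?cx ?pb0 //; exact/pbE_smooth.
- by apply: lati_pb => //; exact/ap_lattice.
- by apply: sm_pb => //; exact/pbE_smooth.
- by rewrite ?extd_pb ?cy ?pb0 //; exact/pbE_smooth.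
- by apply: lati_pb => //; exact/ap_lattice.
Qed.

Lemma ap_meanfX x p : closed_form tau x -> homog 2 x ->
  meanf tau (pullback ap (pullback (E m) (x ^+ p))) = pullback ap (meanf tau (pullback (E m) x)) ^+ p.
Proof.
move=> hx h2; elim: p => [|p IH]; first by rewrite !rmorph1 meanf1.
by rewrite !exprS ap_meanfM ?IH //; exact/closed_formX.
Qed.

Variable x : form m.
Hypothesis hx : xi_class tau hm z0 x.

(** Poincare duality expressed by means: an integral over S^p C is (Im tau)^p / p! times the top
    coefficient of the mean, and the mean of x eta is the product of the means. *)
Lemma xi_test eta : closed_form tau eta ->
  (m`!%:R)^-1 * (T ^+ m * top (meanf tau (pullback (E m) x) * meanf tau (pullback (E m) eta))) =
  (k`!%:R)^-1 * (T ^+ k * top (meanf tau (pullback ap (pullback (E m) eta)))).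
Proof.
move=> he; have [cx h2 /(_ eta he)] := hx; have sE := @smap_sym R m.
have se : sform eta by case: he => -[].
have sx : sform x by case: cx => -[].
rewrite (sym_integralE sE) /=; last exact: (sformM sx se).
have E2 := sym_integralE (smap_comp smap_ap sE) se.
have M := closed_meanfM cx h2 he.
rewrite -M => e.
have e' := etrans e E2.
rewrite (@pb_comp _ _ _ _ _ _ eta smap_ap sE).
exact/e'.
Qed.

Lemma xi_span : exists a b, meanf tau (pullback (E m) x) = cf a * sigma tau + cf b * ptW tau.
Proof.
have [cx h2 _] := hx; have [[sx px] c0] := (closedE _).1 cx.
apply: (@inv_spanned R tau htau); first exact/cstf_meanf. by apply: homog_meanf; auto with sm.
exact/meanf_perm.
Qed.
Lemma fact_neq0 n : n`!%:R != 0 :> C.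
Proof. by auto with sm. Qed.
Lemma T_iT n : T ^+ n * iT ^+ n = 1.
Proof. by rewrite -exprMn divff ?expr1n // T0. Qed.

Lemma top_norm n : (n`!%:R)^-1 * (T ^+ n * top (sigma tau ^+ n : form n)) = 1.
Proof.
rewrite top_sigmaX; move: (T_iT n) (fact_neq0 n); move: (T ^+ n) (iT ^+ n) (n`!%:R) => a b c ab c0.
by rewrite [a * _]mulrA ab mul1r mulVf.
Qed.
Lemma norm_scale (u v w c : C) : u * (v * w) = 1 -> u * (v * (c * w)) = c.
Proof. by move=> h; rewrite -[RHS]mulr1 -h; ring. Qed.

Lemma ptW1 : k = 0%N -> ptW tau = sigma tau :> form m.
Proof.
move=> k0; have := @ptW_sigmaX R tau m isT; rewrite /= => h.
move: h; case: (k) k0 => // _; by rewrite mulr1.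
Qed.

Lemma xi1_mean : k = 0%N -> meanf tau (pullback (E m) x) = sigma tau.
Proof.
move=> k0; have [a [b xE]] := xi_span.
have := xi_test (closed1 m); rewrite !rmorph1 !meanf1 mulr1 xE (ptW1 k0) -mulrDl -cfD cfE.
have s1 j : j = 0%N -> sigma tau ^+ j.+1 = sigma tau :> form m by move=> ->; rewrite expr1.
have s0 j : j = 0%N -> sigma tau ^+ j = 1 :> form k by move=> ->; rewrite expr0.
have := top_norm m; rewrite (s1 k k0) => /norm_scale ->.
have := top_norm k; rewrite (s0 k k0) => -> ->.
by rewrite [cf 1]/(1 : form m) mul1r.
Qed.

(** Write the mean of x as a sigma + b ptW. The test form o^k gives a + b = 1, because ptW sigma^k =
    sigma^(k+1); for k > 0 the test form t o^(k-1) gives a = 1, because ptW squares to 0. For k = 0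
    the forms ptW and sigma coincide. *)
Lemma xi_mean o t : closed_form tau o -> homog 2 o -> closed_form tau t -> homog 2 t ->
  meanf tau (pullback (E m) o) = sigma tau -> meanf tau (pullback (E m) t) = ptW tau ->
  meanf tau (pullback (E m) x) = sigma tau.
Proof.
move=> co h2o ct h2t mo mt; have [a [b xE]] := xi_span.
have topD (p q : form m) : top (p + q) = top p + top q by [].
have mulE (z : form m) : (cf a * sigma tau + cf b * ptW tau) * z = cf a * (sigma tau * z) + cf b * (ptW tau * z).
  by rewrite mulrDl -!mulrA.
have comb c d (z : form m) : top (cf c * z + cf d * z) = (c + d) * top z.
  by rewrite -mulrDl -cfD cfE.
have e1 : a + b = 1. have := xi_test (closed_formX k co h2o).
  rewrite closed_meanfX // ap_meanfX // mo ap_sigma top_norm xE mulE -exprS.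
  have -> : ptW tau * sigma tau ^+ k = sigma tau ^+ m :> form m by exact: (@ptW_sigmaX R tau m isT).
  by rewrite comb (norm_scale _ (top_norm m)).
have [k0|k0] := posnP k. by rewrite xE (ptW1 k0) -mulrDl -cfD e1 [cf 1]/(1 : form m) mul1r.
have sP : sigma tau * ptW tau = ptW tau * sigma tau :> form m.
  apply: (@even_comm _ _ 2) => //; rewrite -mo; exact/homog_meanf/homog_pb.
have e2 : a = 1. have := xi_test (closedM ct h2t (closed_formX k.-1 co h2o)).
  rewrite closed_meanfM // ?closed_meanfX //; last exact/closed_formX.
  rewrite ap_meanfM // ?ap_meanfX //; last exact/closed_formX.
  rewrite mo mt ap_sigma ap_ptW.
  have -> : ptW tau * sigma tau ^+ k.-1 = sigma tau ^+ k :> form k by exact/ptW_sigmaX.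
  rewrite top_norm xE mulE [sigma tau * (_ * _)]mulrA sP -[_ * sigma tau * _]mulrA -exprS prednK //.
  have -> : ptW tau * sigma tau ^+ k = sigma tau ^+ m :> form m by exact: (@ptW_sigmaX R tau m isT).
  rewrite [ptW tau * (ptW tau * _)]mulrA ptW_sq mul0r mulr0 addr0 cfE (norm_scale _ (top_norm m)).
  by [].
have b0 : b = 0 by apply: (addrI a); rewrite e1 e2 addr0.
by rewrite xE e2 b0 (_ : cf 0 = 0 :> form m) ?mul0r ?addr0 ?[cf 1]/1 ?mul1r //; apply: formP => w I; rewrite /cf /form0 if_same.
Qed.

End AddPoint.

Section ThetaMean.
Variables (k : nat) (hm : (0 < k.+1)%N).
Notation m := k.+1.
Notation e1 := (fun u : V m => (u 0 (Ordinal hm))%:M : V 1).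

Definition sumf (w : V m) : V 1 := (\sum_j w 0 j)%:M.

Lemma scal1E (z : C) j : (z%:M : V 1) 0 j = z.
Proof. by rewrite mxE (ord1 j). Qed.
Lemma smap_e1 : smap e1.
Proof. by move=> j; under eq_fun do rewrite scal1E; exact/sm_coord. Qed.
Lemma smap_sumf : smap sumf.
Proof. by move=> j; under eq_fun do rewrite scal1E; apply: sm_sum => i _; auto with sm. Qed.
Lemma esym_id u : E 1 u = u.
Proof. by apply/rowP => j; rewrite (_ : j = Ordinal (ltn0Sn 0)) ?esym1 ?big_ord1; [congr (u 0 _)|rewrite ord1]. Qed.

Lemma pb1_sumf c : pb1 sumf (0, c) = \sum_j ef (j, c).
Proof.
under eq_bigr => j _ do rewrite -pb1_id.
rewrite -extd_sum; auto with sm.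
congr extd; apply: formP => w I; rewrite sumfE /form0; case: (I == finset.set0); last by rewrite big1.
rewrite /rcomp; case: c => /=; rewrite scal1E; elim/big_rec2: _ => // j u v _ <-; rewrite -rmorphD.
  by case: (w 0 j) u => [? ?] [? ?].
by case: (w 0 j) u => [? ?] [? ?].
Qed.

Lemma pb_sumf_sigma : pullback sumf (sigma tau) = ptW tau.
Proof.
by rewrite rmorphM /= pb_cf big_ord1 rmorphM /= !pb_ef !pb1_sumf.
Qed.
Lemma cstf_sumf a : cstf (pb1 sumf a).
Proof. by case: a => j c; rewrite ord1 pb1_sumf; auto with sm. Qed.

Lemma lattice_sumf v : v \in dirs tau m -> exists2 u, lattice tau u & forall w, sumf (w + v) = sumf w + u.
Proof.
move=> hv; exists (sumf v).
  move=> j; rewrite scal1E; elim/big_rec: _ => [|i z _ hz]; first exact/lat10.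
  by apply: lat1D => //; exact/lattice_dirs.
move=> w; apply/rowP => j; rewrite [RHS]mxE !scal1E -big_split; apply: eq_bigr => i _; by rewrite mxE.
Qed.

(** The coordinate e_1 is the sum of the w_j, a map with constant differentials that carries the
    lattice into the lattice; so the mean of the pullback is the pullback of the mean, which on the
    curve itself is [sigma] by [xi1_mean]. *)
Lemma theta_mean t : theta_class tau hm t ->
  closed_form tau t /\ meanf tau (pullback (E m) t) = ptW tau.
Proof.
move=> [h2 [pt [hpt [ct cp [eta [se tE]]]]]]; split=> //.
have [cpt hp2 _] := hpt; have mpt := xi1_mean hpt erefl.
have [/symfE [spt ipt] c0] := (closedE _).1 cpt.
have EW : pullback (E m) (pullback e1 pt) = pullback sumf pt.
  transitivity (pullback (fun w => e1 (E m w)) pt); first exact: (pb_comp pt (@smap_sym R m) smap_e1).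
  rewrite (_ : (fun w => e1 (E m w)) = sumf) //; apply/funext => w; exact: (congr1 _ (esym1 hm w)).
have E1 : pullback (E 1) pt = pt.
  by rewrite (_ : E 1 = id) ?pb_id //; apply/funext => u; exact/esym_id.
have -> : t = pullback e1 pt + extd eta by apply: formP => w I.
have /symfE [sse ise] := se.
rewrite rmorphD /= EW -extd_pb //; last exact/smap_sym.
rewrite meanfD; last 2 first.
- exact: (sm_pb smap_sumf spt).
- exact/sm_extd/pbE_smooth.
rewrite meanf_extd ?addr0 //; last exact/pbE_smooth.
rewrite E1 in ipt mpt; have e := meanf_pb htau smap_sumf cstf_sumf lattice_sumf spt hp2 c0 ipt.
by rewrite e mpt pb_sumf_sigma.
Qed.
End ThetaMean.
End ClassMeans.

(** * Exponentials as sums of powers in the ring of forms *)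

Section FormPowers.
Context {R : realType} {m : nat}.
Notation form := (dform R m).

Lemma form_expE (o : form) : form_exp o = \sum_(r < m.+1) cf (r`!%:R)^-1 * o ^+ r.
Proof.
apply: formP => w K; rewrite sumfE; apply: eq_bigr => r _; rewrite cfE.
suff -> : iter r (wedgef o) (form0 (fun=> 1)) = o ^+ r by [].
by elim: (r : nat) => [|j IH] //; rewrite iterS IH exprS.
Qed.

Lemma trace_expE b' (Om : mform R m b'.+1) :
  trace_exp Om = \sum_(r < m.+1) cf (r`!%:R)^-1 * \tr ((\matrix_(k, l) Om k l) ^+ r).
Proof.
apply: formP => w K; rewrite sumfE; apply: eq_bigr => r _; rewrite cfE; congr (_ * _).
rewrite /mxtrace sumfE; apply: eq_bigr => k _.
suff e : forall k l, iter r (mwedge Om) (@mform1 R m _) k l = ((\matrix_(k, l) Om k l) ^+ r) k l by rewrite e.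
elim: (r : nat) => [|j IH] k1 l1. rewrite mxE /= /mform1; case: (k1 == l1); first by [].
  by apply: formP => v I; rewrite /form0 if_same.
rewrite iterS exprS mxE; apply: formP => v I; rewrite sumfE; apply: eq_bigr => i _.
by rewrite IH mxE.
Qed.

Lemma curvature_scale b' A (c : R[i]) :
  \matrix_(k, l) (fun w I => c * curvature A k l w I : R[i]) = (cf c)%:M * curvM (Am A) :> 'M[form]_b'.+1.
Proof.
apply/matrixP => k l; rewrite mxE -mulmxE mul_scalar_mx mxE; apply: formP => w I; rewrite cfE; congr (_ * _).
have -> : curvM (Am A) k l = dM (Am A) k l + (Am A * Am A) k l by rewrite mxE.
rewrite addfE mulME sumfE; congr (_ + _); first by rewrite !mxE.
by apply: eq_bigr => j _; rewrite !mxE.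
Qed.

End FormPowers.

(** * Comparison of the Chern character with the exponential *)

Section Assembly.
Context {R : realType} (tau : R[i]) (vol : dform R 1) (b' n k : nat).
Notation b := b'.+1.
Notation m := k.+1.
Notation E := (@elem_sym R m).
Notation form := (dform R m).
Notation C := R[i].
Hypotheses (htau : 0 < Im tau) (hvol : volume_form tau vol) (hn : (0 < n)%N) (hm : (0 < m)%N).
Variables (A : mform R m b) (z0 : C) (t x : form).
Hypotheses (hA : chern_connection (@laughlin_metric R tau vol b n m) A).
Hypotheses (ht : theta_class tau hm t) (hx : xi_class tau hm z0 x).
Notation om := (om1 A).

Lemma closedD (y z : form) : closed_form tau y -> closed_form tau z -> closed_form tau (y + z).
Proof.
move=> /closedE [s1 c1] /closedE [s2 c2]; split; first exact/symfD.
by rewrite extdD ?c1 ?c2 ?addr0 //; [case: s1|case: s2].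
Qed.

Lemma closedZ c (y : form) : closed_form tau y -> closed_form tau (cf c * y).
Proof.
move=> /closedE [iy cy]; split; first by apply: symfM => //; exact/symf_cf.
by rewrite extd_cfM ?cy ?mulr0; case: iy.
Qed.

Lemma closed_sum T l (P : pred T) (F : T -> form) :
  (forall a, P a -> closed_form tau (F a)) -> closed_form tau (\sum_(a <- l | P a) F a).
Proof.
move=> h; elim/big_rec: _ => [|a y ha hy]; last by apply: closedD => //; exact/h.
have := closedZ 0 (closed1 tau m).
rewrite mulr1 (_ : cf 0 = 0 :> form) //; apply: formP => w I; rewrite /cf /form0 if_same //.
Qed.
Lemma closed_extd (y : form) : sym_form tau y -> closed_form tau (extd y).
Proof. by move=> h; apply/closedE; split; [exact/symf_extd|apply: extd_extd; case: h]. Qed.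
Lemma homogZ p c (y : form) : homog p y -> homog p (cf c * y).
Proof. by move=> h w I hI; rewrite cfE h ?mulr0. Qed.

Lemma closed_om1 : closed_form tau om.
Proof.
apply/closedE; split; first exact: (sym_om1 htau hvol hn hm hA).
exact: (closed_om _ (sm_a1 hA)).
Qed.
Lemma homog_om1 : homog 2 om.
Proof. exact/homogZ/homog_extd/(homog_a1 hA). Qed.

Lemma meanE_cfM c y : closed_form tau y -> meanf tau (pullback E (cf c * y)) = cf c * meanf tau (pullback E y).
Proof.
move=> [[sy _] _]; rewrite rmorphM /= pb_cf meanf_cfM //; exact/pbE_smooth.
Qed.
Lemma meanED y z : closed_form tau y -> closed_form tau z ->
  meanf tau (pullback E (y + z)) = meanf tau (pullback E y) + meanf tau (pullback E z).
Proof.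
move=> [[sy _] _] [[sz _] _]; rewrite rmorphD meanfD //; exact/pbE_smooth.
Qed.

Let ct : closed_form tau t. Proof. by have [] := theta_mean htau ht. Qed.
Let mt : meanf tau (pullback E t) = ptW tau. Proof. by have [] := theta_mean htau ht. Qed.
Let h2t : homog 2 t. Proof. by case: ht. Qed.
Let cx : closed_form tau x. Proof. by case: hx. Qed.
Let h2x : homog 2 x. Proof. by case: hx. Qed.

Let n0 : n%:R != 0 :> C. Proof. by rewrite pnatr_eq0 -lt0n. Qed.

Lemma mean_x : meanf tau (pullback E x) = sigma tau.
Proof.
(* The curvature provides the test form of mean [sigma] for [xi_mean]: [om1] + t / b has mean -n
   sigma. *)
have cs : closed_form tau (om + cf b%:R^-1 * t) by apply: closedD; [exact/closed_om1|exact/closedZ].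
apply: (xi_mean htau hx (closedZ (- n%:R^-1) cs) _ ct h2t _ mt).
  by apply/homogZ/homogD; [exact/homog_om1|exact/homogZ].
have c2 := closedZ b%:R^-1 ct.
by rewrite meanE_cfM // (meanED closed_om1 c2) (meanE_cfM _ ct) (mean_om1 htau hvol hn hm hA) mt
  opprD addrAC addNr add0r cfN mulrNN mulrA cfM mulVf // mul1r.
Qed.

Notation o' := (- (cf b%:R^-1 * t) - cf n%:R * x).

Lemma closedN (y : form) : closed_form tau y -> closed_form tau (- y).
Proof.
rewrite (_ : - y = cf (-1) * y); first exact/closedZ.
by apply: formP => w I; rewrite cfE mulN1r.
Qed.
Lemma closed_target : closed_form tau o'.
Proof. by apply: closedD; apply: closedN; exact/closedZ. Qed.
Lemma homog_target : homog 2 o'.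
Proof. by apply: homogD; apply: homogN; exact/homogZ. Qed.

(** The difference of both sides has mean 0, so [exactness] applies to it. *)
Lemma om1_class : exists eta, [/\ sym_form tau eta, homog 1 eta & om = o' + extd eta].
Proof.
have cN := closedN closed_target; have cy := closedD closed_om1 cN.
have [[sy _] _] := cy; have [isy cy0] := (closedE _ _).1 cy.
have [||eta [h1 h2 e]] := exactness htau isy _ cy0.
- by apply: homogD; [exact/homog_om1|exact/homogN/homog_target].
- rewrite meanED //; last exact/closed_om1.
  rewrite opprB opprK meanED; [|exact/closedZ|exact/closedZ].
  rewrite (mean_om1 htau hvol hn hm hA) !meanE_cfM // mt mean_x [X in - _ + X]addrC addNr //.
by exists eta; rewrite -e addrC subrK.
Qed.

Lemma chern_character_class : same_deRham_class tau
    (trace_exp (fun k l w I => 'i / (2 * pi%:C) * curvature A k l w I))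
    (fun w I => b%:R * form_exp (fun v J => - (b%:R^-1 * t v J) - n%:R * x v J) w I).
Proof.
have -> : (fun v J => - (b%:R^-1 * t v J) - n%:R * x v J) = o' :> form.
  by apply: formP => w I; rewrite addfE !oppfE !cfE.
have -> : (fun w I => b%:R * form_exp o' w I) = \sum_(r < m.+1) cf (r`!%:R)^-1 * (o' ^+ r *+ b) :> form.
  transitivity (cf b%:R * form_exp o'); first by apply: formP => w I; rewrite cfE.
  rewrite form_expE mulr_sumr; apply: eq_bigr => r _.
  by rewrite mulrA [cf b%:R * _]cfC -mulrA; congr (_ * _); rewrite cf_nat mulr_natl.
have [eta [se he oE]] := om1_class.
have [so co] := (closedE _ _).1 closed_om1; have [st c't] := (closedE _ _).1 closed_target.
(* The primitive in degree r: [cohom_powers] compares om^r with o'^r, with multiplicity b, and [cw]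
   accounts for the traceless part. *)
pose mu r : form := (eta * \sum_(i < r) om ^+ (r.-1 - i) * o' ^+ i) *+ b + cw (Am A) cpi (a1 A) r.
have natE (y : form) : y *+ b = cf b%:R * y by rewrite cf_nat mulr_natl.
have se1 r : sym_form tau (eta * \sum_(i < r) om ^+ (r.-1 - i) * o' ^+ i).
  by apply: symfM => //; apply: symf_sum => i _; apply: symfM; exact/symfX.
have smu r : sym_form tau (mu r). apply: symfD; last exact: (sym_cw htau hvol hn hm hA).
  by rewrite natE; apply: symfM => //; exact/symf_cf.
have trE : trace_exp (fun k l w I => 'i / (2 * pi%:C) * curvature A k l w I) =
    \sum_(r < m.+1) cf (r`!%:R)^-1 * (o' ^+ r *+ b) + extd (\sum_(r < m.+1) cf (r`!%:R)^-1 * mu r).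
  rewrite trace_expE (curvature_scale A cpi) extd_sum => [|r _]; last first.
    by apply: sformM; [exact/sm_cf|case: (smu r)].
  rewrite -big_split /=; apply: eq_bigr => r _.
  rewrite extd_cfM; last by case: (smu r).
  rewrite -mulrDr; congr (_ * _).
  rewrite (chern_weil cpi (sAm hA) (hAm hA) (sm_a1 hA) (homog_a1 hA)) -[cf cpi * extd _]/om.
  have s1 : sform om by case: so.
  have s2 : sform o' by case: st.
  have s3 : sform eta by case: se.
  rewrite (cohom_powers r s1 s2 homog_om1 homog_target co c't s3 he oE) mulrnDl -addrA; congr (_ + _).
  have sr : sform (eta * \sum_(i < r) om ^+ (r.-1 - i) * o' ^+ i) by case: (se1 r).
  rewrite /mu !natE extdD ?extd_cfM //. by apply: sformM => //; exact/sm_cf.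
  by case: (sym_cw htau hvol hn hm hA r).
have c1 : closed_form tau (\sum_(r < m.+1) cf (r`!%:R)^-1 * (o' ^+ r *+ b)).
  apply: closed_sum => r _; rewrite natE; do 2 apply: closedZ.
  by apply: closed_formX; [exact/closed_target|exact/homog_target].
have s1 : sym_form tau (\sum_(r < m.+1) cf (r`!%:R)^-1 * mu r).
  by apply: symf_sum => r _; apply: symfM; [exact/symf_cf|exact/smu].
split=> //; first by rewrite trE; apply: closedD => //; exact/closed_extd.
by exists (\sum_(r < m.+1) cf (r`!%:R)^-1 * mu r); split=> // w I; rewrite trE.
Qed.

End Assembly.

Theorem proposition1 (R : realType) (tau : R[i]) (htau : 0 < complex.Im tau)
  (b n m : nat) (hb : (0 < b)%N) (hn : (0 < n)%N) (hm : (0 < m)%N)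
  (vol : dform R 1) (hvol : volume_form tau vol)
  (A : mform R m b)
  (hA : chern_connection (@laughlin_metric R tau vol b n m) A)
  (z0 : R[i]) (t x : dform R m)
  (ht : theta_class tau hm t) (hx : xi_class tau hm z0 x) :
  same_deRham_class tau
    (trace_exp (fun k l w I => 'i / (2 * pi%:C) * curvature A k l w I))
    (fun w I => b%:R *
       form_exp (fun v J => - (b%:R^-1 * t v J) - n%:R * x v J) w I).
Proof.
(* The ring of square matrices and the analysis of [add_point] are set up for sizes written as
   successors. *)
destruct b as [|b'] ; destruct m as [|k] => //.
exact: (chern_character_class htau hvol hn hA ht hx).
Qed.
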